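(* (a) Let $P=P_\rho$ be a pseudodifferential operator on $E$ with $r\times r$ matrix valued symbol $\sigma(P)=\rho=\rho(\xi)$ (of some order $M\in\mathbb R$). Then the adjoint $P^*$ of $P$ with respect to $\langle\vec a,\vec b\rangle=\tau(\vec b^*\vec a)$ is a pseudodifferential operator whose symbol satisfies $$\sigma(P^* )\sim\sum_{(\ell_1,\ldots,\ell_n)\in(\mathbb Z_{\ge 0})^n}\frac{\partial_1^{\ell_1}\cdots\partial_n^{\ell_n}\delta_1^{\ell_1}\cdots\delta_n^{\ell_n}(\rho(\xi))^*}{\ell_1!\cdots\ell_n!}.$$ (b) If moreover $Q=P_{\rho'}$ is a pseudodifferential operator on $E$ with $r\times r$ matrix valued symbol $\sigma(Q)=\rho'=\rho'(\xi)$ (of some order $M'\in\mathbb R$), then the product $PQ=P\circ Q$ is also a pseudodifferential operator and has symbol $$\sigma(PQ)\sim\sum_{(\ell_1,\ldots,\ell_n)\in(\mathbb Z_{\ge 0})^n}\frac{\partial_1^{\ell_1}\cdots\partial_n^{\ell_n}(\rho(\xi))\,\delta_1^{\ell_1}\cdots\delta_n^{\ell_n}(\rho'(\xi))}{\ell_1!\cdots\ell_n!}.$$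
   Context: Let $n$ be a positive integer and fix a real skew-symmetric $n\times n$ matrix $\theta$ whose entries above the diagonal are irrational and linearly independent over $\mathbb Q$. $A_\theta$ is the universal $C^*$-algebra generated by unitaries $U_1,\dots,U_n$ with $U_kU_j=e^{2\pi i\theta_{j,k}}U_jU_k$. For $m\in\mathbb Z^n$ write $U^m=U_1^{m_1}\cdots U_n^{m_n}$. $\{\alpha_s\}_{s\in\mathbb R^n}$ is the $n$-parameter group of automorphisms of $A_\theta$ with $\alpha_s(U^m)=e^{is\cdot m}U^m$. $A_\theta^\infty$ is the subalgebra of those $a\in A_\theta$ for which $s\mapsto\alpha_s(a)$ is smooth from $\mathbb R^n$ to $A_\theta$; equivalently $a=\sum_m a_mU^m$ with $(a_m)_{m\in\mathbb Z^n}$ rapidly decreasing. $\tau:A_\theta\to\mathbb C$ is the trace with $\tau(1)=1$ and $\tau(U^m)=0$ for $m\neq0$; $\|a\|=\tau(a^*a)^{1/2}$. $\delta_j$ is the derivation on $A_\theta^\infty$ with $\delta_j(U_j)=U_j$ and $\delta_j(U_k)=0$ for $k\ne j$; $\partial_j=\partial/\partial\xi_j$; $\delta^i=\prod_j\delta_j^{i_j}$ and $\partial^i=\prod_j\partial_j^{i_j}$ for multi-indices $i$. All of $\alpha_s,\delta_j,\partial_j$ act entrywise on vectors and matrices. A map $\rho\in C^\infty(\mathbb R^n,A_\theta^\infty)$ is a (scalar) symbol of order $m\in\mathbb R$ (written $\rho\in S^m$) if for all $i,j\in\mathbb Z_{\ge0}^n$ there is a constant $C$ (depending on $\rho,i,j$)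 with $\|\delta^i\partial^j\rho(\xi)\|\le C(1+|\xi|)^{m-|j|}$ for all $\xi\in\mathbb R^n$. An $r\times r$ matrix valued symbol of order $m$ is $\rho=(\rho_{j,k})$ with every $\rho_{j,k}\in S^m$; $(\rho(\xi))^*$ is the adjoint in $M_r(A_\theta^\infty)$. $E$ is a finitely generated projective right $A_\theta^\infty$-module, written as a direct summand $E=(A_\theta^\infty)^re$ of the free module $(A_\theta^\infty)^r$, where $e\in M_r(A_\theta^\infty)$ is a self-adjoint idempotent. Elements of $(A_\theta^\infty)^r$ are column vectors on which matrices over $A_\theta^\infty$ act by left multiplication, and $(A_\theta^\infty)^re$ denotes the range of $e$, i.e. $\{\vec a:e\vec a=\vec a\}$. The inner product on $E$ is $\langle\vec a,\vec b\rangle=\tau(\vec b^*\vec a)=\sum_j\tau(b_j^*a_j)$. For a matrix valued symbol $\rho$, the pseudodifferential operator $P_\rho:E\to E$ with symbol $\rho$ is $$P_\rho(\vec a)=\frac1{(2\pi)^n}\int_{\mathbb R^n}\int_{\mathbb R^n}e^{-is\cdot\xi}\rho(\xi)\alpha_s(\vec a)\,ds\,d\xi,$$ an oscillatory integral, i.e. the limit as $\epsilon\to0$ of the integrals with integrand multiplied by $\varphi(\epsilon s,\epsilon\xi)$, where $\varphi$ is any Schwartz function on $\mathbb R^{2n}$ with $\varphi(0)=1$; it is a standing convention that this formula defines an operator from $E$ to $E$. Writing $\sigma(P)=\rho$ means $P=P_\rho$. For a matrix valued symbol $\sigma$ of order $m$ and matrix valued symbols $\sigma_\ell$ of order $m-|\ell|$,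 $\sigma\sim\sum_\ell\sigma_\ell$ means that $\sigma-\sum_{|\ell|<N}\sigma_\ell$ is a matrix valued symbol of order $m-N$ for every integer $N\ge1$. Here $m=M$ in (a) and $m=M+M'$ in (b).
   Formalization: Part (a) fails literally (e=diag(1,0), ρ=E₁₂: P=0 on E but ρ*=E₂₁). Proved instead: P* has symbol eσ with σ having the stated expansion, and P*=P_σ itself when the formula for P_ρ also maps the complement (1-e)(A_θ^∞)^r to itself (automatic for e=1). *)

(* Defs.v *)
(* MathComp-Analysis, over an arbitrary R : realType, with C = R[i]. *)
From HB Require Import structures.
From mathcomp Require Import all_boot all_order all_algebra.
From mathcomp Require Import complex.
From mathcomp Require Import all_classical all_reals all_analysis.
Set Implicit Arguments.
Unset Strict Implicit.
Unset Printing Implicit Defensive.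
Import Order.TTheory GRing.Theory Num.Theory.
Import numFieldNormedType.Exports.
Local Open Scope classical_set_scope.
Local Open Scope ring_scope.

(* Unital, nonzero C*-algebras over R[i]. A plain record, because
   Hierarchy-Builder refuses a common substructure of the normed modules and
   the algebras here (the join with numDomainType is missing); the ring and
   algebra structures are attached to the carrier below. The norm of a normed
   module over R[i] is valued in (the nonnegative reals of) R[i]. *)
Record cstarAlg (R : realType) := CStarAlg {
  cstar_base : completeNormedModType R[i];
  cstar_one : cstar_base;
  cstar_mul : cstar_base -> cstar_base -> cstar_base;
  cstar_star : cstar_base -> cstar_base;
  cstar_mulA : associative cstar_mul;
  cstar_mul1r : left_id cstar_one cstar_mul;
  cstar_mulr1 : right_id cstar_one cstar_mul;
  cstar_mulDl : left_distributive cstar_mul +%R;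
  cstar_mulDr : right_distributive cstar_mul +%R;
  cstar_one_neq0 : cstar_one != 0;
  cstar_scaleAl : forall (c : R[i]) a b,
    c *: cstar_mul a b = cstar_mul (c *: a) b;
  cstar_scaleAr : forall (c : R[i]) a b,
    c *: cstar_mul a b = cstar_mul a (c *: b);
  cstar_normM : forall a b, `|cstar_mul a b| <= `|a| * `|b|;
  cstar_starK : involutive cstar_star;
  cstar_starD : forall a b, cstar_star (a + b) = cstar_star a + cstar_star b;
  cstar_starZ : forall (c : R[i]) a,
    cstar_star (c *: a) = conjc c *: cstar_star a;
  cstar_starM : forall a b,
    cstar_star (cstar_mul a b) = cstar_mul (cstar_star b) (cstar_star a);
  cstar_normS : forall a, `|cstar_mul (cstar_star a) a| = `|a| ^+ 2
}.

Definition cstar_sort (R : realType) (A : cstarAlg R) : Type := cstar_base A.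
Coercion cstar_sort : cstarAlg >-> Sortclass.

HB.instance Definition _ (R : realType) (A : cstarAlg R) :=
  CompleteNormedModule.copy (cstar_sort A) (cstar_base A).
HB.instance Definition _ (R : realType) (A : cstarAlg R) :=
  GRing.Zmodule_isNzRing.Build (cstar_sort A)
    (@cstar_mulA R A) (@cstar_mul1r R A) (@cstar_mulr1 R A)
    (@cstar_mulDl R A) (@cstar_mulDr R A) (@cstar_one_neq0 R A).
HB.instance Definition _ (R : realType) (A : cstarAlg R) :=
  GRing.Lmodule_isLalgebra.Build R[i] (cstar_sort A) (@cstar_scaleAl R A).
HB.instance Definition _ (R : realType) (A : cstarAlg R) :=
  GRing.Lalgebra_isAlgebra.Build R[i] (cstar_sort A) (@cstar_scaleAr R A).

Definition star (R : realType) (A : cstarAlg R) (a : A) : A := @cstar_star R A a.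

Definition unitary (R : realType) (A : cstarAlg R) (u : A) : Prop :=
  star u * u = 1 /\ u * star u = 1.

(* Integer powers of a unitary: u ^ (-k) = (u^* ) ^ k. *)
Definition upow (R : realType) (A : cstarAlg R) (u : A) (k : int) : A :=
  match k with Posz p => u ^+ p | Negz p => star u ^+ p.+1 end.

(* e^{ix} *)
Definition cexp (R : realType) (x : R) : R[i] := Complex (cos x) (sin x).

Definition dotv (R : realType) n (s t : 'rV[R]_n) : R :=
  \sum_(j < n) s 0 j * t 0 j.

Definition enorm (R : realType) n (x : 'rV[R]_n) : R := Num.sqrt (dotv x x).

Definition mabs n (l : 'I_n -> nat) : nat := (\sum_(j < n) l j)%N.

(* The word in which each letter j occurs l j times, letters increasing, so
   that foldr D x (mword l) is D_1^{l_1} ( ... (D_n^{l_n} x)). *)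
Definition mword n (l : 'I_n -> nat) : seq 'I_n :=
  flatten [seq nseq (l j) j | j <- enum 'I_n].

(* Differential calculus for maps from R^m to a normed space over R[i]; the
   increments are real. *)
Section Derivatives.
Context {R : realType} {m : nat} {W : normedModType R[i]}.
Implicit Types f : 'rV[R]_m -> W.

Definition dquot f (j : 'I_m) (x : 'rV[R]_m) (h : R) : W :=
  (h^-1)%:C%C *: (f (x + h *: delta_mx 0 j) - f x).

Definition pderiv (j : 'I_m) f : 'rV[R]_m -> W :=
  fun x => lim (dquot f j x @ 0^').

Definition wderiv (w : seq 'I_m) f : 'rV[R]_m -> W := foldr pderiv f w.

Definition mderiv (l : 'I_m -> nat) f : 'rV[R]_m -> W := wderiv (mword l) f.

Definition Cinfty f : Prop := forall w : seq 'I_m,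
  continuous (wderiv w f) /\
  (forall j x, dquot (wderiv w f) j x @ 0^' --> pderiv j (wderiv w f) x).

End Derivatives.

(* Smooth vectors of an action of R^n, with their natural Frechet topology,
   given by the seminorms a |-> ||(d/ds)^w alpha_s(a)|_{s=0}||. *)
Section SmoothVectors.
Context {R : realType} {n : nat} {A : cstarAlg R} (alpha : 'rV[R]_n -> A -> A).

Definition orbit (a : A) : 'rV[R]_n -> A := fun s => alpha s a.

Definition smooth_vec (a : A) : Prop := Cinfty (orbit a).

Definition orbit_deriv (w : seq 'I_n) (a : A) : A := wderiv w (orbit a) 0.

Definition smooth_cvg (F : set_system A) (a : A) : Prop :=
  smooth_vec a /\ forall w, orbit_deriv w @ F --> orbit_deriv w a.

(* C^oo(R^n, A^oo) *)
Definition Cinfty_smooth (rho : 'rV[R]_n -> A) : Prop :=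
  (forall xi, smooth_vec (rho xi)) /\
  forall w : seq 'I_n,
    (forall xi, smooth_vec (wderiv w rho xi)) /\
    (forall xi, smooth_cvg (wderiv w rho @ xi) (wderiv w rho xi)) /\
    (forall j xi, smooth_cvg (dquot (wderiv w rho) j xi @ 0^')
                             (pderiv j (wderiv w rho) xi)).

End SmoothVectors.

Definition nct_relations (R : realType) n (theta : 'M[R]_n)
    (B : cstarAlg R) (V : 'I_n -> B) : Prop :=
  (forall j, unitary (V j)) /\
  (forall j k, V k * V j = cexp (2 * pi * theta j k) *: (V j * V k)).

(* The noncommutative n-torus A_theta with its action of R^n, its trace and its
   derivations, each given by the properties that determine it. *)
Record ncTorus (R : realType) (n : nat) (theta : 'M[R]_n) := NCTorus {
  nct_alg :> cstarAlg R;

  (* universal C*-algebra generated by the unitaries U_j *)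
  nctU : 'I_n -> nct_alg;
  nctU_rel : nct_relations theta nctU;
  nctU_gen : forall S : set nct_alg, closed S -> S 1 ->
    (forall j, S (nctU j)) ->
    (forall (c : R[i]) a b, S a -> S b -> S (c *: a + b)) ->
    (forall a b, S a -> S b -> S (a * b)) ->
    (forall a, S a -> S (star a)) ->
    forall a, S a;
  nctU_univ : forall (B : cstarAlg R) (V : 'I_n -> B), nct_relations theta V ->
    exists f : {lrmorphism nct_alg -> B},
      (forall a, f (star a) = star (f a)) /\ (forall j, f (nctU j) = V j);

  (* the n-parameter group of automorphisms *)
  ncta : 'rV[R]_n -> {lrmorphism nct_alg -> nct_alg};
  ncta_star : forall s a, ncta s (star a) = star (ncta s a);
  ncta_norm : forall s a, `|ncta s a| = `|a|;
  ncta0 : forall a, ncta 0 a = a;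
  nctaD : forall s t a, ncta (s + t) a = ncta s (ncta t a);
  ncta_U : forall (s : 'rV[R]_n) (m : 'rV[int]_n),
    let Um := \prod_(j < n) upow (nctU j) (m 0 j) in
    ncta s Um = cexp (dotv s (map_mx intr m)) *: Um;

  (* the tracial state *)
  nct_tau : {scalar nct_alg};
  nct_tau_cont : continuous nct_tau;
  nct_tau_ge0 : forall a, 0 <= nct_tau (star a * a);
  nct_tauC : forall a b, nct_tau (a * b) = nct_tau (b * a);
  nct_tau1 : nct_tau 1 = 1;
  nct_tauU : forall m : 'rV[int]_n, m != 0 ->
    nct_tau (\prod_(j < n) upow (nctU j) (m 0 j)) = 0;

  (* the (continuous) derivations of the smooth subalgebra; their values
     outside of it are irrelevant *)
  nctd : 'I_n -> nct_alg -> nct_alg;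
  nctd_smooth : forall j a, smooth_vec ncta a -> smooth_vec ncta (nctd j a);
  nctd_linear : forall j (c : R[i]) a b,
    smooth_vec ncta a -> smooth_vec ncta b ->
    nctd j (c *: a + b) = c *: nctd j a + nctd j b;
  nctdM : forall j a b, smooth_vec ncta a -> smooth_vec ncta b ->
    nctd j (a * b) = nctd j a * b + a * nctd j b;
  nctd_U : forall j k, nctd j (nctU k) = if k == j then nctU k else 0;
  nctd_cont : forall j (u : nat -> nct_alg) a,
    (forall k, smooth_vec ncta (u k)) -> smooth_cvg ncta (u @ \oo) a ->
    smooth_cvg ncta ((nctd j \o u) @ \oo) (nctd j a)
}.

(* Lebesgue measure on R^m, on m-tuples of reals with their product
   sigma-algebra, as the m-fold product of the Lebesgue measure on R. *)
Section LebesgueRm.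
Variable R : realType.
Let T := measurableTypeR R.

Definition tcons m (p : T * m.-tuple T) : m.+1.-tuple T :=
  [tuple of p.1 :: p.2].

Lemma measurable_tcons m : measurable_fun [set: T * m.-tuple T] (@tcons m).
Proof. exact: measurable_cons. Qed.

Definition lebesgueS m (mu : {measure set (m.-tuple T) -> \bar R}) :
    {measure set (m.+1.-tuple T) -> \bar R} :=
  measure_function_pushforward__canonical__measure_function_Measure
    (lebesgue_measure \x^ mu)%E (@measurable_tcons m).

Fixpoint lebesgueRm m : {measure set (m.-tuple T) -> \bar R} :=
  if m is k.+1 then lebesgueS (lebesgueRm k) else \d_ [tuple].

Definition row_of_tuple m (t : m.-tuple T) : 'rV[R]_m :=
  \row_(j < m) (tnth t j : R).

End LebesgueRm.

(* v is the integral of f over R^m in the weak sense (integral tested against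
   all continuous linear functionals, which separate the points of A). *)
Definition is_integral (R : realType) m (A : cstarAlg R)
    (f : 'rV[R]_m -> A) (v : A) : Prop :=
  forall L : {scalar A}, continuous L ->
    let re (t : m.-tuple (measurableTypeR R)) :=
      complex.Re (L (f (row_of_tuple t))) in
    let im (t : m.-tuple (measurableTypeR R)) :=
      complex.Im (L (f (row_of_tuple t))) in
    [/\ (lebesgueRm R m).-integrable setT (EFin \o re),
        (lebesgueRm R m).-integrable setT (EFin \o im) &
        L v = Complex (\int[lebesgueRm R m]_(t in setT) re t)%R
                      (\int[lebesgueRm R m]_(t in setT) im t)%R].

Definition schwartz (R : realType) m (phi : 'rV[R]_m -> R[i]^o) : Prop :=
  Cinfty phi /\
  forall k l : 'I_m -> nat, exists C : R, forall z : 'rV[R]_m,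
    `|(\prod_(j < m) z 0 j ^+ k j)%:C%C * (mderiv l phi z : R[i])| <= C%:C%C.

Section Symbols.
Context {R : realType} {n : nat} {theta : 'M[R]_n} (T : ncTorus theta).

Definition Tinf (a : T) : Prop := smooth_vec (@ncta _ _ _ T) a.

(* tau(a^* a) ^ (1/2), where tau(a^* a) is a nonnegative real *)
Definition l2norm (a : T) : R :=
  Num.sqrt (complex.Re (nct_tau T (star a * a))).

Definition mdelta (l : 'I_n -> nat) (a : T) : T := foldr (@nctd _ _ _ T) a (mword l).

Definition symbol (m : R) (rho : 'rV[R]_n -> T) : Prop :=
  Cinfty_smooth (@ncta _ _ _ T) rho /\
  forall i j : 'I_n -> nat, exists C : R, forall xi : 'rV[R]_n,
    l2norm (mdelta i (mderiv j rho xi)) <=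
      C * (1 + enorm xi) `^ (m - (mabs j)%:R).

Definition mxsymbol r (m : R) (rho : 'rV[R]_n -> 'M[T]_r) : Prop :=
  forall j k, symbol m (fun xi => rho xi j k).

Definition mxstar r1 r2 (M : 'M[T]_(r1, r2)) : 'M[T]_(r2, r1) :=
  (map_mx (@star R T) M)^T.

Definition mxderiv r (l : 'I_n -> nat) (rho : 'rV[R]_n -> 'M[T]_r) :
    'rV[R]_n -> 'M[T]_r :=
  fun xi => \matrix_(j, k) mderiv l (fun eta => rho eta j k) xi.

Definition mxdelta r (l : 'I_n -> nat) (M : 'M[T]_r) : 'M[T]_r :=
  map_mx (mdelta l) M.

Definition mxscale r1 r2 (c : R[i]) (M : 'M[T]_(r1, r2)) : 'M[T]_(r1, r2) :=
  map_mx (fun a => c *: a) M.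

(* sg ~ sum_l sgs l, at order m *)
Definition asymptotic r (m : R) (sg : 'rV[R]_n -> 'M[T]_r)
    (sgs : ('I_n -> nat) -> 'rV[R]_n -> 'M[T]_r) : Prop :=
  [/\ mxsymbol m sg,
      forall l, mxsymbol (m - (mabs l)%:R) (sgs l) &
      forall N : nat, (0 < N)%N ->
        mxsymbol (m - N%:R) (fun xi => sg xi -
          \sum_(l : {ffun 'I_n -> 'I_N} | (mabs (fun j => l j) < N)%N)
             sgs (fun j => l j) xi)].

Definition mfact (l : 'I_n -> nat) : nat := (\prod_(j < n) (l j)`!)%N.

Definition adjoint_term r (rho : 'rV[R]_n -> 'M[T]_r) (l : 'I_n -> nat) :
    'rV[R]_n -> 'M[T]_r :=
  fun xi => mxscale (mfact l)%:R^-1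
    (mxderiv l (fun eta => mxdelta l (mxstar (rho eta))) xi).

Definition product_term r (rho rho' : 'rV[R]_n -> 'M[T]_r)
    (l : 'I_n -> nat) : 'rV[R]_n -> 'M[T]_r :=
  fun xi => mxscale (mfact l)%:R^-1
    (mxderiv l rho xi *m mxdelta l (rho' xi)).

(* Self-adjoint idempotents of M_r(A^oo). *)
Definition projector r (e : 'M[T]_r) : Prop :=
  [/\ forall j k, Tinf (e j k), mxstar e = e & e *m e = e].

(* The module (A^oo)^r e, i.e. the range of e on columns over A^oo. *)
Definition inE r (e : 'M[T]_r) (a : 'cV[T]_r) : Prop :=
  (forall j, Tinf (a j 0)) /\ e *m a = a.

Definition inner r (a b : 'cV[T]_r) : R[i] :=
  \sum_(j < r) nct_tau T (star (b j 0) * a j 0).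

(* Regularized integrand at z = (s, xi) in R^(2n). *)
Definition osc_integrand r (rho : 'rV[R]_n -> 'M[T]_r) (a : 'cV[T]_r)
    (phi : 'rV[R]_(n + n) -> R[i]^o) (eps : R) (z : 'rV[R]_(n + n)) :
    'cV[T]_r :=
  let s := lsubmx z in let xi := rsubmx z in
  mxscale ((phi (eps *: z) : R[i]) * cexp (- dotv s xi))
    (rho xi *m map_mx (ncta T s) a).

(* v = (2 pi)^(-n) * the oscillatory integral of e^{-is.xi} rho(xi) alpha_s(a),
   the limit being taken in A^oo, entrywise. *)
Definition is_oscillatory r (rho : 'rV[R]_n -> 'M[T]_r) (a v : 'cV[T]_r) :
    Prop :=
  forall phi : 'rV[R]_(n + n) -> R[i]^o, schwartz phi -> phi 0 = 1 ->
    exists I : R -> 'cV[T]_r,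
      (forall eps, eps != 0 -> forall k,
         Tinf (I eps k 0) /\
         is_integral (fun z => osc_integrand rho a phi eps z k 0) (I eps k 0)) /\
      (forall k, smooth_cvg (@ncta _ _ _ T)
         ((fun eps => (((2 * pi) ^- n)%:C%C *: I eps k 0 : T)) @ 0^') (v k 0)).

(* P = P_rho as an operator on E = (A^oo)^r e. Since it is required that P maps
   E to E, [exists P, is_pdo e rho P] says that the formula for P_rho defines
   an operator from E to E. Values of P outside of E are irrelevant. *)
Definition is_pdo r (e : 'M[T]_r) (rho : 'rV[R]_n -> 'M[T]_r)
    (P : 'cV[T]_r -> 'cV[T]_r) : Prop :=
  forall a, inE e a -> inE e (P a) /\ is_oscillatory rho a (P a).

(* The formula for P_rho also defines an operator on the complementary summand
   (A^oo)^r (1 - e), i.e. it respects (A^oo)^r = E + (1 - e)(A^oo)^r. Invariance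
   of E alone does not pass to adjoint symbols: for e = diag(1, 0) and the
   constant symbol rho = E_12 one has P_rho = 0 on E, while the symbol rho^* =
   E_21 defines a nonzero map from E to its complement. *)
Definition respects_complement r (e : 'M[T]_r)
    (rho : 'rV[R]_n -> 'M[T]_r) : Prop :=
  exists P' : 'cV[T]_r -> 'cV[T]_r, is_pdo (1%:M - e) rho P'.

Definition is_adjoint r (e : 'M[T]_r) (P Ps : 'cV[T]_r -> 'cV[T]_r) : Prop :=
  (forall b, inE e b -> inE e (Ps b)) /\
  (forall a b, inE e a -> inE e b -> inner (P a) b = inner a (Ps b)).

End Symbols.

(* The entries of theta above the diagonal are linearly independent over Q. *)
Definition upper_Qfree (R : realType) n (theta : 'M[R]_n) : Prop :=
  forall q : 'I_n -> 'I_n -> rat,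
    \sum_(j < n) \sum_(k < n | (j < k)%N) ratr (q j k) * theta j k = 0 ->
    forall j k : 'I_n, (j < k)%N -> q j k = 0.

(* Main.v *)
(* Every object is expanded in the monomials U^k. A symbol of order m is a
   series rho(xi) = sum_k c_k(xi) U^k whose coefficients are scalar symbols of
   order m decaying rapidly in k, and conversely. Fourier inversion evaluates the
   oscillatory integral: P_rho U^m = rho(m) U^m. To see this the amplitude is
   rescaled, powers of (1 - d^2/ds_j^2) are moved onto the cutoff by integration
   by parts, and the limit is taken by dominated convergence; the constant is
   found by testing against prod_j exp(- |y_j|), whose Fourier transform is
   explicit. On Fourier series one computes
     P_rho P_rho' = P_sigma,  sigma(xi) = sum_{k,l} c_k(xi + l) c'_l(xi) U^k U^l,
     (P_rho)^* = P_sigma,     sigma(xi) = sum_k conj(c_k(xi - k)) (U^k)^*,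
   and the asymptotic expansions are the Taylor expansions of c_k(xi + l) around
   xi, because the derivations multiply the coefficient of U^l by monomials in
   l; Peetre's inequality bounds the remainders. The operator only determines its
   action on E, so the symbol of P^* on E is e sigma; when P_rho also preserves
   (1 - e)(A^oo)^r, the operator P_sigma already maps E to itself. *)
From HB Require Import structures.
Require Import Defs.
From mathcomp Require Import all_boot all_order all_algebra.
From mathcomp Require Import complex.
From mathcomp Require Import all_classical all_reals all_analysis measurable_realfun.
From mathcomp Require Import ring lra zify.
Set Implicit Arguments.
Unset Strict Implicit.
Unset Printing Implicit Defensive.
Import Order.TTheory GRing.Theory Num.Theory.
Import numFieldNormedType.Exports.
Local Open Scope classical_set_scope.
Local Open Scope ring_scope.

(** * Norms and countable sums *)

(** Two gaps separate the definitions from a calculus of coefficients. Symbol estimates use the L^2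
    norm, smoothness the C^*-norm. They meet coefficientwise: a Fourier coefficient is bounded by
    the L^2 norm because the trace is positive, and both norms of a series are bounded by the sum of
    its coefficients, which rapid decay controls. Moreover [is_oscillatory] is a relation built on
    weak integrals, so a formula describes the given operator only once its values are unique, that
    is, once Fourier coefficients separate points. The trace is not assumed faithful; separation
    comes from Fejer means, contractive because on polynomials they are averages of the action over
    finite grids with nonnegative weights.

    Adjoints and products of monomials are monomials up to phases depending on theta. These phases
    are never computed: series are kept in the families (U^k)^* and U^k U^l, of which only norms and
    frequencies matter.

    When the complement is preserved, the part of P_sigma b outside E vanishes because it is
    orthogonal to itself. *)

Section RealNorm.
Context {R : realType}.
Implicit Types (c : R[i]).

(** Norms over [R[i]] are valued in [R[i]]; all estimates take place in the ordered field [R]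
    through this real part, and [nrE] shows that nothing is lost. *)
Definition nr (V : normedZmodType R[i]) (x : V) : R := complex.Re `|x|.

Lemma nrE (V : normedZmodType R[i]) (x : V) : `|x| = (nr x)%:C%C.
Proof.
have := normr_ge0 x; rewrite /nr.
by case: `|x| => a b /=; rewrite lecE /= => /andP[/eqP -> _].
Qed.

Lemma nr_ge0 (V : normedZmodType R[i]) (x : V) : 0 <= nr x.
Proof. by have := normr_ge0 x; rewrite nrE lecR. Qed.

Lemma nr0 (V : normedZmodType R[i]) : nr (0 : V) = 0.
Proof. by rewrite /nr normr0. Qed.

Lemma nrN (V : normedZmodType R[i]) (x : V) : nr (- x) = nr x.
Proof. by rewrite /nr normrN. Qed.

Lemma nr_eq0 (V : normedZmodType R[i]) (x : V) : nr x = 0 -> x = 0.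
Proof. by move=> h; apply/normr0_eq0; rewrite nrE h. Qed.

Lemma nrD (V : normedZmodType R[i]) (x y : V) : nr (x + y) <= nr x + nr y.
Proof. by have := ler_normD x y; rewrite !nrE -rmorphD /= lecR. Qed.

Lemma nrB (V : normedZmodType R[i]) (x y : V) : nr (x - y) <= nr x + nr y.
Proof. by rewrite -(nrN y) nrD. Qed.

Lemma nr_distrC (V : normedZmodType R[i]) (x y : V) : nr (x - y) = nr (y - x).
Proof. by rewrite -nrN opprB. Qed.

Lemma nr_triangle (V : normedZmodType R[i]) (x y z : V) :
  nr (x - z) <= nr (x - y) + nr (y - z).
Proof. by have := nrD (x - y) (y - z); rewrite subrKA. Qed.

Lemma nr_sum (V : normedZmodType R[i]) (I : Type) (r : seq I) (P : pred I)
    (F : I -> V) :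
  nr (\sum_(i <- r | P i) F i) <= \sum_(i <- r | P i) nr (F i).
Proof.
elim/big_rec2: _ => [|i y x _ le]; first by rewrite nr0.
by apply: (le_trans (nrD _ _)); rewrite lerD2l.
Qed.

Lemma nrM c c' : nr (c * c') = nr c * nr c'.
Proof. by apply: (@complexI R); rewrite -nrE normrM !nrE rmorphM. Qed.

Lemma nrX c k : nr (c ^+ k) = nr c ^+ k.
Proof. by apply: (@complexI R); rewrite -nrE normrX !nrE rmorphXn. Qed.

Lemma nr1 : nr (1 : R[i]) = 1.
Proof. by rewrite /nr normr1. Qed.

Lemma nrV c : nr (c^-1) = (nr c)^-1.
Proof. by apply: (@complexI R); rewrite -nrE normfV !nrE fmorphV. Qed.

Lemma nr_real (x : R) : nr (x%:C%C) = `|x|.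
Proof. by rewrite /nr normc_def /= expr0n addr0 sqrtr_sqr. Qed.

Lemma nr_sqr c : nr c ^+ 2 = complex.Re c ^+ 2 + complex.Im c ^+ 2.
Proof.
by rewrite /nr normc_def /= sqr_sqrtr // addr_ge0 ?sqr_ge0.
Qed.

Lemma nr_conj c : nr (conjc c) = nr c.
Proof. by case: c => a b; rewrite /nr !normc_def /= sqrrN. Qed.

Lemma nr_cexp (x : R) : nr (cexp x) = 1.
Proof. by rewrite /nr normc_def /= cos2Dsin2 sqrtr1. Qed.

Lemma nr_Re c : `|complex.Re c| <= nr c.
Proof.
rewrite -(@ler_pXn2r _ 2) ?nnegrE ?nr_ge0 // nr_sqr real_normK ?num_real //.
by rewrite lerDl sqr_ge0.
Qed.

Lemma nr_Im c : `|complex.Im c| <= nr c.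
Proof.
rewrite -(@ler_pXn2r _ 2) ?nnegrE ?nr_ge0 // nr_sqr real_normK ?num_real //.
by rewrite lerDr sqr_ge0.
Qed.

Lemma nr_ReIm c : nr c <= `|complex.Re c| + `|complex.Im c|.
Proof.
rewrite -(@ler_pXn2r _ 2) ?nnegrE ?nr_ge0 ?addr_ge0 // nr_sqr sqrrD.
rewrite !real_normK ?num_real // -addrA lerD2l lerDr.
by rewrite mulrn_wge0 // mulr_ge0.
Qed.

Lemma nrZ (V : normedModType R[i]) c (x : V) : nr (c *: x) = nr c * nr x.
Proof. by apply: (@complexI R); rewrite -nrE normrZ !nrE rmorphM. Qed.

(** A positive element of [R[i]] is real, so real tolerances suffice. *)
Lemma cvg_nrP (V : normedModType R[i]) (U : Type) (F : set_system U)
    {FF : Filter F} (f : U -> V) (l : V) :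
  (f @ F --> l) <-> forall e : R, 0 < e -> \forall t \near F, nr (f t - l) < e.
Proof.
split.
- move=> /cvgrPdist_lt h e e0.
  have := h e%:C%C; rewrite ltcR => /(_ e0); apply: filterS => t.
  by rewrite distrC nrE ltcR.
- move=> h; apply/cvgrPdist_lt => e e0.
  have [x x0 ex] : exists2 x : R, 0 < x & e = x%:C%C.
    move: e e0 => [a b]; rewrite ltcE /= => /andP[/eqP -> a0].
    by exists a.
  have := h _ x0; apply: filterS => t.
  by rewrite distrC nrE ex ltcR.
Qed.

Lemma cvg_nr (V : normedModType R[i]) (U : Type) (F : set_system U)
    {FF : Filter F} (f : U -> V) (l : V) :
  f @ F --> l -> (fun t => nr (f t)) @ F --> nr l.
Proof.
move=> /cvg_nrP h; apply/cvgrPdist_lt => e e0.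
have := h e e0; apply: filterS => t; apply: le_lt_trans.
have h1 := nrD (f t - l) l; have h2 := nrD (l - f t) (f t).
rewrite subrK in h1; rewrite subrK nr_distrC in h2.
by rewrite ler_norml; apply/andP; split; lra.
Qed.

Lemma cvg_ReIm (U : Type) (F : set_system U) {FF : Filter F}
    (f : U -> R[i]^o) (l : R[i]^o) :
  (f @ F --> l) <-> ((fun t => complex.Re (f t)) @ F --> complex.Re l) /\
                    ((fun t => complex.Im (f t)) @ F --> complex.Im l).
Proof.
split.
- move=> /cvg_nrP h; split; apply/cvgrPdist_lt => e e0.
  + have := h e e0; apply: filterS => t; apply: le_lt_trans.
    by rewrite distrC -raddfB nr_Re.
  + have := h e e0; apply: filterS => t; apply: le_lt_trans.
    by rewrite distrC -raddfB nr_Im.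
- move=> [/cvgrPdist_lt h1 /cvgrPdist_lt h2]; apply/cvg_nrP => e e0.
  have e20 : 0 < e / 2 by lra.
  have := h2 _ e20; apply: filterS2 (h1 _ e20) => t.
  move=> a b; apply: le_lt_trans (nr_ReIm _) _.
  by rewrite !raddfB /= distrC [X in _ + X]distrC; lra.
Qed.

End RealNorm.

Section CountableSums.
Context {R : realType}.

(** Series over a countable type are summed along the pickling codes; a code that names no element
    contributes 0. *)
Definition cseq (I : countType) (V : zmodType) (f : I -> V) (k : nat) : V :=
  oapp f 0 (pickle_inv k).

Definition psum (I : countType) (V : zmodType) (f : I -> V) (N : nat) : V :=
  \sum_(k < N) cseq f k.

Definition csum (I : countType) (V : normedModType R[i]) (f : I -> V) : V :=
  lim (psum f @ \oo).

(** Stated through finite subfamilies, hence independent of the enumeration that [psum] uses; this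
    is what makes products and reorderings painless. *)
Definition summable_bound (I : countType) (b : I -> R) : Prop :=
  (forall i, 0 <= b i) /\
  exists K : R, forall s : seq I, uniq s -> \sum_(i <- s) b i <= K.

Lemma psum_seq (I : countType) (V : zmodType) (f : I -> V) (N : nat) :
  psum f N = \sum_(i <- pmap (@pickle_inv I) (iota 0 N)) f i.
Proof.
rewrite /psum -(big_mkord xpredT (cseq f)) /index_iota subn0 big_pmap.
by apply: eq_bigr => k _; rewrite /cseq; case: pickle_inv.
Qed.

Lemma pmap_pickle_uniq (I : countType) (N : nat) :
  uniq (pmap (@pickle_inv I) (iota 0 N)).
Proof.
by apply: (pmap_uniq (g := pickle)); [exact: pickle_invK|exact: iota_uniq].
Qed.

Lemma psum_bound (I : countType) (b : I -> R) (K : R) (N : nat) :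
  (forall s : seq I, uniq s -> \sum_(i <- s) b i <= K) -> psum b N <= K.
Proof. by move=> h; rewrite psum_seq h // pmap_pickle_uniq. Qed.

Lemma cseq_ge0 (I : countType) (b : I -> R) k :
  (forall i, 0 <= b i) -> 0 <= cseq b k.
Proof. by rewrite /cseq; case: pickle_inv => /=. Qed.

Lemma psum_morph (I : countType) (V W : zmodType) (g : {additive V -> W})
    (f : I -> V) N : g (psum f N) = psum (g \o f) N.
Proof.
rewrite /psum raddf_sum; apply: eq_bigr => k _; rewrite /cseq.
by case: pickle_inv => //=; rewrite raddf0.
Qed.

Lemma psumD (I : countType) (V : zmodType) (f g : I -> V) N :
  psum (fun i => f i + g i) N = psum f N + psum g N.
Proof.
rewrite /psum -big_split; apply: eq_bigr => k _; rewrite /cseq.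
by case: pickle_inv => //=; rewrite addr0.
Qed.

Lemma psumB (I : countType) (V : zmodType) (f g : I -> V) N :
  psum (fun i => f i - g i) N = psum f N - psum g N.
Proof.
rewrite /psum -sumrB; apply: eq_bigr => k _; rewrite /cseq.
by case: pickle_inv => //=; rewrite subr0.
Qed.

Lemma psum_tail (I : countType) (V : normedModType R[i]) (f : I -> V)
    (b : I -> R) (N M : nat) : (N <= M)%N ->
  (forall i, nr (f i) <= b i) -> nr (psum f M - psum f N) <= psum b M - psum b N.
Proof.
move=> NM fb; rewrite /psum.
rewrite -!(big_mkord xpredT (cseq f)) -!(big_mkord xpredT (cseq b)).
rewrite !(big_cat_nat (leq0n N) NM) /=.
rewrite [X in nr (X - _)]addrC addrK [X in _ <= X - _]addrC addrK.
apply: le_trans (nr_sum _ _ _) _; apply: ler_sum => k _.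
by rewrite /cseq; case: pickle_inv => //=; rewrite nr0.
Qed.

Lemma psum_norm (I : countType) (V : normedModType R[i]) (f : I -> V)
    (b : I -> R) (N : nat) :
  (forall i, nr (f i) <= b i) -> nr (psum f N) <= psum b N.
Proof.
move=> fb; have := @psum_tail I V f b 0 N (leq0n N) fb.
by rewrite {2 4}/psum !big_ord0 !subr0.
Qed.

Lemma psum_cvg_bound (I : countType) (b : I -> R) : summable_bound b ->
  cvg (psum b @ \oo).
Proof.
move=> [b0 [K hK]].
apply: nondecreasing_is_cvgn.
- apply/nondecreasing_seqP => k.
  by rewrite /psum big_ord_recr /= lerDl cseq_ge0.
- by exists K => _ [k _ <-]; exact: psum_bound.
Qed.

Lemma psum_tail_small (I : countType) (b : I -> R) : summable_bound b ->
  forall e : R, 0 < e ->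
  exists N : nat, forall M, (N <= M)%N -> psum b M - psum b N <= e.
Proof.
move=> hb e e0; have := psum_cvg_bound hb.
set l := lim _ => /cvgrPdist_lt /(_ (e / 2)).
have -> : 0 < e / 2 by lra.
move=> /(_ isT) [N _ hN]; exists N => M NM.
have := hN N (leqnn N); have := hN M NM => /=.
by rewrite !ltr_norml => /andP[? ?] /andP[? ?]; lra.
Qed.

Lemma csum_cvg (I : countType) (V : completeNormedModType R[i]) (f : I -> V)
    (b : I -> R) :
  summable_bound b -> (forall i, nr (f i) <= b i) ->
  psum f @ \oo --> csum f.
Proof.
move=> hb fb; apply: cauchy_cvg.
apply/cauchy_exP => e e0.
have [x x0 ex] : exists2 x : R, 0 < x & e = x%:C%C.
  move: e e0 => [a c]; rewrite ltcE /= => /andP[/eqP -> a0].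
  by exists a.
have [|N hN] := @psum_tail_small I b hb (x / 3); first lra.
exists (psum f N); exists N => // M /= NM.
rewrite -ball_normE /= nrE ex ltcR nr_distrC.
by apply: (le_lt_trans (psum_tail NM fb)); have := hN M NM; lra.
Qed.

Lemma csum_unique (I : countType) (V : normedModType R[i]) (f : I -> V) l :
  psum f @ \oo --> l -> csum f = l.
Proof. by apply: cvg_lim; exact: norm_hausdorff. Qed.

Lemma cvg_nr_ge (V : normedModType R[i]) (u : nat -> V) (l : V) (K : R) :
  u @ \oo --> l -> (forall k, nr (u k) <= K) -> nr l <= K.
Proof.
move=> /cvg_nr h uK.
rewrite -(cvg_lim (@Rhausdorff R) h); apply: limr_le.
  by apply/cvg_ex; exists (nr l).
by apply: nearW.
Qed.

Lemma csum_norm (I : countType) (V : completeNormedModType R[i]) (f : I -> V)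
    (b : I -> R) (K : R) :
  (forall i, nr (f i) <= b i) ->
  (forall s : seq I, uniq s -> \sum_(i <- s) b i <= K) -> nr (csum f) <= K.
Proof.
move=> fb hK; have hb : summable_bound b.
  by split; [move=> i; apply: le_trans (fb i); exact: nr_ge0|exists K].
apply: (cvg_nr_ge (csum_cvg hb fb)) => N.
by apply: le_trans (psum_norm _ fb) _; exact: psum_bound.
Qed.

Lemma csum_morph (I : countType) (V : completeNormedModType R[i])
    (W : normedModType R[i]) (g : {additive V -> W}) (f : I -> V) (b : I -> R) :
  summable_bound b -> (forall i, nr (f i) <= b i) -> continuous g ->
  psum (g \o f) @ \oo --> g (csum f).
Proof.
move=> hb fb cg.
have -> : psum (g \o f) = g \o psum f.
  by apply/funext => N /=; rewrite psum_morph.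
by apply: continuous_cvg; [exact: cg|exact: csum_cvg hb fb].
Qed.

Lemma csumD (I : countType) (V : completeNormedModType R[i]) (f g : I -> V)
    (b c : I -> R) :
  summable_bound b -> summable_bound c ->
  (forall i, nr (f i) <= b i) -> (forall i, nr (g i) <= c i) ->
  csum (fun i => f i + g i) = csum f + csum g.
Proof.
move=> hb hc fb gc; apply: csum_unique.
rewrite (_ : psum _ = fun N => psum f N + psum g N); last first.
  by apply/funext => N; rewrite psumD.
by apply: cvgD; [exact: csum_cvg hb fb|exact: csum_cvg hc gc].
Qed.

(** The truncation index depends on the majorant [b] alone, not on [f]; this uniformity is what
    allows limits to pass through series. *)
Lemma csum_tail (I : countType) (V : completeNormedModType R[i]) (b : I -> R) :
  summable_bound b -> forall e : R, 0 < e -> exists N : nat, forall f : I -> V,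
    (forall i, nr (f i) <= b i) -> nr (csum f - psum f N) <= e.
Proof.
move=> hb e e0; have [N hN] := psum_tail_small hb e0.
exists N => f fb.
have h : (fun M => psum f (M + N) - psum f N) @ \oo --> csum f - psum f N.
  apply: cvgB; last exact: cvg_cst.
  by rewrite (cvg_shiftn N (psum f)); exact: csum_cvg hb fb.
apply: (cvg_nr_ge h) => M.
by apply: le_trans (psum_tail (leq_addl _ _) fb) (hN _ (leq_addl _ _)).
Qed.

Lemma cvg_psum (I : countType) (V : normedModType R[i]) (U : Type)
    (F : set_system U) {FF : Filter F} (g : I -> U -> V) (l : I -> V) N :
  (forall i, g i @ F --> l i) ->
  (fun t => psum (g ^~ t) N) @ F --> psum l N.
Proof.
move=> gl; rewrite /psum; elim: N => [|N IH].
  by rewrite big_ord0; under eq_fun do rewrite big_ord0; exact: cvg_cst.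
rewrite big_ord_recr /=; under eq_fun do rewrite big_ord_recr /=.
apply: cvgD => //; rewrite /cseq.
by case: pickle_inv => [i|] /=; [exact: gl|exact: cvg_cst].
Qed.

(* Tannery's theorem: dominated convergence for series. *)
Lemma cvg_csum (I : countType) (V : completeNormedModType R[i]) (U : Type)
    (F : set_system U) (FF : ProperFilter F) (g : I -> U -> V) (l : I -> V)
    (b : I -> R) :
  summable_bound b -> (\forall t \near F, forall i, nr (g i t) <= b i) ->
  (forall i, g i @ F --> l i) ->
  (fun t => csum (g ^~ t)) @ F --> csum l.
Proof.
move=> hb gb gl; apply/cvg_nrP => e e0.
have lb i : nr (l i) <= b i.
  have h : (fun t => nr (g i t)) @ F --> nr (l i) by exact: cvg_nr (gl i).
  rewrite -(cvg_lim (@Rhausdorff R) h); apply: limr_le.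
    by apply/cvg_ex; exists (nr (l i)).
  by apply: filterS gb => t; exact.
have [|N hN] := @csum_tail I V b hb (e / 4); first lra.
have /cvg_nrP/(_ (e / 4)) : (fun t => psum (g ^~ t) N) @ F --> psum l N.
  exact: cvg_psum.
have -> : 0 < e / 4 by lra.
move=> /(_ isT); apply: filterS2 gb => t gt near.
have h1 := hN _ gt; have h2 := hN _ lb.
have h3 := nr_triangle (csum (g ^~ t)) (psum (g ^~ t) N) (csum l).
have h4 := nr_triangle (psum (g ^~ t) N) (psum l N) (csum l).
rewrite nr_distrC in h2.
by lra.
Qed.

Lemma csum_single (I : countType) (V : normedModType R[i]) (f : I -> V) (i0 : I) :
  (forall i, i != i0 -> f i = 0) -> csum f = f i0.
Proof.
move=> f0; apply: csum_unique.
apply: (@cvg_trans _ ((fun _ : nat => f i0) @ \oo)); last exact: cvg_cst.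
apply: near_eq_cvg; near=> N.
rewrite psum_seq (bigD1_seq i0) ?pmap_pickle_uniq //=; last first.
  rewrite mem_pmap; apply/mapP; exists (pickle i0).
    by rewrite mem_iota add0n /=; near: N; exists (pickle i0).+1.
  by rewrite pickleK_inv.
by rewrite big1 ?addr0 // => i; exact: f0.
Unshelve. all: by end_near. Qed.

Lemma summable_boundZ (I : countType) (b : I -> R) (C : R) :
  summable_bound b -> 0 <= C -> summable_bound (fun i => C * b i).
Proof.
move=> [b0 [K hK]] C0; split=> [i|]; first by rewrite mulr_ge0.
by exists (C * K) => s us; rewrite -mulr_sumr ler_wpM2l // hK.
Qed.

Lemma sum_uniq_sub (I : choiceType) (s t : seq I) (F : I -> R) :
  (forall i, 0 <= F i) -> uniq s -> uniq t -> {subset s <= t} ->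
  \sum_(i <- s) F i <= \sum_(i <- t) F i.
Proof.
move=> F0 us ut st.
rewrite [leRHS](bigID (mem s)) /= -[leLHS]addr0 lerD //; last exact: sumr_ge0.
rewrite -[X in _ <= X]big_filter le_eqVlt; apply/orP; left; apply/eqP.
apply: perm_big; apply: uniq_perm => //; first exact: filter_uniq.
by move=> i; rewrite mem_filter; case: (boolP (i \in s)) => //= /st ->.
Qed.

(** A finite set of pairs lies in the product of its two projections, over which the sum factors. *)
Lemma summable_bound_prod (I J : countType) (b : I -> R) (c : J -> R) :
  summable_bound b -> summable_bound c ->
  summable_bound (fun p : I * J => b p.1 * c p.2).
Proof.
move=> [b0 [K hK]] [c0 [L hL]]; split=> [i|]; first by rewrite mulr_ge0.
exists (K * L) => s us.
pose s1 := undup (map fst s); pose s2 := undup (map snd s).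
apply: (@le_trans _ _ (\sum_(p <- [seq (i, j) | i <- s1, j <- s2]) b p.1 * c p.2)).
  apply: sum_uniq_sub => //; first by move=> p; rewrite mulr_ge0.
    by apply: allpairs_uniq; rewrite ?undup_uniq // => -[? ?] [? ?].
  move=> [i j] ijs; apply/allpairsP; exists (i, j); rewrite !mem_undup; split => //=.
    by apply/mapP; exists (i, j).
  by apply/mapP; exists (i, j).
rewrite big_allpairs_dep /=.
rewrite (eq_bigr (fun i => b i * \sum_(j <- s2) c j)); last first.
  by move=> i _; rewrite mulr_sumr.
rewrite -mulr_suml.
have K0 : 0 <= K by have := hK [::] isT; rewrite big_nil.
apply: ler_pM; rewrite ?sumr_ge0 //.
  by apply: hK; rewrite undup_uniq.
by apply: hL; rewrite undup_uniq.
Qed.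

End CountableSums.

(** * Partial derivatives and Taylor remainders *)

Section PartialDerivatives.
Context {R : realType} {m : nat}.

(** [pderiv] is a [lim], meaningful only when the limit exists; this relation carries existence and
    value together. *)
Definition is_pd (W : normedModType R[i]) (f : 'rV[R]_m -> W) (j : 'I_m) x (l : W) :=
  dquot f j x @ 0^' --> l.

Lemma pderiv_eq (W : normedModType R[i]) (f : 'rV[R]_m -> W) j x l :
  is_pd f j x l -> pderiv j f x = l.
Proof. by apply: cvg_lim; exact: norm_hausdorff. Qed.

#[local] Opaque pderiv.

Lemma wderiv_cat (W : normedModType R[i]) (f : 'rV[R]_m -> W) v w :
  wderiv (v ++ w) f = wderiv v (wderiv w f).
Proof. by rewrite /wderiv foldr_cat. Qed.

Lemma Cinfty_wderiv (W : normedModType R[i]) (f : 'rV[R]_m -> W) w :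
  Cinfty f -> Cinfty (wderiv w f).
Proof. by move=> h v; rewrite -wderiv_cat; exact: h. Qed.

Lemma Cinfty_continuous (W : normedModType R[i]) (f : 'rV[R]_m -> W) :
  Cinfty f -> continuous f.
Proof. by move=> /(_ [::])[]. Qed.

Lemma Cinfty_pd (W : normedModType R[i]) (f : 'rV[R]_m -> W) j x :
  Cinfty f -> is_pd f j x (pderiv j f x).
Proof. by move=> /(_ [::])[_]; exact. Qed.

(** A family indexed by words and stable under differentiation is the family of all iterated
    derivatives. Here and in [Cinfty_family], smoothness and formulas for derivatives are obtained
    by exhibiting such a family. *)
Lemma wderiv_family (W : normedModType R[i])
    (D : seq 'I_m -> 'rV[R]_m -> W) :
  (forall w j x, is_pd (D w) j x (D (j :: w) x)) ->
  forall w, wderiv w (D [::]) = D w.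
Proof.
move=> h; elim=> //= j w IH; rewrite IH.
by apply/funext => x; exact: pderiv_eq.
Qed.

Lemma Cinfty_family (W : normedModType R[i])
    (D : seq 'I_m -> 'rV[R]_m -> W) :
  (forall w, continuous (D w)) ->
  (forall w j x, is_pd (D w) j x (D (j :: w) x)) ->
  Cinfty (D [::]).
Proof.
move=> c h w; rewrite (wderiv_family h); split=> [|j x]; first exact: c.
by have := h w j x; rewrite /is_pd (pderiv_eq (h w j x)).
Qed.

(** Homogeneity is asked for real scalars only, so that complex conjugation is covered along with
    linear maps. *)
Lemma dquot_comp (W W' : normedModType R[i]) (T : {additive W -> W'})
    (f : 'rV[R]_m -> W) j x :
  (forall (r : R) a, T (r%:C%C *: a) = r%:C%C *: T a) ->
  dquot (T \o f) j x = T \o dquot f j x.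
Proof.
move=> Tr; apply/funext => h; rewrite /dquot /=.
rewrite Tr.
rewrite (raddfB T).
by [].
Qed.

Lemma is_pd_comp (W W' : normedModType R[i]) (T : {additive W -> W'})
    (f : 'rV[R]_m -> W) j x l :
  (forall (r : R) a, T (r%:C%C *: a) = r%:C%C *: T a) -> continuous T ->
  is_pd f j x l -> is_pd (T \o f) j x (T l).
Proof.
move=> Tr cT h; rewrite /is_pd dquot_comp //.
by apply: continuous_cvg h; exact: cT.
Qed.

Lemma wderiv_comp (W W' : normedModType R[i]) (T : {additive W -> W'})
    (f : 'rV[R]_m -> W) :
  (forall (r : R) a, T (r%:C%C *: a) = r%:C%C *: T a) -> continuous T ->
  (forall w j x, is_pd (wderiv w f) j x (wderiv (j :: w) f x)) ->
  forall w, wderiv w (T \o f) = T \o wderiv w f.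
Proof.
move=> Tr cT hf.
apply: (@wderiv_family W' (fun w => T \o wderiv w f)) => w j x /=.
by apply: is_pd_comp => //; exact: hf.
Qed.

Lemma Cinfty_comp (W W' : normedModType R[i]) (T : {additive W -> W'})
    (f : 'rV[R]_m -> W) :
  (forall (r : R) a, T (r%:C%C *: a) = r%:C%C *: T a) -> continuous T ->
  Cinfty f -> Cinfty (T \o f).
Proof.
move=> Tr cT hf.
apply: (@Cinfty_family W' (fun w => T \o wderiv w f)).
  by move=> w x; apply: continuous_comp; [exact: (hf w).1|exact: cT].
by move=> w j x /=; apply: is_pd_comp => //; exact: (hf w).2.
Qed.

Lemma is_pdD (W : normedModType R[i]) (f g : 'rV[R]_m -> W) j x a b :
  is_pd f j x a -> is_pd g j x b -> is_pd (fun y => f y + g y) j x (a + b).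
Proof.
move=> hf hg; rewrite /is_pd.
rewrite (_ : dquot _ j x = fun h => dquot f j x h + dquot g j x h).
  exact: cvgD.
by apply/funext => h; rewrite /dquot -scalerDr opprD addrACA.
Qed.

Lemma is_pdZ (W : normedModType R[i]) (c : R[i]) (f : 'rV[R]_m -> W) j x a :
  is_pd f j x a -> is_pd (fun y => c *: f y) j x (c *: a).
Proof.
move=> hf; rewrite /is_pd.
rewrite (_ : dquot _ j x = fun h => c *: dquot f j x h); first exact: cvgZl_tmp.
by apply/funext => h; rewrite /dquot -scalerBr !scalerA mulrC.
Qed.

Lemma cvg_sum_seq (W : normedModType R[i]) (U : Type) (F : set_system U)
    {FF : Filter F} (I : Type) (r : seq I) (P : pred I) (f : I -> U -> W)
    (l : I -> W) :
  (forall i, P i -> f i @ F --> l i) ->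
  (fun t => \sum_(i <- r | P i) f i t) @ F --> \sum_(i <- r | P i) l i.
Proof.
move=> h; elim: r => [|i r IH].
  by rewrite big_nil; under eq_fun do rewrite big_nil; exact: cvg_cst.
rewrite big_cons; under eq_fun do rewrite big_cons.
by case: ifP => Pi //; apply: cvgD => //; exact: h.
Qed.

Lemma is_pd_sum (W : normedModType R[i]) (I : Type) (r : seq I) (P : pred I)
    (f : I -> 'rV[R]_m -> W) j x l :
  (forall i, P i -> is_pd (f i) j x (l i)) ->
  is_pd (fun y => \sum_(i <- r | P i) f i y) j x (\sum_(i <- r | P i) l i).
Proof.
move=> h; elim: r => [|i r IH].
  rewrite big_nil (_ : (fun _ => _) = fun=> 0).
    rewrite /is_pd (_ : dquot _ j x = fun=> 0); first exact: cvg_cst.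
    by apply/funext => t; rewrite /dquot subr0 scaler0.
  by apply/funext => y; rewrite big_nil.
rewrite big_cons (_ : (fun _ => _) = fun y => if P i then f i y +
    \sum_(k <- r | P k) f k y else \sum_(k <- r | P k) f k y); last first.
  by apply/funext => y; rewrite big_cons.
by case: ifP => Pi //; apply: is_pdD => //; exact: h.
Qed.

Lemma Cinfty_sum (W : normedModType R[i]) (I : Type) (r : seq I) (P : pred I)
    (f : I -> 'rV[R]_m -> W) :
  (forall i, P i -> Cinfty (f i)) ->
  Cinfty (fun y => \sum_(i <- r | P i) f i y) /\
  forall w, wderiv w (fun y => \sum_(i <- r | P i) f i y) =
    fun y => \sum_(i <- r | P i) wderiv w (f i) y.
Proof.
move=> h.
have hd w j x : is_pd (fun y => \sum_(i <- r | P i) wderiv w (f i) y) j x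
    (\sum_(i <- r | P i) wderiv (j :: w) (f i) x).
  by apply: is_pd_sum => i Pi; exact: (h i Pi w).2.
split; last exact: (@wderiv_family W
  (fun w y => \sum_(i <- r | P i) wderiv w (f i) y) hd).
apply: (@Cinfty_family W (fun w y => \sum_(i <- r | P i) wderiv w (f i) y)) hd.
move=> w x; apply: (@cvg_sum_seq _ _ _ (nbhs_filter x) _ _ _ (fun i => wderiv w (f i)) (fun i => wderiv w (f i) x)) => i Pi.
exact: (h i Pi w).1.
Qed.

Lemma continuous_translate (a : 'rV[R]_m) : continuous (fun x : 'rV[R]_m => x + a).
Proof. by move=> x; apply: (@cvgD _ _ _ (nbhs x) _ id (fun=> a)); [exact: cvg_id|exact: cvg_cst]. Qed.

Lemma Cinfty_translate (W : normedModType R[i]) (f : 'rV[R]_m -> W) a :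
  Cinfty f -> Cinfty (fun x => f (x + a)) /\
  forall w, wderiv w (fun x => f (x + a)) = fun x => wderiv w f (x + a).
Proof.
move=> h.
have hd w j x : is_pd (fun x => wderiv w f (x + a)) j x
    (wderiv (j :: w) f (x + a)).
  have := (h w).2 j (x + a); rewrite /is_pd.
  rewrite (_ : dquot (wderiv w f) j (x + a) =
    dquot (fun x => wderiv w f (x + a)) j x) //.
  by apply/funext => t; rewrite /dquot addrAC.
split; last exact: (@wderiv_family W (fun w x => wderiv w f (x + a)) hd).
apply: (@Cinfty_family W (fun w x => wderiv w f (x + a))) hd => w x.
apply: (@continuous_comp _ _ _ (fun x : 'rV[R]_m => x + a) (wderiv w f)).
  exact: continuous_translate.
exact: (h w).1.
Qed.

Lemma Cinfty_cst (W : normedModType R[i]) (a : W) :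
  Cinfty (fun _ : 'rV[R]_m => a) /\
  forall w, wderiv w (fun _ : 'rV[R]_m => a) = fun=> if w is [::] then a else 0.
Proof.
pose D (w : seq 'I_m) (x : 'rV[R]_m) : W := if w is [::] then a else 0.
have hd w j x : is_pd (D w) j x (D (j :: w) x).
  rewrite /is_pd (_ : dquot _ j x = fun=> 0); first exact: cvg_cst.
  by apply/funext => t; rewrite /dquot /D; case: w; rewrite subrr scaler0.
split; last exact: (@wderiv_family W D hd).
by apply: (@Cinfty_family W D _ hd) => w; exact: (@cst_continuous _ _ (D w 0)).
Qed.

Lemma is_pd_scale (W : normedModType R[i]) (f : 'rV[R]_m -> R[i]^o)
    (g : 'rV[R]_m -> W) j x a b :
  {for x, continuous g} -> is_pd f j x a -> is_pd g j x b ->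
  is_pd (fun y => (f y : R[i]) *: g y) j x ((a : R[i]) *: g x + (f x : R[i]) *: b).
Proof.
move=> cg hf hg; rewrite /is_pd.
rewrite (_ : dquot _ j x = fun h : R =>
    (dquot f j x h : R[i]) *: g (x + h *: delta_mx 0 j) +
    (f x : R[i]) *: dquot g j x h).
  apply: cvgD; last by apply: cvgZl_tmp.
  apply: (@cvgZ _ _ _ _ _ (dquot f j x : _ -> R[i])) => //.
  have e : (fun h : R => x + h *: delta_mx 0 j : 'rV[R]_m) @ 0^' --> x.
    rewrite -[X in _ --> X]addr0; apply: cvgD; first exact: cvg_cst.
    rewrite -(scale0r (delta_mx 0 j)); apply: cvgZr_tmp.
    exact: nbhs_dnbhs.
  exact: cvg_comp e cg.
apply/funext => h; rewrite /dquot.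
set c := (h^-1)%:C%C; rewrite scalerA [f x * c]mulrC -!scalerA -scalerDr.
congr (_ *: _); rewrite scalerBl scalerBr.
by rewrite addrA subrK.
Qed.

(** All ways to distribute the letters of a word between two factors, with repetitions: in this form
    the Leibniz rule has no binomial coefficients. *)
Fixpoint splits (w : seq 'I_m) : seq (seq 'I_m * seq 'I_m) :=
  if w is j :: w' then [seq (j :: p.1, p.2) | p <- splits w'] ++
                       [seq (p.1, j :: p.2) | p <- splits w']
  else [:: ([::], [::])].

Lemma splits_size w p : p \in splits w -> (size p.1 + size p.2)%N = size w.
Proof.
elim: w p => [|j w IH] p /=; first by rewrite inE => /eqP ->.
by rewrite mem_cat => /orP[] /mapP[q /IH <- ->] /=; rewrite ?addnS.
Qed.

Lemma Cinfty_scale (W : normedModType R[i]) (f : 'rV[R]_m -> R[i]^o)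
    (g : 'rV[R]_m -> W) : Cinfty f -> Cinfty g ->
  Cinfty (fun y => (f y : R[i]) *: g y) /\
  forall w, wderiv w (fun y => (f y : R[i]) *: g y) =
    fun y => \sum_(p <- splits w) (wderiv p.1 f y : R[i]) *: wderiv p.2 g y.
Proof.
move=> hf hg.
pose D w y : W := \sum_(p <- splits w) (wderiv p.1 f y : R[i]) *: wderiv p.2 g y.
have hd w j x : is_pd (D w) j x (D (j :: w) x).
  rewrite /D /= big_cat !big_map /= -big_split /=.
  apply: is_pd_sum => p _; apply: is_pd_scale.
  - exact: (hg p.2).1.
  - exact: (hf p.1).2.
  - exact: (hg p.2).2.
have D0 : D [::] = fun y => (f y : R[i]) *: g y.
  by apply/funext => y; rewrite /D /= big_seq1.
rewrite -D0; split; last exact: (@wderiv_family W D hd).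
apply: (@Cinfty_family W D) hd => w x.
apply: (@cvg_sum_seq _ _ _ (nbhs_filter x) _ _ _
  (fun p y => (wderiv p.1 f y : R[i]) *: wderiv p.2 g y)
  (fun p => (wderiv p.1 f x : R[i]) *: wderiv p.2 g x)) => p _.
by apply: (@cvgZ _ _ _ _ _ (wderiv p.1 f : _ -> R[i])); [exact: (hf p.1).1|exact: (hg p.2).1].
Qed.

End PartialDerivatives.

Section MeanValue.
Context {R : realType} {m : nat}.
Implicit Types (f : 'rV[R]_m -> R[i]^o).

#[local] Opaque pderiv.

Lemma near_rV (W : normedModType R[i]) (f : 'rV[R]_m -> W) x :
  {for x, continuous f} -> forall e : R, 0 < e -> exists2 d : R, 0 < d &
    forall y : 'rV[R]_m, (forall j, `|y 0 j - x 0 j| < d) -> nr (f y - f x) < e.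
Proof.
move=> /cvg_nrP h e e0; have /nbhs_ballP[d /= d0 hd] := h e e0.
exists d => // y hy; apply: hd; split=> // i j; rewrite !ord1.
by rewrite /ball /= distrC.
Qed.

(** The mean value theorem holds for real functions only, so it is applied separately to real and
    imaginary parts through this real version of [is_pd]. *)
Definition rpd (g : 'rV[R]_m -> R) (j : 'I_m) x (l : R) :=
  (fun h : R => h^-1 * (g (x + h *: delta_mx 0 j) - g x)) @ 0^' --> l.

Lemma rpd_Re f j x (l : R[i]^o) : is_pd f j x l ->
  rpd (fun y => complex.Re (f y)) j x (complex.Re l).
Proof.
move=> /cvg_ReIm[h _]; move: h; rewrite /rpd.
set u := (X in X @ _ --> _ -> _); set v := (X in _ -> X @ _ --> _).
suff -> : u = v by [].
apply/funext => h; rewrite /u /v /dquot /=.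
by case: (f _) (f x) => a b [c d] /=; rewrite mul0r subr0.
Qed.

Lemma rpd_Im f j x (l : R[i]^o) : is_pd f j x l ->
  rpd (fun y => complex.Im (f y)) j x (complex.Im l).
Proof.
move=> /cvg_ReIm[_ h]; move: h; rewrite /rpd.
set u := (X in X @ _ --> _ -> _); set v := (X in _ -> X @ _ --> _).
suff -> : u = v by [].
apply/funext => h; rewrite /u /v /dquot /=.
by case: (f _) (f x) => a b [c d] /=; rewrite mul0r addr0.
Qed.

Lemma rpd_mean_value (g g' : 'rV[R]_m -> R) j x (h : R) :
  (forall y, rpd g j y (g' y)) ->
  exists2 c : R, 0 <= c <= 1 &
    g (x + h *: delta_mx 0 j) - g x = h * g' (x + (c * h) *: delta_mx 0 j).
Proof.
move=> hg.
pose u (t : R) := g (x + t *: delta_mx 0 j).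
have du t : is_derive t (1 : R) u (g' (x + t *: delta_mx 0 j)).
  have := hg (x + t *: delta_mx 0 j); rewrite /rpd.
  set v := (X in X @ _ --> _).
  have -> : v = (fun s : R => s^-1 *: (u (s *: 1 + t) - u t)).
    apply/funext => s; rewrite /v /u /GRing.scale /= mulr1.
    by rewrite -addrA -scalerDl [t + s]addrC.
  move=> vl; split; first by apply/cvg_ex; eexists; exact: vl.
  by rewrite /derive; apply: cvg_lim vl; exact: Rhausdorff.
have cu (A : set R) : {within A, continuous u}.
  apply: continuous_subspaceT => t; apply: differentiable_continuous.
  by apply/derivable1_diffP; case: (du t).
have [h0|h0|->] := ltgtP h 0; last first.
- by exists 0; rewrite ?lexx ?ler01 // scale0r addr0 subrr mul0r.
- have [c /andP[c0 c1] e] := MVT h0 (fun t _ => du t) (cu _).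
  rewrite !bnd_simp in c0 c1.
  exists (c / h).
    apply/andP; split; first by rewrite divr_ge0 // ltW.
    by rewrite ler_pdivrMr // mul1r ltW.
  rewrite -mulrA mulVf ?gt_eqF // mulr1.
  by move: e; rewrite /u scale0r addr0 subr0 mulrC.
- have [c /andP[c0 c1] e] := MVT h0 (fun t _ => du t) (cu _).
  rewrite !bnd_simp in c0 c1.
  exists (c / h).
    apply/andP; split; first by rewrite ler_ndivlMr // mul0r (ltW c1).
    by rewrite ler_ndivrMr // mul1r ltW.
  rewrite -mulrA mulVf ?lt_eqF // mulr1.
  move: e; rewrite /u scale0r addr0 sub0r mulrN => e.
  by rewrite -opprB e opprK mulrC.
Qed.

(** The factor 2 is the price of treating real and imaginary parts separately, each with its own
    intermediate point. *)
Lemma mean_value_le f f' j x (h B : R) :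
  (forall y, is_pd f j y (f' y)) ->
  (forall c : R, 0 <= c <= 1 -> nr (f' (x + (c * h) *: delta_mx 0 j)) <= B) ->
  nr (f (x + h *: delta_mx 0 j) - f x) <= 2 * `|h| * B.
Proof.
move=> hf hB.
have [c hc ec] := @rpd_mean_value _ (fun y => complex.Re (f' y)) j x h
  (fun y => rpd_Re (hf y)).
have [d hd ed] := @rpd_mean_value _ (fun y => complex.Im (f' y)) j x h
  (fun y => rpd_Im (hf y)).
apply: le_trans (nr_ReIm _) _.
rewrite !raddfB /= ec ed !normrM -mulrDr -mulrA mulrCA ler_wpM2l //.
rewrite mulr_natl mulr2n lerD //.
  by apply: le_trans (nr_Re _) _; exact: hB.
by apply: le_trans (nr_Im _) _; exact: hB.
Qed.

Lemma rpd_translate_diff (g g' : 'rV[R]_m -> R) j a x :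
  (forall y, rpd g j y (g' y)) ->
  rpd (fun y => g (y + a) - g y) j x (g' (x + a) - g' x).
Proof.
move=> hg; rewrite /rpd.
rewrite (_ : (fun h : R => _) = fun h : R =>
    h^-1 * (g (x + a + h *: delta_mx 0 j) - g (x + a)) -
    h^-1 * (g (x + h *: delta_mx 0 j) - g x)).
  by apply: cvgB; exact: hg.
by apply/funext => h; rewrite -mulrBr (addrAC x a); congr (_ * _); ring.
Qed.

(** Schwarz's theorem: the second difference of [g] over a square of side t equals t^2 times either
    mixed derivative at some point of the square, according to the order in which the mean value
    theorem is applied; continuity of both at [x] concludes. *)
Lemma rpd_symm (g gi gj gij gji : 'rV[R]_m -> R) i j (x : 'rV[R]_m) :
  (forall y, rpd g i y (gi y)) -> (forall y, rpd g j y (gj y)) ->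
  (forall y, rpd gj i y (gij y)) -> (forall y, rpd gi j y (gji y)) ->
  (forall e : R, 0 < e -> exists2 d : R, 0 < d &
    forall y : 'rV[R]_m, (forall k, `|y 0 k - x 0 k| < d) ->
      `|gij y - gij x| < e) ->
  (forall e : R, 0 < e -> exists2 d : R, 0 < d &
    forall y : 'rV[R]_m, (forall k, `|y 0 k - x 0 k| < d) ->
      `|gji y - gji x| < e) ->
  gij x = gji x.
Proof.
move=> hi hj hij hji cij cji; apply/eqP; rewrite -subr_eq0; apply/eqP.
apply/normr0_eq0/eqP; rewrite eq_le normr_ge0 andbT.
apply/ler_addgt0Pl => e e0; rewrite addr0.
have e20 : 0 < e / 2 by lra.
have [d1 d10 h1] := cij _ e20; have [d2 d20 h2] := cji _ e20.
(* Both intermediate points are within 2t of [x] in each coordinate, and 2t must be smaller than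
   both radii. *)
pose t := Num.min d1 d2 / 3.
have t0 : 0 < t by rewrite divr_gt0 // lt_min d10.
have td1 : 2 * t < d1.
  have : Num.min d1 d2 <= d1 by rewrite ge_min lexx.
  by rewrite /t; lra.
have td2 : 2 * t < d2.
  have : Num.min d1 d2 <= d2 by rewrite ge_min lexx orbT.
  by rewrite /t; lra.
clearbody t.
have [c hc ec] := @rpd_mean_value
  (fun y => g (y + t *: delta_mx 0 i) - g y) _ j x t
  (fun y => @rpd_translate_diff _ _ _ _ y hj).
have [c' hc' ec'] := @rpd_mean_value _ _ i (x + (c * t) *: delta_mx 0 j) t hij.
have [b hb eb] := @rpd_mean_value
  (fun y => g (y + t *: delta_mx 0 j) - g y) _ i x t
  (fun y => @rpd_translate_diff _ _ _ _ y hi).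
have [b' hb' eb'] := @rpd_mean_value _ _ j (x + (b * t) *: delta_mx 0 i) t hji.
move: ec eb; rewrite ec' eb' => ec eb.
pose p1 := x + (c * t) *: delta_mx 0 j + (c' * t) *: delta_mx 0 i.
pose p2 := x + (b * t) *: delta_mx 0 i + (b' * t) *: delta_mx 0 j.
rewrite -/p1 in ec; rewrite -/p2 in eb.
have near (y : 'rV[R]_m) (k l : 'I_m) (u v : R) : 0 <= u <= 1 -> 0 <= v <= 1 ->
    forall s, `|(y + (u * t) *: delta_mx 0 k + (v * t) *: delta_mx 0 l) 0 s - y 0 s| <= 2 * t.
  move=> hu hv s; rewrite !mxE eqxx /=.
  have -> (a1 b1 c1 : R) : a1 + b1 + c1 - a1 = b1 + c1 by ring.
  apply: le_trans (ler_normD _ _) _; rewrite mulr_natl mulr2n.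
  have aux (a : R) (o : bool) : 0 <= a <= 1 -> `|a * t * o%:R| <= t.
    move=> /andP[a0 a1]; rewrite !normrM (gtr0_norm t0) (ger0_norm a0).
    case: o; rewrite ?normr1 ?normr0 ?mulr1 ?mulr0 ?(ltW t0) //.
    by rewrite ler_piMl // ltW.
  by apply: lerD; exact: aux.
have e12 : gij p1 = gji p2.
  have t0' : t != 0 by rewrite gt_eqF.
  apply: (mulfI t0'); apply: (mulfI t0').
  rewrite -ec -eb.
  by rewrite (addrAC x (t *: delta_mx 0 i)); ring.
have n1 : `|gij p1 - gij x| < e / 2.
  by apply: h1 => k; apply: le_lt_trans td1; apply: near.
have n2 : `|gji p2 - gji x| < e / 2.
  by apply: h2 => k; apply: le_lt_trans td2; apply: near.
rewrite -(subrKA (gij p1)) [in X in _ + X]e12.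
apply: le_trans (ler_normD _ _) _; rewrite distrC.
by apply: ltW; rewrite [ltRHS](_ : e = e / 2 + e / 2) ?ltrD //; lra.
Qed.

Lemma pderivC f i j : Cinfty f -> pderiv i (pderiv j f) = pderiv j (pderiv i f).
Proof.
move=> hf; apply/funext => x; apply/eqP; rewrite eq_complex; apply/andP.
have h1 k y : is_pd f k y (pderiv k f y) by exact: Cinfty_pd.
have h2 k l y : is_pd (pderiv l f) k y (pderiv k (pderiv l f) y).
  exact: (hf [:: l]).2.
have h3 k l e : 0 < e -> exists2 d : R, 0 < d &
    forall y : 'rV[R]_m, (forall j, `|y 0 j - x 0 j| < d) ->
    nr (pderiv k (pderiv l f) y - pderiv k (pderiv l f) x) < e.
  by apply: near_rV; exact: (hf [:: k; l]).1.
split; apply/eqP.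
- apply: (@rpd_symm (fun y => complex.Re (f y)) (fun y => complex.Re (pderiv i f y))
    (fun y => complex.Re (pderiv j f y))
    (fun y => complex.Re (pderiv i (pderiv j f) y))
    (fun y => complex.Re (pderiv j (pderiv i f) y)) i j).
  + by move=> y; exact: rpd_Re.
  + by move=> y; exact: rpd_Re.
  + by move=> y; exact: rpd_Re.
  + by move=> y; exact: rpd_Re.
  + move=> e /(h3 i j)[d d0 hd]; exists d => // y /hd; apply: le_lt_trans.
    by rewrite -raddfB nr_Re.
  + move=> e /(h3 j i)[d d0 hd]; exists d => // y /hd; apply: le_lt_trans.
    by rewrite -raddfB nr_Re.
- apply: (@rpd_symm (fun y => complex.Im (f y)) (fun y => complex.Im (pderiv i f y))
    (fun y => complex.Im (pderiv j f y))
    (fun y => complex.Im (pderiv i (pderiv j f) y))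
    (fun y => complex.Im (pderiv j (pderiv i f) y)) i j).
  + by move=> y; exact: rpd_Im.
  + by move=> y; exact: rpd_Im.
  + by move=> y; exact: rpd_Im.
  + by move=> y; exact: rpd_Im.
  + move=> e /(h3 i j)[d d0 hd]; exists d => // y /hd; apply: le_lt_trans.
    by rewrite -raddfB nr_Im.
  + move=> e /(h3 j i)[d d0 hd]; exists d => // y /hd; apply: le_lt_trans.
    by rewrite -raddfB nr_Im.
Qed.

Lemma wderiv_pderivC f w j : Cinfty f ->
  wderiv w (pderiv j f) = pderiv j (wderiv w f).
Proof.
move=> hf; elim: w => [|i w IH]; first exact: erefl.
rewrite -[LHS]/(pderiv i (wderiv w (pderiv j f))) IH.
apply: pderivC; exact: Cinfty_wderiv.
Qed.

Lemma wderivC f v w : Cinfty f -> wderiv v (wderiv w f) = wderiv w (wderiv v f).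
Proof.
move=> hf; elim: v => [|i v IH]; first exact: erefl.
rewrite -[LHS]/(pderiv i (wderiv v (wderiv w f))) IH.
rewrite -wderiv_pderivC; [exact: erefl|exact: Cinfty_wderiv].
Qed.

Lemma wderiv_perm f v w : Cinfty f -> perm_eq v w -> wderiv v f = wderiv w f.
Proof.
move=> hf vw.
have h : wderiv v f = wderiv v f by exact: erefl.
apply: (@catCA_perm_ind _ (fun s => wderiv v f = wderiv s f)) vw h => s1 s2 s3 ->.
rewrite !wderiv_cat wderivC; [exact: erefl|exact: Cinfty_wderiv].
Qed.

End MeanValue.

(** * Polynomial weights and Peetre's inequality *)

Section Weights.
Context {R : realType} {m : nat}.
Implicit Types x y : 'rV[R]_m.

(** A product weight, so that the integral of its inverse over R^m and the sum over Z^m factor into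
    one-dimensional ones. It also dominates every coordinate. *)
Definition pw x : R := \prod_(j < m) (1 + x 0 j ^+ 2).

(** A variant of 1 + |x| with the l^1 norm: comparable with it ([enorm_jb]) and submultiplicative
    ([jbD]) with constant 1. *)
Definition jb x : R := 1 + \sum_(j < m) `|x 0 j|.

Lemma pw_ge1 x : 1 <= pw x.
Proof.
rewrite /pw; elim/big_ind: _ => [//|a b a1 b1|j _].
  by rewrite -[1]mulr1 ler_pM.
by rewrite lerDl sqr_ge0.
Qed.

Lemma jb_ge1 x : 1 <= jb x.
Proof. by rewrite lerDl sumr_ge0. Qed.

Lemma jb_gt0 x : 0 < jb x.
Proof. exact: lt_le_trans (jb_ge1 x). Qed.

Lemma le_prod_ge1 (I : finType) (F : I -> R) (j : I) :
  (forall i, 1 <= F i) -> F j <= \prod_i F i.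
Proof.
move=> h; rewrite (bigD1 j) //= ler_peMr //; first by apply: le_trans (h j).
elim/big_ind: _ => [//|a b a1 b1|i _]; last exact: h.
by rewrite -[1]mulr1 ler_pM.
Qed.

Lemma le_sum_prod (I : finType) (F : I -> R) : (forall i, 0 <= F i) ->
  1 + \sum_i F i <= \prod_i (1 + F i).
Proof.
move=> h; suff : 1 + \sum_i F i <= \prod_i (1 + F i) /\ 0 <= \sum_i F i by case.
elim/big_rec2: _ => [|i a b _ [le b0]]; first by rewrite addr0.
split; last by rewrite addr_ge0.
apply: (@le_trans _ _ ((1 + F i) * (1 + a))).
  by have := mulr_ge0 (h i) b0; lra.
by rewrite ler_wpM2l // addr_ge0.
Qed.

Lemma coord_le_pw x j : `|x 0 j| <= pw x.
Proof.
have h : `|x 0 j| <= 1 + x 0 j ^+ 2.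
  by rewrite ler_norml; apply/andP; split; nra.
apply: (le_trans h); apply: (@le_prod_ge1 _ (fun j => 1 + x 0 j ^+ 2)) => i.
by rewrite lerDl sqr_ge0.
Qed.

Lemma jb_le_pw x : jb x <= 2 ^+ m * pw x.
Proof.
apply: (le_trans (le_sum_prod (fun j => normr_ge0 (x 0 j)))).
rewrite -[X in 2 ^+ X](card_ord m) -prodr_const -big_split /=.
apply: ler_prod => j _; rewrite addr_ge0 //=.
rewrite -real_normK ?num_real //; have := normr_ge0 (x 0 j).
by move: `|_| => a a0; nra.
Qed.

Lemma jbD x y : jb (x + y) <= jb x * jb y.
Proof.
apply: (@le_trans _ _ (jb x + \sum_(j < m) `|y 0 j|)).
  rewrite /jb -addrA -big_split lerD2l; apply: ler_sum => j _.
  by rewrite mxE ler_normD.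
by rewrite [jb y]/jb mulrDr mulr1 lerD2l ler_peMl ?sumr_ge0 ?jb_ge1.
Qed.

Lemma jbN x : jb (- x) = jb x.
Proof. by rewrite /jb; congr (_ + _); apply: eq_bigr => j _; rewrite mxE normrN. Qed.

(** Orders of symbols are arbitrary reals: the first comparison serves s >= 0, the second one s <
    0. *)
Lemma powR_le_equiv (a b K s : R) : 0 < a -> 0 < b -> 0 < K ->
  a <= K * b -> b <= K * a -> a `^ s <= K `^ `|s| * b `^ s.
Proof.
move=> a0 b0 K0 ab ba; have [s0|s0] := leP 0 s.
  rewrite ger0_norm // -powRM ?(ltW K0) ?(ltW b0) //.
  by apply: ge0_ler_powR => //; rewrite nnegrE ?mulr_ge0 ?(ltW a0) ?(ltW b0) ?(ltW K0).
rewrite ltr0_norm // -[in a `^ s](opprK s) -[in b `^ s](opprK s).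
have : 0 < - s by rewrite oppr_gt0.
move: (- s) => {s0}s s0; rewrite !powRN.
rewrite -ler_pdivrMl ?powR_gt0 // -invfM lef_pV2 ?posrE ?mulr_gt0 ?powR_gt0 //.
rewrite -powRM ?(ltW K0) ?(ltW a0) //.
by apply: ge0_ler_powR => //; rewrite ?nnegrE ?mulr_ge0 ?(ltW a0) ?(ltW b0) ?(ltW K0) // ltW.
Qed.

(** Submultiplicativity is used for x + y and for x = (x + y) - y, which gives the two comparisons
    required by [powR_le_equiv]. *)
Lemma peetre x y (s : R) : jb (x + y) `^ s <= jb y `^ `|s| * jb x `^ s.
Proof.
apply: powR_le_equiv; rewrite ?jb_gt0 //.
  by rewrite mulrC jbD.
by rewrite -[jb y]jbN mulrC -{1}(addrK y x) jbD.
Qed.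

Lemma enorm_ge0 x : 0 <= enorm x.
Proof. exact: sqrtr_ge0. Qed.

Lemma coord_le_enorm x j : `|x 0 j| <= enorm x.
Proof.
rewrite -sqrtr_sqr ler_wsqrtr // /dotv (bigD1 j) //= expr2 lerDl.
by apply: sumr_ge0 => i _; rewrite -expr2 sqr_ge0.
Qed.

Lemma enorm_le_sum x : enorm x <= \sum_(j < m) `|x 0 j|.
Proof.
have S0 : 0 <= \sum_(j < m) `|x 0 j| by rewrite sumr_ge0.
rewrite -(ger0_norm S0) -sqrtr_sqr ler_wsqrtr // expr2 mulr_suml.
apply: ler_sum => j _; rewrite -expr2 -real_normK ?num_real // expr2.
by rewrite ler_wpM2l // (bigD1 j) //= lerDl sumr_ge0.
Qed.

Lemma enorm_jb x s :
  (1 + enorm x) `^ s <= (1 + m%:R) `^ `|s| * jb x `^ s /\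
  jb x `^ s <= (1 + m%:R) `^ `|s| * (1 + enorm x) `^ s.
Proof.
have e0 := enorm_ge0 x; have j1 := jb_ge1 x.
have m0 : (0 : R) <= m%:R by rewrite ler0n.
have h1 : 1 + enorm x <= (1 + m%:R) * jb x.
  apply: (@le_trans _ _ (jb x)); first by rewrite lerD2l enorm_le_sum.
  by rewrite ler_peMl ?lerDl // ltW ?jb_gt0.
have h2 : jb x <= (1 + m%:R) * (1 + enorm x).
  have : \sum_(j < m) `|x 0 j| <= m%:R * enorm x.
    rewrite -[m in m%:R]card_ord -sumr_const mulr_suml.
    by apply: ler_sum => j _; rewrite mul1r coord_le_enorm.
  by rewrite /jb; nra.
by split; apply: powR_le_equiv => //; lra.
Qed.

(** One factor 1 + x_j^2 is expanded at a time, raising the exponent of x_j by 2; the coordinates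
    are treated by induction inside the induction on p. The index type is arbitrary: points of R^m
    for Schwartz functions, lattice points for smooth elements, pairs of a lattice point and a
    covector for symbols. *)
Lemma moments_pw (I : Type) (x : I -> 'rV[R]_m) (u : I -> R) :
  (forall i, 0 <= u i) ->
  (forall k : 'I_m -> nat, exists C, forall i,
     `|\prod_(j < m) x i 0 j ^+ k j| * u i <= C) ->
  forall p, exists C, forall i, pw (x i) ^+ p * u i <= C.
Proof.
move=> u0 h p.
suff H : forall k : 'I_m -> nat, exists C, forall i,
    `|\prod_(j < m) x i 0 j ^+ k j| * (pw (x i) ^+ p * u i) <= C.
  have [C hC] := H (fun=> 0%N); exists C => i; apply: le_trans (hC i).
  rewrite big1 ?normr1 ?mul1r // => j _; exact: expr0.
elim: p => [|p IH] k.
  have [C hC] := h k; exists C => i; by rewrite expr0 mul1r.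
have H : forall (s : seq 'I_m) (k : 'I_m -> nat), exists C, forall i,
    `|\prod_(j < m) x i 0 j ^+ k j| *
      (\prod_(j <- s) (1 + x i 0 j ^+ 2) * (pw (x i) ^+ p * u i)) <= C.
  elim=> [|a s IHs] l.
    by have [C hC] := IH l; exists C => i; rewrite big_nil mul1r.
  have [C1 hC1] := IHs l.
  have [C2 hC2] := IHs (fun j => l j + (j == a) * 2)%N.
  exists (C1 + C2) => i; rewrite big_cons.
  apply: le_trans (lerD (hC1 i) (hC2 i)).
  have -> : \prod_(j < m) x i 0 j ^+ (l j + (j == a) * 2) =
      (\prod_(j < m) x i 0 j ^+ l j) * x i 0 a ^+ 2.
    under eq_bigr do rewrite exprD.
    rewrite big_split /=; congr (_ * _).
    rewrite (bigD1 a) //= eqxx big1 ?mulr1 //.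
    by move=> j /negbTE ->.
  rewrite normrM [`|x i 0 a ^+ 2|]ger0_norm ?sqr_ge0 //.
  by rewrite le_eqVlt; apply/orP; left; apply/eqP; ring.
have [C hC] := H (enum 'I_m) k; exists C => i; apply: le_trans (hC i).
by rewrite exprS -mulrA /pw big_enum.
Qed.

End Weights.

Section Multiindices.
Context {n : nat}.

Lemma count_mword (l : 'I_n -> nat) j : count_mem j (mword l) = l j.
Proof.
rewrite /mword count_flatten -map_comp sumnE big_map big_enum /=.
rewrite (bigD1 j) //= big1 => [|i /negbTE ij].
  by rewrite count_nseq /= eqxx mul1n addn0.
by rewrite count_nseq /= ij.
Qed.

Lemma size_mword (l : 'I_n -> nat) : size (mword l) = mabs l.
Proof.
rewrite /mword size_flatten /shape -map_comp sumnE big_map big_enum.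
by apply: eq_bigr => j _; rewrite /= size_nseq.
Qed.

Lemma perm_mword (l l' : 'I_n -> nat) i :
  (forall j, l' j = (l j + (j == i))%N) -> perm_eq (mword l') (rcons (mword l) i).
Proof.
move=> h; apply/allP => j _ /=; apply/eqP.
by rewrite count_mword -cats1 count_cat count_mword /= h addn0 eq_sym.
Qed.

End Multiindices.

Section Taylor.
Context {R : realType} {n : nat}.
Implicit Types (f : 'rV[R]_n -> R[i]^o) (x l : 'rV[R]_n).
#[local] Opaque pderiv.

Definition head_row l (k : nat) : 'rV[R]_n :=
  \row_j (if (j < k)%N then l 0 j else 0).

(* Moving from 0 to l one coordinate at a time only requires partial
   derivatives inside the box spanned by l. *)
Lemma box_mean_value (F : 'rV[R]_n -> R[i]^o) (F' : 'I_n -> 'rV[R]_n -> R[i]^o)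
    l (B : R) :
  (forall j (y : 'rV[R]_n), is_pd F j y (F' j y)) ->
  (forall j (y : 'rV[R]_n), (forall k, `|y 0 k| <= `|l 0 k|) -> nr (F' j y) <= B) ->
  nr (F l - F 0) <= 2 * (\sum_j `|l 0 j|) * B.
Proof.
move=> hF hB.
have e0 : head_row l 0 = 0 by apply/rowP => j; rewrite !mxE.
have en : head_row l n = l by apply/rowP => j; rewrite !mxE ltn_ord.
have -> : F l - F 0 = \sum_(k < n) (F (head_row l k.+1) - F (head_row l k)).
  rewrite -{1}en -{1}e0 -(big_mkord xpredT
    (fun k => F (head_row l k.+1) - F (head_row l k))).
  by rewrite telescope_sumr.
apply: le_trans (nr_sum _ _ _) _.
rewrite mulr_sumr mulr_suml; apply: ler_sum => k _.
have -> : head_row l k.+1 = head_row l k + l 0 k *: delta_mx 0 k.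
  apply/rowP => j; rewrite !mxE eqxx ltnS leq_eqVlt /=.
  have [->|jk] := eqVneq j k; first by rewrite ltnn eqxx mulr1 add0r.
  by rewrite (inj_eq val_inj) (negbTE jk) mulr0 addr0.
apply: mean_value_le => [y|c /andP[c0 c1]]; first exact: hF.
apply: hB => j; rewrite !mxE eqxx /=.
have [->|jk] := eqVneq j k.
  by rewrite ltnn mulr1 add0r normrM (ger0_norm c0) ler_piMl.
by rewrite mulr0 addr0; case: ifP; rewrite ?normr0.
Qed.

Definition monom (b : 'I_n -> nat) l : R[i]^o :=
  (\prod_(j < n) l 0 j ^+ b j)%:C%C.

Lemma is_pd_pow (c : R) (b : nat) i x (f : 'rV[R]_n -> R) :
  (forall h, f (x + h *: delta_mx 0 i) = c * (x 0 i + h) ^+ b) ->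
  is_pd (fun l => (f l)%:C%C : R[i]^o) i x (c * (b%:R * x 0 i ^+ b.-1))%:C%C.
Proof.
move=> hf; rewrite /is_pd.
have h0 : is_derive (x 0 i) (1 : R) (fun t : R => t ^+ b) (b%:R * x 0 i ^+ b.-1).
  have := @is_deriveX _ _ id b (x 0 i) 1 1 (is_derive_id _ _).
  by rewrite /GRing.scale /= mulr1 exprfctE.
have h1 : (fun h : R => h^-1 *: ((h *: (1 : R) + x 0 i) ^+ b - x 0 i ^+ b)) @ 0^'
   --> b%:R * x 0 i ^+ b.-1.
  case: h0 => /cvg_ex[a /= ha]; rewrite /derive => <-.
  by rewrite (cvg_lim _ ha).
apply/cvg_ReIm; split=> /=.
  rewrite (_ : (fun t : R => _) = fun h : R =>
      c * (h^-1 *: ((h *: (1 : R) + x 0 i) ^+ b - x 0 i ^+ b))).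
    by apply: cvgM; [exact: cvg_cst|exact: h1].
  apply/funext => h; rewrite hf -{2}[x](addr0 x) -(scale0r (delta_mx 0 i)) hf.
  have -> : h *: (1 : R) + x 0 i = x 0 i + h by rewrite /GRing.scale /= mulr1 addrC.
  by rewrite addr0 /GRing.scale /=; ring.
rewrite (_ : (fun t : R => _) = fun=> 0); first exact: cvg_cst.
by apply/funext => h; rewrite /dquot /=; ring.
Qed.

Lemma is_pd_monom (b : 'I_n -> nat) i x :
  is_pd (monom b) i x ((b i)%:R * monom (fun j => b j - (j == i))%N x).
Proof.
pose c := \prod_(j < n | j != i) x 0 j ^+ b j.
have -> : (b i)%:R * monom (fun j => b j - (j == i))%N x =
    (c * ((b i)%:R * x 0 i ^+ (b i).-1))%:C%C.
  rewrite /monom (bigD1 i) //= eqxx subn1.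
  rewrite (eq_bigr (fun j => x 0 j ^+ b j)) => [|j /negbTE ->]; last by rewrite subn0.
  by rewrite -/c !rmorphM /= rmorph_nat; ring.
apply: (@is_pd_pow c (b i) i x (fun l => \prod_(j < n) l 0 j ^+ b j)) => h.
rewrite (bigD1 i) //= !mxE !eqxx mulr1 mulrC; congr (_ * _).
by apply: eq_bigr => j /negbTE ji; rewrite !mxE ji andbF mulr0 addr0.
Qed.

Section Remainder.
Context (K : nat).
(** Multi-indices with entries at most [K], so that sums over them are finite. [K] is separate from
    the degree N: the induction on N keeps the index type fixed. *)
Let B := {ffun 'I_n -> 'I_K.+1}.

Definition tcoef f x (b : 'I_n -> nat) : R[i] := (mfact b)%:R^-1 * mderiv b f x.

Definition rem N f x l : R[i]^o :=
  f (x + l) - \sum_(b : B | (mabs (fun j => b j) < N)%N)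
    tcoef f x (fun j => b j) * monom (fun j => b j) l.

Let up (i : 'I_n) (b : B) : B :=
  [ffun j => if j == i then inord (b j).+1 else b j].
Let down (i : 'I_n) (b : B) : B :=
  [ffun j => if j == i then inord (b j).-1 else b j].

Lemma mabs_bump (b b' : 'I_n -> nat) i :
  (forall j, b' j = (b j + (j == i))%N) -> mabs b' = (mabs b).+1.
Proof.
move=> h; rewrite /mabs (eq_bigr (fun j => b j + (j == i)))%N => [|j _]; last exact: h.
by rewrite big_split /= -addn1; congr addn; rewrite (bigD1 i) //= eqxx big1 // => j /negbTE ->.
Qed.

Lemma mfact_bump (b b' : 'I_n -> nat) i :
  (forall j, b' j = (b j + (j == i))%N) -> mfact b' = ((b i).+1 * mfact b)%N.
Proof.
move=> h; rewrite /mfact (bigD1 i) //= h eqxx addn1 factS -mulnA.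
rewrite [in RHS](bigD1 i) //=; congr (_ * (_ * _))%N.
by apply: eq_bigr => j /negbTE ji; rewrite h ji addn0.
Qed.

Lemma mderiv_bump f (b b' : 'I_n -> nat) i : Cinfty f ->
  (forall j, b' j = (b j + (j == i))%N) -> mderiv b' f = mderiv b (pderiv i f).
Proof.
move=> hf h; rewrite /mderiv (wderiv_perm hf (perm_mword h)).
by rewrite -cats1 wderiv_cat.
Qed.

Let upE i (b : B) : (b i < K)%N -> forall j, (up i b j = b j + (j == i) :> nat)%N.
Proof.
move=> bK j; rewrite ffunE; case: eqVneq => [->|_]; last by rewrite addn0.
by rewrite inordK ?addn1 // ltnS.
Qed.

(** Differentiating the Taylor remainder in the increment [l] lowers its order by one and replaces
    [f] by its partial derivative: terms with b_i = 0 disappear and the others are reindexed by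
    raising b_i. *)
Lemma rem_pd N f x l i : Cinfty f -> (N <= K)%N ->
  is_pd (rem N.+1 f x) i l (rem N (pderiv i f) x l).
Proof.
move=> hf NK.
have h1 : is_pd (fun l => f (x + l)) i l (pderiv i f (x + l)).
  have := (Cinfty_translate x hf).1 [::]; rewrite /= => -[_ /(_ i l)].
  have := (Cinfty_translate x hf).2 [:: i]; rewrite /= => -> /=.
  rewrite [x + l]addrC (_ : (fun l0 => f (x + l0)) = fun l0 => f (l0 + x)) //.
  by apply/funext => y; rewrite addrC.
rewrite /rem; apply: is_pdD h1 _.
pose q (b : B) : R[i]^o := tcoef f x (fun j => b j) *
  ((b i)%:R * monom (fun j => b j - (j == i))%N l).
have h2 : @is_pd _ _ R[i]^o (fun l => - \sum_(b : B | (mabs (fun j => b j) < N.+1)%N)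
    tcoef f x (fun j => b j) * monom (fun j => b j) l) i l
    (- \sum_(b : B | (mabs (fun j => b j) < N.+1)%N) q b).
  rewrite -sumrN; under eq_fun do rewrite -sumrN.
  apply: is_pd_sum => b _.
  have hm := @is_pd_monom (fun j => b j) i l.
  rewrite /q; move: (tcoef f x _) => c.
  rewrite -mulNr (_ : (fun y => - (c * monom (fun j => b j) y)) =
    fun y => - c * monom (fun j => b j) y); first exact: (@is_pdZ _ _ _ (- c)).
  by apply/funext => y; rewrite mulNr.
suff <- : \sum_(b : B | (mabs (fun j => b j) < N.+1)%N) q b =
    \sum_(b : B | (mabs (fun j => b j) < N)%N)
      tcoef (pderiv i f) x (fun j => b j) * monom (fun j => b j) l by [].
rewrite (bigID (fun b : B => 0 < b i)%N) /= [X in _ + X]big1 ?addr0; last first.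
  by move=> b /andP[_]; rewrite lt0n negbK /q => /eqP ->; rewrite mul0r mulr0.
rewrite (reindex_onto (up i) (down i)) /=; last first.
  move=> b /andP[_ b0]; apply/ffunP => j; rewrite !ffunE.
  case: eqVneq => // ->; apply/val_inj => /=.
  have e : (inord (b i).-1 : 'I_K.+1) = (b i).-1 :> nat.
    by rewrite inordK // (leq_ltn_trans (leq_pred _)).
  by rewrite e prednK // inord_val.
have key b : ((mabs (fun j => up i b j) < N.+1)%N && (0 < up i b i)%N &&
    (down i (up i b) == b)) = (mabs (fun j => b j) < N)%N.
  have [bK|bK] := ltnP (b i) K.
    rewrite (mabs_bump (upE bK)) ltnS upE // eqxx addn1 /= andbT.
    rewrite (_ : _ == b) ?andbT //; apply/eqP/ffunP => j; rewrite 2!ffunE.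
    case: eqVneq => // ->.
    have e : (inord (b i).+1 : 'I_K.+1) = (b i).+1 :> nat by rewrite inordK.
    by rewrite e /= inord_val.
  (* If b_i = K, the successor is out of range and [inord] returns 0, so the filter rejects
     [up i b]. The right-hand side excludes such [b] as well, since its degree is at least K >=
     N. *)
  have -> : (0 < up i b i)%N = false.
    rewrite ffunE eqxx val_insubd ifN //.
    by rewrite -leqNgt ltnS.
  rewrite andbF /=; symmetry; apply/negbTE; rewrite -leqNgt.
  apply: leq_trans NK _; apply: leq_trans bK _.
  by rewrite /mabs (bigD1 i) //= leq_addr.
rewrite (eq_bigl _ _ key); apply: eq_bigr => b hb.
have bK : (b i < K)%N.
  apply: leq_trans NK; apply: leq_ltn_trans hb.
  by rewrite /mabs (bigD1 i) //= leq_addr.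
rewrite /q /tcoef (mfact_bump (upE bK)) (mderiv_bump hf (upE bK)).
rewrite upE // eqxx addn1 natrM invfM.
have -> : monom (fun j => up i b j - (j == i))%N l = monom (fun j => b j) l.
  by rewrite /monom; congr (_%:C%C); apply: eq_bigr => j _; rewrite upE // addnK.
by rewrite mulrA [X in X * _]mulrC !mulrA mulfV ?pnatr_eq0 // mul1r.
Qed.

(** The remainder vanishes at l = 0 and its gradient consists of remainders of lower order, so
    [box_mean_value] gains one factor of size |l| at each degree. Only derivatives of order exactly
    N over the box enter, which is what later produces the gain N in the order of the symbol. *)
Lemma rem_bound N f x l (C : R) : Cinfty f -> (N <= K.+1)%N ->
  (forall w (y : 'rV[R]_n), size w = N -> (forall k, `|y 0 k| <= `|l 0 k|) ->
     nr (wderiv w f (x + y)) <= C) ->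
  nr (rem N f x l) <= (2 * \sum_j `|l 0 j|) ^+ N * C.
Proof.
elim: N f l C => [|N IH] f l C hf NK hC.
  rewrite /rem big1 // subr0 expr0 mul1r; apply: (hC [::]) => //.
have r0 : rem N.+1 f x 0 = 0.
  rewrite /rem addr0 (bigD1 [ffun=> ord0]) /=; last first.
    by rewrite /mabs big1 // => j _; rewrite ffunE.
  rewrite big1 ?addr0 => [|b /andP[_ b0]].
    rewrite /tcoef /monom /mfact big1 => [|j _]; last by rewrite ffunE.
    rewrite big1 => [|j _]; last by rewrite ffunE expr0.
    rewrite (_ : mderiv _ f = f) ?invr1 ?mul1r ?mulr1 ?subrr //.
    rewrite /mderiv (_ : mword _ = [::]) //; apply/nilP; rewrite /nilp size_mword.
    by rewrite /mabs big1 // => j _; rewrite ffunE.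
  have [i bi] : exists i, (b i != ord0).
    apply/existsP; rewrite -negb_forall; apply: contra b0 => /forallP h.
    by apply/eqP/ffunP => j; rewrite ffunE; apply/eqP.
  rewrite /monom (bigD1 i) //= mxE expr0n.
  by rewrite (_ : (b i == 0 :> nat) = false) ?mul0r ?mulr0 //; apply/negbTE.
rewrite -[rem _ _ _ l]subr0 -r0.
have -> : (2 * \sum_j `|l 0 j|) ^+ N.+1 * C =
    2 * (\sum_j `|l 0 j|) * ((2 * \sum_j `|l 0 j|) ^+ N * C).
  by rewrite exprS mulrA.
apply: (@box_mean_value _ (fun j y => rem N (pderiv j f) x y)).
  by move=> j y; exact: rem_pd.
move=> j y hy.
have C0 : 0 <= C.
  by apply: le_trans (hC (nseq N.+1 j) 0 _ _); rewrite ?nr_ge0 ?size_nseq // => k; rewrite mxE normr0.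
apply: (@le_trans _ _ ((2 * \sum_j `|y 0 j|) ^+ N * C)).
  apply: IH; [exact: (@Cinfty_wderiv _ _ _ _ [:: j])|exact: ltnW|].
  move=> w z sw hz; have := hC (rcons w j) z; rewrite -cats1 wderiv_cat.
  apply; first by rewrite size_cat sw addn1.
  by move=> k; apply: le_trans (hz k) (hy k).
rewrite ler_wpM2r // lerXn2r ?nnegrE ?mulr_ge0 ?sumr_ge0 //.
by rewrite ler_wpM2l // ler_sum.
Qed.

End Remainder.
End Taylor.

(** * Termwise differentiation of series *)

Section Termwise.
Context {R : realType} {m : nat} {I : countType} {V : completeNormedModType R[i]}.
#[local] Opaque pderiv.

(** Each derivative has a majorant summable in the index and of polynomial growth in the variable,
    hence locally uniform. *)
Definition tame (d : I -> 'rV[R]_m -> R[i]^o) : Prop :=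
  (forall i, Cinfty (d i)) /\
  forall w, exists q : nat, exists2 b : I -> R, summable_bound b &
    forall i x, nr (wderiv w (d i) x) <= jb x ^+ q * b i.

Lemma tame_wderiv d w : tame d -> tame (fun i => wderiv w (d i)).
Proof.
move=> [h1 h2]; split=> [i|v]; first exact: Cinfty_wderiv.
have [q [b hb hq]] := h2 (v ++ w); exists q, b => // i x.
by rewrite -wderiv_cat; exact: hq.
Qed.

Lemma jb_near (x y : 'rV[R]_m) : (forall j, `|y 0 j - x 0 j| <= 1) ->
  jb y <= jb x * (1 + m%:R).
Proof.
move=> h; rewrite -(subrKC x y); apply: le_trans (jbD _ _) _.
rewrite ler_wpM2l ?(ltW (jb_gt0 x)) // {1}/jb lerD2l -[m in m%:R]card_ord -sumr_const.
by apply: ler_sum => j _; rewrite !mxE; exact: h.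
Qed.

Lemma csumZB (f g : I -> V) (b c : I -> R) (a : R[i]) :
  summable_bound b -> summable_bound c ->
  (forall i, nr (f i) <= b i) -> (forall i, nr (g i) <= c i) ->
  a *: (csum f - csum g) = csum (fun i => a *: (f i - g i)).
Proof.
move=> hb hc fb gc; symmetry; apply: csum_unique.
rewrite (_ : psum _ = fun N => a *: (psum f N - psum g N)); last first.
  apply/funext => N; rewrite -psumB /psum scaler_sumr; apply: eq_bigr => k _.
  by rewrite /cseq; case: pickle_inv => //=; rewrite scaler0.
by apply: cvgZl_tmp; apply: cvgB; [exact: csum_cvg hb fb|exact: csum_cvg hc gc].
Qed.

Context (U : I -> V).
Context (U1 : forall i, nr (U i) <= 1).

Definition tsum (d : I -> 'rV[R]_m -> R[i]^o) (x : 'rV[R]_m) : V :=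
  csum (fun i => (d i x : R[i]) *: U i).

Lemma nr_scaleU (c : R[i]) i : nr (c *: U i) <= nr c.
Proof. by rewrite nrZ ler_piMr ?nr_ge0. Qed.

Lemma tsum_continuous d : tame d -> continuous (tsum d).
Proof.
move=> [h1 h2] x; have [q [b [b0 hb] hq]] := h2 [::].
have hb' : summable_bound (fun i => (jb x * (1 + m%:R)) ^+ q * b i).
  apply: summable_boundZ; first by split.
  by rewrite exprn_ge0 // mulr_ge0 ?(ltW (jb_gt0 x)) // addr_ge0 ?ler0n.
rewrite /continuous_at /tsum.
apply: (@cvg_csum _ _ _ _ (nbhs x) _
   (fun i y => (d i y : R[i]) *: U i) (fun i => (d i x : R[i]) *: U i)
   _ hb').
  apply/nbhs_ballP; exists 1 => //= y [_ hy] i.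
  apply: le_trans (nr_scaleU _ _) _; apply: le_trans (hq i y) _.
  rewrite ler_wpM2r // lerXn2r ?nnegrE ?(ltW (jb_gt0 _)) //.
    by rewrite mulr_ge0 ?(ltW (jb_gt0 x)) // addr_ge0 ?ler0n.
  by apply: jb_near => j; have := hy 0 j; rewrite /ball /= distrC => /ltW.
move=> i; apply: cvgZr_tmp; exact: (h1 i [::]).1.
Qed.

(** By the mean value inequality the difference quotients are dominated by the majorant of the
    derivative near [x], and dominated convergence for series applies. *)
Lemma tsum_pd d j x : tame d ->
  is_pd (tsum d) j x (tsum (fun i => pderiv j (d i)) x).
Proof.
move=> td; have [h1 h2] := td.
have [q [b [b0 hb] hq]] := h2 [:: j]; have [q' [c hc hq']] := h2 [::].
have K0 : 0 <= jb x * (1 + m%:R).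
  by rewrite mulr_ge0 ?(ltW (jb_gt0 x)) // addr_ge0 ?ler0n.
have hb' : summable_bound (fun i => (2 * (jb x * (1 + m%:R)) ^+ q) * b i).
  by apply: summable_boundZ; [split|rewrite mulr_ge0 ?exprn_ge0].
have sc (y : 'rV[R]_m) : summable_bound (fun i => jb y ^+ q' * c i).
  by apply: summable_boundZ => //; rewrite exprn_ge0 ?(ltW (jb_gt0 y)).
have hc' y i : nr ((d i y : R[i]) *: U i) <= jb y ^+ q' * c i.
  exact: le_trans (nr_scaleU _ _) (hq' i y).
rewrite /is_pd (_ : dquot _ j x =
    fun h => csum (fun i => (dquot (d i) j x h : R[i]) *: U i)); last first.
  apply/funext => h; rewrite /dquot /tsum.
  rewrite (csumZB _ (sc _) (sc _) (hc' _) (hc' _)).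
  by congr csum; apply/funext => i; rewrite -scalerBl scalerA.
apply: (@cvg_csum _ _ _ _ (0^') _
   (fun i h => (dquot (d i) j x h : R[i]) *: U i)
   (fun i => (pderiv j (d i) x : R[i]) *: U i) _ hb').
  near=> h => i.
  have h0 : h != 0 by near: h; exact: nbhs_dnbhs_neq.
  have hl : `|h| <= 1 by near: h; apply: nbhs_dnbhs; exists 1 => //= y; rewrite /ball /= sub0r normrN => /ltW.
  apply: le_trans (nr_scaleU _ _) _.
  rewrite -[nr _]/(nr ((h^-1)%:C%C * (d i (x + h *: delta_mx 0 j) - d i x) : R[i])).
  rewrite nrM nr_real normfV.
  rewrite -ler_pdivlMl ?invr_gt0 ?normr_gt0 // invrK.
  have := @mean_value_le _ _ (d i) (pderiv j (d i)) j x h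
    ((jb x * (1 + m%:R)) ^+ q * b i).
  rewrite !mulrA [_ * 2]mulrC; apply.
    by move=> y; exact: (h1 i [::]).2.
  move=> s /andP[s0 s1]; apply: le_trans (hq i _) _.
  rewrite ler_wpM2r // lerXn2r ?nnegrE ?(ltW (jb_gt0 _)) //.
  apply: jb_near => k; rewrite !mxE [x 0 k + _]addrC addrK eqxx /=.
  case: (k == j); rewrite ?mulr1 ?mulr0 ?normr0 //.
  by rewrite normrM (ger0_norm s0) mulr_ile1.
move=> i; apply: cvgZr_tmp; exact: (h1 i [::]).2.
Unshelve. all: by end_near. Qed.

Lemma tsum_Cinfty d : tame d -> Cinfty (tsum d) /\
  forall w, wderiv w (tsum d) = tsum (fun i => wderiv w (d i)).
Proof.
move=> td.
have hp w j x : is_pd (tsum (fun i => wderiv w (d i))) j x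
    (tsum (fun i => wderiv (j :: w) (d i)) x).
  by have := @tsum_pd _ j x (tame_wderiv w td).
split; last exact: (@wderiv_family _ _ _ (fun w => tsum (fun i => wderiv w (d i))) hp).
apply: (@Cinfty_family _ _ _ (fun w => tsum (fun i => wderiv w (d i)))) hp => w.
by apply: tsum_continuous; exact: tame_wderiv.
Qed.

End Termwise.

(** * Fourier coefficients on the noncommutative torus *)

Section CstarBasics.
Context {R : realType} {A : cstarAlg R}.
Implicit Types a b u v : A.

Lemma cstar_nrM a b : nr (a * b) <= nr a * nr b.
Proof. by have := cstar_normM a b; rewrite !nrE -rmorphM /= lecR. Qed.

Lemma starK a : star (star a) = a.
Proof. exact: cstar_starK. Qed.

Lemma starD a b : star (a + b) = star a + star b.
Proof. exact: cstar_starD. Qed.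

Lemma starM a b : star (a * b) = star b * star a.
Proof. exact: cstar_starM. Qed.

Lemma starZ c a : star (c *: a) = conjc c *: star a.
Proof. exact: cstar_starZ. Qed.

Lemma star0 : star 0 = 0 :> A.
Proof. by have := starZ 0 0; rewrite scale0r conjc0 scale0r. Qed.

Lemma starN a : star (- a) = - star a.
Proof. by apply/eqP; rewrite -subr_eq0 opprK -starD addNr star0. Qed.

Lemma starB a b : star (a - b) = star a - star b.
Proof. by rewrite starD starN. Qed.

Lemma star1 : star 1 = 1 :> A.
Proof. by rewrite -[LHS]mulr1 -{2}[1]starK -starM mulr1 starK. Qed.

Lemma nr_starM a : nr (star a * a) = nr a ^+ 2.
Proof.
by have := cstar_normS a; rewrite !nrE -rmorphXn /= => /(@complexI R).
Qed.

Lemma nr_star a : nr (star a) = nr a.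
Proof.
have h b : nr b <= nr (star b).
  have [->|b0] := eqVneq (nr b) 0; first exact: nr_ge0.
  have bp : 0 < nr b by rewrite lt_neqAle eq_sym b0 nr_ge0.
  by rewrite -(ler_pM2r bp) -expr2 -nr_starM cstar_nrM.
by apply/eqP; rewrite eq_le h andbT -{2}[a]starK h.
Qed.

Lemma nr_one : nr (1 : A) = 1.
Proof.
have h : nr (1 : A) = nr (1 : A) ^+ 2 by rewrite -nr_starM star1 mulr1.
have h0 : nr (1 : A) != 0 by apply/eqP => /nr_eq0/eqP; rewrite oner_eq0.
by apply: (mulfI h0); rewrite mulr1 -expr2.
Qed.

Lemma unitary_nr u : unitary u -> nr u = 1.
Proof.
move=> [uu _]; have := nr_starM u; rewrite uu nr_one => /esym/eqP.
rewrite sqrf_eq1 => /orP[/eqP//|/eqP h].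
by have := nr_ge0 u; rewrite h ler0N1.
Qed.

Lemma unitary_star u : unitary u -> unitary (star u).
Proof. by move=> [h1 h2]; split; rewrite starK. Qed.

Lemma unitaryM u v : unitary u -> unitary v -> unitary (u * v).
Proof.
move=> [u1 u2] [v1 v2]; split; rewrite starM.
  by rewrite mulrA -[_ * _ * u]mulrA u1 mulr1.
by rewrite mulrA -[_ * _ * star v]mulrA v2 mulr1.
Qed.

Lemma unitary1 : unitary (1 : A).
Proof. by split; rewrite star1 mulr1. Qed.

Lemma unitaryX u k : unitary u -> unitary (u ^+ k).
Proof.
by move=> h; elim: k => [|k IH]; [exact: unitary1|rewrite exprS; exact: unitaryM].
Qed.

Lemma unitary_upow u k : unitary u -> unitary (upow u k).
Proof. by case: k => p h /=; apply: unitaryX => //; exact: unitary_star. Qed.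

Lemma unitary_prod (I : Type) (s : seq I) (x : I -> A) :
  (forall i, unitary (x i)) -> unitary (\prod_(i <- s) x i).
Proof.
by move=> h; elim/big_ind: _ => //; [exact: unitary1|exact: unitaryM].
Qed.

Lemma continuous_mull a : continuous (fun b => a * b).
Proof.
move=> b; apply/cvg_nrP => e e0.
have /cvg_nrP/(_ (e / (1 + nr a))) : (id : A -> A) @ b --> b by exact: cvg_id.
have na : 0 < 1 + nr a by rewrite ltr_pwDl ?nr_ge0.
rewrite divr_gt0 // => /(_ isT); apply: filterS => c hc.
rewrite -mulrBr; apply: le_lt_trans (cstar_nrM _ _) _.
move: hc; rewrite ltr_pdivlMr // mulrC; apply: le_lt_trans.
by rewrite ler_wpM2r ?nr_ge0 // lerDr.
Qed.

Lemma continuous_mulr a : continuous (fun b => b * a).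
Proof.
move=> b; apply/cvg_nrP => e e0.
have /cvg_nrP/(_ (e / (1 + nr a))) : (id : A -> A) @ b --> b by exact: cvg_id.
have na : 0 < 1 + nr a by rewrite ltr_pwDl ?nr_ge0.
rewrite divr_gt0 // => /(_ isT); apply: filterS => c hc.
rewrite -mulrBl; apply: le_lt_trans (cstar_nrM _ _) _.
move: hc; rewrite ltr_pdivlMr //; apply: le_lt_trans.
by rewrite ler_wpM2l ?nr_ge0 // lerDr.
Qed.

Lemma continuous_star : continuous (@star R A).
Proof.
move=> b; apply/cvg_nrP => e e0.
have /cvg_nrP/(_ e e0) : (id : A -> A) @ b --> b by exact: cvg_id.
by apply: filterS => c; rewrite -starB nr_star.
Qed.

(** Commutation up to an unspecified nonzero scalar. The phases are never tracked, since only the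
    frequency of a product of monomials is used. *)
Definition qcomm a b : Prop := exists2 c : R[i], c != 0 & a * b = c *: (b * a).

Lemma qcomm_sym a b : qcomm a b -> qcomm b a.
Proof.
move=> [c c0 e]; exists c^-1; first by rewrite invr_eq0.
by rewrite e scalerA mulVf // scale1r.
Qed.

Lemma qcomm1 a : qcomm 1 a.
Proof. by exists 1; rewrite ?oner_neq0 // scale1r mul1r mulr1. Qed.

Lemma qcommM a b d : qcomm a d -> qcomm b d -> qcomm (a * b) d.
Proof.
move=> [c c0 e] [c' c0' e']; exists (c' * c); first by rewrite mulf_neq0.
by rewrite -mulrA e' -scalerAr [a * (d * b)]mulrA e -scalerAl scalerA -mulrA.
Qed.

Lemma qcommX a d k : qcomm a d -> qcomm (a ^+ k) d.
Proof.
move=> h; elim: k => [|k IH]; first exact: qcomm1.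
by rewrite exprS; exact: qcommM.
Qed.

Lemma qcomm_star u d : unitary u -> qcomm u d -> qcomm (star u) d.
Proof.
move=> [u1 u2] [c c0 e]; exists c^-1; first by rewrite invr_eq0.
have h : d * star u = c *: (star u * d).
  by rewrite -[LHS]mul1r -u1 -!mulrA [u * _]mulrA e -scalerAl -scalerAr -!mulrA u2 mulr1.
by rewrite h scalerA mulVf // scale1r.
Qed.

Lemma qcomm_upow u d k : unitary u -> qcomm u d -> qcomm (upow u k) d.
Proof.
by case: k => p hu h /=; apply: qcommX => //; exact: qcomm_star.
Qed.

Lemma qcomm_prod (I : Type) (s : seq I) (x : I -> A) d :
  (forall i, qcomm (x i) d) -> qcomm (\prod_(i <- s) x i) d.
Proof.
move=> h; elim/big_ind: _ => //; first exact: qcomm1.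
by move=> a b; exact: qcommM.
Qed.

Lemma qcomm_prodM (I : Type) (s : seq I) (x y : I -> A) :
  (forall i j, qcomm (x i) (y j)) ->
  exists c : R[i], (\prod_(i <- s) x i) * (\prod_(i <- s) y i) =
    c *: \prod_(i <- s) (x i * y i).
Proof.
move=> h; elim: s => [|i s [c e]].
  by exists 1; rewrite !big_nil mulr1 scale1r.
rewrite !big_cons.
have [c' c0' e'] : qcomm (\prod_(j <- s) x j) (y i) by exact: qcomm_prod.
exists (c' * c).
move: e e' {h}; set X := \prod_(j <- s) x j; set Y := \prod_(j <- s) y j.
set Z := \prod_(j <- s) _ => e e'.
rewrite -[x i * X * _]mulrA [X * (y i * Y)]mulrA e' -scalerAl -scalerAr.
by rewrite -[y i * X * Y]mulrA e -!scalerAr scalerA mulrA.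
Qed.

Lemma qcomm_star_prod (I : Type) (s : seq I) (x : I -> A) :
  (forall i j, qcomm (star (x i)) (star (x j))) ->
  exists c : R[i], star (\prod_(i <- s) x i) = c *: \prod_(i <- s) star (x i).
Proof.
move=> h; elim: s => [|i s [c e]].
  by exists 1; rewrite !big_nil star1 scale1r.
rewrite !big_cons starM e.
have [c' c0' e'] : qcomm (\prod_(j <- s) star (x j)) (star (x i)) by exact: qcomm_prod.
by exists (c * c'); rewrite -scalerAl e' scalerA.
Qed.

Lemma upow_succ u (k : int) : unitary u -> upow u (k + 1) = upow u k * u.
Proof.
move=> [u1 u2]; case: k => p.
  by rewrite (_ : Posz p + 1 = Posz p.+1) /= ?exprSr // -addn1.
case: p => [|p] /=; first by rewrite subnn expr0 expr1 u1.
by rewrite subn1 [star u ^+ p.+2]exprSr -mulrA u1 mulr1.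
Qed.

Lemma upow_pred u (k : int) : unitary u -> upow u (k - 1) = upow u k * star u.
Proof.
move=> hu; have := upow_succ (k - 1) hu; rewrite subrK => ->.
by rewrite -mulrA hu.2 mulr1.
Qed.

Lemma upowD u (k l : int) : unitary u -> upow u k * upow u l = upow u (k + l).
Proof.
move=> hu; elim/int_rec: l => [|p IH|p IH]; first by rewrite addr0 mulr1.
  rewrite -addn1 PoszD addrA !upow_succ // mulrA.
  by rewrite IH.
by rewrite -addn1 PoszD opprD addrA !upow_pred // mulrA IH.
Qed.

Lemma upow_star u (k : int) : star (upow u k) = upow u (- k).
Proof.
have starX v p : star (v ^+ p) = star v ^+ p.
  by elim: p => [|p IH]; rewrite ?star1 // exprS starM IH exprSr.
case: k => [[|p]|p]; rewrite ?oppr0 /=; first exact: star1.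
  by rewrite starX.
by rewrite starX starK.
Qed.

Lemma linear_bounded (L : {scalar A}) : continuous L ->
  exists2 C : R, 0 <= C & forall a, nr (L a : R[i]) <= C * nr a.
Proof.
move=> cL.
have /(@cvg_nrP _ R[i]^o)/(_ 1 ltr01) := cL 0; rewrite linear0.
move=> /nbhs_ballP[d d0 hd].
have [x x0 ex] : exists2 x : R, 0 < x & d = x%:C%C.
  move: d d0 {hd} => [a c]; rewrite /= ltcE /= => /andP[/eqP -> a0].
  by exists a.
exists (2 / x); first by rewrite divr_ge0 // ltW.
move=> a; have [a0|a0] := eqVneq (nr a) 0.
  by rewrite (nr_eq0 a0) linear0 !nr0 mulr0.
have ap : 0 < nr a by rewrite lt_neqAle eq_sym a0 nr_ge0.
have b0 : 0 < x / (2 * nr a) by rewrite divr_gt0 // mulr_gt0.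
have := hd ((x / (2 * nr a))%:C%C *: a).
rewrite -ball_normE /= sub0r normrN nrE ex ltcR nrZ nr_real gtr0_norm //.
have -> : x / (2 * nr a) * nr a = x / 2 by field; rewrite a0.
have -> : x / 2 < x by lra.
move=> /(_ isT); rewrite linearZ subr0 /=.
rewrite -[nr _]/(nr ((x / (2 * nr a))%:C%C * L a : R[i])).
rewrite nrM nr_real gtr0_norm // => h.
rewrite ltW // -(@ltr_pM2l _ (x / (2 * nr a))) //; apply: lt_le_trans h _.
by rewrite le_eqVlt; apply/orP; left; apply/eqP; field; rewrite a0 gt_eqF.
Qed.

End CstarBasics.

Section Monomials.
Context {R : realType} {n : nat} {theta : 'M[R]_n} (T : ncTorus theta).
Implicit Types (a b : T) (k l : 'rV[int]_n).

Definition mon k : T := \prod_(j < n) upow (@nctU _ _ _ T j) (k 0 j).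

Definition kvec k : 'rV[R]_n := map_mx intr k.

Definition coef k a : R[i] := nct_tau T (star (mon k) * a).

Lemma cexp_neq0 (x : R) : cexp x != 0.
Proof.
by apply/eqP => h; have := nr_cexp x; rewrite h nr0 => /esym/eqP; rewrite oner_eq0.
Qed.

Lemma nctU_unitary j : unitary (@nctU _ _ _ T j).
Proof. by have [h _] := nctU_rel T. Qed.

Lemma mon_unitary k : unitary (mon k).
Proof. by apply: unitary_prod => j; apply: unitary_upow; exact: nctU_unitary. Qed.

Lemma nr_mon k : nr (mon k) = 1.
Proof. exact/unitary_nr/mon_unitary. Qed.

Lemma qcomm_nctU i j p q : qcomm (upow (@nctU _ _ _ T i) p) (upow (@nctU _ _ _ T j) q).
Proof.
apply: qcomm_upow; first exact: nctU_unitary.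
apply: qcomm_sym; apply: qcomm_upow; first exact: nctU_unitary.
have [_ h] := nctU_rel T; exists (cexp (2 * pi * theta i j)); first exact: cexp_neq0.
exact: h.
Qed.

Lemma monM k l : exists c : R[i], mon k * mon l = c *: mon (k + l).
Proof.
have [c e] := @qcomm_prodM _ _ _ (index_enum 'I_n)
  (fun j => upow (@nctU _ _ _ T j) (k 0 j)) (fun j => upow (@nctU _ _ _ T j) (l 0 j))
  (fun i j => qcomm_nctU i j _ _).
exists c; rewrite /mon e; congr (_ *: _); apply: eq_bigr => j _.
by rewrite upowD ?mxE //; exact: nctU_unitary.
Qed.

Lemma star_mon k : exists c : R[i], star (mon k) = c *: mon (- k).
Proof.
have [|c e] := @qcomm_star_prod _ _ _ (index_enum 'I_n)
  (fun j => upow (@nctU _ _ _ T j) (k 0 j)).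
  by move=> i j; rewrite !upow_star; exact: qcomm_nctU.
exists c; rewrite /mon e; congr (_ *: _); apply: eq_bigr => j _.
by rewrite upow_star mxE.
Qed.

Lemma mon0 : mon 0 = 1.
Proof. by rewrite /mon big1 // => j _; rewrite mxE. Qed.

Lemma ncta_mon s k : ncta T s (mon k) = cexp (dotv s (kvec k)) *: mon k.
Proof. exact: ncta_U. Qed.

Lemma coef_mon k l : coef k (mon l) = (k == l)%:R.
Proof.
rewrite /coef; have [->|kl] := eqVneq.
  by rewrite (mon_unitary l).1 nct_tau1.
have [c ->] := star_mon k; rewrite -scalerAl.
have [c' ->] := monM (- k) l; rewrite !linearZ /= nct_tauU ?mulr0 //.
by rewrite addrC subr_eq0 eq_sym.
Qed.

Lemma coef_is_linear k : linear_for *%R (coef k).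
Proof.
move=> c a b; rewrite /coef mulrDr linearD /=; congr (_ + _).
by rewrite -scalerAr linearZ.
Qed.

HB.instance Definition _ k :=
  GRing.isLinear.Build R[i] T R[i] *%R (coef k) (coef_is_linear k).

Lemma coef_continuous k : continuous (coef k : T -> R[i]^o).
Proof.
move=> a; apply: (@continuous_comp _ _ _ (fun b => star (mon k) * b) (nct_tau T)).
  exact: continuous_mull.
exact: nct_tau_cont.
Qed.

Lemma coef_bounded : exists2 C : R, 0 <= C & forall k a, nr (coef k a) <= C * nr a.
Proof.
have [C C0 hC] := linear_bounded (@nct_tau_cont _ _ _ T).
exists C => // k a; apply: le_trans (hC _) _; rewrite ler_wpM2l //.
apply: le_trans (cstar_nrM _ _) _.
by rewrite nr_star nr_mon mul1r.
Qed.

(** The trace of x^* x is real for x = a + c; the choices c = 1 and c = i give the two real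
    equations. *)
Lemma nct_tau_star a : nct_tau T (star a) = conjc (nct_tau T a).
Proof.
have re x : 0 <= x -> complex.Im x = 0 :> R.
  by case: x => p q; rewrite lecE /= => /andP[/eqP -> _].
have key (c : R[i]) : complex.Im (conjc c * nct_tau T a + c * nct_tau T (star a) +
   (nct_tau T (star a * a) + c * conjc c)) = 0.
  have := nct_tau_ge0 (a + c *: 1); move/re => <-; congr complex.Im.
  rewrite starD starZ star1 mulrDl !mulrDr -!scalerAl -!scalerAr !mul1r !mulr1.
  have tD (x y : T) : nct_tau T (x + y) = nct_tau T x + nct_tau T y by exact: linearD.
  have tZ d (x : T) : nct_tau T (d *: x) = d * nct_tau T x by exact: linearZ.
  by rewrite !tD !tZ nct_tau1; ring.
have k0 := re _ (nct_tau_ge0 a).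
have := key 'i%C; have := key 1; move: k0.
case: (nct_tau T a) => p q; case: (nct_tau T (star a)) => p' q'.
case: (nct_tau T _) => p'' q'' /= -> h1 h2.
by apply/eqP; rewrite eq_complex /=; apply/andP; split; apply/eqP; move: h1 h2; lra.
Qed.

(** Bessel's inequality for one monomial, from positivity of the trace at a - c U^k with c the
    coefficient. It turns the L^2 estimates defining symbols into estimates of every Fourier
    coefficient. *)
Lemma nr_coef_le_l2norm k a : nr (coef k a) <= l2norm a.
Proof.
rewrite /l2norm -(ger0_norm (nr_ge0 (coef k a))) -sqrtr_sqr ler_wsqrtr //.
set c := coef k a.
have e1 : nct_tau T (star a * mon k) = conjc c.
  by rewrite /c /coef -nct_tau_star starM starK.
have := nct_tau_ge0 (a - c *: mon k).
rewrite starB starZ mulrBl !mulrBr -!scalerAl -!scalerAr scalerA.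
rewrite (mon_unitary k).1 !linearB !linearZ /= nct_tau1 e1 -/(coef k a) -/c.
rewrite nr_sqr; case: (nct_tau T _) => p q; case: (c) => x y /=.
by rewrite lecE /= => /andP[_]; lra.
Qed.

Definition mpoly a := exists s : seq ('rV[int]_n * R[i]),
  a = \sum_(p <- s) p.2 *: mon p.1.

Lemma mpolyD a b : mpoly a -> mpoly b -> mpoly (a + b).
Proof. by move=> [s ->] [t ->]; exists (s ++ t); rewrite big_cat. Qed.

Lemma mpolyZ c a : mpoly a -> mpoly (c *: a).
Proof.
move=> [s ->]; exists [seq (p.1, c * p.2) | p <- s].
by rewrite big_map scaler_sumr; apply: eq_bigr => p _; rewrite scalerA.
Qed.

Lemma mpoly_mon k : mpoly (mon k).
Proof. by exists [:: (k, 1)]; rewrite big_seq1 scale1r. Qed.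

Lemma mpoly_sum (I : Type) (s : seq I) (F : I -> T) :
  (forall i, mpoly (F i)) -> mpoly (\sum_(i <- s) F i).
Proof.
move=> h; elim/big_ind: _ => //; last exact: mpolyD.
by exists [::]; rewrite big_nil.
Qed.

Lemma mpolyM a b : mpoly a -> mpoly b -> mpoly (a * b).
Proof.
move=> [s ->] [t ->]; rewrite mulr_suml; apply: mpoly_sum => p.
rewrite mulr_sumr; apply: mpoly_sum => q.
rewrite -scalerAl -scalerAr; do 2 apply: mpolyZ.
by have [c ->] := monM p.1 q.1; apply: mpolyZ; exact: mpoly_mon.
Qed.

Lemma mpoly_star a : mpoly a -> mpoly (star a).
Proof.
move=> [s ->]; rewrite (_ : star _ = \sum_(p <- s) star (p.2 *: mon p.1)).
  apply: mpoly_sum => p; rewrite starZ; apply: mpolyZ.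
  by have [c ->] := star_mon p.1; apply: mpolyZ; exact: mpoly_mon.
by elim: s => [|p s IH]; rewrite ?big_nil ?star0 // !big_cons starD IH.
Qed.

Lemma mpoly_U j : mpoly (@nctU _ _ _ T j).
Proof.
have -> : @nctU _ _ _ T j = mon (delta_mx 0 j).
  rewrite /mon (eq_bigr (fun i => if i == j then @nctU _ _ _ T j else 1)).
    by rewrite -big_mkcond /= big_pred1_eq.
  by move=> i _; rewrite mxE eqxx /=; case: eqVneq => [->|_].
exact: mpoly_mon.
Qed.

(** [nctU_gen] expresses that the generators generate by a minimality property: the norm closure of
    the span of monomials is closed, contains the generators, and is stable under all the
    operations. *)
Lemma mpoly_dense a (e : R) : 0 < e -> exists2 p, mpoly p & nr (a - p) < e.
Proof.
move: a e.
pose S : set T := [set a | forall e : R, 0 < e -> exists2 p, mpoly p & nr (a - p) < e].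
have pS p : mpoly p -> S p by move=> hp e e0; exists p; rewrite ?subrr ?nr0.
suff h : forall a, S a by move=> a e; exact: h.
apply: nctU_gen => //.
- move=> a ca e e0; have e2 : 0 < e / 2 by lra.
  have nb : nbhs a [set b : T | nr (b - a) < e / 2].
    by have /cvg_nrP/(_ _ e2) : (id : T -> T) @ a --> a by exact: cvg_id.
  have [b [/(_ _ e2)[p hp bp] /= ab]] := ca _ nb; exists p => //.
  by apply: le_lt_trans (nr_triangle _ b _) _; rewrite nr_distrC; lra.
- by apply: pS; rewrite -mon0; exact: mpoly_mon.
- by move=> j; apply: pS; exact: mpoly_U.
- move=> c a b ha hb e e0.
  have c1 : 0 < nr c + 1 by rewrite ltr_wpDl ?nr_ge0.
  have [|p hp ap] := ha (e / (2 * (nr c + 1))); first by rewrite divr_gt0 // mulr_gt0.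
  have [|q hq bq] := hb (e / 2); first lra.
  exists (c *: p + q); first by apply: mpolyD => //; exact: mpolyZ.
  rewrite opprD addrACA -scalerBr; apply: le_lt_trans (nrD _ _) _.
  rewrite nrZ; suff : nr c * nr (a - p) <= e / 2 by lra.
  apply: (@le_trans _ _ ((nr c + 1) * nr (a - p))).
    by rewrite ler_wpM2r ?nr_ge0 // lerDl.
  by move: ap; rewrite ltr_pdivlMr ?mulr_gt0 //; lra.
- move=> a b ha hb e e0.
  pose K := nr a + nr b + 1.
  have K0 : 0 < K by rewrite ltr_wpDl // addr_ge0 ?nr_ge0.
  (* The cap at 1 bounds the norm of the second approximant by [nr b + 1], one of the summands of
     which [K] is made. *)
  have d0 : 0 < Num.min 1 (e / (2 * K)).
    by rewrite lt_min ltr01 divr_gt0 // mulr_gt0.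
  have [q hq bq] := hb _ d0; have [p hp ap] := ha _ d0.
  exists (p * q); first exact: mpolyM.
  move: ap bq; rewrite !lt_min => /andP[ap1 ap] /andP[bq1 bq].
  have -> : a * b - p * q = (a - p) * q + a * (b - q).
    by rewrite mulrBl mulrBr [RHS]addrC subrKA.
  have q1 : nr q <= nr b + 1.
    have := nrB b (b - q); rewrite opprB addrC subrK => h.
    by apply: le_trans h _; lra.
  apply: le_lt_trans (nrD _ _) _.
  have h1 := cstar_nrM (a - p) q; have h2 := cstar_nrM a (b - q).
  have h3 : nr (a - p) * nr q <= nr (a - p) * (nr b + 1) by rewrite ler_wpM2l ?nr_ge0.
  have := nr_ge0 (a - p); have := nr_ge0 (b - q); have := nr_ge0 a; have := nr_ge0 b.
  move: ap bq; rewrite !ltr_pdivlMr ?mulr_gt0 // /K; nra.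
- move=> a ha e e0; have [p hp ap] := ha _ e0.
  by exists (star p); [exact: mpoly_star|rewrite -starB nr_star].
Qed.

End Monomials.

Section ComplexExponential.
Context {R : realType}.

Lemma cexpD (x y : R) : cexp (x + y) = cexp x * cexp y.
Proof. by apply/eqP; rewrite eq_complex /= cosD sinD addrC; apply/andP; split; apply/eqP; ring. Qed.

Lemma cexp0 : cexp (0 : R) = 1.
Proof. by rewrite /cexp cos0 sin0. Qed.

Lemma cexpN (x : R) : cexp (- x) = conjc (cexp x).
Proof. by rewrite /cexp cosN sinN. Qed.

Lemma cexp_sum (I : Type) (s : seq I) (F : I -> R) :
  cexp (\sum_(i <- s) F i) = \prod_(i <- s) cexp (F i).
Proof.
by elim: s => [|i s IH]; rewrite ?big_nil ?cexp0 // !big_cons cexpD IH.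
Qed.

Lemma cexpMn (x : R) k : cexp (x * k%:R) = cexp x ^+ k.
Proof.
elim: k => [|k IH]; first by rewrite mulr0 cexp0.
by rewrite -addn1 natrD mulrDr mulr1 cexpD IH addn1 exprSr.
Qed.

Lemma cexp_2pi_int (q : int) : cexp (2 * pi * q%:~R : R) = 1.
Proof.
have h : cexp (2 * pi : R) = 1 by rewrite mulr_natl /cexp cos2pi sin2pi.
case: q => p; first by rewrite -pmulrn cexpMn h expr1n.
by rewrite NegzE mulrNz mulrN cexpN -pmulrn cexpMn h expr1n conjc1.
Qed.

(** Half angle: cos x = 1 forces sin (x / 2) = 0, while the sine is positive on (0, pi). *)
Lemma cexp_eq1 (x : R) : `|x| < 2 * pi -> cexp x = 1 -> x = 0.
Proof.
have key (y : R) : 0 < y -> y < 2 * pi -> cexp y = 1 -> False.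
  move=> y0 y2 [h _].
  have s0 : 0 < sin (y / 2) by apply: sin_gt0_pi; apply/andP; split; lra.
  have := cosD (y / 2) (y / 2); rewrite (_ : y / 2 + y / 2 = y); last lra.
  by have := cos2Dsin2 (y / 2); rewrite h; nra.
move=> hx h1; have [x0|x0|->] // := ltgtP x 0; exfalso.
  apply: (key (- x)); rewrite ?oppr_gt0 //; first by rewrite -ltr0_norm.
  by rewrite cexpN h1 conjc1.
by apply: (key x) => //; rewrite -(gtr0_norm x0).
Qed.

Lemma sum_root_unity (z : R[i]) N : z ^+ N = 1 -> z != 1 -> \sum_(t < N) z ^+ t = 0.
Proof.
move=> zN z1; have := subrX1 z N; rewrite zN subrr => /esym/eqP.
by rewrite mulf_eq0 subr_eq0 (negbTE z1) /= => /eqP.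
Qed.

End ComplexExponential.

(** * Fejer kernels on finite grids *)

Section FejerKernel.
Context {R : realType} {n : nat}.
Implicit Types (q : 'rV[int]_n).

Definition ivec K (i : {ffun 'I_n -> 'I_K}) : 'rV[int]_n := \row_j (i j : nat)%:Z.

(** Points of the torus whose coordinates are N-th roots of unity. Averages over this grid replace
    Haar integration, so Fejer means of elements of the algebra are finite sums. *)
Definition gvec N (g : {ffun 'I_n -> 'I_N}) : 'rV[R]_n :=
  \row_j (2 * pi / N%:R * (g j)%:R).

Lemma kvecD q q' : kvec (R := R) (q + q') = kvec q + kvec q'.
Proof. exact: map_mxD. Qed.

Lemma kvecN q : kvec (R := R) (- q) = - kvec q.
Proof. exact: map_mxN. Qed.

Lemma dotvDr (s t u : 'rV[R]_n) : dotv s (t + u) = dotv s t + dotv s u.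
Proof. by rewrite /dotv -big_split; apply: eq_bigr => j _; rewrite mxE mulrDr. Qed.

Lemma dotvNr (s t : 'rV[R]_n) : dotv s (- t) = - dotv s t.
Proof. by rewrite /dotv -sumrN; apply: eq_bigr => j _; rewrite mxE mulrN. Qed.

(** Orthogonality of the characters of (Z/N)^n; the bound on the entries of [q] excludes aliasing of
    distinct frequencies. *)
Lemma grid_sum N q : (0 < N)%N -> (forall j, `|q 0 j| < N%:Z) ->
  \sum_(g : {ffun 'I_n -> 'I_N}) cexp (dotv (gvec g) (kvec q)) =
  (if q == 0 then (N ^ n)%:R else 0) :> R[i].
Proof.
move=> N0 hq.
have Nr : (N%:R : R) != 0 by rewrite pnatr_eq0 -lt0n.
pose z j : R[i] := cexp (2 * pi / N%:R * (q 0 j)%:~R).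
have -> : \sum_(g : {ffun 'I_n -> 'I_N}) cexp (dotv (gvec g) (kvec q)) =
    \sum_(g : {ffun 'I_n -> 'I_N}) \prod_j z j ^+ g j.
  apply: eq_bigr => g _; rewrite /dotv cexp_sum; apply: eq_bigr => j _.
  by rewrite /z -cexpMn !mxE; congr cexp; ring.
rewrite -(bigA_distr_bigA (fun j (t : 'I_N) => z j ^+ t)).
have zN j : z j ^+ N = 1.
  by rewrite /z -cexpMn -[RHS](cexp_2pi_int (q 0 j)); congr cexp; field.
have [q0|q0] := eqVneq q 0.
  rewrite (eq_bigr (fun=> N%:R)); first by rewrite prodr_const card_ord natrX.
  move=> j _; rewrite (eq_bigr (fun=> 1)) => [|t _]; last first.
    by rewrite /z q0 mxE mulr0 cexp0 expr1n.
  by rewrite sumr_const card_ord.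
have [j qj] : exists j, q 0 j != 0.
  apply/existsP; rewrite -negb_forall; apply: contra q0 => /forallP h.
  by apply/eqP/rowP => j; rewrite mxE; apply/eqP.
rewrite (bigD1 j) //= sum_root_unity ?mul0r //.
apply: contra qj => /eqP/cexp_eq1 h.
have : 2 * pi / N%:R * (q 0 j)%:~R = 0 :> R.
  apply: h; rewrite normrM ger0_norm; last by rewrite divr_ge0 // mulr_ge0 // pi_ge0.
  rewrite mulrAC ltr_pdivrMr ?ltr0n // ltr_pM2l; last by rewrite mulr_gt0 // pi_gt0.
  by rewrite -intr_norm -[N%:R]/(N%:Z%:~R) ltr_int.
move/eqP; rewrite !mulf_eq0 invr_eq0 (negbTE Nr) pnatr_eq0 /= gt_eqF ?pi_gt0 //=.
by rewrite intr_eq0.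
Qed.

Definition dirichlet K (s : 'rV[R]_n) : R[i] :=
  \sum_(i : {ffun 'I_n -> 'I_K}) cexp (dotv s (kvec (ivec i))).

Lemma dirichlet_sqr K s :
  \sum_(i : {ffun 'I_n -> 'I_K}) \sum_(i' : {ffun 'I_n -> 'I_K})
     cexp (dotv s (kvec (ivec i - ivec i'))) = (nr (dirichlet K s) ^+ 2)%:C%C.
Proof.
transitivity (dirichlet K s * conjc (dirichlet K s)).
  rewrite /dirichlet rmorph_sum mulr_suml; apply: eq_bigr => i _.
  rewrite mulr_sumr; apply: eq_bigr => i' _.
  by rewrite kvecD kvecN dotvDr dotvNr cexpD cexpN.
by rewrite rmorphXn /= -nrE sqr_normc.
Qed.

Lemma ivec_diff_lt K (i i' : {ffun 'I_n -> 'I_K}) j :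
  `|(ivec i - ivec i') 0 j| < K%:Z.
Proof.
rewrite !mxE ltr_norml; have := ltn_ord (i j); have := ltn_ord (i' j).
by move: (i j : nat) (i' j : nat) => a b; lia.
Qed.

Lemma ivec_inj K : injective (@ivec K).
Proof.
move=> i i' /rowP h; apply/ffunP => j; apply/val_inj.
by have := h j; rewrite !mxE => -[].
Qed.

Lemma dirichlet_mean K N : (K <= N)%N -> (0 < K)%N ->
  \sum_(g : {ffun 'I_n -> 'I_N}) nr (dirichlet K (gvec g)) ^+ 2 =
  (K ^ n)%:R * (N ^ n)%:R :> R.
Proof.
move=> KN K0; apply: (@complexI R); rewrite rmorph_sum /=.
under eq_bigr do rewrite -dirichlet_sqr.
rewrite exchange_big /= (eq_bigr (fun=> (N ^ n)%:R)) => [|i _].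
  by rewrite sumr_const card_ffun !card_ord rmorphM /= !rmorph_nat mulr_natl.
rewrite exchange_big /= (bigD1 i) //= [X in _ + X]big1 => [|i' ii'].
  rewrite grid_sum ?subrr ?eqxx ?addr0 //; first exact: leq_trans KN.
  by move=> j; rewrite mxE normr0 ltz_nat; exact: leq_trans KN.
rewrite grid_sum; [|exact: leq_trans KN|].
  by rewrite subr_eq0 (inj_eq (@ivec_inj K)) eq_sym (negbTE ii').
move=> j; apply: lt_le_trans (ivec_diff_lt _ _ _) _.
by rewrite lez_nat.
Qed.

(** The classical weight, the product of the positive parts of 1 - |q_j| / K, written as a count of
    pairs with difference [q]: this is how it arises when the square of the Dirichlet kernel is
    expanded. *)
Definition fejer_weight K q : R :=
  (\sum_(i : {ffun 'I_n -> 'I_K}) \sum_(i' : {ffun 'I_n -> 'I_K})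
     (ivec i' - ivec i == q)%:R) / (K ^ n)%:R.

Lemma fejer_weight_prod K q :
  fejer_weight K q = \prod_j ((\sum_(x < K) \sum_(y < K)
    ((y : nat)%:Z - (x : nat)%:Z == q 0 j)%:R) / K%:R).
Proof.
rewrite /fejer_weight prodf_div prodr_const card_ord natrX; congr (_ / _).
rewrite bigA_distr_bigA; apply: eq_bigr => i _ /=.
rewrite bigA_distr_bigA; apply: eq_bigr => i' _ /=.
have [<-|h] := eqVneq (ivec i' - ivec i) q.
  by rewrite big1 // => j _; rewrite !mxE eqxx.
have [j qj] : exists j, (ivec i' - ivec i) 0 j != q 0 j.
  apply/existsP; rewrite -negb_forall; apply: contra h => /forallP h.
  by apply/eqP/rowP => j; apply/eqP.
by move: qj; rewrite (bigD1 j) //= !mxE => /negbTE ->; rewrite mul0r.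
Qed.

Lemma sum_geq K c : (\sum_(x < K) (c <= x)%N = K - c)%N.
Proof.
elim: K => [|K IH]; first by rewrite big_ord0.
by rewrite big_ord_recr /= IH; case: leqP; lia.
Qed.

Lemma sum_ltn K c : (\sum_(x < K) (x < c)%N = minn K c)%N.
Proof.
elim: K => [|K IH]; first by rewrite big_ord0 min0n.
by rewrite big_ord_recr /= IH; case: (leqP c K); lia.
Qed.

(** The defect counts the x in [0, K) for which x + m leaves this interval. *)
Lemma fejer_count K (m : int) :
  `|\sum_(x < K) \sum_(y < K) ((y : nat)%:Z - (x : nat)%:Z == m)%:R - K%:R| <=
  (`|m|%N)%:R :> R.
Proof.
pose c (x : 'I_K) : R := \sum_(y < K) ((y : nat)%:Z - (x : nat)%:Z == m)%:R.
have c1 (x : 'I_K) : (0 <= (x : nat)%:Z + m < K%:Z) -> c x = 1.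
  move=> /andP[h1 h2].
  have [y hy] : exists y : 'I_K, (y : nat)%:Z = (x : nat)%:Z + m.
    move: h1 h2; case: (_ + m) => // p _; rewrite ltz_nat => pK.
    by exists (Ordinal pK).
  rewrite /c (bigD1 y) //= big1 => [|y' yy'].
    by rewrite (_ : _ == m) ?addr0 // hy addrC addKr.
  rewrite (_ : (_ == m) = false) //; apply/negbTE; apply: contra yy' => /eqP h.
  by apply/eqP/val_inj => /=; apply/eqP; rewrite -eqz_nat; apply/eqP; rewrite hy -h addrC subrK.
have c0 (x : 'I_K) : ~~ (0 <= (x : nat)%:Z + m < K%:Z) -> c x = 0.
  move=> h; rewrite /c big1 // => y _; rewrite (_ : (_ == m) = false) //.
  apply/negbTE; apply: contra h => /eqP <-; rewrite addrC subrK.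
  by rewrite lez_nat ltz_nat ltn_ord.
rewrite -/c -[K in _ - K%:R]card_ord -sumr_const -sumrB.
apply: (@le_trans _ _ (\sum_(x < K) (~~ (0 <= (x : nat)%:Z + m < K%:Z))%:R)).
  apply: le_trans (ler_norm_sum _ _ _) _; apply: ler_sum => x _.
  rewrite -[X in `|X - 1|]/(c x).
  have [/c1 ->|/c0 ->] := boolP (0 <= (x : nat)%:Z + m < K%:Z).
    by rewrite subrr normr0.
  by rewrite sub0r normrN normr1.
rewrite -natr_sum ler_nat.
have [hm|hm] := leP 0 m.
  rewrite (eq_bigr (fun x : 'I_K => (K - `|m| <= x)%N : nat)).
    by rewrite sum_geq; lia.
  by move=> x _; congr nat_of_bool; have := ltn_ord x; lia.
rewrite (eq_bigr (fun x : 'I_K => (x < `|m|)%N : nat)).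
  by rewrite sum_ltn geq_minr.
by move=> x _; congr nat_of_bool; have := ltn_ord x; lia.
Qed.

Lemma fejer_weight_cvg q : (fun K => fejer_weight K q) @ \oo --> (1 : R).
Proof.
under eq_fun do rewrite fejer_weight_prod.
set f := fun K : nat => _.
suff : f @ \oo --> \prod_(j < n) (1 : R) by rewrite big1_eq.
apply: (@cvg_big _ _ _ _ _ (@mul_continuous R)) => j _.
apply/cvgrPdist_le => e e0.
near=> K.
have K0 : 0 < K%:R :> R by rewrite ltr0n; near: K; exists 1%N.
set S := \sum_(x < K) _.
have -> : 1 - S / K%:R = (K%:R - S) / K%:R by field; rewrite gt_eqF.
rewrite normrM distrC.
rewrite [`|K%:R^-1|]gtr0_norm ?invr_gt0 // ler_pdivrMr //.
apply: le_trans (fejer_count K (q 0 j)) _.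
rewrite mulrC -ler_pdivrMr //.
near: K; exact: nbhs_infty_ger.
Unshelve. all: by end_near. Qed.

End FejerKernel.

Section FourierUniqueness.
Context {R : realType} {n : nat} {theta : 'M[R]_n} (T : ncTorus theta).
Implicit Types (a b : T) (k l : 'rV[int]_n).

(** Expressed through Fourier coefficients alone, so that it vanishes when they all do; its
    contractivity is read off [grid_mean]. *)
Definition fejer K a : T := ((K ^ n)%:R^-1 : R[i]) *:
  \sum_(i : {ffun 'I_n -> 'I_K}) \sum_(i' : {ffun 'I_n -> 'I_K})
    coef (ivec i' - ivec i) a *: mon T (ivec i' - ivec i).

Lemma fejerZD K (c : R[i]) a b : fejer K (c *: a + b) = c *: fejer K a + fejer K b.
Proof.
rewrite /fejer scalerA mulrC -scalerA -scalerDr; congr (_ *: _).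
rewrite scaler_sumr -big_split; apply: eq_bigr => i _ /=.
rewrite scaler_sumr -big_split; apply: eq_bigr => i' _ /=.
by rewrite linearP /= scalerDl scalerA.
Qed.

Lemma fejer_sum K (I : Type) (s : seq I) (F : I -> T) (c : I -> R[i]) :
  fejer K (\sum_(i <- s) c i *: F i) = \sum_(i <- s) c i *: fejer K (F i).
Proof.
elim: s => [|i s IH]; last by rewrite !big_cons fejerZD IH.
rewrite !big_nil /fejer big1 ?scaler0 // => i _; rewrite big1 // => i' _.
by rewrite linear0 scale0r.
Qed.

Lemma fejerB K a b : fejer K (a - b) = fejer K a - fejer K b.
Proof. by rewrite -scaleN1r addrC fejerZD scaleN1r addrC. Qed.

Lemma fejer_mon K l : fejer K (mon T l) = (fejer_weight K l)%:C%C *: mon T l.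
Proof.
rewrite /fejer /fejer_weight rmorphM /= fmorphV rmorph_nat mulrC -scalerA.
congr (_ *: _); rewrite rmorph_sum /= scaler_suml; apply: eq_bigr => i _.
rewrite rmorph_sum scaler_suml; apply: eq_bigr => i' _ /=.
by rewrite coef_mon rmorph_nat; case: eqVneq => [->|_]; rewrite ?scale0r.
Qed.

(** A convex combination of the isometries [ncta], since by [dirichlet_mean] the weights have total
    mass 1 when K <= N. It agrees with [fejer K] on U^l as soon as N is at least K + |l_j| for all
    j. *)
Definition grid_mean K N a : T := (((K ^ n)%:R * (N ^ n)%:R)^-1 : R[i]) *:
  \sum_(g : {ffun 'I_n -> 'I_N}) (nr (dirichlet K (gvec g)) ^+ 2)%:C%C *:
    ncta T (gvec g) a.

Lemma grid_mean_contraction K N a : (K <= N)%N -> (0 < K)%N ->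
  nr (grid_mean K N a) <= nr a.
Proof.
move=> KN K0; have N0 : (0 < N)%N by exact: leq_trans KN.
have P0 : (0 : R) < (K ^ n)%:R * (N ^ n)%:R by rewrite mulr_gt0 // ltr0n expn_gt0 ?K0 ?N0.
rewrite /grid_mean nrZ nrV nrM.
rewrite (_ : nr (K ^ n)%:R = (K ^ n)%:R); last first.
  by rewrite -[X in nr X](rmorph_nat (real_complex R)) nr_real ger0_norm.
rewrite (_ : nr (N ^ n)%:R = (N ^ n)%:R); last first.
  by rewrite -[X in nr X](rmorph_nat (real_complex R)) nr_real ger0_norm.
rewrite ler_pdivrMl // -(dirichlet_mean KN K0) mulr_suml.
apply: le_trans (nr_sum _ _ _) _; apply: ler_sum => g _.
rewrite nrZ nr_real ger0_norm ?exprn_ge0 ?nr_ge0 //.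
by have := ncta_norm (gvec g) a; rewrite !nrE => /(@complexI R) ->.
Qed.

Lemma grid_mean_mon K N l : (0 < K)%N -> (forall j, (K + `|l 0%R j| <= N)%N) ->
  (0 < n)%N -> grid_mean K N (mon T l) = fejer K (mon T l).
Proof.
move=> K0 hN n0.
have N0 : (0 < N)%N by have := hN (Ordinal n0); lia.
rewrite fejer_mon /grid_mean.
under eq_bigr do rewrite ncta_mon scalerA.
rewrite -scaler_suml scalerA; congr (_ *: _).
under eq_bigr do rewrite -dirichlet_sqr mulr_suml.
rewrite exchange_big /=.
under eq_bigr do under eq_bigr do rewrite mulr_suml.
under eq_bigr do rewrite exchange_big /=.
rewrite /fejer_weight rmorphM /= fmorphV rmorph_nat invfM mulrC mulrA mulrAC.
congr (_ * _); rewrite rmorph_sum mulr_suml; apply: eq_bigr => i _ /=.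
rewrite rmorph_sum mulr_suml; apply: eq_bigr => i' _ /=.
under eq_bigr do rewrite -cexpD -dotvDr -kvecD.
rewrite grid_sum //; last first.
  move=> j; rewrite mxE; apply: le_lt_trans (ler_normD _ _) _.
  have h : K%:Z + `|l 0 j| <= N%:Z by rewrite -abszE -PoszD lez_nat.
  by apply: lt_le_trans h; rewrite ltrD2r; exact: ivec_diff_lt.
rewrite -[ivec i - ivec i']opprB addrC subr_eq0 eq_sym rmorph_nat.
case: eqVneq => _; last by rewrite mul0r.
by rewrite mulfV // pnatr_eq0 -lt0n expn_gt0 N0.
Qed.

Lemma fejer_contraction_mpoly K a : (0 < K)%N -> (0 < n)%N -> mpoly a ->
  nr (fejer K a) <= nr a.
Proof.
move=> K0 n0 [s ->].
(* One grid fine enough for all frequencies of the polynomial at once. *)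
pose N := (K + \sum_(p <- s) \sum_j `|(p.1 : 'rV[int]_n) 0%R j|)%N.
rewrite (_ : fejer K _ = grid_mean K N (\sum_(p <- s) p.2 *: mon T p.1)).
  by apply: grid_mean_contraction => //; exact: leq_addr.
have -> : grid_mean K N (\sum_(p <- s) p.2 *: mon T p.1) =
    \sum_(p <- s) p.2 *: grid_mean K N (mon T p.1).
  rewrite /grid_mean; under [RHS]eq_bigr do rewrite scalerA mulrC -scalerA.
  rewrite -scaler_sumr; congr (_ *: _).
  under [RHS]eq_bigr do rewrite scaler_sumr.
  rewrite exchange_big /=; apply: eq_bigr => g _.
  rewrite linear_sum scaler_sumr; apply: eq_bigr => p _.
  by rewrite linearZ /= !scalerA mulrC.
rewrite fejer_sum; apply: eq_big_seq => p ps; congr (_ *: _).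
symmetry; apply: grid_mean_mon => // j; rewrite leq_add2l.
by rewrite (big_rem p) //= (bigD1 j) //= -!addnA leq_addr.
Qed.

Lemma fejer_bound K : exists2 C : R, 0 <= C & forall a, nr (fejer K a) <= C * nr a.
Proof.
have [C C0 hC] := coef_bounded T.
exists (nr ((K ^ n)%:R^-1 : R[i]) *
  (\sum_(i : {ffun 'I_n -> 'I_K}) \sum_(i' : {ffun 'I_n -> 'I_K}) C)).
  by rewrite mulr_ge0 ?nr_ge0 // sumr_ge0 // => i _; rewrite sumr_ge0.
move=> a; rewrite /fejer nrZ -mulrA ler_wpM2l ?nr_ge0 // mulr_suml.
apply: le_trans (nr_sum _ _ _) _; apply: ler_sum => i _; rewrite mulr_suml.
apply: le_trans (nr_sum _ _ _) _; apply: ler_sum => i' _.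
by rewrite nrZ nr_mon mulr1.
Qed.

(** Extension by density. The constant of [fejer_bound] depends on [K], which is harmless since [K]
    is fixed while the polynomial approximates [a]. *)
Lemma fejer_contraction K a : (0 < K)%N -> (0 < n)%N -> nr (fejer K a) <= nr a.
Proof.
move=> K0 n0; have [C C0 hC] := fejer_bound K.
apply/ler_addgt0Pl => e e0.
have d0 : 0 < e / (C + 1) by rewrite divr_gt0 // ltr_wpDl.
have [p hp ap] := mpoly_dense a d0.
have h1 := fejer_contraction_mpoly K0 n0 hp.
have h2 := hC (a - p); rewrite fejerB in h2.
have h3 := nrD (fejer K a - fejer K p) (fejer K p); rewrite subrK in h3.
have h4 := nrD (p - a) a; rewrite subrK nr_distrC in h4.
have h5 : (C + 1) * nr (a - p) <= e.
  by move: ap; rewrite ltr_pdivlMr ?ltr_wpDl // mulrC => /ltW.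
by lra.
Qed.

Lemma fejer_cvg_mpoly a : mpoly a -> (fun K => fejer K a) @ \oo --> a.
Proof.
move=> [s ->]; under eq_fun do rewrite fejer_sum.
apply: (@cvg_sum_seq _ T _ _ _ _ _ _
  (fun p K => p.2 *: fejer K (mon T p.1)) (fun p => p.2 *: mon T p.1)) => p _.
apply: cvgZl_tmp; under eq_fun do rewrite fejer_mon.
suff : (fun K => (fejer_weight K p.1)%:C%C *: mon T p.1) @ \oo --> 1 *: mon T p.1.
  by rewrite scale1r.
apply: cvgZr_tmp; apply/cvg_ReIm; split=> /=; first exact: fejer_weight_cvg.
exact: cvg_cst.
Qed.

(** Let p be a polynomial close to [a]. The Fejer mean of p is that of p - a, hence small by
    contractivity; it also converges to p. So p and [a] are small. Faithfulness of the trace is not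
    presupposed, but follows later in [tau_eq0]. *)
Lemma coef_eq0 a : (0 < n)%N -> (forall k, coef k a = 0) -> a = 0.
Proof.
move=> n0 h; apply: nr_eq0; apply/eqP; rewrite eq_le nr_ge0 andbT.
apply/ler_addgt0Pl => e e0; rewrite addr0.
have [|p hp ap] := @mpoly_dense _ _ _ T a (e / 3); first lra.
have /cvg_nrP/(_ (e / 3)) := fejer_cvg_mpoly hp.
have -> : 0 < e / 3 by lra.
move=> /(_ isT)[N _ hN].
have := hN N.+1 (leqnSn N) => /= h1.
have h2 := fejer_contraction (p - a) (ltn0Sn N) n0.
have h3 : fejer N.+1 a = 0.
  rewrite /fejer big1 ?scaler0 // => i _; rewrite big1 // => i' _.
  by rewrite h scale0r.
rewrite fejerB h3 subr0 in h2.
have h4 := nrD (a - p) p; rewrite subrK in h4.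
have h5 := nrD (p - fejer N.+1 p) (fejer N.+1 p); rewrite subrK nr_distrC in h5.
by rewrite nr_distrC in h2; lra.
Qed.

Lemma coef_inj a b : (0 < n)%N -> (forall k, coef k a = coef k b) -> a = b.
Proof.
move=> n0 h; apply/eqP; rewrite -subr_eq0; apply/eqP/coef_eq0 => // k.
by rewrite linearB /= h subrr.
Qed.

End FourierUniqueness.

Section SummableWeights.
Context {R : realType}.

Lemma abszD_ge0 (m : int) (K : nat) :
  (`|m| <= K)%N -> (`|(m + K%:Z)%R|%N)%:Z = m + K%:Z.
Proof. lia. Qed.

(** Telescoping: 1 / (1 + t^2) <= 2 (1 / t - 1 / (t + 1)) for t >= 1. *)
Lemma sum_inv_sqr_le (K : nat) : \sum_(t < K) (1 + (t.+1%:R : R) ^+ 2)^-1 <= 2.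
Proof.
suff : \sum_(t < K) (1 + (t.+1%:R : R) ^+ 2)^-1 <= 2 * (1 - K.+1%:R^-1).
  by move/le_trans; apply; rewrite ler_piMr // lerBlDr lerDl invr_ge0 ler0n.
elim: K => [|K IH]; first by rewrite big_ord0 invr1 subrr mulr0.
rewrite big_ord_recr /=; apply: le_trans (lerD IH (lexx _)) _.
rewrite -lerBrDl -mulrBr (_ : forall a b : R, 1 - a - (1 - b) = b - a); last first.
  by move=> a b; ring.
have x0 : (0 : R) <= K%:R by rewrite ler0n.
rewrite -[K.+2%:R]natr1 -[K.+1%:R]natr1; move: (K%:R : R) x0 => x x0.
have -> : 2 * ((x + 1)^-1 - (x + 1 + 1)^-1) = (((x + 1) * (x + 1 + 1)) / 2)^-1.
  by field; rewrite !gt_eqF //; lra.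
by rewrite lef_pV2 ?posrE; nra.
Qed.

Lemma sum_box_le (K : nat) :
  \sum_(t < K + K.+1) (1 + ((t%:R - K%:R) : R) ^+ 2)^-1 <= 5.
Proof.
rewrite big_split_ord /= (reindex_inj rev_ord_inj) /= [X in _ + X]big_ord_recl /=.
rewrite addn0 subrr expr0n addr0 invr1.
have -> : 5 = 2 + (1 + 2) :> R by lra.
apply: lerD; last rewrite lerD2l.
  apply: le_trans (sum_inv_sqr_le K); apply: ler_sum => t _.
  have -> : (K - t.+1)%:R - K%:R = - (t.+1%:R) :> R.
    by rewrite natrB // addrAC subrr add0r.
  by rewrite sqrrN.
apply: le_trans (sum_inv_sqr_le K); apply: ler_sum => t _.
by rewrite /bump /= add1n natrD [K%:R + _]addrC addrK.
Qed.

(** A finite set of lattice points lies in a box [-K, K]^n, over which the sum is a product of n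
    one-dimensional sums, each at most 5 = 2 + 1 + 2: negative integers, zero, positive integers. *)
Lemma summable_pw n : summable_bound (fun k : 'rV[int]_n => (pw (kvec (R := R) k))^-1).
Proof.
split=> [k|]; first by rewrite invr_ge0 (le_trans ler01) // pw_ge1.
exists (5 ^+ n) => s us.
pose K := (\sum_(k <- s) \sum_j `|k 0%R j|)%N.
pose F (f : {ffun 'I_n -> 'I_(K + K.+1)}) : 'rV[int]_n := \row_j ((f j : nat)%:Z - K%:Z).
have Finj : injective F.
  move=> f g /rowP h; apply/ffunP => j; apply/val_inj.
  by have := h j; rewrite !mxE => /addIr[].
apply: (@le_trans _ _ (\sum_(k <- [seq F f | f <- enum {ffun 'I_n -> 'I_(K + K.+1)}])
    (pw (kvec (R := R) k))^-1)).
  apply: sum_uniq_sub => //.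
  - by move=> k; rewrite invr_ge0 (le_trans ler01) // pw_ge1.
  - by rewrite map_inj_uniq // enum_uniq.
  - move=> k ks.
    have hk j : (`|k 0%R j| <= K)%N.
      by rewrite /K (big_rem k) //= (bigD1 j) //= -!addnA leq_addr.
    have hk' j : (`|(k 0%R j + K%:Z)%R| < K + K.+1)%N by have := hk j; lia.
    apply/mapP; exists [ffun j => Ordinal (hk' j)]; first by rewrite mem_enum.
    apply/rowP => j; rewrite !mxE ffunE /=.
    by rewrite abszD_ge0 ?addrK.
rewrite big_map big_enum /=.
have -> : \sum_(f : {ffun 'I_n -> 'I_(K + K.+1)}) (pw (kvec (R := R) (F f)))^-1 =
    \sum_(f : {ffun 'I_n -> 'I_(K + K.+1)}) \prod_j (1 + (((f j)%:R - K%:R) : R) ^+ 2)^-1.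
  apply: eq_bigr => f _; rewrite /pw -prodfV; apply: eq_bigr => j _.
  by rewrite !mxE rmorphB /= -!pmulrn.
rewrite -(bigA_distr_bigA (fun _ (t : 'I_(K + K.+1)) => (1 + ((t%:R - K%:R) : R) ^+ 2)^-1)).
rewrite prodr_const card_ord lerXn2r ?nnegrE ?ler0n //; last exact: sum_box_le.
by apply: sumr_ge0 => t _; rewrite invr_ge0 addr_ge0 // sqr_ge0.
Qed.

End SummableWeights.

(** * Symbols as Fourier series *)

Section EigenFamilies.
Context {R : realType} {n : nat} {theta : 'M[R]_n} (T : ncTorus theta).
#[local] Opaque pderiv.

(* Instances: U^k, (U^k)^* and U^k U^l, the three kinds of series in which
   symbols, adjoint symbols and product symbols are expanded. *)
Record eigenfamily (I : countType) (U : I -> T) (q : I -> 'rV[int]_n)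
    (om : I -> R) : Prop := EigenFamily {
  ef_norm : forall i, nr (U i) <= 1;
  ef_mon : forall i, exists c : R[i], U i = c *: mon T (q i);
  ef_ge1 : forall i, 1 <= om i;
  ef_freq : exists2 K : R, 1 <= K & forall i j, `|kvec (R := R) (q i) 0 j| <= K * om i;
  ef_sum : exists p, summable_bound (fun i => (om i ^+ p)^-1)
}.

Definition rapid (I : Type) (om : I -> R) (x : I -> R[i]) : Prop :=
  forall p, exists2 C : R, 0 <= C & forall i, om i ^+ p * nr (x i) <= C.

Definition freq (q : 'rV[int]_n) (w : seq 'I_n) : R := \prod_(j <- w) (kvec q 0 j).

(** The Fourier side of a symbol of order m: scalar symbol estimates for the coefficients, decaying
    faster than every power of the weight [om], uniformly in the covector. [csym_symbol] and
    [symbol_csym] give the equivalence with [symbol]. *)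
Definition csym (I : Type) (om : I -> R) (m : R) (d : I -> 'rV[R]_n -> R[i]^o) : Prop :=
  (forall i, Cinfty (d i)) /\
  forall p w, exists2 C : R, 0 <= C & forall i x,
    om i ^+ p * nr (wderiv w (d i) x) <= C * jb x `^ (m - (size w)%:R).

Lemma ncta_continuous s : continuous (ncta T s).
Proof.
move=> a; apply/cvg_nrP => e e0.
have /cvg_nrP/(_ e e0) : (id : T -> T) @ a --> a by exact: cvg_id.
apply: filterS => b; rewrite -raddfB.
by have := ncta_norm s (b - a); rewrite !nrE => /(@complexI R) ->.
Qed.

Lemma orbit_deriv0 a : orbit_deriv (ncta T) [::] a = a.
Proof. exact: ncta0. Qed.

Lemma dotv_continuous (k : 'rV[R]_n) : continuous (fun s => dotv s k).
Proof.
move=> s; apply: (@cvg_big _ _ _ _ _ (@add_continuous R) _ (nbhs s)) => j _.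
by apply: cvgM; [exact: coord_continuous|exact: cvg_cst].
Qed.

Lemma cexp_dotv_continuous (k : 'rV[R]_n) :
  continuous (fun s => cexp (dotv s k) : R[i]^o).
Proof.
move=> s; apply/(@cvg_ReIm _ _ _ (nbhs_filter s)); split=> /=.
  apply: (@continuous_comp _ _ _ (fun s => dotv s k) cos).
    exact: dotv_continuous.
  exact: continuous_cos.
apply: (@continuous_comp _ _ _ (fun s => dotv s k) sin).
  exact: dotv_continuous.
exact: continuous_sin.
Qed.

Lemma is_derive_quot (f : R -> R) x df : is_derive x (1 : R) f df ->
  (fun h : R => h^-1 * (f (x + h) - f x)) @ 0^' --> df.
Proof.
move=> -[/cvg_ex[a /= ha] <-]; rewrite /derive (cvg_lim _ ha) //.
suff -> : (fun h : R => h^-1 * (f (x + h) - f x)) =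
  (fun h : R => h^-1 *: (f (h *: (1 : R) + x) - f x)) by [].
by apply/funext => h; rewrite /GRing.scale /= mulr1 [x + h]addrC.
Qed.

Lemma is_pd_cexp (c : R[i]) (kp : 'rV[R]_n) j x :
  is_pd (fun s => c * cexp (dotv s kp) : R[i]^o) j x
    ('i%C * (kp 0 j)%:C%C * c * cexp (dotv x kp)).
Proof.
have e (h : R) : dotv (x + h *: delta_mx 0 j) kp = dotv x kp + h * kp 0 j.
  rewrite /dotv (eq_bigr (fun i => x 0 i * kp 0 i + (if i == j then h * kp 0 j else 0))).
    by rewrite big_split /= -big_mkcond big_pred1_eq.
  by move=> i _; rewrite !mxE eqxx /=; case: eqVneq => [->|_]; rewrite ?mulr1 ?mulr0 ?addr0 ?mulrDl.
rewrite /is_pd.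
have -> : dquot (fun s => c * cexp (dotv s kp) : R[i]^o) j x =
    fun h : R => c * cexp (dotv x kp) * ((h^-1)%:C%C * (cexp (h * kp 0 j) - 1)).
  by apply/funext => h; rewrite /dquot e cexpD /GRing.scale /=; ring.
have -> : 'i%C * (kp 0 j)%:C%C * c * cexp (dotv x kp) =
    c * cexp (dotv x kp) * ('i%C * (kp 0 j)%:C%C) by ring.
apply: (@cvgZl_tmp _ R[i]^o _ _ _ (c * cexp (dotv x kp))).
set k := kp 0 j.
have lin : is_derive (0 : R) (1 : R) (fun h : R => h * k) k.
  have := is_deriveM (is_derive_id (0 : R) (1 : R)) (is_derive_cst k (0 : R) (1 : R)).
  by rewrite /GRing.scale /= !mulr0 add0r mulr1.
apply/cvg_ReIm; split=> /=.
- have dc : is_derive (0 : R) (1 : R) (fun h => cos (h * k)) 0.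
    have := @is_derive1_comp _ cos (fun h : R => h * k) 0 _ _ (is_derive_cos _) lin.
    by rewrite mul0r sin0 oppr0 mul0r.
  have := is_derive_quot dc; rewrite mul0r cos0.
  rewrite mulr0 subr0.
  set u := (X in X @ _ --> _ -> _); set v := (X in _ -> X @ _ --> _).
  suff -> : u = v by [].
  by apply/funext => h; rewrite /u /v add0r; ring.
- have dc : is_derive (0 : R) (1 : R) (fun h => sin (h * k)) k.
    have := @is_derive1_comp _ sin (fun h : R => h * k) 0 _ _ (is_derive_sin _) lin.
    by rewrite mul0r cos0 mul1r.
  have := is_derive_quot dc; rewrite mul0r sin0.
  rewrite mul0r mul1r add0r.
  set u := (X in X @ _ --> _ -> _); set v := (X in _ -> X @ _ --> _).
  suff -> : u = v by [].
  by apply/funext => h; rewrite /u /v add0r; ring.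
Qed.

(** The eigenvalue on U^q of the derivative of the action along the word w. A letter j contributes i
    q_j here, but q_j for the derivation [nctd j]; the moduli agree ([nr_ipow]). *)
Definition ipow (q : 'rV[int]_n) (w : seq 'I_n) : R[i] :=
  'i%C ^+ size w * (freq q w)%:C%C.

Lemma Cinfty_cexp (c : R[i]) (q : 'rV[int]_n) :
  Cinfty (fun s => c * cexp (dotv s (kvec q)) : R[i]^o) /\
  forall w, wderiv w (fun s => c * cexp (dotv s (kvec q)) : R[i]^o) =
    fun s => ipow q w * c * cexp (dotv s (kvec q)).
Proof.
pose D w (s : 'rV[R]_n) : R[i]^o := ipow q w * c * cexp (dotv s (kvec q)).
have D0 : D [::] = (fun s => c * cexp (dotv s (kvec q)) : R[i]^o).
  by apply/funext => s; rewrite /D /ipow /freq big_nil /= !mul1r.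
have hD w j x : is_pd (D w) j x (D (j :: w) x).
  have := @is_pd_cexp (ipow q w * c) (kvec q) j x.
  have -> // : 'i%C * (kvec q 0 j)%:C%C * (ipow q w * c) * cexp (dotv x (kvec q)) = D (j :: w) x.
  by rewrite /D /ipow /freq big_cons /= exprS rmorphM /=; ring.
rewrite -D0; split; last exact: (@wderiv_family _ _ _ D hD).
apply: (@Cinfty_family _ _ _ D) hD => w x.
apply: (@cvgZl_tmp _ R[i]^o _ _ (nbhs_filter x) (ipow q w * c)); exact: cexp_dotv_continuous.
Qed.

Section Family.
Context {I : countType} {U : I -> T} {q : I -> 'rV[int]_n} {om : I -> R}.
Context (E : eigenfamily U q om).
Implicit Types x y : I -> R[i].

Definition fsum x : T := csum (fun i => x i *: U i).

Lemma om_ge0 i : 0 <= om i.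
Proof. by apply: le_trans (ef_ge1 E i). Qed.

Lemma om_gt0 i : 0 < om i.
Proof. by apply: lt_le_trans (ef_ge1 E i). Qed.

Lemma rapid_bound x : rapid om x ->
  exists2 b, summable_bound b & forall i, nr (x i) <= b i.
Proof.
move=> hx; have [p hp] := ef_sum E; have [C C0 hC] := hx p.
exists (fun i => C * (om i ^+ p)^-1); first exact: summable_boundZ.
by move=> i; rewrite ler_pdivlMr ?exprn_gt0 ?om_gt0 // mulrC hC.
Qed.

Lemma nr_U_le (c : R[i]) i : nr (c *: U i) <= nr c.
Proof. by rewrite nrZ ler_piMr ?nr_ge0 // (ef_norm E). Qed.

Lemma rapidZD (c : R[i]) x y : rapid om x -> rapid om y ->
  rapid om (fun i => c * x i + y i).
Proof.
move=> hx hy p; have [C C0 hC] := hx p; have [D D0 hD] := hy p.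
exists (nr c * C + D); first by rewrite addr_ge0 // mulr_ge0 ?nr_ge0.
move=> i; apply: (@le_trans _ _ (om i ^+ p * (nr c * nr (x i) + nr (y i)))).
  by rewrite ler_wpM2l ?exprn_ge0 ?om_ge0 // -nrM nrD.
by rewrite mulrDr mulrCA lerD // ler_wpM2l ?nr_ge0.
Qed.

Lemma rapid_le x y : rapid om x -> (forall i, nr (y i) <= nr (x i)) -> rapid om y.
Proof.
move=> hx h p; have [C C0 hC] := hx p; exists C => // i.
by apply: le_trans (hC i); rewrite ler_wpM2l ?exprn_ge0 ?om_ge0.
Qed.

Lemma ipow_bound w : exists2 K : R, 1 <= K & forall i, nr (ipow (q i) w) <= K * om i ^+ size w.
Proof.
have [K K1 hK] := ef_freq E.
exists (K ^+ size w); first by rewrite exprn_ege1.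
move=> i; rewrite /ipow nrM nrX nr_real.
have -> : nr 'i%C = 1 :> R.
  by rewrite /nr normc_def /= expr0n expr1n add0r sqrtr1.
rewrite expr1n mul1r -exprMn /freq.
elim: w => [|j w IH]; first by rewrite big_nil normr1.
by rewrite big_cons normrM exprS ler_pM.
Qed.

Lemma rapid_ipow x w : rapid om x -> rapid om (fun i => ipow (q i) w * x i).
Proof.
move=> hx p; have [K K1 hK] := ipow_bound w.
have [C C0 hC] := hx (p + size w)%N; exists (K * C).
  by rewrite mulr_ge0 // (le_trans ler01).
move=> i; rewrite nrM mulrCA.
apply: (@le_trans _ _ (K * om i ^+ size w * (om i ^+ p * nr (x i)))).
  by rewrite ler_wpM2r // mulr_ge0 ?nr_ge0 ?exprn_ge0 ?om_ge0.
by rewrite -mulrA ler_wpM2l ?(le_trans ler01) // mulrA -exprD addnC.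
Qed.

Lemma fsum_cvg x : rapid om x -> psum (fun i => x i *: U i) @ \oo --> fsum x.
Proof.
move=> /rapid_bound[b hb xb]; apply: csum_cvg hb _ => i.
exact: le_trans (nr_U_le _ _) (xb i).
Qed.

Lemma fsumZD (c : R[i]) x y : rapid om x -> rapid om y ->
  fsum (fun i => c * x i + y i) = c *: fsum x + fsum y.
Proof.
move=> hx hy; apply: csum_unique.
rewrite (_ : psum _ = fun N => c *: psum (fun i => x i *: U i) N + psum (fun i => y i *: U i) N).
  by apply: cvgD; [apply: cvgZl_tmp|]; exact: fsum_cvg.
apply/funext => N; rewrite /psum scaler_sumr -big_split; apply: eq_bigr => k _ /=.
rewrite /cseq; case: pickle_inv => /= [i|]; last by rewrite scaler0 addr0.
by rewrite scalerDl scalerA.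
Qed.

Lemma ncta_U s i : ncta T s (U i) = cexp (dotv s (kvec (q i))) *: U i.
Proof.
by have [c ->] := ef_mon E i; rewrite linearZ /= ncta_mon !scalerA mulrC.
Qed.

Lemma ncta_fsum s x : rapid om x ->
  ncta T s (fsum x) = fsum (fun i => x i * cexp (dotv s (kvec (q i)))).
Proof.
move=> hx; symmetry; apply: csum_unique; have [b hb xb] := rapid_bound hx.
have := @csum_morph _ _ _ T (ncta T s) (fun i => x i *: U i) b hb _ (@ncta_continuous s).
have -> : ncta T s \o (fun i => x i *: U i) =
    fun i => (x i * cexp (dotv s (kvec (q i)))) *: U i.
  by apply/funext => i /=; rewrite linearZ /= ncta_U scalerA.
by apply => i; exact: le_trans (nr_U_le _ _) (xb i).
Qed.

Lemma tame_orbit x : rapid om x ->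
  tame (fun i s => x i * cexp (dotv s (kvec (q i))) : R[i]^o).
Proof.
move=> hx; split=> [i|w]; first exact: (Cinfty_cexp _ _).1.
have [b hb xb] := rapid_bound (rapid_ipow w hx).
exists 0%N, b => // i s; rewrite (Cinfty_cexp _ _).2 expr0 mul1r.
by rewrite nrM nr_cexp mulr1.
Qed.

Lemma fsum_smooth x : rapid om x ->
  smooth_vec (ncta T) (fsum x) /\
  forall w, orbit_deriv (ncta T) w (fsum x) = fsum (fun i => ipow (q i) w * x i).
Proof.
move=> hx.
have e : @Defs.orbit R n T (ncta T) (fsum x) =
    tsum U (fun i s => x i * cexp (dotv s (kvec (q i))) : R[i]^o).
  by apply/funext => s; rewrite /Defs.orbit ncta_fsum.
have [h1 h2] := tsum_Cinfty (ef_norm E) (tame_orbit hx).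
split; first by rewrite /smooth_vec e.
move=> w; rewrite /orbit_deriv e h2 /tsum /fsum; congr csum; apply/funext => i.
rewrite (Cinfty_cexp _ _).2; congr (_ *: _).
rewrite (_ : dotv _ _ = 0) ?cexp0 ?mulr1 //.
by rewrite /dotv big1 // => j _; rewrite mxE mul0r.
Qed.

Lemma fsumZB (c : R[i]) x y : rapid om x -> rapid om y ->
  c *: (fsum x - fsum y) = fsum (fun i => c * (x i - y i)).
Proof.
move=> /rapid_bound[b hb xb] /rapid_bound[b' hb' yb].
rewrite (csumZB _ hb hb') => [|i|i].
- by congr csum; apply/funext => i; rewrite -scalerBl scalerA.
- exact: le_trans (nr_U_le _ _) (xb i).
- exact: le_trans (nr_U_le _ _) (yb i).
Qed.

Lemma rapidZB (c : R[i]) x y : rapid om x -> rapid om y ->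
  rapid om (fun i => c * (x i - y i)).
Proof.
move=> hx hy; apply: (rapid_le (rapidZD (- c) hy
    (rapidZD c hx (rapidZD 0 hx (rapidZD (-1) hx hx))))) => i.
by rewrite mul0r mulN1r addNr !addr0 mulrBr addrC mulNr.
Qed.

Lemma orbit_derivZB (c : R[i]) x y w : rapid om x -> rapid om y ->
  orbit_deriv (ncta T) w (c *: (fsum x - fsum y)) =
  c *: (orbit_deriv (ncta T) w (fsum x) - orbit_deriv (ncta T) w (fsum y)).
Proof.
move=> hx hy; rewrite fsumZB // (fsum_smooth (rapidZB c hx hy)).2.
rewrite (fsum_smooth hx).2 (fsum_smooth hy).2 fsumZB; try exact: rapid_ipow.
by congr fsum; apply/funext => i; ring.
Qed.

End Family.
End EigenFamilies.
Arguments fsum {R n theta T I} U x.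

Section SymbolSynthesis.
Context {R : realType} {n : nat} {theta : 'M[R]_n} (T : ncTorus theta).
#[local] Opaque pderiv.

Lemma jb_powR_le (s : R) : exists k, forall x : 'rV[R]_n, jb x `^ s <= jb x ^+ k.
Proof.
exists (Num.bound `|s|) => x; rewrite -powR_mulrn ?(ltW (jb_gt0 x)) //.
rewrite ler_powR ?jb_ge1 //; apply: le_trans (ler_norm s) _.
by apply: ltW; exact: archi_boundP.
Qed.

Lemma Cinfty_Z (W : normedModType R[i]) (f : 'rV[R]_n -> W) (c : R[i]) : Cinfty f ->
  Cinfty (fun x => c *: f x) /\
  forall w, wderiv w (fun x => c *: f x) = fun x => c *: wderiv w f x.
Proof.
move=> hf.
have hd w j x : is_pd (fun x => c *: wderiv w f x) j x (c *: wderiv (j :: w) f x).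
  by apply: is_pdZ; exact: (hf w).2.
split; last exact: (@wderiv_family _ _ _ (fun w x => c *: wderiv w f x) hd).
apply: (@Cinfty_family _ _ _ (fun w x => c *: wderiv w f x)) hd => w x.
by apply: (@cvgZl_tmp _ W _ _ (nbhs_filter x)); exact: (hf w).1.
Qed.

Section Family.
Context {I : countType} {U : I -> T} {q : I -> 'rV[int]_n} {om : I -> R}.
Context (E : eigenfamily U q om).
Implicit Types (d : I -> 'rV[R]_n -> R[i]^o) (m : R).

Lemma csym_wderiv m d v : csym om m d ->
  csym om (m - (size v)%:R) (fun i => wderiv v (d i)).
Proof.
move=> [h1 h2]; split=> [i|p w]; first exact: Cinfty_wderiv.
have [C C0 hC] := h2 p (w ++ v); exists C => // i x.
have := hC i x; rewrite wderiv_cat size_cat natrD opprD.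
by rewrite -addrA [- _ - _]addrC.
Qed.

Lemma csym_rapid m d w x : csym om m d -> rapid om (fun i => wderiv w (d i) x).
Proof.
move=> [_ h] p; have [C C0 hC] := h p w.
by exists (C * jb x `^ (m - (size w)%:R)); [rewrite mulr_ge0 ?powR_ge0|move=> i; exact: hC].
Qed.

Lemma csym_tame m d : csym om m d -> tame d.
Proof.
move=> [h1 h2]; split=> // w; have [p hp] := ef_sum E.
have [C C0 hC] := h2 p w; have [k hk] := jb_powR_le (m - (size w)%:R).
exists k, (fun i => C * (om i ^+ p)^-1); first exact: summable_boundZ.
move=> i x; rewrite mulrA ler_pdivlMr ?exprn_gt0 ?(om_gt0 E) // mulrC.
by apply: le_trans (hC i x) _; rewrite mulrC ler_wpM2r.
Qed.

Lemma csym_ipow m d v : csym om m d -> csym om m (fun i x => ipow (q i) v * d i x).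
Proof.
move=> [h1 h2]; split=> [i|p w]; first exact: (Cinfty_Z _ (h1 i)).1.
have [K K1 hK] := ipow_bound E v; have [C C0 hC] := h2 (p + size v)%N w.
exists (K * C); first by rewrite mulr_ge0 // (le_trans ler01).
move=> i x; rewrite (Cinfty_Z (ipow (q i) v) (h1 i)).2.
rewrite -[nr _]/(nr (ipow (q i) v * wderiv w (d i) x)) nrM mulrCA.
apply: (@le_trans _ _ (K * om i ^+ size v * (om i ^+ p * nr (wderiv w (d i) x)))).
  by rewrite ler_wpM2r // mulr_ge0 ?nr_ge0 ?exprn_ge0 ?(om_ge0 E).
rewrite -!mulrA ler_wpM2l ?(le_trans ler01) // mulrA -exprD addnC; exact: hC.
Qed.

Lemma wderiv_ipow m d v w x i : csym om m d ->
  wderiv w (fun x => ipow (q i) v * d i x : R[i]^o) x = ipow (q i) v * wderiv w (d i) x.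
Proof. by move=> [h1 _]; rewrite (Cinfty_Z (ipow (q i) v) (h1 i)).2. Qed.

Lemma tsum_wderiv m d w : csym om m d ->
  wderiv w (tsum U d) = fun x => fsum U (fun i => wderiv w (d i) x).
Proof. by move=> hd; rewrite (tsum_Cinfty (ef_norm E) (csym_tame hd)).2. Qed.

(** Each Frechet seminorm of a series is the norm of another series of the same kind, with
    coefficients multiplied by [ipow]. Smoothness with values in the smooth subalgebra is thereby
    reduced to smoothness in norm. *)
Lemma orbit_deriv_tsum m d v w x : csym om m d ->
  orbit_deriv (ncta T) v (wderiv w (tsum U d) x) =
  wderiv w (tsum U (fun i x => ipow (q i) v * d i x)) x.
Proof.
move=> hd; rewrite (tsum_wderiv w hd) (fsum_smooth E (csym_rapid w x hd)).2.
rewrite (tsum_wderiv w (csym_ipow v hd)) /fsum; congr csum; apply/funext => i.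
by rewrite (wderiv_ipow _ _ _ _ hd).
Qed.

Lemma smooth_cvg_tsum m d w (S : Type) (F : set_system S)
    (u : S -> T) (x : 'rV[R]_n) : csym om m d ->
  (forall v, (fun t => orbit_deriv (ncta T) v (u t)) @ F -->
     wderiv w (tsum U (fun i x => ipow (q i) v * d i x)) x) ->
  smooth_cvg (ncta T) (u @ F) (wderiv w (tsum U d) x).
Proof.
move=> hd h; split.
  by rewrite (tsum_wderiv w hd); exact: (fsum_smooth E (csym_rapid w x hd)).1.
by move=> v; rewrite (orbit_deriv_tsum v w x hd); exact: h.
Qed.

Lemma Cinfty_smooth_tsum m d : csym om m d -> Cinfty_smooth (ncta T) (tsum U d).
Proof.
move=> hd.
have sm w x : smooth_vec (ncta T) (wderiv w (tsum U d) x).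
  by rewrite (tsum_wderiv w hd); exact: (fsum_smooth E (csym_rapid w x hd)).1.
have cv v := (tsum_Cinfty (ef_norm E) (csym_tame (csym_ipow v hd))).1.
split=> [x|w]; first exact: (sm [::]).
split; first exact: sm.
split=> [x|j x].
  apply: (smooth_cvg_tsum hd) => v.
  under eq_fun do rewrite (orbit_deriv_tsum v w _ hd).
  exact: (cv v w).1.
apply: (@smooth_cvg_tsum m d (j :: w) _ _ _ _ hd) => v.
suff -> : (fun t : R => orbit_deriv (ncta T) v (dquot (wderiv w (tsum U d)) j x t)) =
    dquot (wderiv w (tsum U (fun i x => ipow (q i) v * d i x))) j x.
  exact: (cv v w).2.
apply/funext => h; rewrite /dquot !(tsum_wderiv w hd).
rewrite (orbit_derivZB E _ _ (csym_rapid w _ hd) (csym_rapid w _ hd)).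
by rewrite -!(orbit_deriv_tsum v w _ hd) !(tsum_wderiv w hd).
Qed.

End Family.
End SymbolSynthesis.

(** * The derivations on Fourier series *)

Section Derivations.
Context {R : realType} {n : nat} {theta : 'M[R]_n} (T : ncTorus theta).
#[local] Opaque pderiv.
Implicit Types (a b : T) (k l : 'rV[int]_n).

Local Notation D := (@nctd _ _ _ T).
Local Notation smooth := (smooth_vec (ncta T)).
Local Notation om := (fun k : 'rV[int]_n => pw (kvec (R := R) k)).

Lemma mon_family : eigenfamily (mon T) id om.
Proof.
split=> [i|i|i||]; first by rewrite nr_mon.
- by exists 1; rewrite scale1r.
- exact: pw_ge1.
- by exists 1 => // i j; rewrite mul1r coord_le_pw.
- exists 1%N; have := @summable_pw R n.
  by congr summable_bound; apply/funext => i; rewrite expr1.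
Qed.

Lemma star_mon_family : eigenfamily (fun k => star (mon T k)) (fun k => - k) om.
Proof.
split=> [i|i|i||]; first by rewrite nr_star nr_mon.
- by have [c ->] := star_mon T i; exists c.
- exact: pw_ge1.
- by exists 1 => // i j; rewrite mul1r kvecN mxE normrN coord_le_pw.
- exact: ef_sum mon_family.
Qed.

Lemma mon_mul_family :
  eigenfamily (fun p : 'rV[int]_n * 'rV[int]_n => mon T p.1 * mon T p.2)
    (fun p => p.1 + p.2) (fun p => om p.1 * om p.2).
Proof.
split=> [p|p|p||].
- by apply: le_trans (cstar_nrM _ _) _; rewrite !nr_mon mulr1.
- by have [c ->] := monM T p.1 p.2; exists c.
- by rewrite -[1]mulr1 ler_pM ?pw_ge1.
- exists 2 => [|p j]; first by rewrite ler1n.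
  rewrite kvecD mxE; apply: le_trans (ler_normD _ _) _.
  rewrite mulrDl mul1r; apply: lerD; apply: le_trans (coord_le_pw _ j) _.
    by rewrite ler_peMr ?pw_ge1 // (le_trans ler01) ?pw_ge1.
  by rewrite ler_peMl ?pw_ge1 // (le_trans ler01) ?pw_ge1.
- exists 1%N; have := summable_bound_prod (@summable_pw R n) (@summable_pw R n).
  by congr summable_bound; apply/funext => p; rewrite expr1 invfM.
Qed.

Lemma rapid_single (I : eqType) (w : I -> R) i0 (c : R[i]) :
  (forall i, 1 <= w i) -> rapid w (fun i => if i == i0 then c else 0).
Proof.
move=> w1 p; exists (w i0 ^+ p * nr c).
  by rewrite mulr_ge0 ?nr_ge0 ?exprn_ge0 // (le_trans ler01).
move=> i; case: eqVneq => [->|_] //; rewrite nr0 mulr0.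
by rewrite mulr_ge0 ?nr_ge0 ?exprn_ge0 // (le_trans ler01).
Qed.

Lemma fsum_single (I : countType) (U : I -> T) i0 (c : R[i]) :
  fsum U (fun i => if i == i0 then c else 0) = c *: U i0.
Proof.
rewrite /fsum (csum_single (i0 := i0)) ?eqxx // => i /negbTE ->.
by rewrite scale0r.
Qed.

Lemma smooth_scale_mon (c : R[i]) k : smooth (c *: mon T k).
Proof.
rewrite -fsum_single; apply: (fsum_smooth mon_family _).1.
by apply: rapid_single => i; exact: pw_ge1.
Qed.

(** A joint eigenvector of the derivations. Proportionality to U^k is included because it provides
    the smoothness that the Leibniz rule requires. *)
Definition dweight a k := (exists c : R[i], a = c *: mon T k) /\
  forall j, D j a = (kvec k 0 j)%:C%C *: a.

Lemma dweightM a b k l : dweight a k -> dweight b l -> dweight (a * b) (k + l).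
Proof.
move=> [[c ea] da] [[c' eb] db]; split.
  have [c'' e] := monM T k l; exists (c * c' * c'').
  by rewrite ea eb -scalerAl -scalerAr e !scalerA.
move=> j; rewrite nctdM; first last.
- by rewrite eb; exact: smooth_scale_mon.
- by rewrite ea; exact: smooth_scale_mon.
have -> : kvec (k + l) 0 j = kvec k 0 j + kvec l 0 j :> R by rewrite kvecD mxE.
by rewrite rmorphD /= scalerDl da db -scalerAl -scalerAr.
Qed.

Lemma kvec0 j : kvec (R := R) (0 : 'rV[int]_n) 0 j = 0.
Proof. by rewrite !mxE. Qed.

Lemma dweight1 : dweight 1 0.
Proof.
split; first by exists 1; rewrite mon0 scale1r.
move=> j; have s1 : smooth 1 by rewrite -(mon0 T) -[mon T 0]scale1r; exact: smooth_scale_mon.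
have := nctdM j s1 s1; rewrite !mulr1 mul1r => /esym/eqP.
by rewrite -subr_eq0 addrK => /eqP ->; rewrite kvec0 rmorph0 scale0r.
Qed.

Lemma nctU_mon j : @nctU _ _ _ T j = mon T (delta_mx 0 j).
Proof.
rewrite /mon (eq_bigr (fun i => if i == j then @nctU _ _ _ T j else 1)).
  by rewrite -big_mkcond /= big_pred1_eq.
by move=> i _; rewrite mxE eqxx /=; case: eqVneq => [->|_].
Qed.

Lemma kvec_delta i j : kvec (R := R) (delta_mx 0 i : 'rV[int]_n) 0 j = (j == i)%:R.
Proof. by rewrite !mxE eqxx /=; case: eqP. Qed.

Lemma dweightU i : dweight (@nctU _ _ _ T i) (delta_mx 0 i).
Proof.
split; first by exists 1; rewrite scale1r nctU_mon.
move=> j; rewrite nctd_U kvec_delta eq_sym.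
by case: (j == i) => /=; rewrite ?rmorph1 ?rmorph0 ?scale1r ?scale0r.
Qed.

(** The Leibniz rule applied to u^* u = 1 determines the derivations on adjoints of the
    generators. *)
Lemma dweightUs i : dweight (star (@nctU _ _ _ T i)) (- delta_mx 0 i).
Proof.
have [c e] := star_mon T (delta_mx 0 i); rewrite -nctU_mon in e.
split; first by exists c.
move=> j; set u := @nctU _ _ _ T i.
have [u1 u2] := nctU_unitary T i.
have su : smooth u by rewrite /u nctU_mon -[mon _ _]scale1r; exact: smooth_scale_mon.
have sus : smooth (star u) by rewrite /u e; exact: smooth_scale_mon.
have := nctdM j sus su; rewrite u1 dweight1.2 kvec0 rmorph0 scale0r (dweightU i).2 kvec_delta.
move=> /esym/eqP; rewrite addrC addr_eq0 -scalerAr u1 => /eqP h.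
have : D j (star u) * u * star u = D j (star u) by rewrite -mulrA u2 mulr1.
move=> <-; rewrite -[D j (star u) * u]opprK -h.
rewrite mulNr -scalerAl mul1r -scaleNr; congr (_ *: _).
by rewrite kvecN mxE kvec_delta rmorphN.
Qed.

Lemma dweightX a k p : dweight a k -> dweight (a ^+ p) (k *+ p).
Proof.
move=> h; elim: p => [|p IH]; first exact: dweight1.
by rewrite exprS mulrS; exact: dweightM.
Qed.

Lemma nctd_mon j k : D j (mon T k) = (kvec k 0 j)%:C%C *: mon T k.
Proof.
suff [_ h] : dweight (mon T k) k by exact: h.
have ek : k = \sum_(i < n) delta_mx 0 i *~ k 0 i.
  rewrite {1}[k]row_sum_delta; apply: eq_bigr => i _.
  by rewrite -scaler_int; congr (_ *: _); rewrite intz.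
rewrite {2}ek /mon; elim/big_rec2: _ => [|i y x _ h]; first exact: dweight1.
apply: dweightM => //; case: (k 0 i) => p.
  by rewrite /= -pmulrn; apply: dweightX; exact: dweightU.
by rewrite /= NegzE mulrNz -mulNrz -pmulrn; apply: dweightX; exact: dweightUs.
Qed.

Lemma smoothZD (c : R[i]) a b : smooth a -> smooth b -> smooth (c *: a + b) /\
  forall w, orbit_deriv (ncta T) w (c *: a + b) =
    c *: orbit_deriv (ncta T) w a + orbit_deriv (ncta T) w b.
Proof.
move=> sa sb.
pose D w s : T := c *: wderiv w (Defs.orbit (ncta T) a) s + wderiv w (Defs.orbit (ncta T) b) s.
have hD w j x : is_pd (D w) j x (D (j :: w) x).
  by apply: is_pdD; [apply: is_pdZ; exact: (sa w).2|exact: (sb w).2].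
have D0 : D [::] = Defs.orbit (ncta T) (c *: a + b).
  by apply/funext => s; rewrite /D /= /Defs.orbit linearP.
split.
  rewrite /smooth_vec -D0; apply: (@Cinfty_family _ _ _ D) hD => w x.
  apply: (@cvgD _ _ _ (nbhs x) _ (fun s => c *: wderiv w (Defs.orbit (ncta T) a) s)).
    by apply: (@cvgZl_tmp _ T _ _ (nbhs_filter x)); exact: (sa w).1.
  exact: (sb w).1.
by move=> w; rewrite /orbit_deriv -D0 (@wderiv_family _ _ _ D hD).
Qed.

Section Family.
Context {I : countType} {U : I -> T} {q : I -> 'rV[int]_n} {om : I -> R}.
Context (E : eigenfamily U q om).

Lemma nctd_U_family j (c : R[i]) i : D j (c *: U i) = ((kvec (q i) 0 j)%:C%C * c) *: U i.
Proof.
have [c' ->] := ef_mon E i; rewrite !scalerA.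
have s1 := smooth_scale_mon 1 (q i); rewrite scale1r in s1.
have s0 := smooth_scale_mon 0 (q i).
have := nctd_linear j (c * c') s1 s0; rewrite scale0r addr0 => ->.
have := nctd_linear j 1 s0 s0; rewrite !scale0r scaler0 addr0 scale1r => /esym/eqP.
rewrite -subr_eq0 addrK => /eqP ->.
by rewrite addr0 nctd_mon scalerA; congr (_ *: _); ring.
Qed.

Lemma smooth_psum (x : I -> R[i]) N : smooth (psum (fun i => x i *: U i) N) /\
  (forall w, orbit_deriv (ncta T) w (psum (fun i => x i *: U i) N) =
     psum (fun i => (ipow (q i) w * x i) *: U i) N) /\
  forall j, D j (psum (fun i => x i *: U i) N) =
     psum (fun i => ((kvec (q i) 0 j)%:C%C * x i) *: U i) N.
Proof.
have sU c i : smooth (c *: U i).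
  by have [c' ->] := ef_mon E i; rewrite scalerA; exact: smooth_scale_mon.
have s0 : smooth 0 by have := smooth_scale_mon 0 0; rewrite scale0r.
have d0 j : D j 0 = 0.
  have := nctd_linear j 1 s0 s0; rewrite scaler0 addr0 scale1r => /esym/eqP.
  by rewrite -subr_eq0 addrK => /eqP.
have o0 w : orbit_deriv (ncta T) w 0 = 0.
  have [_ /(_ w)] := smoothZD 0 s0 s0; rewrite !scaler0 scale0r !add0r.
  have [_ /(_ w)] := smoothZD 1 s0 s0; rewrite !scaler0 scale1r addr0 => /esym/eqP.
  by rewrite -subr_eq0 addrK => /eqP.
have oU w c i : orbit_deriv (ncta T) w (c *: U i) = (ipow (q i) w * c) *: U i.
  rewrite -(fsum_single U i c) (fsum_smooth E _).2; last first.
    by apply: rapid_single => i'; exact: ef_ge1 E i'.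
  rewrite -[RHS]fsum_single; congr fsum; apply/funext => i'.
  by case: eqVneq => [->|_] //; rewrite mulr0.
rewrite /psum; elim: N => [|N [IH1 [IH2 IH3]]].
  by rewrite !big_ord0; split=> //; split=> [w|j]; rewrite big_ord0.
have sN : smooth (cseq (fun i => x i *: U i) N).
  by rewrite /cseq; case: pickle_inv => /= [i|]; [exact: sU|exact: s0].
have e : \sum_(k < N.+1) cseq (fun i => x i *: U i) k =
   1 *: \sum_(k < N) cseq (fun i => x i *: U i) k + cseq (fun i => x i *: U i) N.
  by rewrite big_ord_recr /= scale1r.
rewrite e; have [h1 h2] := smoothZD 1 IH1 sN; split=> //; split=> [w|j].
  rewrite h2 scale1r IH2 big_ord_recr /=; congr (_ + _).
  by rewrite /cseq; case: pickle_inv => /= [i|]; [exact: oU|exact: o0].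
rewrite nctd_linear // scale1r IH3 big_ord_recr /=; congr (_ + _).
by rewrite /cseq; case: pickle_inv => /= [i|]; [exact: nctd_U_family|exact: d0].
Qed.

Lemma smooth_cvg_psum (x : I -> R[i]) : rapid om x ->
  smooth_cvg (ncta T) (psum (fun i => x i *: U i) @ \oo) (fsum U x).
Proof.
move=> hx; have [h1 h2] := fsum_smooth E hx; split=> // w.
rewrite h2.
have : (fun N => orbit_deriv (ncta T) w (psum (fun i => x i *: U i) N)) @ \oo -->
    fsum U (fun i => ipow (q i) w * x i).
  under eq_fun do rewrite (smooth_psum x _).2.1.
  by apply: (fsum_cvg E); exact: (rapid_ipow E).
exact.
Qed.

Lemma rapid_kvec j (x : I -> R[i]) : rapid om x ->
  rapid om (fun i => (kvec (q i) 0 j)%:C%C * x i).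
Proof.
move=> hx; apply: (rapid_le E (rapid_ipow E [:: j] hx)) => i.
rewrite /ipow /freq big_seq1 expr1 !nrM.
have -> : nr 'i%C = 1 :> R.
  by rewrite /nr normc_def /= expr0n expr1n add0r sqrtr1.
by rewrite mul1r.
Qed.

(** The derivations are known on monomials and sequentially continuous for the Frechet topology, in
    which the partial sums converge by [smooth_cvg_psum]. *)
Lemma nctd_fsum j (x : I -> R[i]) : rapid om x ->
  D j (fsum U x) = fsum U (fun i => (kvec (q i) 0 j)%:C%C * x i).
Proof.
move=> hx.
have [_ /(_ [::])] := nctd_cont j (fun N => (smooth_psum x N).1) (smooth_cvg_psum hx).
rewrite !orbit_deriv0 => h1.
have h2 := fsum_cvg E (rapid_kvec j hx).
apply: (cvg_unique _ _ h2); first exact: norm_hausdorff.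
suff -> : psum (fun i => ((kvec (q i) 0 j)%:C%C * x i) *: U i) =
  (fun N => orbit_deriv (ncta T) [::] (D j (psum (fun i => x i *: U i) N))) by [].
by apply/funext => N; rewrite orbit_deriv0 (smooth_psum x N).2.2.
Qed.

Lemma mdelta_fsum (l : 'I_n -> nat) (x : I -> R[i]) : rapid om x ->
  mdelta (T := T) l (fsum U x) = fsum U (fun i => (freq (q i) (mword l))%:C%C * x i).
Proof.
move=> hx; rewrite /mdelta.
suff h w : foldr D (fsum U x) w = fsum U (fun i => (freq (q i) w)%:C%C * x i) /\
    rapid om (fun i => (freq (q i) w)%:C%C * x i) by exact: (h (mword l)).1.
elim: w => [|j w [IH hr]].
  have -> : (fun i => (freq (q i) [::])%:C%C * x i) = x.
    by apply/funext => i; rewrite /freq big_nil mul1r.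
  by [].
have e : (fun i => (freq (q i) (j :: w))%:C%C * x i) =
    (fun i => (kvec (q i) 0 j)%:C%C * ((freq (q i) w)%:C%C * x i)).
  by apply/funext => i; rewrite /freq big_cons rmorphM mulrA.
by rewrite e /= IH nctd_fsum //; split=> //; exact: rapid_kvec.
Qed.

End Family.
End Derivations.

(** * Symbols and their Fourier coefficients *)

Section FourierCoefficients.
Context {R : realType} {n : nat} {theta : 'M[R]_n} (T : ncTorus theta).
#[local] Opaque pderiv.
Implicit Types (a b : T) (k l : 'rV[int]_n).
Local Notation om := (fun k : 'rV[int]_n => pw (kvec (R := R) k)).

Lemma l2norm_bounded : exists2 C : R, 0 <= C & forall a, l2norm a <= C * nr a.
Proof.
have [C C0 hC] := linear_bounded (@nct_tau_cont _ _ _ T).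
exists (Num.sqrt C); first exact: sqrtr_ge0.
move=> a; rewrite -[nr a]ger0_norm ?nr_ge0 // -sqrtr_sqr -sqrtrM // /l2norm.
rewrite ler_wsqrtr //; apply: le_trans (ler_norm _) _.
by apply: le_trans (nr_Re _) _; rewrite -nr_starM hC.
Qed.

Lemma freq_mword k (l : 'I_n -> nat) :
  freq k (mword l) = \prod_(j < n) kvec (R := R) k 0 j ^+ l j.
Proof.
rewrite /freq /mword big_flatten big_map big_enum /=; apply: eq_bigr => j _.
by elim: (l j) => [|p IH]; rewrite ?big_nil ?expr0 //= big_cons IH exprS.
Qed.

Lemma nr_ipow k w (c : R[i]) : nr (ipow k w * c) = nr ((freq k w)%:C%C * c).
Proof.
rewrite /ipow !nrM nrX.
have -> : nr 'i%C = 1 :> R.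
  by rewrite /nr normc_def /= expr0n expr1n add0r sqrtr1.
by rewrite expr1n mul1r.
Qed.

Section Family.
Context {I : countType} {U : I -> T} {q : I -> 'rV[int]_n} {om : I -> R}.
Context (E : eigenfamily U q om).

(** The L^2 norm is at most a constant times the C^*-norm, which is at most the sum of the moduli of
    the coefficients; one summable power of the weight is spent on this sum. *)
Lemma csym_symbol m d : csym om m d -> symbol m (tsum U d).
Proof.
move=> hd; split; first exact: (Cinfty_smooth_tsum E hd).
move=> i j; have [C C0 hC] := l2norm_bounded.
have [p [b0 [K hK]]] := ef_sum E.
have [B B0 hB] := (csym_ipow E (mword i) hd).2 p (mword j).
exists (C * (B * K) * (1 + n%:R) `^ `|m - (mabs j)%:R|) => xi.
rewrite /mderiv (tsum_wderiv E _ hd) (mdelta_fsum E); last exact: (csym_rapid _ _ hd).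
apply: le_trans (hC _) _; rewrite -!mulrA ler_wpM2l //.
have K0 : 0 <= K by have := hK [::] isT; rewrite big_nil.
apply: (@le_trans _ _ (B * jb xi `^ (m - (mabs j)%:R) * K)); last first.
  by rewrite -mulrA ler_wpM2l // mulrC ler_wpM2l //; exact: (enorm_jb _ _).2.
apply: (@csum_norm _ _ _ _
    (fun i' => B * jb xi `^ (m - (mabs j)%:R) * (om i' ^+ p)^-1)).
  move=> i'; apply: le_trans (nr_U_le E _ _) _.
  rewrite -nr_ipow -(wderiv_ipow _ _ _ _ hd) ler_pdivlMr ?exprn_gt0 ?(om_gt0 E) //.
  by rewrite mulrC -size_mword; exact: hB.
move=> s us; rewrite -mulr_sumr ler_wpM2l ?mulr_ge0 ?powR_ge0 //; exact: hK.
Qed.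

End Family.

Lemma coef_fsum (x : 'rV[int]_n -> R[i]) l : rapid om x -> coef l (fsum (mon T) x) = x l.
Proof.
move=> hx; have [b hb xb] := rapid_bound (mon_family T) hx.
have h := @csum_morph _ _ _ R[i]^o (coef l : {additive T -> R[i]^o})
  (fun k => x k *: mon T k) b hb _ (@coef_continuous _ _ _ T l).
have {}h := h (fun k => le_trans (nr_U_le (mon_family T) _ _) (xb k)).
rewrite -(csum_unique h) (csum_single (i0 := l)) /=.
  by rewrite linearZ /= coef_mon eqxx mulr1.
by move=> k kl; rewrite linearZ /= coef_mon eq_sym (negbTE kl) mulr0.
Qed.

Lemma linear_eq0 (F : T -> R[i]) (C : R) :
  (forall c a b, F (c *: a + b) = c * F a + F b) ->
  (forall a, nr (F a) <= C * nr a) -> (forall k, F (mon T k) = 0) ->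
  forall a, F a = 0.
Proof.
move=> lF bF F0 a; apply: nr_eq0; apply/eqP; rewrite eq_le nr_ge0 andbT.
apply/ler_addgt0Pl => e e0; rewrite addr0.
have C1 : 0 < `|C| + 1 by rewrite ltr_wpDl.
have [|p [s ->] ap] := @mpoly_dense _ _ _ T a (e / (`|C| + 1)); first by rewrite divr_gt0.
have Fs : F (\sum_(p <- s) p.2 *: mon T p.1) = 0.
  elim: s {ap} => [|q s IH]; last by rewrite big_cons lF F0 IH mulr0 addr0.
  rewrite big_nil; have := lF 1 0 0; rewrite scaler0 addr0 mul1r => /esym/eqP.
  by rewrite -subr_eq0 addrK => /eqP.
have e1 : F a = F (a - \sum_(p <- s) p.2 *: mon T p.1).
  by rewrite addrC -scaleN1r lF Fs mulr0 add0r.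
rewrite e1; apply: le_trans (bF _) _.
apply: (@le_trans _ _ ((`|C| + 1) * nr (a - \sum_(p <- s) p.2 *: mon T p.1))).
  by rewrite ler_wpM2r ?nr_ge0 // (le_trans (ler_norm C)) // lerDl.
by move: ap; rewrite ltr_pdivlMr // mulrC => /ltW.
Qed.

Lemma coef_ncta k s a : coef k (ncta T s a) = coef k a * cexp (dotv s (kvec k)).
Proof.
have [C C0 hC] := coef_bounded T.
apply/eqP; rewrite -subr_eq0; apply/eqP.
apply: (@linear_eq0 (fun a => coef k (ncta T s a) - coef k a * cexp (dotv s (kvec k))) (C + C)).
- by move=> c b b'; rewrite !linearP /=; ring.
- move=> b; apply: le_trans (nrB _ _) _; rewrite nrM nr_cexp mulr1 mulrDl lerD //.
  apply: le_trans (hC _ _) _.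
  by have := ncta_norm s b; rewrite !nrE => /(@complexI R) ->.
- move=> l; rewrite ncta_mon linearZ /= coef_mon.
  by case: eqVneq => [->|_]; rewrite ?mulr0 ?mul0r ?subr0 // mulr1 mul1r subrr.
Qed.

Lemma coef_wderiv m (f : 'rV[R]_m -> T) k : Cinfty f ->
  Cinfty (fun x => coef k (f x) : R[i]^o) /\
  forall w, wderiv w (fun x => coef k (f x) : R[i]^o) = fun x => coef k (wderiv w f x).
Proof.
move=> hf.
have cZ (r : R) a : coef k (r%:C%C *: a) = r%:C%C *: (coef k a : R[i]^o) by rewrite linearZ.
split.
  exact: (@Cinfty_comp _ _ _ R[i]^o (coef k : {additive T -> R[i]^o}) f cZ (@coef_continuous _ _ _ T k) hf).
exact: (@wderiv_comp _ _ _ R[i]^o (coef k : {additive T -> R[i]^o}) f cZ (@coef_continuous _ _ _ T k)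
  (fun w => (hf w).2)).
Qed.

Lemma coef_orbit_deriv k w a : smooth_vec (ncta T) a ->
  coef k (orbit_deriv (ncta T) w a) = ipow k w * coef k a.
Proof.
move=> sa; have := (coef_wderiv k sa).2 w => /(congr1 (fun f => f 0)) <-.
rewrite (_ : (fun s => _) = fun s => coef k a * cexp (dotv s (kvec k)) : R[i]^o).
  rewrite (Cinfty_cexp _ _).2 (_ : dotv _ _ = 0) ?cexp0 ?mulr1 //.
  by rewrite /dotv big1 // => j _; rewrite mxE mul0r.
by apply/funext => s; exact: coef_ncta.
Qed.

(** The coefficients of an iterated derivative of the orbit are those of [a] times monomials in k,
    and coefficients are bounded by the norm; all moments are thus bounded. *)
Lemma smooth_rapid a : smooth_vec (ncta T) a -> rapid om (fun k => coef k a).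
Proof.
move=> sa p; have [C C0 hC] := coef_bounded T.
have [|D hD] := @moments_pw R n _ (fun k => kvec k) (fun k => nr (coef k a)) (fun k => nr_ge0 _) _ p.
  move=> l; exists (C * nr (orbit_deriv (ncta T) (mword l) a)) => k.
  rewrite -freq_mword -nr_real -nrM -nr_ipow -coef_orbit_deriv //; exact: hC.
exists `|D| => // k; apply: le_trans (hD k) (ler_norm _).
Qed.

Context (n_gt0 : (0 < n)%N).

Lemma smooth_fsum a : smooth_vec (ncta T) a -> a = fsum (mon T) (fun k => coef k a).
Proof.
move=> sa; apply: (coef_inj n_gt0) => k.
by rewrite coef_fsum //; exact: smooth_rapid.
Qed.

Lemma coef_mdelta k (l : 'I_n -> nat) a : smooth_vec (ncta T) a ->
  coef k (mdelta l a) = (freq k (mword l))%:C%C * coef k a.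
Proof.
move=> sa; have ra := smooth_rapid sa.
rewrite {1}(smooth_fsum sa) (mdelta_fsum (mon_family T)) // coef_fsum //.
apply: (rapid_le (mon_family T) (rapid_ipow (mon_family T) (mword l) ra)) => i.
by rewrite nr_ipow.
Qed.

Lemma Cinfty_smooth_Cinfty (rho : 'rV[R]_n -> T) :
  Cinfty_smooth (ncta T) rho -> Cinfty rho.
Proof.
move=> [_ h] w; have [_ [h1 h2]] := h w; split=> [x|j x].
  have [_ /(_ [::])] := h1 x; rewrite orbit_deriv0 => h3.
  have e : wderiv w rho = orbit_deriv (ncta T) [::] \o wderiv w rho.
    by apply/funext => y /=; rewrite orbit_deriv0.
  by rewrite /continuous_at {1}e.
have [_ /(_ [::])] := h2 j x; rewrite orbit_deriv0 => h3.
have e : dquot (wderiv w rho) j x = orbit_deriv (ncta T) [::] \o dquot (wderiv w rho) j x.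
  by apply/funext => y /=; rewrite orbit_deriv0.
by rewrite {1}e.
Qed.

(** Applying derivations to [rho] multiplies the k-th coefficient by a monomial in k, and the L^2
    norm bounds each coefficient. After division by the expected power of [jb], these are moment
    bounds over all pairs (k, xi), to which [moments_pw] applies uniformly. *)
Lemma symbol_csym m (rho : 'rV[R]_n -> T) : symbol m rho ->
  csym om m (fun k xi => coef k (rho xi)) /\
  rho = tsum (mon T) (fun k xi => coef k (rho xi)).
Proof.
move=> [sm h]; have ci := Cinfty_smooth_Cinfty sm.
split; last by apply/funext => xi; exact: smooth_fsum (sm.1 xi).
split=> [k|p w]; first exact: (coef_wderiv k ci).1.
pose j i : nat := count_mem i w.
have jw : perm_eq w (mword j).
  by apply/allP => i _ /=; rewrite count_mword.
have sj : size w = mabs j by rewrite (perm_size jw) size_mword.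
pose W (xi : 'rV[R]_n) := jb xi `^ (m - (mabs j)%:R).
have W0 xi : 0 < W xi by rewrite powR_gt0 ?jb_gt0.
pose u (z : 'rV[int]_n * 'rV[R]_n) := nr (coef z.1 (mderiv j rho z.2)) / W z.2.
have u0 z : 0 <= u z by rewrite divr_ge0 ?nr_ge0 // ltW.
have mom (l : 'I_n -> nat) : exists C, forall z : 'rV[int]_n * 'rV[R]_n,
    `|\prod_(i < n) kvec z.1 0 i ^+ l i| * u z <= C.
  have [C hC] := h l j.
  exists (`|C| * (1 + n%:R) `^ `|m - (mabs j)%:R|) => -[k xi] /=.
  rewrite /u /= -freq_mword mulrA ler_pdivrMr //.
  have -> : `|freq k (mword l)| * nr (coef k (mderiv j rho xi)) =
      nr ((freq k (mword l))%:C%C * coef k (mderiv j rho xi)) by rewrite nrM nr_real.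
  rewrite -coef_mdelta; last exact: ((sm.2 (mword j)).1 xi).
  apply: le_trans (nr_coef_le_l2norm _ _) _; apply: le_trans (hC xi) _.
  rewrite -mulrA; apply: (@le_trans _ _ (`|C| * (1 + enorm xi) `^ (m - (mabs j)%:R))).
    by rewrite ler_wpM2r ?powR_ge0 ?ler_norm.
  by rewrite ler_wpM2l //; exact: (enorm_jb _ _).1.
have [D hD] := moments_pw u0 mom p.
exists `|D| => // k xi; rewrite (wderiv_perm (coef_wderiv k ci).1 jw) (coef_wderiv k ci).2.
have := hD (k, xi); rewrite /u /= mulrA ler_pdivrMr // sj => /le_trans; apply.
by rewrite ler_wpM2r ?powR_ge0 ?ler_norm.
Qed.

End FourierCoefficients.

(** * Integration over R^m *)

Section LebesgueSpace.
Context {R : realType}.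
Local Notation TT := (measurableTypeR R).

(** A name for [lebesgueRm] to which the measure and sigma-finiteness structures are attached. *)
Definition lebR m : set (m.-tuple TT) -> \bar R := lebesgueRm R m.

HB.instance Definition _ m := Measure.on (@lebR m).

Definition tbox m (i : nat) : set (m.-tuple TT) :=
  [set t | forall j, tnth t j \in `[- i%:R : R, i%:R]].

Lemma measurable_tbox m i : measurable (@tbox m i).
Proof.
have -> : @tbox m i = \bigcap_(j : 'I_m) ((@tnth m TT ^~ j) @^-1` `[- i%:R : R, i%:R]%classic).
  by apply/seteqP; split => [t h j _ /=|t h j]; [exact: h|exact: (h j I)].
apply: fin_bigcap_measurable => //= j _.
by rewrite -[X in measurable X]setTI; apply: measurable_tnth => //.
Qed.

Lemma preimage_tcons_tbox m i :
  @tcons R m @^-1` (@tbox m.+1 i) = `[- i%:R : R, i%:R]%classic `*` @tbox m i.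
Proof.
apply/seteqP; split => [[x t] h|[x t] [h1 h2] j].
  split => /=; first by have := h ord0; rewrite /= /tnth /=.
  by move=> j; have := h (lift ord0 j); rewrite tnthS.
case: (unliftP ord0 j) => [k ->|->]; first by rewrite tnthS; exact: h2.
by rewrite /tnth /=.
Qed.

Lemma lebR_tbox m i : (lebR (@tbox m i) < +oo)%E.
Proof.
elim: m i => [|m IH] i.
  by rewrite /lebR /= diracE; case: (_ \in _) => //=; rewrite ltry.
have -> : lebR (@tbox m.+1 i) =
   (lebesgue_measure \x^ lebesgueRm R m)%E (@tcons R m @^-1` (@tbox m.+1 i)) by [].
rewrite preimage_tcons_tbox product_measure2E //; last exact: measurable_tbox.
rewrite lte_mul_pinfty //.
  by rewrite -[X in X \is a fin_num]/(lebesgue_measure `[- i%:R : R, i%:R]%classic) lebesgue_measure_itv /=; case: ifP.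
exact: IH.
Qed.

Lemma lebR_sigma_finite m : sigma_finite setT (@lebR m).
Proof.
exists (fun i => @tbox m i); last by move=> i; split; [exact: measurable_tbox|exact: lebR_tbox].
apply/esym/seteqP; split => // t _.
have [N HN] : exists N : nat, forall j : 'I_m, `|(tnth t j : R)| <= N%:R.
  exists (\sum_(j < m) Num.bound `|tnth t j : R|)%N => j.
  apply: (@le_trans _ _ (Num.bound `|tnth t j : R|)%:R); first exact/ltW/archi_boundP.
  by rewrite ler_nat (bigD1 j) //= leq_addr.
by exists N => // j; rewrite in_itv /= -ler_norml.
Qed.

HB.instance Definition _ m :=
  Measure_isSigmaFinite.Build _ _ _ (@lebR m) (@lebR_sigma_finite m).

Lemma rot_tcons m (x : TT) (t : m.-tuple TT) :
  row_of_tuple (tcons (x, t)) = row_mx (x%:M : 'rV[R]_1) (row_of_tuple t) :> 'rV[R]_(1 + m).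
Proof.
apply/rowP => j; rewrite !mxE; case: splitP => k hk.
  by rewrite (_ : j = ord0) ?mxE ?(ord1 k) ?eqxx //; apply/val_inj; rewrite /= hk (ord1 k).
have -> : j = lift ord0 k by apply/val_inj; rewrite /= hk.
by rewrite mxE tnthS.
Qed.

(* The function is the limit of its values at the points of finer and finer
   lattices. *)
Lemma measurable_cont m (f : 'rV[R]_m -> R) : continuous f ->
  measurable_fun setT (fun t : m.-tuple TT => f (row_of_tuple t)).
Proof.
move=> cf.
pose fl (K : nat) (t : m.-tuple TT) : 'rV[int]_m :=
  \row_j Num.floor (K.+1%:R * (tnth t j : R)).
pose fk (K : nat) (t : m.-tuple TT) : R := f (K.+1%:R^-1 *: map_mx intr (fl K t)).
apply: (@measurable_fun_cvg _ _ _ _ fk) => //.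
  move=> K _ Y mY; rewrite setTI.
  have -> : fk K @^-1` Y = \bigcup_(z in [set z : 'rV[int]_m | Y (f (K.+1%:R^-1 *: map_mx intr z))])
     [set t | fl K t = z].
    by apply/seteqP; split => [t h|t [z h zE]]; [exists (fl K t)|move: h; rewrite /= -zE].
  rewrite bigcup_mkcond; apply: countable_bigcupT_measurable.
    exact: countableP.
  move=> z; case: ifP => // _.
  have -> : [set t | fl K t = z] = \bigcap_(j : 'I_m)
      ((@tnth m TT ^~ j) @^-1` `[(z 0 j)%:~R / K.+1%:R : R, (z 0 j + 1)%:~R / K.+1%:R[%classic).
    apply/seteqP; split => [t <- j _ /=|t h].
      rewrite mxE in_itv /= ler_pdivrMr ?ltr_pdivlMr ?ltr0n // mulrC.
      by rewrite floor_itv.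
    apply/rowP => j; rewrite mxE; apply: floor_def.
    have := h j I; rewrite /= in_itv /= ler_pdivrMr ?ltr_pdivlMr ?ltr0n // mulrC.
    by [].
  apply: fin_bigcap_measurable => //= j _.
  by rewrite -[X in measurable X]setTI; apply: measurable_tnth.
move=> t _; rewrite /fk; apply: (@cvg_comp _ _ _ _ _ _ (nbhs (row_of_tuple t))); last exact: cf.
apply/cvg_ballP => e e0; near=> K.
split => [//|i j]; rewrite !mxE /ball /=.
have K0 : 0 < K.+1%:R :> R by rewrite ltr0n.
have := floor_itv (K.+1%:R * (tnth t j : R)); rewrite intrD1 => /andP[h1 h2].
rewrite -(ltr_pM2l K0) -[X in X * `|_|](gtr0_norm K0) -normrM mulrBr mulrA divff ?gt_eqF // mul1r.
rewrite ger0_norm ?subr_ge0 //; apply: (@le_lt_trans _ _ 1); first by rewrite lerBlDl ltW.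
rewrite -ltr_pdivrMl // mulr1; near: K; exact: near_infty_natSinv_lt (PosNum e0).
Unshelve. all: by end_near.
Qed.

Lemma ge0_int_S m (f : m.+1.-tuple TT -> \bar R) :
  measurable_fun setT f -> (forall t, 0 <= f t)%E ->
  (\int[@lebR m.+1]_t f t =
   \int[@lebesgue_measure R]_x \int[@lebR m]_t f (tcons (x, t)))%E.
Proof.
move=> mf f0.
have mtc := @measurable_tcons R m.
have -> : (\int[@lebR m.+1]_t f t =
   \int[pushforward (lebesgue_measure \x^ @lebR m) (@tcons R m)]_t f t)%E by [].
rewrite ge0_integral_pushforward // preimage_setT.
have h := fubini_tonelli1 (m1 := @lebesgue_measure R) (m2 := @lebR m) (f \o @tcons R m).
rewrite /fubini_F /= in h; rewrite -h //; last exact: measurableT_comp.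
(* [lebesgueS] is built on the product [\x^], whereas Tonelli's theorem concerns [\x]; the two agree
   on rectangles, hence everywhere. *)
apply: eq_measure_integral => A mA _.
apply/esym/(product_measure_unique (m' := (lebesgue_measure \x^ @lebR m)%E)) => // B C mB mC.
exact: product_measure2E.
Qed.

End LebesgueSpace.

Section NiceReal.
Context {R : realType}.
Local Notation TT := (measurableTypeR R).

Lemma int_cauchy : (\int[@lebesgue_measure R]_x ((1 + x ^+ 2)^-1)%:E = (pi : R)%:E)%E.
Proof.
have p0 (x : R) : 0 < 1 + x ^+ 2 by rewrite ltr_pwDl // sqr_ge0.
have cf : continuous (fun x : R => (1 + x ^+ 2)^-1).
  move=> x; apply: cvgV; first by rewrite gt_eqF.
  by apply: cvgD; [exact: cvg_cst|exact: exprn_continuous].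
rewrite ge0_symfun_integralT //; first last.
- by move=> x /=; rewrite sqrrN.
- by move=> x; rewrite invr_ge0 ltW.
have -> : [set x : R | 0 <= x] = `[0, +oo[%classic by apply/seteqP; split => x /=; rewrite in_itv /= andbT.
rewrite (@ge0_continuous_FTC2y R _ (@atan R) 0 (pi / 2)).
- by rewrite atan0 sube0 -EFinM mulrC divfK.
- by move=> x _; rewrite invr_ge0 ltW.
- exact: continuous_subspaceT.
- exact: cvgy_atan.
- by move=> x _; exact: derivable_atan.
- by apply: cvg_at_right_filter; exact: continuous_atan.
- by move=> x _; rewrite derive1_atan.
Qed.

Definition pwinv m (x : 'rV[R]_m) : R := (pw x)^-1.

Lemma pw_gt0 m (x : 'rV[R]_m) : 0 < pw x.
Proof. exact: lt_le_trans (pw_ge1 x). Qed.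

Lemma pw_continuous m : continuous (@pw R m).
Proof.
move=> x; rewrite /pw; apply: cvg_big => //; [exact: mul_continuous|exact: nbhs_filter|].
move=> j _; apply: (cvgD (FF := nbhs_filter x)); first exact: cvg_cst.
apply: (@cvg_comp _ _ _ (fun y : 'rV[R]_m => y 0 j) (fun a : R => a ^+ 2) (nbhs x) (nbhs (x 0 j))).
  exact: coord_continuous.
exact: exprn_continuous.
Qed.

Lemma pwinv_continuous m : continuous (@pwinv m).
Proof. by move=> x; apply: (cvgV (FF := nbhs_filter x)); [rewrite gt_eqF // pw_gt0|exact: pw_continuous]. Qed.

Lemma pwinv_ge0 m (x : 'rV[R]_m) : 0 <= pwinv x.
Proof. by rewrite invr_ge0 ltW // pw_gt0. Qed.

Lemma pw_tcons m (x : TT) (t : m.-tuple TT) :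
  pw (row_of_tuple (tcons (x, t))) = (1 + (x : R) ^+ 2) * pw (row_of_tuple t).
Proof.
rewrite /pw big_ord_recl; congr (_ * _); first by rewrite mxE.
by apply: eq_bigr => j _; rewrite !mxE tnthS.
Qed.

Lemma int_pwinv m : (\int[@lebR R m]_t (pwinv (row_of_tuple t))%:E = (pi ^+ m : R)%:E)%E.
Proof.
elim: m => [|m IH].
  rewrite expr0 /lebR /= integral_dirac //; last first.
    by apply/measurable_EFinP; apply: measurable_cont; exact: pwinv_continuous.
  rewrite diracT mul1e /pwinv /pw big_ord0 invr1 //.
rewrite ge0_int_S; last 2 first.
- by apply/measurable_EFinP; apply: measurable_cont; exact: pwinv_continuous.
- by move=> t; rewrite lee_fin pwinv_ge0.
under eq_integral => x _.
  under eq_integral => t _ do rewrite /pwinv pw_tcons invfM EFinM.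
  rewrite ge0_integralZl //; last 3 first.
  - by apply/measurable_EFinP; apply: (@measurable_cont _ m (@pwinv m)); exact: pwinv_continuous.
  - by move=> t _; rewrite lee_fin (pwinv_ge0 (row_of_tuple t)).
  - by rewrite lee_fin invr_ge0 addr_ge0 // sqr_ge0.
  rewrite -[X in (_ * X)%E]/(\int[@lebR R m]_t (pwinv (row_of_tuple t))%:E)%E IH; over.
rewrite /= ge0_integralZr //; last 3 first.
- apply/measurable_EFinP; apply: continuous_measurable_fun => x.
  apply: cvgV; first by rewrite gt_eqF // ltr_pwDl // sqr_ge0.
  by apply: cvgD; [exact: cvg_cst|exact: exprn_continuous].
- by move=> t _; rewrite lee_fin invr_ge0 addr_ge0 // sqr_ge0.
- by rewrite lee_fin exprn_ge0 // pi_ge0.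
by rewrite int_cauchy -EFinM exprS.
Qed.

(** Continuous functions dominated by a multiple of [pwinv]. The class is stable under slicing,
    partial integration and affine substitution, and measurability and integrability are automatic,
    so Fubini and changes of variables carry no side conditions. *)
Definition rnice m (f : 'rV[R]_m -> R) : Prop :=
  continuous f /\ exists C, forall x, `|f x| <= C * pwinv x.

Lemma integrable_pwinv m C :
  (@lebR R m).-integrable setT (EFin \o (fun t => C * pwinv (row_of_tuple t))).
Proof.
rewrite -[EFin \o _]/(fun t => (C%:E * (pwinv (row_of_tuple t))%:E)%E).
apply: integrableZl => //; apply/integrableP; split.
  by apply/measurable_EFinP; apply: measurable_cont; exact: pwinv_continuous.
under eq_integral do rewrite gee0_abs ?lee_fin ?pwinv_ge0 //.
by rewrite int_pwinv ltry.
Qed.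

Lemma rnice_integrable m (f : 'rV[R]_m -> R) : rnice f ->
  (@lebR R m).-integrable setT (EFin \o (fun t => f (row_of_tuple t))).
Proof.
move=> [cf [C hC]]; apply: (le_integrable _ _ _ (integrable_pwinv m C)) => //.
  by apply/measurable_EFinP; exact: measurable_cont.
by move=> t _ /=; rewrite lee_fin (le_trans (hC _)) // ler_norm.
Qed.

Definition rint m (f : 'rV[R]_m -> R) : R :=
  (\int[@lebR R m]_t f (row_of_tuple t))%R.

Lemma rint_pwinv m : rint (@pwinv m) = pi ^+ m.
Proof. by rewrite /rint /Rintegral int_pwinv. Qed.

Lemma rniceD m (f g : 'rV[R]_m -> R) : rnice f -> rnice g -> rnice (fun x => f x + g x).
Proof.
move=> [cf [C hC]] [cg [D hD]]; split.
  by move=> x; apply: (cvgD (FF := nbhs_filter x)); [exact: cf|exact: cg].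
by exists (C + D) => x; rewrite mulrDl (le_trans (ler_normD _ _)) // lerD.
Qed.

Lemma rniceZ m (f : 'rV[R]_m -> R) c : rnice f -> rnice (fun x => c * f x).
Proof.
move=> [cf [C hC]]; split.
  by move=> x; apply: (cvgM (FF := nbhs_filter x)); [exact: cvg_cst|exact: cf].
by exists (`|c| * C) => x; rewrite normrM -mulrA ler_wpM2l.
Qed.

Lemma rnice_pwinv m : rnice (@pwinv m).
Proof.
split; first exact: pwinv_continuous.
by exists 1 => x; rewrite mul1r ger0_norm // pwinv_ge0.
Qed.

Lemma rintD m (f g : 'rV[R]_m -> R) : rnice f -> rnice g ->
  rint (fun x => f x + g x) = rint f + rint g.
Proof. by move=> nf ng; rewrite /rint RintegralD //; exact: rnice_integrable. Qed.

Lemma rintZ m (f : 'rV[R]_m -> R) c : rnice f -> rint (fun x => c * f x) = c * rint f.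
Proof. by move=> nf; rewrite /rint RintegralZl //; exact: rnice_integrable. Qed.

Lemma rint_le m (f g : 'rV[R]_m -> R) : rnice f -> rnice g ->
  (forall x, f x <= g x) -> rint f <= rint g.
Proof. by move=> nf ng h; apply: le_Rintegral => //; exact: rnice_integrable. Qed.

Lemma rint_bound m (f : 'rV[R]_m -> R) C : rnice f ->
  (forall x, `|f x| <= C * pwinv x) -> `|rint f| <= C * pi ^+ m.
Proof.
move=> nf hC; rewrite -rint_pwinv -rintZ; last exact: rnice_pwinv.
have nC := rniceZ C (rnice_pwinv m).
rewrite ler_norml; apply/andP; split.
  rewrite -mulN1r -rintZ //; apply: rint_le => //; first exact: rniceZ.
  by move=> x; rewrite mulN1r lerNl (le_trans _ (hC x)) // -normrN ler_norm.
by apply: rint_le => // x; apply: le_trans (hC x); rewrite ler_norm.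
Qed.

Lemma rint_cvg m (f_ : nat -> 'rV[R]_m -> R) f C :
  (forall k, continuous (f_ k)) -> continuous f ->
  (forall k x, `|f_ k x| <= C * pwinv x) ->
  (forall x, f_ ^~ x @ \oo --> f x) ->
  (fun k => rint (f_ k)) @ \oo --> rint f.
Proof.
move=> cf_ cf hC h.
have nf : rnice f.
  split => //; exists C => x; apply: (@closed_cvg _ _ _ eventually_filter (fun k => `|f_ k x|) (fun y => y <= C * pwinv x)).
  - exact: closed_le.
  - by apply: nearW => k; exact: hC.
  - by apply: cvg_norm; exact: h.
have [] := @dominated_convergence _ _ R (@lebR R m) setT measurableT
  (fun k t => (f_ k (row_of_tuple t))%:E) (fun t => (f (row_of_tuple t))%:E)
  (fun t => (C * pwinv (row_of_tuple t))%:E).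
- by move=> k; apply/measurable_EFinP; exact: measurable_cont.
- by apply/measurable_EFinP; exact: measurable_cont.
- by apply: aeW => t _; apply: cvg_EFin; [exact: nearW|exact: h].
- exact: integrable_pwinv.
- by apply: aeW => t k _; rewrite lee_fin; exact: hC.
move=> _ _ H; rewrite /rint /Rintegral.
have fin : ((\int[@lebR R m]_t (f (row_of_tuple t))%:E) \is a fin_num)%E.
  by apply: integrable_fin_num => //; exact: rnice_integrable.
by apply: fine_cvg; rewrite fineK.
Qed.

End NiceReal.

Section SeqFilter.
Context {T : Type} {U : topologicalType}.

(** Dominated convergence is a statement on sequences; for a filter with a countable decreasing
    base, a failure of convergence yields a sequence of counterexamples, one in each member of the
    base. *)
Lemma cvg_from_seq (F : set_system T) {FF : Filter F} (B : nat -> set T) (f : T -> U) (l : U) :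
  (forall k, F (B k)) -> (forall k j, (k <= j)%N -> B j `<=` B k) ->
  (forall A, F A -> exists k, B k `<=` A) ->
  (forall u : nat -> T, (forall k, B k (u k)) -> f \o u @ \oo --> l) ->
  f @ F --> l.
Proof.
move=> FB Bd base H A nA; apply: contrapT => nF.
have {nF} h k : exists t, B k t /\ ~ A (f t).
  apply: contrapT => hk; apply: nF; apply: (@filterS _ F _ (B k)) => // t Bt.
  by apply: contrapT => nAt; apply: hk; exists t.
have [u hu] := choice h.
have [N _ HN] := H u (fun k => (hu k).1) A nA.
by have /= := HN N (leqnn N); exact: (hu N).2.
Qed.

End SeqFilter.

Section Fubini.
Context {R : realType}.
Local Notation TT := (measurableTypeR R).

Lemma rint_cvgF (T : Type) (F : set_system T) {FF : Filter F} (B : nat -> set T) m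
   (G : T -> 'rV[R]_m -> R) (g : 'rV[R]_m -> R) C :
  (forall k, F (B k)) -> (forall k j, (k <= j)%N -> B j `<=` B k) ->
  (forall A, F A -> exists k, B k `<=` A) ->
  (forall t, B 0%N t -> continuous (G t)) -> continuous g ->
  (forall t x, B 0%N t -> `|G t x| <= C * pwinv x) ->
  (forall x, G ^~ x @ F --> g x) ->
  (fun t => rint (G t)) @ F --> rint g.
Proof.
move=> FB Bd base cG cg hC h; apply: (cvg_from_seq (B := B)) => // u hu.
apply: (@rint_cvg R m (G \o u) g C) => //.
- by move=> k; apply: cG; apply: Bd (hu k).
- by move=> k x; apply: hC; apply: Bd (hu k).
move=> x; apply: cvg_comp (h x) => A FA.
have [k kA] := base A FA; exists k => // j /= kj; apply: kA.
exact: Bd (hu j).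
Qed.

Lemma rV_base m (x : 'rV[R]_m) (A : set 'rV[R]_m) : nbhs x A ->
  exists k, ball x (k.+1%:R^-1 : R) `<=` A.
Proof.
move=> /nbhs_ballP[e /= e0 he].
have [N _ HN] := near_infty_natSinv_lt (PosNum e0).
exists N => y hy; apply: he; apply: le_ball hy; apply/ltW; exact: (HN N (leqnn N)).
Qed.

Lemma rint_continuous k m (G : 'rV[R]_k -> 'rV[R]_m -> R) C :
  (forall x, continuous (G x)) -> (forall y, continuous (G ^~ y)) ->
  (forall x y, `|G x y| <= C * pwinv y) -> continuous (fun x => rint (G x)).
Proof.
move=> c1 c2 hC x.
apply: (@rint_cvgF _ (nbhs x) (nbhs_filter x) (fun k => ball x (k.+1%:R^-1 : R)) _ G (G x) C) => //.
- by move=> j; apply/nbhs_ballP; exists (j.+1%:R^-1) => //=; rewrite invr_gt0.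
- move=> i j ij; apply: le_ball; rewrite lef_pV2 ?posrE ?ltr0n //.
  by rewrite ler_nat.
- exact: rV_base.
- by move=> y; exact: c2.
Qed.

Lemma pw_row_mx k m (x : 'rV[R]_k) (y : 'rV[R]_m) : pw (row_mx x y) = pw x * pw y.
Proof.
rewrite /pw big_split_ord /=; congr (_ * _); apply: eq_bigr => j _.
  by rewrite row_mxEl.
by rewrite row_mxEr.
Qed.

Lemma pwinv_row_mx k m (x : 'rV[R]_k) (y : 'rV[R]_m) :
  pwinv (row_mx x y) = pwinv x * pwinv y.
Proof. by rewrite /pwinv pw_row_mx invfM. Qed.

Lemma row_mx_continuousl k m (y : 'rV[R]_m) : continuous (fun x : 'rV[R]_k => row_mx x y).
Proof.
move=> x A /nbhs_ballP[e /= e0 hA]; apply/nbhs_ballP; exists e => //= z [_ hz].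
apply: hA; split => // i j; rewrite !mxE.
by case: splitP => l _; [exact: hz|exact: ballxx].
Qed.

Lemma row_mx_continuousr k m (x : 'rV[R]_k) : continuous (fun y : 'rV[R]_m => row_mx x y).
Proof.
move=> y A /nbhs_ballP[e /= e0 hA]; apply/nbhs_ballP; exists e => //= z [_ hz].
apply: hA; split => // i j; rewrite !mxE.
by case: splitP => l _; [exact: ballxx|exact: hz].
Qed.

Lemma rnice_slice k m (f : 'rV[R]_(k + m) -> R) x : rnice f -> rnice (fun y => f (row_mx x y)).
Proof.
move=> [cf [C hC]]; split.
  by move=> y; apply: (@cvg_comp _ _ _ (row_mx x) f (nbhs y) (nbhs (row_mx x y))); [exact: row_mx_continuousr|exact: cf].
by exists (C * pwinv x) => y; rewrite -mulrA -pwinv_row_mx.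
Qed.

Lemma pwinv_le1 m (x : 'rV[R]_m) : pwinv x <= 1.
Proof. by rewrite invf_le1 ?pw_ge1 ?pw_gt0. Qed.

Lemma rnice_rint k m (f : 'rV[R]_(k + m) -> R) : rnice f ->
  rnice (fun x => rint (fun y => f (row_mx x y))).
Proof.
move=> nf; have [cf [C hC]] := nf.
have C0 : 0 <= C.
  have := le_trans (normr_ge0 _) (hC 0); rewrite pmulr_lge0 // /pwinv invr_gt0; exact: pw_gt0.
split.
  apply: (@rint_continuous k m (fun x y => f (row_mx x y)) C).
  - by move=> x; have [] := rnice_slice x nf.
  - by move=> y x; apply: (@cvg_comp _ _ _ (fun z : 'rV[R]_k => row_mx z y) f (nbhs x) (nbhs (row_mx x y))); [exact: row_mx_continuousl|exact: cf].
  - move=> x y; apply: (le_trans (hC _)); rewrite pwinv_row_mx ler_wpM2l //.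
    by rewrite ler_piMl ?pwinv_ge0 ?pwinv_le1.
exists (C * pi ^+ m) => x; rewrite mulrAC; apply: rint_bound; first exact: rnice_slice.
by move=> y; rewrite -mulrA -pwinv_row_mx.
Qed.

Lemma rint_ge0_S m (f : 'rV[R]_(1 + m) -> R) : rnice f -> (forall x, 0 <= f x) ->
  ((rint f)%:E = \int[@lebesgue_measure R]_x (rint (fun y => f (row_mx x%:M y)))%:E)%E.
Proof.
move=> nf f0.
have fin k (g : 'rV[R]_k -> R) : rnice g -> ((rint g)%:E = \int[@lebR R k]_t (g (row_of_tuple t))%:E)%E.
  move=> ng; rewrite /rint /Rintegral fineK //; apply: integrable_fin_num => //.
  exact: rnice_integrable.
rewrite fin // (@ge0_int_S _ m (fun t => (f (row_of_tuple t))%:E)).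
- apply: eq_integral => x _; rewrite fin; last exact: rnice_slice.
  by apply: eq_integral => t _; rewrite rot_tcons.
- by apply/measurable_EFinP; apply: measurable_cont; case: nf.
- by move=> t; rewrite lee_fin.
Qed.

Lemma rint0 (f : 'rV[R]_0 -> R) : rint f = f 0.
Proof.
have -> : f = (fun x => f 0 * pwinv x).
  by apply/funext => x; rewrite /pwinv /pw big_ord0 invr1 mulr1; congr f; apply/rowP; case.
rewrite rintZ; last exact: rnice_pwinv.
by rewrite rint_pwinv expr0 mulr1 /pwinv /pw big_ord0 invr1 mulr1.
Qed.

Lemma rint_ge0_1 (f : 'rV[R]_1 -> R) : rnice f -> (forall x, 0 <= f x) ->
  ((rint f)%:E = \int[@lebesgue_measure R]_x (f x%:M)%:E)%E.
Proof.
move=> nf f0; rewrite (@rint_ge0_S 0 f) //; apply: eq_integral => x _.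
rewrite rint0; congr (f _)%:E; apply/rowP => j; rewrite (ord1 j).
have := row_mxEl (x%:M : 'rV[R]_1) (0 : 'rV[R]_0) 0 0.
by rewrite (_ : lshift 0 0 = 0) //; apply/val_inj.
Qed.

(** Tonelli's theorem covers nonnegative functions; adding a multiple of [pwinv] that dominates [f]
    reduces the general case to two nonnegative ones. [rint_aff1] uses the same device. *)
Lemma rint_split1 m (f : 'rV[R]_(1 + m) -> R) : rnice f ->
  rint f = rint (fun x : 'rV[R]_1 => rint (fun y => f (row_mx x y))).
Proof.
have ge0 g : rnice g -> (forall x, 0 <= g x) ->
    rint g = rint (fun x : 'rV[R]_1 => rint (fun y : 'rV[R]_m => g (row_mx x y))).
  move=> ng g0; apply: EFin_inj; rewrite rint_ge0_S // rint_ge0_1 //.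
    exact: rnice_rint.
  by move=> x; apply: Rintegral_ge0.
move=> nf; have [_ [C hC]] := nf.
have nC := rniceZ C (@rnice_pwinv R (1 + m)).
have ng := rniceD nf nC.
have C0 (x : 'rV[R]_(1 + m)) : 0 <= C * pwinv x by exact: le_trans (normr_ge0 _) (hC x).
have := ge0 _ ng; rewrite rintD //.
have -> : (fun x : 'rV[R]_1 => rint (fun y : 'rV[R]_m => f (row_mx x y) + C * pwinv (row_mx x y)))
   = (fun x => rint (fun y => f (row_mx x y)) + rint (fun y : 'rV[R]_m => C * pwinv (row_mx x y))).
  by apply/funext => x; rewrite rintD //; [exact: rnice_slice|exact: (rnice_slice x nC)].
rewrite rintD; [|exact: rnice_rint|exact: (rnice_rint nC)].
rewrite -(ge0 _ nC C0) => /(_ _)/addIr -> // x.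
by have := hC x; rewrite ler_norml => /andP[h _]; lra.
Qed.

Lemma rint_split k m (f : 'rV[R]_(k + m) -> R) : rnice f ->
  rint f = rint (fun x : 'rV[R]_k => rint (fun y => f (row_mx x y))).
Proof.
elim: k f => [|k IH] f nf.
  rewrite rint0; congr (rint _); apply/funext => y; congr f.
  apply/rowP => j; have -> : j = rshift 0 j by apply/val_inj.
  by rewrite row_mxEr; congr (y 0 _); apply/val_inj.
rewrite (@rint_split1 (k + m) f) // (@rint_split1 k (fun x => rint (fun y => f (row_mx x y)))); last first.
  exact: (@rnice_rint (1 + k) m).
congr (rint _); apply/funext => a.
rewrite IH; last exact: (@rnice_slice 1 (k + m) f a nf).
congr (rint _); apply/funext => x; congr (rint _); apply/funext => y; congr f.
by rewrite row_mxA (_ : esym (addnA 1 k m) = erefl) ?castmx_id //; exact: eq_irrelevance.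
Qed.

End Fubini.

Section Affine.
Context {R : realType}.

(** Substitution along an increasing map settles c > 0; for c < 0 it is combined with a reflection,
    whose invariance follows by cutting the line at 0. *)
Lemma ge0_int_affine (f : R -> R) (c b : R) : continuous f -> (forall x, 0 <= f x) -> c != 0 ->
  (`|c|%:E * \int[@lebesgue_measure R]_x (f (c * x + b))%:E = \int[@lebesgue_measure R]_x (f x)%:E)%E.
Proof.
have mT (g : R -> R) : continuous g -> measurable_fun setT (EFin \o g).
  by move=> cg; apply/measurable_EFinP; exact: continuous_measurable_fun.
have caff (c' b' : R) : continuous (fun x : R => c' * x + b').
  move=> x; apply: cvgD; last exact: cvg_cst.
  by apply: cvgM; [exact: cvg_cst|exact: cvg_id].
have pos (g : R -> R) (c' b' : R) : continuous g -> (forall x, 0 <= g x) -> 0 < c' ->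
    (c'%:E * \int[@lebesgue_measure R]_x (g (c' * x + b'))%:E = \int[@lebesgue_measure R]_x (g x)%:E)%E.
  move=> cg g0 c0.
  have D x : is_derive (x : R) (1 : R) (fun x : R => c' * x + b') c'.
    by apply: is_derive_eq; rewrite addr0 /GRing.scale /= mulr1.
  have E : (fun x : R => c' * x + b')^`()%classic = cst c'.
    by apply/funext => x; rewrite derive1E; apply: derive_val.
  rewrite (@increasing_ge0_integration_by_substitutionT R (fun x => c' * x + b') g) //.
  - have ccomp : continuous (fun x => g (c' * x + b')).
      by move=> x; apply: continuous_comp; [exact: caff|exact: cg].
    rewrite E -ge0_integralZl //; [|exact: (mT _ ccomp)|by move=> x _; rewrite lee_fin|by rewrite lee_fin ltW].
    by apply: eq_integral => x _; rewrite -EFinM mulrC.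
  - by move=> x y xy; rewrite ltrD2r ltr_pM2l.
  - by rewrite E; move=> x; exact: cvg_cst.
  - by rewrite E; apply: is_cvg_cst.
  - by rewrite E; apply: is_cvg_cst.
  - apply/cvgrNyPle => A; near=> x; rewrite -lerBrDr -ler_pdivlMl //.
  - apply/cvgryPge => A; near=> x; rewrite -lerBlDr -ler_pdivrMl //.
have refl (g : R -> R) : continuous g -> (forall x, 0 <= g x) ->
    (\int[@lebesgue_measure R]_x (g (- x))%:E = \int[@lebesgue_measure R]_x (g x)%:E)%E.
  move=> cg g0.
  have half (h : R -> R) : continuous h -> (forall x, 0 <= h x) ->
     (\int[@lebesgue_measure R]_x (h x)%:E = \int[@lebesgue_measure R]_(x in `[0%R, +oo[) (h x)%:E
        + \int[@lebesgue_measure R]_(x in `[0%R, +oo[) (h (- x))%:E)%E.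
    move=> ch h0; have mh := mT _ ch.
    rewrite -(setUv `[0%R, +oo[%classic) ge0_integral_setU //= ; last 4 first.
    - exact: measurableC.
    - by rewrite setUv.
    - by move=> x _; rewrite lee_fin.
    - exact/disj_setPCl.
    congr (_ + _)%E; rewrite setCitvr integral_itv_bndo_bndc; last exact/measurable_funTS.
    rewrite -{1}oppr0 ge0_integration_by_substitutionNy //.
    exact: continuous_subspaceT.
  have cgN : continuous (fun x => g (- x)).
    by move=> x; apply: continuous_comp; [exact: opp_continuous|exact: cg].
  rewrite half // [RHS]half // addeC; congr (_ + _)%E.
  by apply: eq_integral => x _; rewrite opprK.
move=> cf f0; rewrite neq_lt => /orP[c0|c0]; last by rewrite gtr0_norm // pos.
rewrite ltr0_norm // -(refl f) // -(@pos (fun x => f (- x)) (- c) (- b)) ?oppr_gt0 //.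
  by congr (_ * _)%E; apply: eq_integral => x _; congr (f _)%:E; ring.
by move=> x; apply: continuous_comp; [exact: opp_continuous|exact: cf].
Unshelve. all: by end_near.
Qed.

Definition aff m (c b x : 'rV[R]_m) : 'rV[R]_m := \row_j (c 0 j * x 0 j + b 0 j).

Lemma aff_row_mx k m (c1 b1 x1 : 'rV[R]_k) (c2 b2 x2 : 'rV[R]_m) :
  aff (row_mx c1 c2) (row_mx b1 b2) (row_mx x1 x2) = row_mx (aff c1 b1 x1) (aff c2 b2 x2).
Proof.
apply/rowP => j; rewrite mxE -[j](@splitK k m); case: (fintype.split j) => i /=.
  by rewrite !row_mxEl mxE.
by rewrite !row_mxEr mxE.
Qed.

Lemma aff_continuous m (c b : 'rV[R]_m) : continuous (aff c b).
Proof.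
move=> x A /nbhs_ballP[e /= e0 hA].
have h : \forall y \near x, forall j, ball (aff c b x 0 j) e (aff c b y 0 j).
  apply: (@filter_forall _ _ _ (nbhs x) (nbhs_filter x)) => j.
  have : (fun t : 'rV[R]_m => c 0 j * t 0 j + b 0 j) @ x --> c 0 j * x 0 j + b 0 j.
    apply: (cvgD (FF := nbhs_filter x)); last exact: cvg_cst.
    apply: (cvgM (FF := nbhs_filter x)); first exact: cvg_cst.
    exact: coord_continuous.
  move=> /(_ (ball (c 0 j * x 0 j + b 0 j) e) (nbhsx_ballx _ _ e0)).
  by apply: (@filterS _ (nbhs x) (nbhs_filter x)) => y /=; rewrite !mxE.
apply: (@filterS _ (nbhs x) (nbhs_filter x)) h => y hy; apply: hA; split => // i j; rewrite (ord1 i); exact: hy.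
Qed.

Lemma pwinv_aff m (c b : 'rV[R]_m) : (forall j, c 0 j != 0) ->
  exists D, forall x, pwinv (aff c b x) <= D * pwinv x.
Proof.
(* Writing u = ((c u + b) - b) / c and using (v - b)^2 <= 2 (v^2 + b^2) gives 1 + u^2 <= D (1 + (c u
   + b)^2) in each coordinate. *)
move=> c0; pose D j : R := 1 + 2 * (c 0 j) ^- 2 * (1 + b 0 j ^+ 2).
exists (\prod_j D j) => x; rewrite /pwinv ler_pdivlMr ?pw_gt0 // mulrC ler_pdivrMr ?pw_gt0 //.
rewrite -big_split /=; apply: ler_prod => j _; rewrite mxE addr_ge0 ?sqr_ge0 //=.
have k0 : 0 <= (c 0 j) ^- 2 by rewrite invr_ge0 sqr_ge0.
have := c0 j; rewrite /D; move: (x 0 j) (c 0 j) (b 0 j) k0 => u a d k0 a0.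
have -> : u = ((a * u + d) - d) / a by rewrite addrK mulrC mulKf.
rewrite expr_div_n; move: (a ^- 2) k0 => k k0.
have -> : a * ((a * u + d - d) / a) + d = a * u + d by rewrite addrK (mulrC a u) mulfK // mulrC.
move: (a * u + d) => v.
have h1 : (v - d) ^+ 2 <= 2 * (v ^+ 2 + d ^+ 2) by have := sqr_ge0 (v + d); nra.
have h2 : (v - d) ^+ 2 * k <= 2 * (v ^+ 2 + d ^+ 2) * k by rewrite ler_wpM2r.
have h3 : 0 <= k * (d ^+ 2 * v ^+ 2) by apply: mulr_ge0 => //; apply: mulr_ge0; apply: sqr_ge0.
by have := sqr_ge0 v; nra.
Qed.

Lemma rnice_aff m (c b : 'rV[R]_m) (f : 'rV[R]_m -> R) : (forall j, c 0 j != 0) ->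
  rnice f -> rnice (fun x => f (aff c b x)).
Proof.
move=> c0 [cf [C hC]]; split.
  move=> x; apply: (@cvg_comp _ _ _ (aff c b) f (nbhs x) (nbhs (aff c b x))); first exact: aff_continuous.
  exact: cf.
have [D hD] := pwinv_aff b c0; exists (`|C| * D) => x.
apply: (le_trans (hC _)); apply: (@le_trans _ _ (`|C| * pwinv (aff c b x))).
  by rewrite ler_wpM2r ?pwinv_ge0 ?ler_norm.
by rewrite -mulrA ler_wpM2l.
Qed.

Lemma aff_scalar (c b : 'rV[R]_1) (x : R) : aff c b x%:M = (c 0 0 * x + b 0 0)%:M.
Proof. by apply/rowP => j; rewrite !mxE (ord1 j) eqxx !mulr1n. Qed.

Lemma scalar_mx_continuous : continuous (fun x : R => x%:M : 'rV[R]_1).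
Proof.
move=> x A /nbhs_ballP[e /= e0 hA]; apply/nbhs_ballP; exists e => //= z hz.
by apply: hA; split => // i j; rewrite !mxE (ord1 i) (ord1 j) eqxx !mulr1n.
Qed.

Lemma rint_aff1 (c b : 'rV[R]_1) (f : 'rV[R]_1 -> R) : c 0 0 != 0 -> rnice f ->
  rint (fun x => f (aff c b x)) = `|c 0 0|^-1 * rint f.
Proof.
move=> c0; have c0' j : c 0 j != 0 by rewrite (ord1 j).
have pos g : rnice g -> (forall x, 0 <= g x) ->
    rint (fun x => g (aff c b x)) = `|c 0 0|^-1 * rint g.
  move=> ng g0; apply: EFin_inj; rewrite EFinM rint_ge0_1 //; last exact: rnice_aff.
  rewrite rint_ge0_1 // -(@ge0_int_affine (fun x => g x%:M) (c 0 0) (b 0 0)) //; last first.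
    move=> x; apply: (@cvg_comp _ _ _ (fun x : R => x%:M : 'rV[R]_1) g (nbhs x) (nbhs (x%:M : 'rV[R]_1))).
      exact: scalar_mx_continuous.
    by have [cg _] := ng; exact: cg.
  rewrite muleA -EFinM mulVf ?normr_eq0 // mul1e.
  by apply: eq_integral => x _; rewrite aff_scalar.
move=> nf; have [_ [C hC]] := nf.
have nC := rniceZ C (@rnice_pwinv R 1).
have C0 (x : 'rV[R]_1) : 0 <= C * pwinv x by exact: le_trans (normr_ge0 _) (hC x).
have := pos _ (rniceD nf nC); rewrite !rintD //; [|exact: rnice_aff|exact: (rnice_aff b c0' nC)].
rewrite (pos _ nC C0) mulrDr => /(_ _)/addIr -> // x.
by have := hC x; rewrite ler_norml => /andP[h _]; lra.
Qed.

Lemma rint_aff m (c b : 'rV[R]_m) (f : 'rV[R]_m -> R) : (forall j, c 0 j != 0) -> rnice f ->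
  rint (fun x => f (aff c b x)) = (\prod_j `|c 0 j|)^-1 * rint f.
Proof.
elim: m c b f => [|m IH] c b f c0 nf.
  by rewrite !rint0 big_ord0 invr1 mul1r; congr f; apply/rowP; case.
rewrite (@rint_split1 _ m) ?(@rint_split1 _ m f) //; last exact: rnice_aff.
rewrite -[c](@hsubmxK _ 1 1 m) -[b](@hsubmxK _ 1 1 m).
set c1 : 'rV[R]_1 := @lsubmx _ 1 1 m c; set c2 := @rsubmx _ 1 1 m c.
set b1 : 'rV[R]_1 := @lsubmx _ 1 1 m b; set b2 := @rsubmx _ 1 1 m b.
have c10 j : c1 0 j != 0 by rewrite mxE.
have c20 j : c2 0 j != 0 by rewrite mxE.
under eq_fun => x.
  under eq_fun => y do rewrite (@aff_row_mx 1 m).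
  rewrite (IH c2 b2 (fun y => f (row_mx (aff c1 b1 x) y))) //; last exact: (@rnice_slice _ 1 m f _ nf).
  over.
rewrite (@rint_aff1 c1 b1 (fun x => _ * rint (fun y => f (row_mx x y)))) //; last first.
  by apply: rniceZ; exact: (@rnice_rint _ 1 m f nf).
rewrite rintZ; last exact: (@rnice_rint _ 1 m f nf).
rewrite mulrA -invfM; congr (_^-1 * _).
rewrite (@big_split_ord _ _ _ 1 m) /= big_ord1 (@row_mxEl _ 1 1 m); congr (_ * _).
by apply: eq_bigr => j _; rewrite (@row_mxEr _ 1 1 m).
Qed.

End Affine.

Section ComplexIntegral.
Context {R : realType}.
Implicit Types (m k : nat).

Definition cnice m (f : 'rV[R]_m -> R[i]^o) : Prop :=
  continuous f /\ exists C, forall x, nr (f x : R[i]) <= C * pwinv x.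

Definition cint m (f : 'rV[R]_m -> R[i]^o) : R[i]^o :=
  Complex (rint (fun x => complex.Re (f x))) (rint (fun x => complex.Im (f x))).

Lemma continuous_Re m (f : 'rV[R]_m -> R[i]^o) : continuous f -> continuous (fun x => complex.Re (f x)).
Proof. by move=> cf x; have [+ _] := (@cvg_ReIm R _ (nbhs x) (nbhs_filter x) f (f x)).1 (cf x). Qed.

Lemma continuous_Im m (f : 'rV[R]_m -> R[i]^o) : continuous f -> continuous (fun x => complex.Im (f x)).
Proof. by move=> cf x; have [_ +] := (@cvg_ReIm R _ (nbhs x) (nbhs_filter x) f (f x)).1 (cf x). Qed.

Lemma cnice_Re m (f : 'rV[R]_m -> R[i]^o) : cnice f -> rnice (fun x => complex.Re (f x)).
Proof.
move=> [cf [C hC]]; split; first exact: continuous_Re.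
by exists C => x; apply: le_trans (nr_Re _) (hC x).
Qed.

Lemma cnice_Im m (f : 'rV[R]_m -> R[i]^o) : cnice f -> rnice (fun x => complex.Im (f x)).
Proof.
move=> [cf [C hC]]; split; first exact: continuous_Im.
by exists C => x; apply: le_trans (nr_Im _) (hC x).
Qed.

Lemma cnice_bound_ge0 m (f : 'rV[R]_m -> R[i]^o) C :
  (forall x, nr (f x : R[i]) <= C * pwinv x) -> 0 <= C.
Proof.
by move=> h; have := le_trans (nr_ge0 _) (h 0); rewrite pmulr_lge0 // invr_gt0 pw_gt0.
Qed.

Lemma cniceD m (f g : 'rV[R]_m -> R[i]^o) : cnice f -> cnice g -> cnice (fun x => f x + g x).
Proof.
move=> [cf [C hC]] [cg [D hD]]; split.
  by move=> x; apply: (cvgD (FF := nbhs_filter x)); [exact: cf|exact: cg].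
by exists (C + D) => x; rewrite mulrDl (le_trans (nrD _ _)) // lerD.
Qed.

Lemma cnice_mull m (g f : 'rV[R]_m -> R[i]^o) B : continuous g -> (forall x, nr (g x : R[i]) <= B) ->
  cnice f -> cnice (fun x => (g x : R[i]) * f x).
Proof.
move=> cg hB [cf [C hC]]; split.
  by move=> x; apply: (cvgM (FF := nbhs_filter x)); [exact: cg|exact: cf].
exists (B * C) => x; rewrite nrM -mulrA; apply: ler_pM => //; exact: nr_ge0.
Qed.

Lemma cniceZ m (f : 'rV[R]_m -> R[i]^o) (c : R[i]) : cnice f -> cnice (fun x => c * f x).
Proof.
have cc : continuous (fun _ : 'rV[R]_m => c : R[i]^o) by exact: cst_continuous.
by apply: (cnice_mull cc (B := nr c)).
Qed.

Lemma cintD m (f g : 'rV[R]_m -> R[i]^o) : cnice f -> cnice g ->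
  cint (fun x => f x + g x) = cint f + cint g.
Proof.
move=> nf ng; rewrite /cint.
have -> : (fun x => complex.Re (f x + g x)) = fun x => complex.Re (f x) + complex.Re (g x).
  by apply/funext => x; rewrite raddfD.
have -> : (fun x => complex.Im (f x + g x)) = fun x => complex.Im (f x) + complex.Im (g x).
  by apply/funext => x; rewrite raddfD.
by rewrite (rintD (cnice_Re nf) (cnice_Re ng)) (rintD (cnice_Im nf) (cnice_Im ng)).
Qed.

Lemma cintZ m (f : 'rV[R]_m -> R[i]^o) (c : R[i]) : cnice f ->
  cint (fun x => c * f x) = c * cint f.
Proof.
move=> nf; have nr' := cnice_Re nf; have ni := cnice_Im nf; case: c => a b.
have e1 : (fun x => complex.Re (Complex a b * f x : R[i])) =
    fun x => a * complex.Re (f x) + (- b) * complex.Im (f x).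
  by apply/funext => x; case: (f x) => u v /=; rewrite mulNr.
have e2 : (fun x => complex.Im (Complex a b * f x : R[i])) =
    fun x => a * complex.Im (f x) + b * complex.Re (f x).
  by apply/funext => x; case: (f x) => u v /=.
rewrite /cint e1 e2 !rintD ?rintZ //; try exact: rniceZ.
by apply/eqP; rewrite eq_complex /= mulNr !eqxx.
Qed.

Lemma cint_bound m (f : 'rV[R]_m -> R[i]^o) C : continuous f ->
  (forall x, nr (f x : R[i]) <= C * pwinv x) -> nr (cint f : R[i]) <= 2 * (C * pi ^+ m).
Proof.
move=> cf hC; have nf : cnice f by split => //; exists C.
apply: (le_trans (nr_ReIm _)); rewrite mulr2n mulrDl mul1r /= lerD //.
  by apply: rint_bound (cnice_Re nf) _ => x; apply: le_trans (nr_Re _) (hC x).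
by apply: rint_bound (cnice_Im nf) _ => x; apply: le_trans (nr_Im _) (hC x).
Qed.

Lemma cint_cvgF (T : Type) (F : set_system T) {FF : Filter F} (B : nat -> set T) m
   (G : T -> 'rV[R]_m -> R[i]^o) (g : 'rV[R]_m -> R[i]^o) C :
  (forall k, F (B k)) -> (forall k j, (k <= j)%N -> B j `<=` B k) ->
  (forall A, F A -> exists k, B k `<=` A) ->
  (forall t, B 0%N t -> continuous (G t)) -> continuous g ->
  (forall t x, B 0%N t -> nr (G t x : R[i]) <= C * pwinv x) ->
  (forall x, G ^~ x @ F --> g x) ->
  (fun t => cint (G t)) @ F --> cint g.
Proof.
move=> FB Bd base cG cg hC h; apply/cvg_ReIm; split => /=.
  apply: (@rint_cvgF R T F FF B m (fun t x => complex.Re (G t x)) _ C) => //.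
  - by move=> t /cG; exact: continuous_Re.
  - exact: continuous_Re.
  - by move=> t x /(hC t x); apply: le_trans; exact: nr_Re.
  - by move=> x; have /cvg_ReIm[] := h x.
apply: (@rint_cvgF R T F FF B m (fun t x => complex.Im (G t x)) _ C) => //.
- by move=> t /cG; exact: continuous_Im.
- exact: continuous_Im.
- by move=> t x /(hC t x); apply: le_trans; exact: nr_Im.
- by move=> x; have /cvg_ReIm[] := h x.
Qed.

Definition punctured (k : nat) : set R := [set h | h != 0 /\ `|h| < k.+1%:R^-1].

Lemma cint_dnbhs m (G : R -> 'rV[R]_m -> R[i]^o) (g : 'rV[R]_m -> R[i]^o) C :
  (forall t, t != 0 -> `|t| < 1 -> continuous (G t)) -> continuous g ->
  (forall t x, t != 0 -> `|t| < 1 -> nr (G t x : R[i]) <= C * pwinv x) ->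
  (forall x, G ^~ x @ 0^' --> g x) ->
  (fun t => cint (G t)) @ 0^' --> cint g.
Proof.
move=> cG cg hC h.
have B0 t : punctured 0 t -> t != 0 /\ `|t| < 1 by rewrite /punctured /= invr1.
apply: (@cint_cvgF R (0^') (@dnbhs_filter R 0) punctured m G g C); last exact: h.
- move=> k; apply/nbhs_ballP; exists (k.+1%:R^-1) => /=; first by rewrite invr_gt0.
  by move=> t; rewrite /ball /= sub0r normrN => ht t0; split.
- move=> k j kj t [t0 ht]; split => //; apply: lt_le_trans ht _.
  by rewrite lef_pV2 ?posrE ?ltr0n // ler_nat.
- move=> A /nbhs_ballP[e /= e0 he].
  have [N _ HN] := near_infty_natSinv_lt (PosNum e0).
  exists N => t [t0 ht]; apply: he => //; rewrite /ball /= sub0r normrN.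
  by apply: lt_trans ht _; exact: (HN N (leqnn N)).
- by move=> t /B0[]; exact: cG.
- exact: cg.
- by move=> t x /B0[? ?]; exact: hC.
Qed.

Lemma cint_split k m (f : 'rV[R]_(k + m) -> R[i]^o) : cnice f ->
  cint f = cint (fun x : 'rV[R]_k => cint (fun y => f (row_mx x y))).
Proof.
move=> nf; rewrite /cint (rint_split (cnice_Re nf)) (rint_split (cnice_Im nf)).
exact: erefl.
Qed.

Lemma cnice_aff m (c b : 'rV[R]_m) (f : 'rV[R]_m -> R[i]^o) : (forall j, c 0 j != 0) ->
  cnice f -> cnice (fun x => f (aff c b x)).
Proof.
move=> c0 [cf [C hC]]; split.
  move=> x; apply: (@cvg_comp _ _ _ (aff c b) f (nbhs x) (nbhs (aff c b x))); first exact: aff_continuous.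
  exact: cf.
have [D hD] := pwinv_aff b c0; exists (C * D) => x.
apply: (le_trans (hC _)); rewrite -mulrA ler_wpM2l //; exact: cnice_bound_ge0 hC.
Qed.

Lemma cint_aff m (c b : 'rV[R]_m) (f : 'rV[R]_m -> R[i]^o) : (forall j, c 0 j != 0) -> cnice f ->
  cint (fun x => f (aff c b x)) = ((\prod_j `|c 0 j|)^-1)%:C%C * cint f.
Proof.
move=> c0 nf; rewrite /cint (rint_aff b c0 (cnice_Re nf)) (rint_aff b c0 (cnice_Im nf)).
by apply/eqP; rewrite eq_complex /= !mul0r subr0 addr0 !eqxx.
Qed.

Lemma cint_translate m (b : 'rV[R]_m) (f : 'rV[R]_m -> R[i]^o) : cnice f ->
  cint (fun x => f (x + b)) = cint f.
Proof.
move=> nf; have := @cint_aff m (const_mx 1) b f _ nf.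
rewrite big1 => [|j _]; last by rewrite mxE normr1.
rewrite invr1 mul1r => <- => [|j]; last by rewrite mxE oner_eq0.
by congr cint; apply/funext => x; congr f; apply/rowP => j; rewrite !mxE mul1r.
Qed.

Lemma pwinv_near m (x : 'rV[R]_m) j (t : R) : `|t| <= 1 ->
  pwinv (x + t *: delta_mx 0 j) <= 3 * pwinv x.
Proof.
move=> t1; rewrite /pwinv ler_pdivlMr ?pw_gt0 // mulrC ler_pdivrMr ?pw_gt0 //.
rewrite /pw (bigD1 j) //= [X in _ <= _ * X](bigD1 j) //= mulrA; apply: ler_pM.
- by rewrite addr_ge0 // sqr_ge0.
- by apply: prodr_ge0 => i _; rewrite addr_ge0 // sqr_ge0.
- rewrite !mxE !eqxx mulr1; move: (x 0 j) t1 => u; rewrite ler_norml => /andP[h1 h2].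
  have ht : t ^+ 2 <= 1 by nra.
  by have := sqr_ge0 (2 * u + 3 * t); nra.
- rewrite le_eqVlt; apply/orP; left; apply/eqP; apply: eq_bigr => i ij.
  by rewrite !mxE eqxx (negbTE ij) mulr0 addr0.
Qed.

(** By translation invariance every difference quotient has integral 0, and dominated convergence
    passes to the derivative; boundary terms never appear. *)
Lemma cint_pderiv0 m (G G' : 'rV[R]_m -> R[i]^o) j : cnice G -> cnice G' ->
  (forall x, is_pd G j x (G' x)) -> cint G' = 0.
Proof.
move=> nG nG' hG; have [cG [C hC]] := nG; have [cG' [C' hC']] := nG'.
have C'0 := cnice_bound_ge0 hC'.
have cq h : cnice (fun x => G (x + h *: delta_mx 0 j)).
  split; first by move=> x; apply: continuous_comp; [exact: continuous_translate|exact: cG].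
  have [D hD] := @pwinv_aff R m (const_mx 1) (h *: delta_mx 0 j) (fun i => ltac:(rewrite mxE oner_eq0; exact: isT)).
  exists (C * D) => x; apply: (le_trans (hC _)); rewrite -mulrA ler_wpM2l ?(cnice_bound_ge0 hC) //.
  apply: le_trans (hD x); rewrite le_eqVlt; apply/orP; left; apply/eqP; congr pwinv.
  by apply/rowP => i; rewrite !mxE mul1r.
have nN : cnice (fun x => (-1 : R[i]) * G x) by exact: cniceZ.
have lim : (fun h => cint (fun x => dquot G j x h)) @ 0^' --> cint G'.
  (* The factor 2 comes from [mean_value_le], the factor 3 from comparing [pwinv] at points at
     distance at most 1. *)
  apply: (@cint_dnbhs m (fun h x => dquot G j x h) G' (2 * (C' * 3))); last exact: hG.
  - move=> h h0 h1 x; rewrite /dquot; apply: (@cvgZl_tmp _ R[i]^o _ _ (nbhs_filter x)).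
    apply: (cvgB (FF := nbhs_filter x)); last exact: cG.
    exact: (cq h).1.
  - exact: cG'.
  - move=> h x h0 h1; rewrite /dquot -[nr _]/(nr ((h^-1)%:C%C * (G (x + h *: delta_mx 0 j) - G x) : R[i])) nrM nr_real normfV ler_pdivrMl ?normr_gt0 //.
    rewrite (_ : _ * (_ * _) = 2 * `|h| * (C' * (3 * pwinv x))); last by ring.
    apply: (@mean_value_le _ _ G G' j x h _ hG) => c /andP[c0 c1].
    apply: (le_trans (hC' _)); rewrite ler_wpM2l //.
    by apply: pwinv_near; rewrite normrM ger0_norm // mulr_ile1 // ltW.
apply: (cvg_unique (@norm_hausdorff _ R[i]^o) lim).
apply: cvg_near_cst; near=> h.
rewrite /dquot (_ : (fun x => _) = fun x => (h^-1)%:C%C * (G (x + h *: delta_mx 0 j) + (-1 : R[i]) * G x)); last first.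
  by apply/funext => x; rewrite mulN1r.
rewrite cintZ; last exact: cniceD.
by rewrite cintD // cint_translate // cintZ // mulN1r subrr mulr0.
Unshelve. all: by end_near.
Qed.

End ComplexIntegral.

(** * Fourier inversion and oscillatory integrals *)

Section Laplace.
Context {R : realType}.

(** Adding 1 to the cosine makes the integrand nonnegative, as the integration theorem on the half
    line requires; the case t = 0 later allows the extra term to be subtracted. *)
Let lap (t x : R) : R := expR (- `|x|) * (1 + cos (t * x)).

Let lap_ge0 t x : 0 <= lap t x.
Proof. by rewrite mulr_ge0 ?expR_ge0 //; have := cos_geN1 (t * x); lra. Qed.

(** The exponential of |x| is the square of that of |x| / 2, hence at least (1 + |x| / 2)^2 >= (1 +
    x^2) / 4. *)
Lemma expRN_norm_le (x : R) : expR (- `|x|) <= 4 * (1 + x ^+ 2)^-1.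
Proof.
have p0 : 0 < 1 + x ^+ 2 by rewrite ltr_pwDl // sqr_ge0.
rewrite ler_pdivlMr // expRN mulrC ler_pdivrMr ?expR_gt0 //.
have -> : expR `|x| = expR (`|x| / 2) ^+ 2 by rewrite -expRM_natl; congr expR; rewrite mulrC divfK.
have h := expR_ge1Dx (`|x| / 2); have a0 := normr_ge0 x.
rewrite -(real_normK (num_real x)); set E := expR _ in h *; set a := `|x| in h a0 *.
have : (1 + a / 2) ^+ 2 <= E ^+ 2 by rewrite lerXn2r // nnegrE; lra.
by nra.
Qed.

Lemma expRN_norm_continuous : continuous (fun x : R => expR (- `|x|)).
Proof.
move=> x; apply: (@cvg_comp _ _ _ (fun x : R => - `|x|) expR (nbhs x) (nbhs (- `|x|))).
  by apply: cvgN; exact: norm_continuous.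
exact: continuous_expR.
Qed.

Lemma cos_mul_continuous (t : R) : continuous (fun x => cos (t * x)).
Proof.
move=> x; apply: (@cvg_comp _ _ _ (fun x : R => t * x) cos (nbhs x) (nbhs (t * x))).
  by apply: cvgM; [exact: cvg_cst|exact: cvg_id].
exact: continuous_cos.
Qed.

Lemma sin_mul_continuous (t : R) : continuous (fun x => sin (t * x)).
Proof.
move=> x; apply: (@cvg_comp _ _ _ (fun x : R => t * x) sin (nbhs x) (nbhs (t * x))).
  by apply: cvgM; [exact: cvg_cst|exact: cvg_id].
exact: continuous_sin.
Qed.

Let lap_continuous t : continuous (lap t).
Proof.
move=> x; apply: cvgM; first exact: expRN_norm_continuous.
by apply: cvgD; [exact: cvg_cst|exact: cos_mul_continuous].
Qed.

Let int_lap t : (\int[@lebesgue_measure R]_x (lap t x)%:E = (2 * (1 + (1 + t ^+ 2)^-1))%:E)%E.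
Proof.
have p0 : 0 < 1 + t ^+ 2 by rewrite ltr_pwDl // sqr_ge0.
rewrite ge0_symfun_integralT //; last by move=> x /=; rewrite /lap normrN mulrN cosN.
have -> : [set x : R | 0 <= x] = `[0, +oo[%classic by apply/seteqP; split => x /=; rewrite in_itv /= andbT.
(* An antiderivative of [lap t] on the half line that tends to 0 at infinity. *)
pose F (x : R) := expR (- x) * ((t * sin (t * x) - cos (t * x)) / (1 + t ^+ 2) - 1).
have D (x : R) : is_derive x (1 : R) F (expR (- x) * (1 + cos (t * x))).
  rewrite /F; apply: is_derive_eq; rewrite /GRing.scale /=.
  have h0 : 1 + t ^+ 2 != 0 by rewrite gt_eqF.
  by field.
rewrite (@ge0_continuous_FTC2y R _ F 0 0).
- rewrite /F !mulr0 oppr0 expR0 sin0 cos0 mulr0 !mul1r sub0r sub0e -EFinN -EFinM.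
  by congr (_%:E); field; rewrite gt_eqF.
- by move=> x _.
- by apply: continuous_subspaceT; exact: lap_continuous.
- pose B : R := (`|t| + 1) / (1 + t ^+ 2) + 1.
  apply/norm_cvg0P; apply: (@squeeze_cvgr _ _ _ _ (cst 0) (fun x => B * expR (- x))).
  + apply: nearW => x /=; rewrite normr_ge0 /F normrM (ger0_norm (expR_ge0 _)) mulrC ler_wpM2r ?expR_ge0 //.
    apply: (le_trans (ler_normB _ _)); rewrite normr1 lerD2r normrM normfV (gtr0_norm p0).
    rewrite ler_wpM2r ?invr_ge0 ?(ltW p0) //; apply: (le_trans (ler_normB _ _)); rewrite normrM lerD //.
      by rewrite ler_piMr // ler_norml sin_geN1 sin_le1.
    by rewrite ler_norml cos_geN1 cos_le1.
  + exact: cvg_cst.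
  + by rewrite -[X in _ --> X](mulr0 B); apply: cvgM; [exact: cvg_cst|exact: cvgr_expR].
- by move=> x _.
- apply: cvg_at_right_filter; apply: differentiable_continuous; apply/derivable1_diffP.
  by have [] := D 0.
- move=> x; rewrite in_itv /= andbT => x0.
  by rewrite derive1E /lap (gtr0_norm x0); apply: derive_val.
Qed.

Definition nice1 (f : R -> R[i]^o) : Prop :=
  continuous f /\ exists C, forall x, nr (f x : R[i]) <= C * (1 + x ^+ 2)^-1.

Lemma coord_comp_continuous m (f : R -> R[i]^o) (j : 'I_m) : continuous f ->
  continuous (fun x : 'rV[R]_m => f (x 0 j)).
Proof.
move=> cf x; apply: (@cvg_comp _ _ _ (fun x : 'rV[R]_m => x 0 j) f (nbhs x) (nbhs (x 0 j))).
  exact: coord_continuous.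
exact: cf.
Qed.

Lemma cnice_prod m (f : 'I_m -> R -> R[i]^o) : (forall j, nice1 (f j)) ->
  cnice (fun x : 'rV[R]_m => \prod_j (f j (x 0 j) : R[i])).
Proof.
move=> h; split.
  move=> x; apply: cvg_big => //; [exact: mul_continuous|exact: nbhs_filter|].
  by move=> j _; apply: coord_comp_continuous; case: (h j).
have {h}[C hC] := choice (fun j => (h j).2).
exists (\prod_j C j) => x; rewrite /pwinv /pw -prodfV -big_split /=.
elim/big_ind2: _ => [|a b c d hb hd|j _]; [by rewrite nr1| |exact: hC].
by rewrite nrM; apply: ler_pM => //; exact: nr_ge0.
Qed.

Lemma cint0 (f : 'rV[R]_0 -> R[i]^o) : cint f = f 0.
Proof. by rewrite /cint !rint0; case: (f 0). Qed.

Lemma cint_prod m (f : 'I_m -> R -> R[i]^o) : (forall j, nice1 (f j)) ->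
  cint (fun x : 'rV[R]_m => \prod_j (f j (x 0 j) : R[i]) : R[i]^o) =
  \prod_j (cint (fun x : 'rV[R]_1 => f j (x 0 0)) : R[i]).
Proof.
elim: m f => [|m IH] f h; first by rewrite cint0 !big_ord0.
rewrite (@cint_split _ 1 m) ?big_ord_recl; last exact: cnice_prod.
pose g (x : 'rV[R]_1) : R[i]^o := f ord0 (x 0 0).
have hg : cnice g.
  have [cf [C hC]] := h ord0; split; first exact: coord_comp_continuous.
  by exists C => x; rewrite /pwinv /pw big_ord1; exact: hC.
have hl j : nice1 (f (lift ord0 j)) by exact: h.
rewrite -(IH (fun j => f (lift ord0 j))) // -/g.
set I := cint (fun x : 'rV[R]_m => _).
rewrite [RHS]mulrC -cintZ //; congr cint; apply/funext => x.
rewrite mulrC -cintZ; last exact: (cnice_prod hl).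
congr cint; apply/funext => y; rewrite big_ord_recl.
have := row_mxEl x y 0 0; rewrite (_ : lshift m 0 = ord0) => [->|]; last exact/val_inj.
congr (_ * _); apply: eq_bigr => j _; congr (f _ _).
by rewrite -(row_mxEr x y 0 j); congr (row_mx _ _ 0 _); apply/val_inj.
Qed.

Definition lap1 (t x : R) : R[i]^o := (expR (- `|x|))%:C%C * cexp (- (t * x)).

Lemma lap1_nice t : nice1 (lap1 t).
Proof.
split.
  move=> x; apply: cvgM; apply/cvg_ReIm; split => /=.
  - exact: expRN_norm_continuous.
  - exact: cvg_cst.
  - under eq_fun do rewrite cosN; rewrite cosN; exact: cos_mul_continuous.
  - under eq_fun do rewrite sinN; rewrite sinN; apply: cvgN; exact: sin_mul_continuous.
exists 4 => x; rewrite /lap1 nrM nr_cexp mulr1 nr_real ger0_norm ?expR_ge0 //.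
exact: expRN_norm_le.
Qed.

Lemma nice1_cnice (f : R -> R[i]^o) : nice1 f -> cnice (fun x : 'rV[R]_1 => f (x 0 0)).
Proof.
move=> [cf [C hC]]; split; first exact: coord_comp_continuous.
by exists C => x; rewrite /pwinv /pw big_ord1; exact: hC.
Qed.

(** The value at s = 0 isolates the integral of the exponential, hence that of its product with the
    cosine. The imaginary part is odd, so reflection shows that it equals its own negative. *)
Lemma cint_lap1 t : cint (fun x : 'rV[R]_1 => lap1 t (x 0 0)) = (2 * (1 + t ^+ 2)^-1)%:C%C.
Proof.
have n1 s := cnice_Re (nice1_cnice (lap1_nice s)).
have eRe s : (fun x : 'rV[R]_1 => complex.Re (lap1 s (x 0 0))) = fun x => expR (- `|x 0 0|) * cos (s * x 0 0).
  by apply/funext => x; rewrite /lap1 /= mul0r subr0 cosN.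
have nl s : rnice (fun x : 'rV[R]_1 => expR (- `|x 0 0|) * cos (s * x 0 0)) by rewrite -eRe.
have e0 : (fun x : 'rV[R]_1 => expR (- `|x 0 0|) * cos (0 * x 0 0)) = fun x => expR (- `|x 0 0|).
  by apply/funext => x; rewrite mul0r cos0 mulr1.
have I s : rint (fun x : 'rV[R]_1 => expR (- `|x 0 0|)) +
     rint (fun x : 'rV[R]_1 => expR (- `|x 0 0|) * cos (s * x 0 0)) = 2 * (1 + (1 + s ^+ 2)^-1).
  rewrite -e0 -rintD //; apply: EFin_inj; rewrite rint_ge0_1; last 2 first.
  - exact: rniceD.
  - by move=> x; rewrite mul0r cos0 -mulrDr; exact: lap_ge0.
  rewrite -int_lap; apply: eq_integral => x _.
  by rewrite !mxE eqxx mulr1n mul0r cos0 -mulrDr.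
have h2 : rint (fun x : 'rV[R]_1 => expR (- `|x 0 0|)) = 2.
  by have := I 0; rewrite e0 expr0n addr0 invr1; lra.
apply/eqP; rewrite eq_complex /= eRe; apply/andP; split; apply/eqP.
  by have := I t; rewrite h2; lra.
have nI := cnice_Im (nice1_cnice (lap1_nice t)).
have := @rint_aff1 R (const_mx (-1)) 0 (fun x : 'rV[R]_1 => complex.Im (lap1 t (x 0 0))) _ nI.
rewrite mxE oppr_eq0 oner_eq0 normrN normr1 invr1 mul1r => /(_ isT).
have -> : (fun x : 'rV[R]_1 => complex.Im (lap1 t (aff (const_mx (-1)) 0 x 0 0))) =
   fun x => (-1) * complex.Im (lap1 t (x 0 0)).
  apply/funext => x.
  have -> : aff (const_mx (-1)) 0 x 0 0 = - x 0 0 by rewrite !mxE mulN1r addr0.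
  by rewrite /lap1 /= normrN mulrN !sinN opprK !mul0r !addr0 mulrN mulN1r opprK.
rewrite rintZ //; lra.
Qed.

End Laplace.

Section FourierInversion.
Context {R : realType} {n : nat}.

Lemma lsubmx_continuous k m : continuous (fun z : 'rV[R]_(k + m) => lsubmx z).
Proof.
move=> x A /nbhs_ballP[e /= e0 hA]; apply/nbhs_ballP; exists e => //= z [_ hz].
by apply: hA; split => // i j; rewrite !mxE; exact: hz.
Qed.

Lemma rsubmx_continuous k m : continuous (fun z : 'rV[R]_(k + m) => rsubmx z).
Proof.
move=> x A /nbhs_ballP[e /= e0 hA]; apply/nbhs_ballP; exists e => //= z [_ hz].
by apply: hA; split => // i j; rewrite !mxE; exact: hz.
Qed.

Lemma pwinv_submx k m (z : 'rV[R]_(k + m)) : pwinv z = pwinv (lsubmx z) * pwinv (rsubmx z).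
Proof. by rewrite -pwinv_row_mx hsubmxK. Qed.

Definition osc (z : 'rV[R]_(n + n)) : R[i]^o := cexp (- dotv (lsubmx z) (rsubmx z)).

Lemma nr_osc z : nr (osc z : R[i]) = 1.
Proof. exact: nr_cexp. Qed.

Lemma osc_continuous : continuous osc.
Proof.
have cd : continuous (fun z : 'rV[R]_(n + n) => - dotv (lsubmx z) (rsubmx z)).
  move=> z; apply: (cvgN (FF := nbhs_filter z)); rewrite /dotv.
  apply: cvg_big => //; first exact: add_continuous.
  move=> j _; apply: (cvgM (FF := nbhs_filter z)).
    under eq_fun do rewrite mxE; rewrite mxE; exact: coord_continuous.
  under eq_fun do rewrite mxE; rewrite mxE; exact: coord_continuous.
move=> z; apply/(@cvg_ReIm R _ (nbhs z) (nbhs_filter z)); split => /=.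
  apply: (@cvg_comp _ _ _ (fun z : 'rV[R]_(n + n) => - dotv (lsubmx z) (rsubmx z)) cos (nbhs z) (nbhs (- dotv (lsubmx z) (rsubmx z)))); first exact: cd.
  exact: continuous_cos.
apply: (@cvg_comp _ _ _ (fun z : 'rV[R]_(n + n) => - dotv (lsubmx z) (rsubmx z)) sin (nbhs z) (nbhs (- dotv (lsubmx z) (rsubmx z)))); first exact: cd.
exact: continuous_sin.
Qed.

Definition hexp (y : 'rV[R]_n) : R := \prod_j expR (- `|y 0 j|).

Lemma hexp_ge0 y : 0 <= hexp y.
Proof. by apply: prodr_ge0 => j _; exact: expR_ge0. Qed.

Lemma hexp_le1 y : hexp y <= 1.
Proof.
rewrite /hexp; apply: prodr_ile1 => j _; rewrite expR_ge0 /=.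
by rewrite -[X in _ <= X]expR0 ler_expR oppr_le0.
Qed.

Lemma hexp_le_pwinv y : hexp y <= 4 ^+ n * pwinv y.
Proof.
rewrite /hexp /pwinv /pw -prodfV -[X in 4 ^+ X](card_ord n) -prodr_const -big_split /=.
by apply: ler_prod => j _; rewrite expR_ge0 expRN_norm_le.
Qed.

Lemma hexp_continuous : continuous hexp.
Proof.
move=> x; apply: cvg_big => //; [exact: mul_continuous|exact: nbhs_filter|].
move=> j _; apply: (@cvg_comp _ _ _ (fun x : 'rV[R]_n => x 0 j) (fun a => expR (- `|a|)) (nbhs x) (nbhs (x 0 j))).
  exact: coord_continuous.
exact: expRN_norm_continuous.
Qed.

Lemma hexp0 : hexp 0 = 1.
Proof. by rewrite /hexp big1 // => j _; rewrite mxE normr0 oppr0 expR0. Qed.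

Lemma complexR_continuous m (f : 'rV[R]_m -> R) : continuous f -> continuous (fun x => (f x)%:C%C : R[i]^o).
Proof.
move=> cf x; apply/(@cvg_ReIm R _ (nbhs x) (nbhs_filter x)); split => /=; first exact: cf.
exact: cvg_cst.
Qed.

Lemma scale_continuous m (d : R) : continuous (fun x : 'rV[R]_m => d *: x).
Proof. by move=> x; apply: (@cvgZl_tmp _ _ _ _ (nbhs_filter x)); exact: cvg_id. Qed.

Lemma cvg_scale0 m (x : 'rV[R]_m) : (fun d : R => d *: x) @ 0^' --> (0 : 'rV[R]_m).
Proof.
rewrite -[X in _ --> X](scale0r x); apply: cvgZr_tmp.
exact: (@cvg_within_filter _ _ (fun d : R => d)) cvg_id.
Qed.

Section Inversion.
Context (psi : 'rV[R]_n -> R[i]^o) (C : R).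
Context (cpsi : continuous psi) (bpsi : forall s, nr (psi s : R[i]) <= C * pwinv s).

Let C0 : 0 <= C. Proof. exact: cnice_bound_ge0 bpsi. Qed.

Let F (d : R) (z : 'rV[R]_(n + n)) : R[i]^o :=
  (psi (lsubmx z) : R[i]) * ((hexp (d *: rsubmx z))%:C%C * osc z).

Let F_nice d : d != 0 -> cnice (F d).
Proof.
move=> d0; split.
  move=> z; apply: (cvgM (FF := nbhs_filter z)).
    by apply: (@cvg_comp _ _ _ (fun z : 'rV[R]_(n + n) => lsubmx z) psi (nbhs z) (nbhs (lsubmx z))); [exact: lsubmx_continuous|exact: cpsi].
  apply: (cvgM (FF := nbhs_filter z)); last exact: osc_continuous.
  apply: (@complexR_continuous _ (fun z : 'rV[R]_(n + n) => hexp (d *: rsubmx z))) => {}z.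
  apply: (@cvg_comp _ _ _ (fun z : 'rV[R]_(n + n) => rsubmx z) (fun y => hexp (d *: y)) (nbhs z) (nbhs (rsubmx z))); first exact: rsubmx_continuous.
  apply: (@cvg_comp _ _ _ (fun y : 'rV[R]_n => d *: y) hexp (nbhs (rsubmx z)) (nbhs (d *: rsubmx z))).
    exact: scale_continuous.
  exact: hexp_continuous.
have [D hD] := @pwinv_aff R n (const_mx d) 0 (fun j => ltac:(rewrite mxE; exact: d0)).
exists (C * (4 ^+ n * D)) => z; rewrite nrM nrM nr_osc mulr1 nr_real ger0_norm ?hexp_ge0 //.
rewrite pwinv_submx mulrACA; apply: ler_pM; rewrite ?nr_ge0 ?hexp_ge0 //.
apply: (le_trans (hexp_le_pwinv _)); rewrite -mulrA ler_wpM2l ?exprn_ge0 //.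
apply: le_trans (hD _); rewrite le_eqVlt; apply/orP; left; apply/eqP; congr pwinv.
by apply/rowP => j; rewrite !mxE addr0.
Qed.

Let sliceE (s : 'rV[R]_n) : (fun y : 'rV[R]_n => (hexp y)%:C%C * cexp (- dotv s y) : R[i]^o) =
  fun y => \prod_j (lap1 (s 0 j) (y 0 j) : R[i]).
Proof.
apply/funext => y; rewrite /lap1 big_split /= /hexp rmorph_prod; congr (_ * _).
by rewrite /dotv -sumrN cexp_sum.
Qed.

Let slice_nice s : cnice (fun y : 'rV[R]_n => (hexp y)%:C%C * cexp (- dotv s y) : R[i]^o).
Proof. rewrite sliceE; apply: (cnice_prod (f := fun j => lap1 (s 0 j))) => j; exact: lap1_nice. Qed.

Let slice_int (s : 'rV[R]_n) :
  cint (fun y : 'rV[R]_n => (hexp y)%:C%C * cexp (- dotv s y) : R[i]^o) = (2 ^+ n * pwinv s)%:C%C.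
Proof.
rewrite sliceE (cint_prod (f := fun j => lap1 (s 0 j))) => [|j]; last exact: lap1_nice.
under eq_bigr do rewrite cint_lap1.
rewrite -rmorph_prod big_split /= prodr_const card_ord.
by rewrite /pwinv /pw prodfV.
Qed.

(** The change of variables (d s, y / d) has Jacobian 1 and moves the parameter from the damping
    factor into [psi]; the inner integral is then the explicit kernel of [slice_int]. *)
Let int_F d : d != 0 -> cint (F d) = cint (fun s => (psi (d *: s) : R[i]) * (2 ^+ n * pwinv s)%:C%C).
Proof.
move=> d0.
pose c : 'rV[R]_(n + n) := row_mx (const_mx d) (const_mx d^-1).
have c0 j : c 0 j != 0.
  by rewrite mxE; case: splitP => k _; rewrite mxE ?invr_eq0.
have := cint_aff 0 c0 (F_nice d0).
rewrite big_split_ord /=.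
rewrite (eq_bigr (fun=> `|d|)) => [|j _]; last by rewrite row_mxEl mxE.
rewrite [X in (_ * X)^-1](eq_bigr (fun=> `|d^-1|)) => [|j _]; last by rewrite row_mxEr mxE.
rewrite !prodr_const card_ord -exprMn -normrM divff // normr1 expr1n invr1 mul1r => <-.
rewrite cint_split; last exact: cnice_aff (F_nice d0).
congr cint; apply/funext => s; rewrite -slice_int -cintZ; last exact: slice_nice.
congr cint; apply/funext => y.
have -> : (0 : 'rV[R]_(n + n)) = row_mx 0 0 by rewrite row_mx0.
rewrite aff_row_mx.
have -> : aff (const_mx d) 0 s = d *: s by apply/rowP => j; rewrite !mxE addr0.
have -> : aff (const_mx d^-1) 0 y = d^-1 *: y by apply/rowP => j; rewrite !mxE addr0.
rewrite /F /osc row_mxKl row_mxKr scalerA divff // scale1r; congr (_ * (_ * cexp (- _))).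
by rewrite /dotv; apply: eq_bigr => j _; rewrite !mxE mulrACA divff // mul1r.
Qed.

(** The kernel 2^n [pwinv] has total mass 2^n pi^n, and [psi] evaluated at d s tends to [psi 0]
    under a fixed integrable majorant. Only continuity and decay of [psi] are involved, not
    differentiability. *)
Lemma fourier_inversion : (fun d => cint (F d)) @ 0^' --> ((psi 0 : R[i]) * ((2 * pi) ^+ n)%:C%C : R[i]^o).
Proof.
have cw : continuous (fun s : 'rV[R]_n => (2 ^+ n * pwinv s)%:C%C : R[i]^o).
  apply: complexR_continuous => s; apply: (cvgM (FF := nbhs_filter s)); first exact: cvg_cst.
  exact: pwinv_continuous.
have -> : (psi 0 : R[i]) * ((2 * pi) ^+ n)%:C%C = cint (fun s : 'rV[R]_n => (psi 0 : R[i]) * (2 ^+ n * pwinv s)%:C%C).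
  have nw : cnice (fun s : 'rV[R]_n => (2 ^+ n * pwinv s)%:C%C : R[i]^o).
    split; first exact: cw.
    by exists (2 ^+ n) => s; rewrite nr_real ger0_norm // mulr_ge0 ?exprn_ge0 ?pwinv_ge0.
  rewrite cintZ //; congr (_ * _); apply/eqP; rewrite eq_complex /=.
  rewrite rintZ ?rint_pwinv; last exact: rnice_pwinv.
  rewrite exprMn eqxx /= -[X in rint X]/(fun=> 0).
  have -> : (fun _ : 'rV[R]_n => 0 : R) = fun s => 0 * pwinv s by apply/funext => s; rewrite mul0r.
  by rewrite rintZ ?mul0r //; exact: rnice_pwinv.
apply: (@cvg_trans _ ((fun d => cint (fun s => (psi (d *: s) : R[i]) * (2 ^+ n * pwinv s)%:C%C)) @ 0^')).
  apply: near_eq_cvg; near=> d; rewrite int_F //.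
  by near: d; exact: nbhs_dnbhs_neq.
apply: (@cint_dnbhs _ _ _ _ (C * 2 ^+ n)).
- move=> d _ _ s; apply: (cvgM (FF := nbhs_filter s)); last exact: cw.
  by apply: (@cvg_comp _ _ _ (fun y : 'rV[R]_n => d *: y) psi (nbhs s) (nbhs (d *: s))); [exact: scale_continuous|exact: cpsi].
- by move=> s; apply: (cvgM (FF := nbhs_filter s)); [exact: cvg_cst|exact: cw].
- move=> d s _ _; rewrite nrM nr_real ger0_norm ?mulr_ge0 ?exprn_ge0 ?pwinv_ge0 // -mulrA.
  apply: ler_wpM2r; first by rewrite mulr_ge0 ?exprn_ge0 ?pwinv_ge0.
  by apply: (le_trans (bpsi _)); rewrite ler_piMr // pwinv_le1.
- move=> s; apply: cvgM; last exact: cvg_cst.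
  apply: (@cvg_comp _ _ _ (fun d : R => d *: s) psi (0^') (nbhs (0 : 'rV[R]_n))); first exact: cvg_scale0.
  exact: cpsi.
Unshelve. all: by end_near.
Qed.

End Inversion.
End FourierInversion.

(** * Rapidly decreasing cutoffs and integration by parts *)

Section RapidDecay.
Context {R : realType} {m : nat}.
Implicit Types f g : 'rV[R]_m -> R[i]^o.

Definition rdec f : Prop := Cinfty f /\
  forall w p, exists C, forall z, pw z ^+ p * nr (wderiv w f z : R[i]) <= C.

Lemma schwartz_rdec f : schwartz f -> rdec f.
Proof.
move=> [hf hs]; split => // w p.
pose l j := count_mem j w.
have -> : wderiv w f = mderiv l f.
  by apply: wderiv_perm => //; apply/allP => j _ /=; rewrite count_mword.
apply: (@moments_pw _ _ _ (fun z => z) (fun z => nr (mderiv l f z : R[i]))) => [z|k]; first exact: nr_ge0.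
have [C hC] := hs k l; exists C => z.
by have := hC z; rewrite normrM nrE (nrE (mderiv l f z : R[i])) -rmorphM /= nr_real lecR.
Qed.

Lemma rdec_pderiv f j : rdec f -> rdec (pderiv j f).
Proof.
move=> [hf hr]; split; first exact: (Cinfty_wderiv [:: j] hf).
move=> w p; have [C hC] := hr (w ++ [:: j]) p; exists C => z.
by have := hC z; rewrite wderiv_cat.
Qed.

Lemma rdecB f g : rdec f -> rdec g -> rdec (fun z => f z - g z).
Proof.
move=> [hf rf] [hg rg].
have [hN dN] := Cinfty_Z (-1 : R[i]) hg.
have [hS dS] := @Cinfty_sum R m R[i]^o bool [:: true; false] xpredT
  (fun b z => if b then f z else (-1 : R[i]) *: g z) (fun b _ => if b as b return Cinfty (fun z => if b then f z else (-1 : R[i]) *: g z) then hf else hN).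
have e : (fun z => f z - g z) = fun z => \sum_(b <- [:: true; false]) (if b then f z else (-1 : R[i]) *: g z).
  by apply/funext => z; rewrite !big_cons big_nil addr0 scaleN1r.
rewrite e; split => // w p.
have [C hC] := rf w p; have [D hD] := rg w p; exists (C + D) => z.
rewrite dS !big_cons big_nil addr0 dN.
rewrite -[nr _]/(nr (wderiv w f z + (-1) * wderiv w g z : R[i])).
apply: (@le_trans _ _ (pw z ^+ p * (nr (wderiv w f z : R[i]) + nr (wderiv w g z : R[i])))).
  apply: ler_wpM2l; first by rewrite exprn_ge0 // ltW // pw_gt0.
  by rewrite mulN1r; exact: nrB.
by rewrite mulrDr lerD.
Qed.

Lemma rdec_bound f p : rdec f -> exists C, forall z, nr (f z : R[i]) <= C * pwinv z ^+ p.
Proof.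
move=> [_ /(_ [::] p)[C hC]]; exists C => z.
by rewrite /pwinv exprVn ler_pdivlMr ?exprn_gt0 ?pw_gt0 // mulrC; exact: hC.
Qed.

Lemma rdec_continuous f : rdec f -> continuous f.
Proof. by move=> [/Cinfty_continuous]. Qed.

Lemma is_pd_cst_dir (W : normedModType R[i]) (f : 'rV[R]_m -> W) j x :
  (forall h : R, f (x + h *: delta_mx 0 j) = f x) -> is_pd f j x 0.
Proof.
move=> h; rewrite /is_pd (_ : dquot f j x = fun=> 0); first exact: cvg_cst.
by apply/funext => t; rewrite /dquot h subrr scaler0.
Qed.

End RapidDecay.

Section IntegrationByParts.
Context {R : realType} {n : nat}.
Local Notation Z := 'rV[R]_(n + n).
Implicit Types (z : Z) (j : 'I_n).

Lemma lsubmx_shift z (h : R) j :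
  lsubmx (z + h *: delta_mx 0 (lshift n j)) = lsubmx z + h *: delta_mx 0 j.
Proof. by apply/rowP => i; rewrite !mxE eq_lshift. Qed.

Lemma rsubmx_shift z (h : R) j : rsubmx (z + h *: delta_mx 0 (lshift n j)) = rsubmx z.
Proof. by apply/rowP => i; rewrite !mxE eq_rlshift mulr0 addr0. Qed.

Lemma is_pd_osc j z :
  is_pd (@osc R n) (lshift n j) z ('i%C * (- rsubmx z 0 j)%:C%C * osc z).
Proof.
have := @is_pd_cexp R n 1 (- rsubmx z) j (lsubmx z).
have e (s : 'rV[R]_n) : dotv s (- rsubmx z) = - dotv s (rsubmx z).
  by rewrite /dotv -sumrN; apply: eq_bigr => i _; rewrite !mxE mulrN.
rewrite /is_pd e mxE mulr1 => h.
rewrite (_ : dquot _ _ _ = dquot (fun s : 'rV[R]_n => 1 * cexp (dotv s (- rsubmx z)) : R[i]^o) j (lsubmx z)) //.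
apply/funext => t; rewrite /dquot /osc lsubmx_shift rsubmx_shift !e.
by rewrite !mul1r.
Qed.

Let w j z : R := (1 + rsubmx z 0 j ^+ 2)^-1.

Lemma coordr_continuous j : continuous (fun z => rsubmx z 0 j).
Proof. have -> : (fun z => rsubmx z 0 j) = fun z => z 0 (rshift n j) by apply/funext => z; rewrite mxE.
by move=> z; exact: coord_continuous. Qed.

Let w_gt0 j z : 0 < 1 + rsubmx z 0 j ^+ 2.
Proof. by rewrite ltr_pwDl // sqr_ge0. Qed.

Let w_continuous j : continuous (w j).
Proof.
move=> z; apply: (cvgV (FF := nbhs_filter z)); first by rewrite gt_eqF.
apply: (cvgD (FF := nbhs_filter z)); first exact: cvg_cst.
by apply: (cvgM (FF := nbhs_filter z)); exact: coordr_continuous.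
Qed.

(** The operator 1 - d^2/ds_j^2 multiplies the phase by 1 + xi_j^2. Both integrations by parts are
    done at once: the difference of the two integrands is the s_j-derivative of the phase times w F1
    + i xi_j w F, where w = 1 / (1 + xi_j^2), and such a derivative has integral 0. *)
Lemma ibp j (F F1 F2 : Z -> R[i]^o) C : continuous F -> continuous F1 -> continuous F2 ->
  (forall z, nr (F z : R[i]) <= C * pwinv z) -> (forall z, nr (F1 z : R[i]) <= C * pwinv z) ->
  (forall z, nr (F2 z : R[i]) <= C * pwinv z) ->
  (forall z, is_pd F (lshift n j) z (F1 z)) -> (forall z, is_pd F1 (lshift n j) z (F2 z)) ->
  cint (fun z => (osc z : R[i]) * F z) = cint (fun z => (osc z : R[i]) * ((w j z)%:C%C * (F z - F2 z))).
Proof.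
move=> cF cF1 cF2 bF bF1 bF2 dF dF1.
pose v z : R := rsubmx z 0 j.
pose wc z : R[i]^o := (w j z)%:C%C.
pose b z : R[i]^o := 'i%C * (v z * w j z)%:C%C.
have cwc : continuous wc by apply: complexR_continuous; exact: w_continuous.
have cvw : continuous (fun z => (v z * w j z)%:C%C : R[i]^o).
  apply: complexR_continuous => z; apply: (cvgM (FF := nbhs_filter z)); [exact: coordr_continuous|exact: w_continuous].
have cb : continuous b by move=> z; apply: (cvgM (FF := nbhs_filter z)); [exact: cvg_cst|exact: cvw].
have bwc z : nr (wc z : R[i]) <= 1.
  rewrite nr_real ger0_norm ?invr_ge0 ?(ltW (w_gt0 _ _)) // invf_le1 // lerDl sqr_ge0 //.
have bb z : nr (b z : R[i]) <= 1.
  rewrite nrM /= nr_real /w /v; move: (rsubmx z 0 j) (w_gt0 j z) => t t0.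
  have -> : nr ('i%C : R[i]) = 1 by rewrite /nr normc_def /= expr0n expr1n add0r sqrtr1.
  rewrite mul1r normrM normfV (gtr0_norm t0) ler_pdivrMr // mul1r.
  by rewrite ler_norml; apply/andP; split; nra.
pose H z : R[i]^o := (wc z : R[i]) *: F1 z + (b z : R[i]) *: F z.
have nF : cnice F by split => //; exists C.
have nF1 : cnice F1 by split => //; exists C.
have nF2 : cnice F2 by split => //; exists C.
have nH : cnice H by apply: cniceD; [exact: cnice_mull cwc bwc nF1|exact: cnice_mull cb bb nF].
pose G z : R[i]^o := (osc z : R[i]) *: H z.
have nosc (g : Z -> R[i]^o) : cnice g -> cnice (fun z => (osc z : R[i]) * g z).
  apply: (cnice_mull (B := 1)); first exact: osc_continuous.
  by move=> z; rewrite nr_osc.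
have nG : cnice G by exact: nosc.
pose G' z : R[i]^o := (osc z : R[i]) * (F z - (wc z : R[i]) * (F z - F2 z)).
have nFF2 : cnice (fun z => (wc z : R[i]) * (F z - F2 z)).
  apply: cnice_mull cwc bwc _.
  have -> : (fun z => F z - F2 z) = fun z => F z + (-1 : R[i]) * F2 z by apply/funext => z; rewrite mulN1r.
  by apply: cniceD nF _; exact: cniceZ.
have nG' : cnice G'.
  apply: nosc; have -> : (fun z => F z - (wc z : R[i]) * (F z - F2 z)) =
    fun z => F z + (-1 : R[i]) * ((wc z : R[i]) * (F z - F2 z)) by apply/funext => z; rewrite mulN1r.
  by apply: cniceD nF _; exact: cniceZ.
have dG z : is_pd G (lshift n j) z (G' z).
  have dwc : is_pd wc (lshift n j) z 0.
    by apply: is_pd_cst_dir => h; rewrite /wc /w rsubmx_shift.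
  have db : is_pd b (lshift n j) z 0.
    by apply: is_pd_cst_dir => h; rewrite /b /v /w rsubmx_shift.
  have dH := is_pdD (is_pd_scale (cF1 z) dwc (dF1 z)) (is_pd_scale (cF z) db (dF z)).
  have := is_pd_scale (nH.1 z) (@is_pd_osc j z) dH.
  suff -> : 'i%C * (- rsubmx z 0 j)%:C%C * osc z *: H z +
    (osc z : R[i]) *: ((0 : R[i]) *: F1 z + (wc z : R[i]) *: F2 z + ((0 : R[i]) *: F z + (b z : R[i]) *: F1 z)) = G' z by [].
  rewrite /G' /H /b /wc /w /v /GRing.scale /=.
  have h0 : (1 + (rsubmx z 0 j)%:C%C ^+ 2 : R[i]) != 0.
    by rewrite -rmorphXn /= -(rmorph1 (real_complex R)) -rmorphD /= fmorph_eq0 gt_eqF.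
  have i2 : 'i%C * 'i%C = -1 :> R[i] by rewrite -expr2 sqr_i.
  rewrite !rmorphM !fmorphV !rmorphD !rmorphXn !rmorph1 !rmorphN /=.
  move: (osc z : R[i]) (F z : R[i]) (F1 z : R[i]) (F2 z : R[i]) (rsubmx z 0 j)%:C%C h0 => o f f1 f2 t t0.
  rewrite !mul0r !add0r.
  transitivity (o * (f2 / (1 + t ^+ 2) - ('i%C * 'i%C) * t ^+ 2 * f / (1 + t ^+ 2))); first by field.
  by rewrite i2; field.
have eq : (fun z => (osc z : R[i]) * F z) = fun z => (osc z : R[i]) * ((wc z : R[i]) * (F z - F2 z)) + G' z.
  by apply/funext => z; rewrite /G' -mulrDr addrC subrK.
rewrite eq cintD; [|exact: nosc nFF2|exact: nG'].
rewrite (cint_pderiv0 nG nG' dG) addr0; exact: erefl.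
Qed.

Definition helm j (f : Z -> R[i]^o) : Z -> R[i]^o :=
  fun z => f z - pderiv (lshift n j) (pderiv (lshift n j) f) z.

Definition hword (s : seq 'I_n) (f : Z -> R[i]^o) := foldr helm f s.

Lemma rdec_hword s f : rdec f -> rdec (hword s f).
Proof.
move=> hf; elim: s => [//|j s IH] /=.
by apply: rdecB => //; do 2! apply: rdec_pderiv.
Qed.

Definition wt (s : seq 'I_n) (y : 'rV[R]_n) : R := \prod_(j <- s) (1 + y 0 j ^+ 2)^-1.

Lemma wt_bound s y : 0 <= wt s y <= 1.
Proof.
rewrite /wt; elim/big_ind: _ => [|a b /andP[a0 a1] /andP[b0 b1]|j _]; first by rewrite ler01 lexx.
  by rewrite mulr_ge0 // mulr_ile1.
have p : 0 < 1 + y 0 j ^+ 2 by rewrite ltr_pwDl // sqr_ge0.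
by rewrite invr_ge0 (ltW p) invf_le1 // lerDl sqr_ge0.
Qed.

Lemma wt_continuous s : continuous (wt s).
Proof.
move=> y; apply: cvg_big => //; [exact: mul_continuous|exact: nbhs_filter|].
move=> j _; apply: (cvgV (FF := nbhs_filter y)); first by rewrite gt_eqF // ltr_pwDl // sqr_ge0.
apply: (cvgD (FF := nbhs_filter y)); first exact: cvg_cst.
by apply: (cvgM (FF := nbhs_filter y)); exact: coord_continuous.
Qed.

Lemma wt_flatten p y : wt (flatten (nseq p (enum 'I_n))) y = pwinv y ^+ p.
Proof.
rewrite /wt; elim: p => [|p IH] /=; first by rewrite big_nil.
by rewrite big_cat IH exprS /= big_enum /pwinv /pw prodfV.
Qed.

(** Derivatives are taken in s only. The factor [u] and the accumulated weights depend on xi and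
    behave as constants, while [kap] commutes with shifts in s, so that every derivative falls on
    [f]. *)
Lemma ibp_iter (kap : Z -> Z) (u : 'rV[R]_n -> R[i]^o) : continuous kap ->
  (forall z (h : R) j, kap (z + h *: delta_mx 0 (lshift n j)) = kap z + h *: delta_mx 0 (lshift n j)) ->
  continuous u ->
  (forall f, rdec f -> exists C, forall z, nr (u (rsubmx z) : R[i]) * nr (f (kap z) : R[i]) <= C * pwinv z) ->
  forall s f, rdec f ->
  cint (fun z => (osc z : R[i]) * ((u (rsubmx z) : R[i]) * f (kap z))) =
  cint (fun z => (osc z : R[i]) * ((wt s (rsubmx z))%:C%C * ((u (rsubmx z) : R[i]) * hword s f (kap z)))).
Proof.
move=> ck hk cu bu s f hf; elim: s => [|j s IH].
  congr cint; apply/funext => z; rewrite /wt big_nil /= mul1r //.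
rewrite IH.
pose k z : R[i]^o := (wt s (rsubmx z))%:C%C * (u (rsubmx z) : R[i]).
have cr (T : topologicalType) (g : 'rV[R]_n -> T) : continuous g -> continuous (fun z => g (rsubmx z)).
  move=> cg z; apply: (@cvg_comp _ _ _ (fun z : Z => rsubmx z) g (nbhs z) (nbhs (rsubmx z))); first exact: rsubmx_continuous.
  exact: cg.
have ck' : continuous k.
  move=> z; apply: (cvgM (FF := nbhs_filter z)); last exact: cr.
  by apply: (cr _ (fun y => (wt s y)%:C%C : R[i]^o)); apply: complexR_continuous; exact: wt_continuous.
have cg g : rdec g -> continuous (fun z => (k z : R[i]) *: g (kap z)).
  move=> rg z; apply: (cvgM (FF := nbhs_filter z)); first exact: ck'.
  apply: (@cvg_comp _ _ _ kap g (nbhs z) (nbhs (kap z))); first exact: ck.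
  exact: rdec_continuous.
have bg g : rdec g -> exists C, forall z, nr ((k z : R[i]) *: g (kap z) : R[i]) <= C * pwinv z.
  move=> rg; have [C hC] := bu g rg; exists C => z; rewrite -[_ *: _]/((k z : R[i]) * g (kap z)) !nrM -mulrA.
  have /andP[w0 w1] := wt_bound s (rsubmx z).
  rewrite nr_real ger0_norm //; apply: le_trans (hC z); by rewrite ler_piMl // mulr_ge0 ?nr_ge0.
have dg g z : rdec g -> is_pd (fun z => (k z : R[i]) *: g (kap z)) (lshift n j) z
    ((k z : R[i]) *: pderiv (lshift n j) g (kap z)).
  move=> rg; have dk : is_pd k (lshift n j) z 0.
    by apply: is_pd_cst_dir => h; rewrite /k rsubmx_shift.
  have dgk : is_pd (fun z => g (kap z)) (lshift n j) z (pderiv (lshift n j) g (kap z)).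
    have e : dquot (fun z => g (kap z)) (lshift n j) z = dquot g (lshift n j) (kap z).
      by apply/funext => h; rewrite /dquot hk.
    rewrite /is_pd e; exact: (@Cinfty_pd _ _ _ g (lshift n j) (kap z) rg.1).
  have cgk : {for z, continuous (fun z => g (kap z))}.
    apply: (@cvg_comp _ _ _ kap g (nbhs z) (nbhs (kap z))); first exact: ck.
    exact: rdec_continuous.
  by have := is_pd_scale cgk dk dgk; rewrite scale0r add0r.
have r0 := rdec_hword s hf; have r1 := rdec_pderiv (lshift n j) r0; have r2 := rdec_pderiv (lshift n j) r1.
have [C0 h0] := bg _ r0; have [C1 h1] := bg _ r1; have [C2 h2] := bg _ r2.
have mx (C : R) z : C <= Num.max C0 (Num.max C1 C2) -> C * pwinv z <= Num.max C0 (Num.max C1 C2) * pwinv z.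
  by move=> h; rewrite ler_wpM2r // pwinv_ge0.
transitivity (cint (fun z => (osc z : R[i]) * ((k z : R[i]) *: hword s f (kap z)))).
  by congr cint; apply/funext => z; rewrite /GRing.scale /= /k !mulrA.
rewrite (@ibp j _ _ _ (Num.max C0 (Num.max C1 C2)) (cg _ r0) (cg _ r1) (cg _ r2)); last first.
- by move=> z; exact: dg.
- by move=> z; exact: dg.
- by move=> z; apply: le_trans (h2 z) (mx _ _ _); rewrite !le_max lexx !orbT.
- by move=> z; apply: le_trans (h1 z) (mx _ _ _); rewrite !le_max lexx !orbT.
- by move=> z; apply: le_trans (h0 z) (mx _ _ _); rewrite !le_max lexx.
congr cint; apply/funext => z; congr (_ * _).
rewrite /GRing.scale /= /k /w /helm -mulrBr {2}/wt big_cons rmorphM /= -/(wt s _) !mulrA.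
by [].
Qed.

End IntegrationByParts.

(** * Limits of the regularised integrals *)

Section OscillatoryIntegral.
Context {R : realType} {n : nat}.
Local Notation Z := 'rV[R]_(n + n).
Implicit Types (z : Z) (e : R) (x y : 'rV[R]_n).

(** The argument of the cutoff after the substitution of s / e for s and of x + e xi for xi: the
    first component no longer depends on [e], and the second tends to 0 with [e]. *)
Definition kap e x z : Z := row_mx (lsubmx z) (e *: (x + e *: rsubmx z)).

Lemma kapE e x : kap e x = aff (row_mx (const_mx 1) (const_mx (e * e))) (row_mx 0 (e *: x)).
Proof.
apply/funext => z; rewrite -{2}[z]hsubmxK aff_row_mx; congr row_mx; apply/rowP => j; rewrite !mxE.
  by rewrite mul1r addr0.
by rewrite mulrDr addrC mulrA.
Qed.

Lemma kap_continuous e x : continuous (kap e x).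
Proof. by rewrite kapE; exact: aff_continuous. Qed.

Lemma kap_shift e x z (h : R) (j : 'I_n) :
  kap e x (z + h *: delta_mx 0 (lshift n j)) = kap e x z + h *: delta_mx 0 (lshift n j).
Proof.
rewrite /kap lsubmx_shift rsubmx_shift -[RHS]hsubmxK lsubmx_shift rsubmx_shift.
by rewrite row_mxKl row_mxKr.
Qed.

Lemma jb_scale_le e y : `|e| <= 1 -> jb (e *: y) <= jb y.
Proof.
move=> e1; rewrite /jb lerD2l; apply: ler_sum => j _; rewrite mxE normrM.
by rewrite ler_piMl.
Qed.

Lemma pwinv_le_l z : pwinv z <= pwinv (lsubmx z).
Proof. by rewrite pwinv_submx ler_piMr ?pwinv_ge0 ?pwinv_le1. Qed.

Lemma pwinv_le_r z : pwinv z <= pwinv (rsubmx z).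
Proof. by rewrite pwinv_submx ler_piMl ?pwinv_ge0 ?pwinv_le1. Qed.

Lemma jb_pwinv q y : jb y ^+ q * pwinv y ^+ q.+1 <= (2 ^+ n) ^+ q * pwinv y.
Proof.
rewrite exprSr mulrA ler_wpM2r ?pwinv_ge0 // -exprMn lerXn2r ?nnegrE ?exprn_ge0 ?mulr_ge0 ?pwinv_ge0 ?(ltW (jb_gt0 _)) //.
by rewrite /pwinv ler_pdivrMr ?pw_gt0 // jb_le_pw.
Qed.

Definition oscint (phi : Z -> R[i]^o) (g : 'rV[R]_n -> R[i]^o) x e : Z -> R[i]^o :=
  fun z => (phi (e *: z) : R[i]) * (cexp (dotv (lsubmx z) (x - rsubmx z)) * (g (rsubmx z) : R[i])).

Lemma cexp_dotB_continuous x : continuous (fun z => cexp (dotv (lsubmx z) (x - rsubmx z)) : R[i]^o).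
Proof.
have -> : (fun z => cexp (dotv (lsubmx z) (x - rsubmx z)) : R[i]^o) =
    fun z => (osc z : R[i]) * cexp (dotv (lsubmx z) x).
  apply/funext => z; rewrite /osc -cexpD; congr cexp.
  by rewrite /dotv -sumrN -big_split /=; apply: eq_bigr => j _; rewrite !mxE; ring.
move=> z; apply: (cvgM (FF := nbhs_filter z)); first exact: osc_continuous.
apply: (@cvg_comp _ _ _ (fun z : Z => lsubmx z) (fun s => cexp (dotv s x) : R[i]^o) (nbhs z) (nbhs (lsubmx z))).
  exact: lsubmx_continuous.
exact: cexp_dotv_continuous.
Qed.

Lemma comp_rsubmx_continuous (T : topologicalType) (g : 'rV[R]_n -> T) :
  continuous g -> continuous (fun z => g (rsubmx z)).
Proof.
move=> cg z; apply: (@cvg_comp _ _ _ (fun z : Z => rsubmx z) g (nbhs z) (nbhs (rsubmx z))).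
  exact: rsubmx_continuous.
exact: cg.
Qed.

Lemma cvg_dnbhs_eq (V : topologicalType) (F G : R -> V) (l : V) :
  (forall e, e != 0 -> `|e| <= 1 -> F e = G e) -> G @ 0^' --> l -> F @ 0^' --> l.
Proof.
move=> h; apply: cvg_trans; apply: near_eq_cvg.
apply/nbhs_ballP; exists 1 => //= e; rewrite /ball /= sub0r normrN => e1 e0.
by rewrite h // ltW.
Qed.

Section Growth.
Context (phi : Z -> R[i]^o) (q : nat).
Context (rphi : rdec phi).

(** Each coordinate is integrated by parts q + 1 times: q of the weights absorb the growth of the
    amplitude, and the last one makes the integral over xi converge. *)
Let s : seq 'I_n := flatten (nseq q.+1 (enum 'I_n)).
Let psi := hword s phi.

Let psi_continuous : continuous psi.
Proof. exact: rdec_continuous (rdec_hword s rphi). Qed.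

Let psi_bound : exists2 C, 0 <= C & forall z, nr (psi z : R[i]) <= C * pwinv z.
Proof.
have [C hC] := rdec_bound 1 (rdec_hword s rphi).
exists C; last by move=> z; rewrite -[pwinv z]expr1.
by have := le_trans (nr_ge0 _) (hC 0); rewrite expr1 pmulr_lge0 // invr_gt0 pw_gt0.
Qed.

Let E (u : 'rV[R]_n -> R[i]^o) (h : Z -> R[i]^o) : Z -> R[i]^o := fun z =>
  (osc z : R[i]) * ((pwinv (rsubmx z) ^+ q.+1)%:C%C * ((u (rsubmx z) : R[i]) * h z)).

Let E_continuous u h : continuous u -> continuous h -> continuous (E u h).
Proof.
move=> cu ch z; apply: (cvgM (FF := nbhs_filter z)); first exact: osc_continuous.
apply: (cvgM (FF := nbhs_filter z)).
  apply: (@comp_rsubmx_continuous _ (fun y => (pwinv y ^+ q.+1)%:C%C : R[i]^o)).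
  apply: complexR_continuous => y.
  apply: (@cvg_comp _ _ _ (@pwinv R n) (fun a : R => a ^+ q.+1) (nbhs y) (nbhs (pwinv y))); first exact: pwinv_continuous.
  exact: exprn_continuous.
by apply: (cvgM (FF := nbhs_filter z)); [exact: comp_rsubmx_continuous|exact: ch].
Qed.

Let E_bound u h U H : 0 <= U -> 0 <= H -> (forall y, nr (u y : R[i]) <= U * jb y ^+ q) ->
  (forall z, nr (h z : R[i]) <= H * pwinv (lsubmx z)) ->
  forall z, nr (E u h z : R[i]) <= H * (2 ^+ n) ^+ q * U * pwinv z.
Proof.
move=> U0 H0 hu hh z; rewrite /E !nrM nr_osc mul1r nr_real ger0_norm ?exprn_ge0 ?pwinv_ge0 //.
have h3 := ler_pM (nr_ge0 _) (nr_ge0 _) (hu (rsubmx z)) (hh z).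
apply: (@le_trans _ _ (pwinv (rsubmx z) ^+ q.+1 * (U * jb (rsubmx z) ^+ q * (H * pwinv (lsubmx z))))).
  by rewrite ler_wpM2l ?exprn_ge0 ?pwinv_ge0.
have h4 := jb_pwinv q (rsubmx z); rewrite pwinv_submx.
have -> : pwinv (rsubmx z) ^+ q.+1 * (U * jb (rsubmx z) ^+ q * (H * pwinv (lsubmx z))) =
   (H * U * pwinv (lsubmx z)) * (jb (rsubmx z) ^+ q * pwinv (rsubmx z) ^+ q.+1).
  by move: (pwinv _ ^+ q.+1) (jb (rsubmx z) ^+ q) => a b; ring.
have -> : H * (2 ^+ n) ^+ q * U * (pwinv (lsubmx z) * pwinv (rsubmx z)) =
   (H * U * pwinv (lsubmx z)) * ((2 ^+ n) ^+ q * pwinv (rsubmx z)).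
  by move: ((2 ^+ n) ^+ q) => t; ring.
by rewrite ler_wpM2l // !mulr_ge0 ?pwinv_ge0.
Qed.

Let psik_bound C e x : 0 <= C -> (forall z, nr (psi z : R[i]) <= C * pwinv z) ->
  forall z, nr (psi (kap e x z) : R[i]) <= C * pwinv (lsubmx z).
Proof.
move=> C0 hC z; apply: (le_trans (hC _)); rewrite ler_wpM2l //; apply: (le_trans (pwinv_le_l _)).
by rewrite /kap row_mxKl.
Qed.

Let psik_continuous e x : continuous (fun z => psi (kap e x z)).
Proof.
move=> z; apply: (@cvg_comp _ _ _ (kap e x) psi (nbhs z) (nbhs (kap e x z))); first exact: kap_continuous.
exact: psi_continuous.
Qed.

Let one_continuous : continuous (fun _ : 'rV[R]_n => 1 : R[i]^o).
Proof. exact: cst_continuous. Qed.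

Let one_bound (y : 'rV[R]_n) : nr (1 : R[i]) <= 1 * jb y ^+ q.
Proof. by rewrite nr1 mul1r exprn_ege1 // jb_ge1. Qed.

Let K : R[i]^o := cint (E (fun=> 1) (fun z => psi (kap 0 0 z))).

(** The constant is common to all amplitudes, so it may be computed with the amplitude
    [hexp (d *: y)]: the integrations by parts are undone, Fourier inversion applies to the
    restriction of [phi] to xi = 0, and d tends to 0. *)
Let KE : K = (phi 0 : R[i]) * ((2 * pi) ^+ n)%:C%C.
Proof.
have [C hC] := rdec_bound 1 rphi.
have bp (t : 'rV[R]_n) : nr (phi (row_mx t 0) : R[i]) <= C * pwinv t.
  have := hC (row_mx t 0); rewrite expr1 pwinv_row_mx => h; apply: le_trans h _.
  by rewrite {2}/pwinv /pw big1 ?invr1 ?mulr1 // => j _; rewrite mxE expr0n addr0.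
have cp : continuous (fun t : 'rV[R]_n => phi (row_mx t 0)).
  move=> t; apply: (@cvg_comp _ _ _ (fun t : 'rV[R]_n => row_mx t 0 : Z) phi (nbhs t) (nbhs (row_mx t 0 : Z))).
    exact: row_mx_continuousl.
  exact: rdec_continuous.
have lim := fourier_inversion cp bp.
have e0 : (row_mx 0 0 : Z) = 0 by rewrite row_mx0.
rewrite e0 in lim; apply: (cvg_unique (@norm_hausdorff _ R[i]^o) _ lim).
pose H d (y : 'rV[R]_n) : R[i]^o := (hexp (d *: y))%:C%C.
have cH d : continuous (H d).
  apply: complexR_continuous => y.
  apply: (@cvg_comp _ _ _ (fun y : 'rV[R]_n => d *: y) hexp (nbhs y) (nbhs (d *: y))); first exact: scale_continuous.
  exact: hexp_continuous.
have bH d y : nr (H d y : R[i]) <= 1 * jb y ^+ q.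
  by rewrite nr_real ger0_norm ?hexp_ge0 // (le_trans (hexp_le1 _)) // mul1r exprn_ege1 // jb_ge1.
have [C1 C10 hC1] := psi_bound.
have limK : (fun d => cint (E (H d) (fun z => psi (kap 0 0 z)))) @ 0^' --> K.
  apply: (@cint_dnbhs _ _ _ _ (C1 * (2 ^+ n) ^+ q * 1)).
  - by move=> d _ _; exact: E_continuous (cH d) (@psik_continuous 0 0).
  - exact: E_continuous one_continuous (@psik_continuous 0 0).
  - move=> d z _ _; exact: (E_bound ler01 C10 (bH d) (psik_bound _ _ C10 hC1)).
  - move=> z; apply: cvgM; first exact: cvg_cst.
    apply: cvgM; first exact: cvg_cst.
    apply: cvgM; last exact: cvg_cst.
    apply/cvg_ReIm; split; last exact: cvg_cst.
    rewrite /= -[X in _ --> X](@hexp0 R n).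
    apply: (@cvg_comp _ _ _ (fun d : R => d *: rsubmx z) hexp (0^') (nbhs (0 : 'rV[R]_n))).
      exact: cvg_scale0.
    exact: hexp_continuous.
apply: cvg_dnbhs_eq limK => d d0 _.
transitivity (cint (fun z => (osc z : R[i]) * ((H d (rsubmx z) : R[i]) * phi (kap 0 0 z)))).
  congr cint; apply/funext => z; rewrite mulrA mulrC; congr (_ * _).
  by rewrite mulrC /H /kap scale0r.
rewrite (@ibp_iter _ _ (kap 0 0) (H d) (@kap_continuous 0 0) (@kap_shift 0 0) (cH d) _ s phi rphi).
  by congr cint; apply/funext => z; rewrite wt_flatten.
move=> f rf; have [B hB] := rdec_bound 1 rf.
have [D hD] := @pwinv_aff R n (const_mx d) 0 (fun j => ltac:(rewrite mxE; exact: d0)).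
exists ((4 ^+ n * D) * B) => z; rewrite nr_real ger0_norm ?hexp_ge0 // pwinv_submx [pwinv _ * _]mulrC mulrACA.
apply: ler_pM; rewrite ?hexp_ge0 ?nr_ge0 //.
  apply: (le_trans (hexp_le_pwinv _)); rewrite -mulrA ler_wpM2l ?exprn_ge0 //.
  apply: le_trans (hD _); rewrite le_eqVlt; apply/orP; left; apply/eqP; congr pwinv.
  by apply/rowP => j; rewrite !mxE addr0.
have B0 : 0 <= B.
  by have := le_trans (nr_ge0 _) (hB 0); rewrite expr1 pmulr_lge0 // invr_gt0 pw_gt0.
apply: (le_trans (hB _)); rewrite expr1 ler_wpM2l //; apply: (le_trans (pwinv_le_l _)).
by rewrite /kap row_mxKl.
Qed.

(** For fixed nonzero [e] the cutoff itself decays. This constant blows up as [e] tends to 0 and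
    only serves to make the regularised integrals legitimate; the uniform estimate is
    [cint_oscint_bound]. *)
Lemma oscint_bound e : e != 0 -> exists2 B, 0 <= B & forall (g : 'rV[R]_n -> R[i]^o) G x,
  (forall y, nr (g y : R[i]) <= G * jb y ^+ q) ->
  forall z, nr (oscint phi g x e z : R[i]) <= B * G * pwinv z.
Proof.
move=> e0; have [C hC] := rdec_bound q.+1 rphi.
have [D hD] := @pwinv_aff R _ (const_mx e) (0 : Z) (fun j => ltac:(rewrite mxE; exact: e0)).
have C0 : 0 <= C.
  have := le_trans (nr_ge0 _) (hC 0); rewrite pmulr_lge0 // exprn_gt0 // invr_gt0 pw_gt0 //.
have D0 : 0 <= D.
  by have := le_trans (pwinv_ge0 _) (hD 0); rewrite pmulr_lge0 // invr_gt0 pw_gt0.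
exists (C * D ^+ q.+1 * (2 ^+ (n + n)) ^+ q); first by rewrite !mulr_ge0 ?exprn_ge0.
move=> g G x bg z; rewrite !nrM nr_cexp mul1r.
have G0 : 0 <= G.
  have := le_trans (nr_ge0 _) (bg 0); rewrite pmulr_lge0 // exprn_gt0 // jb_gt0 //.
have h1 : nr (phi (e *: z) : R[i]) <= C * (D * pwinv z) ^+ q.+1.
  apply: (le_trans (hC _)); rewrite ler_wpM2l // lerXn2r ?nnegrE ?pwinv_ge0 ?mulr_ge0 ?pwinv_ge0 //.
  apply: le_trans (hD z); rewrite le_eqVlt; apply/orP; left; apply/eqP; congr pwinv.
  by apply/rowP => j; rewrite !mxE addr0.
have h2 : nr (g (rsubmx z) : R[i]) <= G * jb z ^+ q.
  apply: (le_trans (bg _)); rewrite ler_wpM2l // lerXn2r ?nnegrE ?(ltW (jb_gt0 _)) //.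
  rewrite /jb lerD2l big_split_ord /=; under eq_bigr do rewrite mxE.
  by rewrite lerDr sumr_ge0.
apply: (le_trans (ler_pM (nr_ge0 _) (nr_ge0 _) h1 h2)).
rewrite [(D * _) ^+ _]exprMn.
have -> : C * (D ^+ q.+1 * pwinv z ^+ q.+1) * (G * jb z ^+ q) =
    C * D ^+ q.+1 * G * (jb z ^+ q * pwinv z ^+ q.+1).
  by move: (D ^+ _) (pwinv z ^+ _) (jb z ^+ _) => a b d; ring.
have -> : C * D ^+ q.+1 * (2 ^+ (n + n)) ^+ q * G * pwinv z =
    C * D ^+ q.+1 * G * ((2 ^+ (n + n)) ^+ q * pwinv z).
  by move: (D ^+ _) ((2 ^+ _) ^+ q) => a b; ring.
apply: ler_wpM2l; first by rewrite !mulr_ge0 ?exprn_ge0.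
rewrite exprSr mulrA ler_wpM2r ?pwinv_ge0 // -exprMn lerXn2r ?nnegrE ?exprn_ge0 ?mulr_ge0 ?pwinv_ge0 ?(ltW (jb_gt0 _)) //.
by rewrite /pwinv ler_pdivrMr ?pw_gt0 // jb_le_pw.
Qed.

Section WithSymbol.
Context (g : 'rV[R]_n -> R[i]^o) (G : R).
Context (cg : continuous g) (bg : forall y, nr (g y : R[i]) <= G * jb y ^+ q).

Let G0 : 0 <= G.
Proof.
have := le_trans (nr_ge0 _) (bg 0); rewrite pmulr_lge0 // exprn_gt0 // jb_gt0 //.
Qed.

Lemma oscint_nice x e : e != 0 -> cnice (oscint phi g x e).
Proof.
move=> e0; split.
  move=> z; apply: (cvgM (FF := nbhs_filter z)).
    apply: (@cvg_comp _ _ _ (fun z : Z => e *: z) phi (nbhs z) (nbhs (e *: z))); first exact: scale_continuous.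
    exact: rdec_continuous.
  apply: (cvgM (FF := nbhs_filter z)); first exact: cexp_dotB_continuous.
  exact: comp_rsubmx_continuous.
have [B _ hB] := oscint_bound e0; exists (B * G) => z; exact: hB.
Qed.

Let jbg x e y : `|e| <= 1 -> nr (g (x + e *: y) : R[i]) <= G * jb x ^+ q * jb y ^+ q.
Proof.
move=> e1; apply: (le_trans (bg _)); rewrite -mulrA ler_wpM2l // -exprMn lerXn2r ?nnegrE ?mulr_ge0 ?(ltW (jb_gt0 _)) //.
apply: (le_trans (jbD _ _)); rewrite ler_wpM2l ?(ltW (jb_gt0 _)) //.
exact: jb_scale_le.
Qed.

Lemma comp_shift_continuous x e : continuous (fun y => g (x + e *: y)).
Proof.
move=> y; apply: (@cvg_comp _ _ _ (fun y : 'rV[R]_n => x + e *: y) g (nbhs y) (nbhs (x + e *: y))); last exact: cg.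
apply: (cvgD (FF := nbhs_filter y)); first exact: cvg_cst.
exact: scale_continuous.
Qed.

(** The substitution of s / e for s and of x + e xi for xi has Jacobian 1; the shift by [x] cancels
    the [x] in the phase, which becomes exp(-i s.xi). After integration by parts the integrand has a
    majorant independent of [e]. *)
Lemma cint_oscintE x e : e != 0 -> `|e| <= 1 ->
  cint (oscint phi g x e) = cint (fun z => (osc z : R[i]) *
    ((pwinv (rsubmx z) ^+ q.+1)%:C%C * ((g (x + e *: rsubmx z) : R[i]) * psi (kap e x z)))).
Proof.
move=> e0 e1.
pose c : Z := row_mx (const_mx e^-1) (const_mx e).
have c0 j : c 0 j != 0 by rewrite mxE; case: splitP => k _; rewrite mxE ?invr_eq0.
have := cint_aff (row_mx 0 x) c0 (oscint_nice x e0).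
rewrite big_split_ord /=.
rewrite (eq_bigr (fun=> `|e^-1|)) => [|j _]; last by rewrite row_mxEl mxE.
rewrite [X in (_ * X)^-1](eq_bigr (fun=> `|e|)) => [|j _]; last by rewrite row_mxEr mxE.
rewrite !prodr_const card_ord -exprMn -normrM mulVf // normr1 expr1n invr1 mul1r => <-.
transitivity (cint (fun z => (osc z : R[i]) * ((g (x + e *: rsubmx z) : R[i]) * phi (kap e x z)))).
  congr cint; apply/funext => z.
  have -> : aff c (row_mx 0 x) z = row_mx (e^-1 *: lsubmx z) (x + e *: rsubmx z).
    rewrite -{1}[z]hsubmxK aff_row_mx; congr row_mx; apply/rowP => j; rewrite !mxE ?addr0 //.
    by rewrite addrC.
  rewrite /oscint /kap row_mxKl row_mxKr scale_row_mx scalerA divff // scale1r.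
  rewrite [RHS]mulrCA mulrC -mulrA mulrCA; congr (_ * (_ * _)).
  rewrite /osc; congr cexp; rewrite /dotv -sumrN; apply: eq_bigr => j _; rewrite !mxE.
  by rewrite opprD addrA subrr add0r mulrN mulrACA mulVf // mul1r.
rewrite (@ibp_iter _ _ (kap e x) (fun y => g (x + e *: y)) (@kap_continuous e x) (@kap_shift e x) (@comp_shift_continuous x e) _ s phi rphi).
  by congr cint; apply/funext => z; rewrite wt_flatten.
move=> f rf; have [C hC] := rdec_bound q.+1 rf.
pose k : Z := row_mx (const_mx 1) (const_mx (e * e)).
have k0 j : k 0 j != 0 by rewrite mxE; case: splitP => i _; rewrite mxE ?oner_eq0 ?mulf_neq0.
have [D hD] := pwinv_aff (row_mx 0 (e *: x)) k0.
have C0 : 0 <= C.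
  have := le_trans (nr_ge0 _) (hC 0); rewrite pmulr_lge0 // exprn_gt0 // invr_gt0 pw_gt0 //.
have D0 : 0 <= D.
  by have := le_trans (pwinv_ge0 _) (hD 0); rewrite pmulr_lge0 // invr_gt0 pw_gt0.
exists (G * jb x ^+ q * (C * D ^+ q.+1) * (2 ^+ n) ^+ q) => z.
have h2 : nr (f (kap e x z) : R[i]) <= C * (D * pwinv z) ^+ q.+1.
  apply: (le_trans (hC _)); rewrite ler_wpM2l // lerXn2r ?nnegrE ?pwinv_ge0 ?mulr_ge0 ?pwinv_ge0 //.
  by rewrite kapE.
apply: (le_trans (ler_pM (nr_ge0 _) (nr_ge0 _) (jbg x (rsubmx z) e1) h2)).
rewrite [(D * _) ^+ _]exprMn.
have -> : G * jb x ^+ q * jb (rsubmx z) ^+ q * (C * (D ^+ q.+1 * pwinv z ^+ q.+1)) =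
    G * jb x ^+ q * (C * D ^+ q.+1) * (jb (rsubmx z) ^+ q * pwinv z ^+ q.+1).
  by move: (D ^+ _) (pwinv z ^+ _) (jb x ^+ q) (jb (rsubmx z) ^+ q) => a b d k'; ring.
rewrite -[X in _ <= X]mulrA.
apply: ler_wpM2l; first by rewrite !mulr_ge0 ?exprn_ge0 // ltW // jb_gt0.
rewrite exprSr mulrA ler_wpM2r ?pwinv_ge0 // -exprMn lerXn2r ?nnegrE ?exprn_ge0 ?mulr_ge0 ?pwinv_ge0 ?(ltW (jb_gt0 _)) //.
apply: (@le_trans _ _ (jb (rsubmx z) * pwinv (rsubmx z))).
  by rewrite ler_wpM2l ?(ltW (jb_gt0 _)) ?pwinv_le_r.
by rewrite /pwinv ler_pdivrMr ?pw_gt0 // jb_le_pw.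
Qed.

Lemma growth_shift x e : `|e| <= 1 -> forall y, nr (g (x + e *: y) : R[i]) <= (G * jb x ^+ q) * jb y ^+ q.
Proof. by move=> e1 y; exact: jbg. Qed.

Let GJ0 x : 0 <= G * jb x ^+ q.
Proof. by rewrite mulr_ge0 // exprn_ge0 // ltW // jb_gt0. Qed.

(** At e = 0 the amplitude is the constant [g x] and the cutoff depends on s only, so the limit
    integral is [g x] times the constant of [KE]. *)
Lemma cint_oscint_cvg x : (fun e => cint (oscint phi g x e)) @ 0^' -->
  ((phi 0 : R[i]) * ((2 * pi) ^+ n)%:C%C * (g x : R[i]) : R[i]^o).
Proof.
have [C C0 hC] := psi_bound.
have nE1 : cnice (E (fun=> 1) (fun z => psi (kap 0 0 z))).
  split; first exact: E_continuous one_continuous (@psik_continuous 0 0).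
  by eexists; exact: (E_bound ler01 C0 one_bound (psik_bound _ _ C0 hC)).
have KQ : (phi 0 : R[i]) * ((2 * pi) ^+ n)%:C%C * (g x : R[i]) =
    cint (E (fun y => g (x + 0 *: y)) (fun z => psi (kap 0 x z))).
  rewrite -KE mulrC /K -cintZ //; congr cint; apply/funext => z.
  rewrite /E /kap !scale0r addr0 mul1r mulrCA; congr (_ * _).
  by rewrite mulrCA.
rewrite KQ.
have lim : (fun e => cint (E (fun y => g (x + e *: y)) (fun z => psi (kap e x z)))) @ 0^' -->
    cint (E (fun y => g (x + 0 *: y)) (fun z => psi (kap 0 x z))).
  apply: (@cint_dnbhs _ _ _ _ (C * (2 ^+ n) ^+ q * (G * jb x ^+ q))).
  - by move=> e _ _; exact: E_continuous (@comp_shift_continuous x e) (@psik_continuous e x).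
  - exact: E_continuous (@comp_shift_continuous x 0) (@psik_continuous 0 x).
  - by move=> e z _ e1; exact: (E_bound (GJ0 x) C0 (growth_shift x (ltW e1)) (psik_bound e x C0 hC)).
  - move=> z; apply: cvgM; first exact: cvg_cst.
    apply: cvgM; first exact: cvg_cst.
    have ce (y : 'rV[R]_n) : (fun e : R => x + e *: y) @ 0^' --> x + 0 *: y.
      rewrite scale0r; apply: cvgD; [exact: cvg_cst|exact: cvg_scale0].
    apply: cvgM.
      apply: (@cvg_comp _ _ _ (fun e : R => x + e *: rsubmx z) g (0^') (nbhs (x + 0 *: rsubmx z))); first exact: ce.
      exact: cg.
    apply: (@cvg_comp _ _ _ (fun e : R => kap e x z) psi (0^') (nbhs (kap 0 x z))); last exact: psi_continuous.
    apply: (@cvg_comp _ _ _ (fun e : R => e *: (x + e *: rsubmx z)) (fun y => row_mx (lsubmx z) y : Z) (0^') (nbhs (0 *: (x + 0 *: rsubmx z)))); last exact: row_mx_continuousr.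
    apply: cvgZ; last exact: ce.
    exact: (@cvg_within_filter _ _ (fun d : R => d)) cvg_id.
by apply: cvg_dnbhs_eq lim => e e0 e1; exact: cint_oscintE.
Qed.

End WithSymbol.

(** Uniform in [e] and linear in the growth constant of the amplitude: this is what allows summation
    over all Fourier coefficients of a symbol before [e] tends to 0. *)
Lemma cint_oscint_bound : exists2 C, 0 <= C &
  forall (g : 'rV[R]_n -> R[i]^o) (G : R) x e, continuous g ->
  (forall y, nr (g y : R[i]) <= G * jb y ^+ q) -> e != 0 -> `|e| <= 1 ->
  nr (cint (oscint phi g x e) : R[i]) <= C * G * jb x ^+ q.
Proof.
have [C C0 hC] := psi_bound.
exists (2 * (C * (2 ^+ n) ^+ q * pi ^+ (n + n))); first by rewrite !mulr_ge0 ?exprn_ge0 // pi_ge0.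
move=> g G x e cg bg e0 e1; rewrite (cint_oscintE cg bg) //.
have GJ0 : 0 <= G * jb x ^+ q.
  have := le_trans (nr_ge0 _) (bg 0); rewrite pmulr_lge0 ?exprn_gt0 ?jb_gt0 // => G0.
  by rewrite mulr_ge0 // exprn_ge0 // ltW // jb_gt0.
have := cint_bound (E_continuous (@comp_shift_continuous g cg x e) (@psik_continuous e x))
  (E_bound GJ0 C0 (growth_shift bg x e1) (psik_bound e x C0 hC)).
move=> h; apply: le_trans h _; rewrite le_eqVlt; apply/orP; left; apply/eqP.
by move: ((2 ^+ n) ^+ q) (pi ^+ (n + n)) (jb x ^+ q) => a b c; ring.
Qed.

End Growth.
End OscillatoryIntegral.

(** * Operators on Fourier series *)

Section SumFubini.
Context {R : realType}.

Definition enumN (I : countType) (N : nat) : seq I := pmap (@pickle_inv I) (iota 0 N).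

Lemma mem_enumN (I : countType) (i : I) : \forall N \near \oo, i \in enumN I N.
Proof.
exists (pickle i).+1 => // N /= iN; rewrite /enumN mem_pmap.
by apply/mapP; exists (pickle i); rewrite ?mem_iota ?pickleK_inv.
Qed.

(** Writing finite sums as series over the whole index type makes truncations accessible to
    dominated convergence. *)
Lemma csum_finite (I : countType) (V : completeNormedModType R[i]) (f : I -> V) (s : seq I) :
  uniq s -> csum (fun i => if i \in s then f i else 0) = \sum_(i <- s) f i.
Proof.
have hb (t : seq I) : summable_bound (fun i => if i \in t then nr (f i) else 0).
  split=> [i|]; first by case: ifP => // _; exact: nr_ge0.
  exists (\sum_(i <- undup t) nr (f i)) => u uu.
  rewrite -big_mkcond /= -big_filter; apply: sum_uniq_sub.
  - by move=> i; exact: nr_ge0.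
  - exact: filter_uniq.
  - exact: undup_uniq.
  - by move=> i; rewrite mem_filter mem_undup => /andP[].
have hn (t : seq I) i : nr (if i \in t then f i else 0) <= (if i \in t then nr (f i) else 0).
  by case: ifP => // _; rewrite nr0.
elim: s => [|i s IH] /= us.
  rewrite big_nil; apply: csum_unique.
  rewrite (_ : psum _ = fun=> 0); first exact: cvg_cst.
  by apply/funext => N; rewrite /psum big1 // => k _; rewrite /cseq; case: pickle_inv.
have /andP[is_ us'] := us; rewrite big_cons -IH //.
have -> : (fun j => if j \in i :: s then f j else 0) =
    (fun j => (if j \in [:: i] then f j else 0) + (if j \in s then f j else 0)).
  apply/funext => j; rewrite inE mem_seq1; case: eqVneq => [->|_] /=; last by rewrite add0r.
  by rewrite (negbTE is_) addr0.
rewrite (csumD (hb [:: i]) (hb s) (hn _) (hn _)); congr (_ + _).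
rewrite (@csum_single _ _ _ _ i) ?mem_seq1 ?eqxx // => j ji.
by rewrite mem_seq1 (negbTE ji).
Qed.

Section Pair.
Context {I J : countType} {V : completeNormedModType R[i]} {f : I * J -> V}
  {b : I -> R} {c : J -> R}.
Context (hb : summable_bound b) (hc : summable_bound c)
  (hf : forall i j, nr (f (i, j)) <= b i * c j).

(** Truncation to a finite rectangle, where the double and the iterated series are the same finite
    sum; letting N grow identifies the two full series. *)
Let fN N (p : I * J) := if p \in [seq (i, j) | i <- enumN I N, j <- enumN J N] then f p else 0.

Let fNE N i j : fN N (i, j) = if (i \in enumN I N) && (j \in enumN J N) then f (i, j) else 0.
Proof.
rewrite /fN; congr (if _ then _ else _).
by apply/allpairsP/andP => [[[i' j'] /= [h1 h2 [-> ->]]]//|[h1 h2]]; exists (i, j).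
Qed.

Let fN_bound N i j : nr (fN N (i, j)) <= b i * c j.
Proof. by rewrite fNE; case: ifP => // _; rewrite nr0 mulr_ge0 ?(proj1 hb) ?(proj1 hc). Qed.

Let fN_cvg i j : fN ^~ (i, j) @ \oo --> f (i, j).
Proof.
apply: cvg_near_cst; near=> N; rewrite fNE.
have -> : i \in enumN I N by near: N; exact: mem_enumN.
by have -> : j \in enumN J N by near: N; exact: mem_enumN.
Unshelve. all: by end_near.
Qed.

Lemma csum_rectangles :
  (fun N => \sum_(i <- enumN I N) \sum_(j <- enumN J N) f (i, j)) @ \oo --> csum f.
Proof.
have e N : \sum_(i <- enumN I N) \sum_(j <- enumN J N) f (i, j) = csum (fN N).
  rewrite /fN csum_finite ?big_allpairs //.
  by apply: allpairs_uniq => [||[i j] [i' j'] _ _ [-> ->]//]; exact: pmap_pickle_uniq.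
rewrite (_ : (fun N => _) = fun N => csum (fN N)); last by apply/funext.
apply: (cvg_csum _ (summable_bound_prod hb hc)) => [|[i j]]; last exact: fN_cvg.
by apply: nearW => N [i j]; exact: fN_bound.
Qed.

Lemma csum_rectangles_iterated :
  (fun N => \sum_(i <- enumN I N) \sum_(j <- enumN J N) f (i, j)) @ \oo -->
  csum (fun i => csum (fun j => f (i, j))).
Proof.
have [b0 [B hB]] := hb; have [c0 [C hC]] := hc.
have C0 : 0 <= C by have := hC [::] isT; rewrite big_nil.
have e N : \sum_(i <- enumN I N) \sum_(j <- enumN J N) f (i, j) = csum (fun i => csum (fun j => fN N (i, j))).
  rewrite -(csum_finite _ (pmap_pickle_uniq I N)) -/(enumN I N); congr csum; apply/funext => i.
  case: ifP => hi.
    rewrite -(csum_finite (fun j => f (i, j)) (pmap_pickle_uniq J N)); congr csum; apply/funext => j.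
    by rewrite fNE hi.
  symmetry; apply: csum_unique; rewrite (_ : psum _ = fun=> 0); first exact: cvg_cst.
  apply/funext => M; rewrite /psum big1 // => k _; rewrite /cseq; case: pickle_inv => //= j.
  by rewrite fNE hi.
rewrite (_ : (fun N => _) = fun N => csum (fun i => csum (fun j => fN N (i, j)))); last by apply/funext.
have hin i : summable_bound (fun j => b i * c j) by exact: summable_boundZ.
apply: (cvg_csum _ (b := fun i => C * b i)); first exact: summable_boundZ.
  apply: nearW => N i; apply: (@csum_norm _ _ _ _ (fun j => b i * c j)); first exact: fN_bound.
  move=> s us; rewrite -mulr_sumr mulrC ler_wpM2r //; exact: hC.
move=> i; apply: (cvg_csum _ (hin i)) => [|j]; last exact: fN_cvg.
by apply: nearW => N j; exact: fN_bound.
Qed.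

Lemma csum_pair : csum f = csum (fun i => csum (fun j => f (i, j))).
Proof. exact: (cvg_unique (@norm_hausdorff _ V) csum_rectangles csum_rectangles_iterated). Qed.

End Pair.

Lemma csum_pair_swap (I J : countType) (V : completeNormedModType R[i]) (f : I * J -> V)
    (b : I -> R) (c : J -> R) :
  summable_bound b -> summable_bound c -> (forall i j, nr (f (i, j)) <= b i * c j) ->
  csum f = csum (fun j => csum (fun i => f (i, j))).
Proof.
move=> hb hc hf; apply: (cvg_unique (@norm_hausdorff _ V) (csum_rectangles hb hc hf)).
have h := @csum_rectangles_iterated J I V (fun p => f (p.2, p.1)) c b hc hb _.
rewrite (_ : (fun N => _) = fun N => \sum_(j <- enumN J N) \sum_(i <- enumN I N) f (i, j)).
  by apply: h => j i; rewrite mulrC.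
by apply/funext => N; rewrite exchange_big.
Qed.

(** The partial sums share the majorant K [pwinv], where K bounds all finite sums of [b], so
    dominated convergence in N exchanges series and integral. *)
Lemma cint_psum m (I : countType) (F : I -> 'rV[R]_m -> R[i]^o) (b : I -> R) (S : 'rV[R]_m -> R[i]^o) :
  summable_bound b -> (forall i, continuous (F i)) ->
  (forall i z, nr (F i z : R[i]) <= b i * pwinv z) ->
  continuous S -> (forall z, psum (F ^~ z) @ \oo --> S z) ->
  cnice S /\ psum (fun i => cint (F i)) @ \oo --> cint S.
Proof.
move=> hb cF hF cS hS; have [b0 [K hK]] := hb.
have pS N z : nr (psum (F ^~ z) N : R[i]^o) <= K * pwinv z.
  apply: (le_trans (@psum_norm R I R[i]^o (F ^~ z) (fun i => b i * pwinv z) N (hF ^~ z))).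
  by apply: psum_bound => s us; rewrite -mulr_suml ler_wpM2r ?pwinv_ge0 ?hK.
split.
  by split => //; exists K => z; exact: (cvg_nr_ge (hS z) (fun N => pS N z)).
have nF i : cnice (F i) by split; [exact: cF|exists (b i); exact: hF].
have hN N : cnice (fun z => psum (F ^~ z) N : R[i]^o) /\
    cint (fun z => psum (F ^~ z) N) = psum (fun i => cint (F i)) N.
  have cst0 : cnice (fun _ : 'rV[R]_m => 0 : R[i]^o) /\ cint (fun _ : 'rV[R]_m => 0 : R[i]^o) = 0.
    have -> : (fun _ : 'rV[R]_m => 0 : R[i]^o) = fun z => (0 : R[i]) * (pwinv z)%:C%C.
      by apply/funext => z; rewrite mul0r.
    have np : cnice (fun z : 'rV[R]_m => (pwinv z)%:C%C : R[i]^o).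
      split; first by apply: complexR_continuous; exact: pwinv_continuous.
      by exists 1 => z; rewrite nr_real mul1r ger0_norm ?pwinv_ge0.
    by split; [exact: cniceZ|rewrite cintZ // mul0r].
  elim: N => [|N [IH1 IH2]].
    have -> : (fun z => psum (F ^~ z) 0) = fun=> 0 by apply/funext => z; rewrite /psum big_ord0.
    by rewrite /psum big_ord0.
  have -> : (fun z => psum (F ^~ z) N.+1) = fun z => psum (F ^~ z) N + cseq (F ^~ z) N.
    by apply/funext => z; rewrite /psum big_ord_recr.
  have h : cnice (fun z => cseq (F ^~ z) N : R[i]^o) /\
      cint (fun z => cseq (F ^~ z) N) = cseq (fun i => cint (F i)) N.
    by rewrite /cseq; case: pickle_inv => [i|] /=.
  split; first exact: cniceD IH1 h.1.
  by rewrite (cintD IH1 h.1) IH2 h.2 {2}/psum big_ord_recr.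
have -> : psum (fun i => cint (F i)) = fun N => cint (fun z => psum (F ^~ z) N).
  by apply/funext => N; rewrite (hN N).2.
apply: (@cint_cvgF _ nat \oo _ (fun k => [set j | (k <= j)%N]) _ _ _ K).
- by move=> k; exists k.
- by move=> k j kj l /=; exact: leq_trans.
- by move=> A [k _ hk]; exists k.
- by move=> N _; exact: (hN N).1.1.
- exact: cS.
- by move=> N z _; exact: pS.
- exact: hS.
Qed.

End SumFubini.

Section Operators.
Context {R : realType} {n : nat} {theta : 'M[R]_n} (T : ncTorus theta).
#[local] Opaque pderiv.

Section UniformlyRapid.
Context {I : countType} {U : I -> T} {q : I -> 'rV[int]_n} {om : I -> R}.
Context (E : eigenfamily U q om).

Lemma cvg_fsum_uniform (S : Type) (F : set_system S) (FF : ProperFilter F) (B : set S)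
    (y : S -> I -> R[i]) (l : I -> R[i]) : F B ->
  (forall p, exists C, forall t i, B t -> om i ^+ p * nr (y t i) <= C) ->
  (forall i, (fun t => y t i : R[i]^o) @ F --> (l i : R[i]^o)) ->
  (fun t => fsum U (y t)) @ F --> fsum U l.
Proof.
move=> FB hy hl; have [p hp] := ef_sum E; have [C hC] := hy p.
have hb : summable_bound (fun i => `|C| * (om i ^+ p)^-1) by exact: summable_boundZ.
apply: (cvg_csum _ hb).
  apply: filterS FB => t Bt i; apply: (le_trans (nr_U_le E _ _)).
  rewrite ler_pdivlMr ?exprn_gt0 ?(om_gt0 E) // mulrC.
  by apply: le_trans (hC t i Bt) _; exact: ler_norm.
by move=> i; apply: cvgZr_tmp; exact: hl.
Qed.

End UniformlyRapid.

Local Notation L := 'rV[int]_n.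
Local Notation om := (fun k : L => pw (kvec (R := R) k)).
Local Notation om2 := (fun p : L * L => pw (kvec (R := R) p.1) * pw (kvec (R := R) p.2)).
Local Notation mm := (fun p : L * L => mon T p.1 * mon T p.2).
Local Notation smooth := (smooth_vec (ncta T)).

Lemma csum_mulr (I : countType) (f : I -> T) (b : I -> R) (a : T) :
  summable_bound b -> (forall i, nr (f i) <= b i) -> csum (fun i => f i * a) = csum f * a.
Proof.
move=> hb fb; apply: csum_unique.
have -> : psum (fun i => f i * a) = fun N => psum f N * a.
  apply/funext => N; rewrite /psum mulr_suml; apply: eq_bigr => k _.
  by rewrite /cseq; case: pickle_inv => //=; rewrite mul0r.
apply: (@cvg_comp _ _ _ (psum f) (fun c => c * a) \oo (nbhs (csum f))); first exact: csum_cvg hb fb.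
exact: continuous_mulr.
Qed.

Lemma csum_mull (I : countType) (f : I -> T) (b : I -> R) (a : T) :
  summable_bound b -> (forall i, nr (f i) <= b i) -> csum (fun i => a * f i) = a * csum f.
Proof.
move=> hb fb; apply: csum_unique.
have -> : psum (fun i => a * f i) = fun N => a * psum f N.
  apply/funext => N; rewrite /psum mulr_sumr; apply: eq_bigr => k _.
  by rewrite /cseq; case: pickle_inv => //=; rewrite mulr0.
apply: (@cvg_comp _ _ _ (psum f) (fun c => a * c) \oo (nbhs (csum f))); first exact: csum_cvg hb fb.
exact: continuous_mull.
Qed.

Lemma csumZ (I : countType) (f : I -> T) (b : I -> R) (c : R[i]) :
  summable_bound b -> (forall i, nr (f i) <= b i) -> csum (fun i => c *: f i) = c *: csum f.
Proof.
move=> hb fb; apply: csum_unique.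
have -> : psum (fun i => c *: f i) = fun N => c *: psum f N.
  apply/funext => N; rewrite /psum scaler_sumr; apply: eq_bigr => k _.
  by rewrite /cseq; case: pickle_inv => //=; rewrite scaler0.
by apply: cvgZl_tmp; exact: csum_cvg hb fb.
Qed.

Lemma fsumM (x y : L -> R[i]) : rapid om x -> rapid om y ->
  fsum (mon T) x * fsum (mon T) y = fsum mm (fun p => x p.1 * y p.2).
Proof.
move=> hx hy; have [b hb xb] := rapid_bound (mon_family T) hx; have [c hc yc] := rapid_bound (mon_family T) hy.
have nU (v : L -> R[i]) (d : L -> R) (vd : forall i, nr (v i) <= d i) i : nr (v i *: mon T i) <= d i.
  by apply: le_trans (vd i); exact: (nr_U_le (mon_family T)).
have [b0 _] := hb; have [c0 _] := hc.
rewrite /fsum -(csum_mulr _ hb (nU x b xb)) (csum_pair hb hc); last first.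
  move=> i j; apply: (le_trans (nr_U_le (mon_mul_family T) _ _)).
  by rewrite /= nrM; apply: ler_pM => //; exact: nr_ge0.
congr csum; apply/funext => i.
rewrite -(csum_mull _ hc (nU y c yc)); congr csum; apply/funext => j.
by rewrite /= -scalerAl -scalerAr scalerA.
Qed.

Lemma rapidZ (I : Type) (w : I -> R) (c : R[i]) (x : I -> R[i]) : rapid w x -> rapid w (fun i => c * x i).
Proof.
move=> hx p; have [C C0 hC] := hx p; exists (nr c * C); first by rewrite mulr_ge0 ?nr_ge0.
by move=> i; rewrite nrM mulrCA ler_wpM2l ?nr_ge0.
Qed.

Lemma rapid_prod (x y : L -> R[i]) : rapid om x -> rapid om y ->
  rapid om2 (fun p => x p.1 * y p.2).
Proof.
move=> hx hy p; have [C C0 hC] := hx p; have [D D0 hD] := hy p.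
exists (C * D); first exact: mulr_ge0.
move=> a; rewrite exprMn nrM mulrACA.
by apply: ler_pM => //; rewrite mulr_ge0 ?nr_ge0 // exprn_ge0 // ltW // pw_gt0.
Qed.

Section Op.
Context (M : R) (c : L -> 'rV[R]_n -> R[i]^o).
Context (hc : csym om M c).

Lemma csym_growth : exists q : nat, forall p, exists2 C : R, 0 <= C & forall k y,
  nr (c k y : R[i]) <= C * (om k ^+ p)^-1 * jb y ^+ q.
Proof.
have [q hq] := jb_powR_le (n := n) M; exists q => p.
have [C C0 hC] := hc.2 p [::]; exists C => // k y.
have o0 : 0 < om k by rewrite pw_gt0.
rewrite mulrAC ler_pdivlMr ?exprn_gt0 // mulrC; apply: le_trans (hC k y) _.
by rewrite subr0 ler_wpM2l.
Qed.

(* The pairs (k, m) index U^k U^m, and the sum over k gives x_m rho(m) U^m. *)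
Definition opcoef (x : L -> R[i]) (p : L * L) : R[i] := (c p.1 (kvec p.2) : R[i]) * x p.2.

Definition opc (x : L -> R[i]) : T := fsum mm (opcoef x).

(** Decay in the first index comes from the symbol, and the polynomial growth of the matrix
    coefficients in the second index is absorbed by the rapid decay of [x]. The parameter t keeps
    the bounds uniform, for use under limits. *)
Lemma rapid_growth (S : Type) (B : set S) (x : S -> L -> R[i]) (J : S -> L * L -> R[i]) q :
  (forall p, exists C, forall t k, B t -> om k ^+ p * nr (x t k) <= C) ->
  (forall p, exists2 C : R, 0 <= C & forall t a, B t ->
     nr (J t a) <= C * (om a.1 ^+ p)^-1 * jb (kvec (R := R) a.2) ^+ q) ->
  forall p, exists C, forall t a, B t -> om2 a ^+ p * nr (J t a * x t a.2) <= C.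
Proof.
move=> hx hJ p; have [C hC] := hx (p + q)%N; have [D D0 hD] := hJ p.
exists (D * (2 ^+ n) ^+ q * C) => t a Bt; rewrite nrM.
have o1 : 0 < om a.1 by rewrite pw_gt0.
have o2 : 0 < om a.2 by rewrite pw_gt0.
apply: (@le_trans _ _ (om2 a ^+ p * (D * (om a.1 ^+ p)^-1 * ((2 ^+ n) ^+ q * om a.2 ^+ q) * nr (x t a.2)))).
  rewrite ler_wpM2l ?exprn_ge0 ?mulr_ge0 ?(ltW o1) ?(ltW o2) // ler_wpM2r ?nr_ge0 //.
  apply: (le_trans (hD t a Bt)); rewrite ler_wpM2l ?mulr_ge0 ?invr_ge0 ?exprn_ge0 ?(ltW o1) //.
  by rewrite -exprMn lerXn2r ?nnegrE ?mulr_ge0 ?exprn_ge0 ?(ltW (jb_gt0 _)) ?(ltW o2) // jb_le_pw.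
have e0 : om a.1 ^+ p != 0 by rewrite gt_eqF // exprn_gt0.
rewrite exprMn.
have -> : om a.1 ^+ p * om a.2 ^+ p * (D * (om a.1 ^+ p)^-1 * ((2 ^+ n) ^+ q * om a.2 ^+ q) * nr (x t a.2)) =
  D * (2 ^+ n) ^+ q * (om a.2 ^+ (p + q) * nr (x t a.2)).
  rewrite exprD; move: e0; move: (om a.1 ^+ p) (om a.2 ^+ p) (om a.2 ^+ q) ((2 ^+ n) ^+ q) (nr _) => u v w z r u0.
  by field.
by rewrite ler_wpM2l ?mulr_ge0 ?exprn_ge0 //; exact: hC.
Qed.

Lemma rapid_uniform (x : L -> R[i]) : rapid om x ->
  forall p, exists C, forall (t : unit) k, [set: unit] t -> om k ^+ p * nr (x k) <= C.
Proof. by move=> hx p; have [C _ hC] := hx p; exists C => t k _. Qed.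

Lemma opcoef_rapid x : rapid om x -> rapid om2 (opcoef x).
Proof.
move=> hx p; have [q hq] := csym_growth.
have [C hC] := @rapid_growth unit setT (fun _ => x) (fun _ a => c a.1 (kvec a.2)) q (rapid_uniform hx)
  (fun p => let: ex_intro2 C C0 hC := hq p in ex_intro2 _ _ C C0 (fun t a _ => hC a.1 (kvec a.2))) p.
exists C; last by move=> a; exact: (hC tt a I).
by apply: le_trans (hC tt (0, 0) I); rewrite mulr_ge0 ?nr_ge0 // exprn_ge0 // mulr_ge0 // ltW // pw_gt0.
Qed.

End Op.
End Operators.

Section OscillatoryOperators.
Context {R : realType} {n : nat} {theta : 'M[R]_n} (T : ncTorus theta).
#[local] Opaque pderiv.
Local Notation L := 'rV[int]_n.
Local Notation Z := 'rV[R]_(n + n).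
Local Notation om := (fun k : L => pw (kvec (R := R) k)).
Local Notation om2 := (fun p : L * L => pw (kvec (R := R) p.1) * pw (kvec (R := R) p.2)).
Local Notation mm := (fun p : L * L => mon T p.1 * mon T p.2).
Context (M : R) (c : L -> 'rV[R]_n -> R[i]^o) (hc : csym om M c).
Context (x : L -> R[i]) (hx : rapid om x) (phi : Z -> R[i]^o) (rphi : rdec phi).

Definition osccoef (e : R) (a : L * L) : R[i] :=
  (cint (oscint phi (c a.1) (kvec a.2) e) : R[i]) * x a.2.

Let Y (e : R) (z : Z) (a : L * L) : R[i] := (oscint phi (c a.1) (kvec a.2) e z : R[i]) * x a.2.

Let jb1 (y : 'rV[R]_n) q (C : R) : 0 <= C -> C <= C * jb y ^+ q.
Proof. by move=> C0; rewrite ler_peMr // exprn_ege1 // jb_ge1. Qed.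

Let om2n_ge0 (a : L * L) p (u : R[i]) : 0 <= om2 a ^+ p * nr u.
Proof. by rewrite mulr_ge0 ?nr_ge0 ?exprn_ge0 ?mulr_ge0 // ltW // pw_gt0. Qed.

Let c_continuous k : continuous (c k).
Proof. exact: Cinfty_continuous (hc.1 k). Qed.

Lemma osccoef_rapid e : e != 0 -> rapid om2 (osccoef e).
Proof.
move=> e0 p; have [q hq] := csym_growth hc.
have [B B0 hB] := oscint_bound q rphi e0.
have [|C hC] := @rapid_growth R n unit setT (fun _ => x) (fun _ a => cint (oscint phi (c a.1) (kvec a.2) e)) q (rapid_uniform hx) _ p.
  move=> p'; have [C C0 hC] := hq p'.
  exists (2 * (B * C * pi ^+ (n + n))); first by rewrite !mulr_ge0 ?exprn_ge0 // pi_ge0.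
  move=> t a _; have [cf _] := oscint_nice rphi (@c_continuous a.1) (hC a.1) (kvec a.2) e0.
  apply: (le_trans (cint_bound cf (hB _ _ (kvec a.2) (hC a.1)))).
  apply: le_trans (jb1 (kvec a.2) q _); last first.
    by rewrite !mulr_ge0 ?invr_ge0 ?exprn_ge0 ?pi_ge0 // ltW // pw_gt0.
  by rewrite le_eqVlt; apply/orP; left; apply/eqP; move: (pi ^+ _) (_^-1) => u v; ring.
exists C; last by move=> a; exact: (hC tt a I).
by apply: le_trans (hC tt (0, 0) I); exact: om2n_ge0.
Qed.

Let Y_bound e p : e != 0 -> exists C, forall z a, om2 a ^+ p * nr (Y e z a) <= C * pwinv z.
Proof.
move=> e0; have [q hq] := csym_growth hc.
have [B B0 hB] := oscint_bound q rphi e0.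
have [||C hC] := @rapid_growth R n Z setT (fun _ => x)
    (fun z a => (pw z)%:C%C * (oscint phi (c a.1) (kvec a.2) e z : R[i])) q _ _ p.
- by move=> p'; have [C hC] := rapid_uniform hx p'; exists C => z k _; exact: (hC tt k I).
- move=> p'; have [C C0 hC] := hq p'.
  exists (B * C); first by rewrite mulr_ge0.
  move=> z a _; rewrite nrM nr_real gtr0_norm ?pw_gt0 //.
  apply: le_trans (jb1 (kvec a.2) q _); last first.
    by rewrite !mulr_ge0 ?invr_ge0 ?exprn_ge0 // ltW // pw_gt0.
  rewrite mulrC -ler_pdivlMr ?pw_gt0 //; apply: (le_trans (hB _ _ (kvec a.2) (hC a.1) z)).
  by rewrite mulrA.
exists C => z a; rewrite -[pwinv z]/((pw z)^-1) ler_pdivlMr ?pw_gt0 //.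
have := hC z a I; rewrite -mulrA nrM nr_real gtr0_norm ?pw_gt0 // => h.
by rewrite -mulrA [nr _ * _]mulrC.
Qed.

Let Y_rapid e z : e != 0 -> rapid om2 (Y e z).
Proof.
move=> e0 p; have [C hC] := Y_bound p e0.
exists (C * pwinv z); last by move=> a; exact: hC.
apply: le_trans (hC z (0, 0)); exact: om2n_ge0.
Qed.

Definition osc_scalar (e : R) (z : Z) : T :=
  ((phi (e *: z) : R[i]) * cexp (- dotv (lsubmx z) (rsubmx z))) *:
  (fsum (mon T) (c ^~ (rsubmx z)) * ncta T (lsubmx z) (fsum (mon T) x)).

Let osc_scalarE e z : e != 0 -> osc_scalar e z = fsum mm (Y e z).
Proof.
move=> e0; rewrite /osc_scalar (ncta_fsum (mon_family T) _ hx).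
have rx : rapid om (fun i => x i * cexp (dotv (lsubmx z) (kvec i))).
  by apply: (rapid_le (mon_family T) hx) => i; rewrite nrM nr_cexp mulr1.
have rc : rapid om (fun k => c k (rsubmx z) : R[i]) := csym_rapid [::] (rsubmx z) hc.
rewrite fsumM //.
have rp : rapid om2 (fun p => (c p.1 (rsubmx z) : R[i]) * (x p.2 * cexp (dotv (lsubmx z) (kvec p.2)))).
  exact: (rapid_prod rc rx).
have [b hb yb] := rapid_bound (mon_mul_family T) rp.
rewrite /fsum -(csumZ _ hb (fun i => le_trans (nr_U_le (mon_mul_family T) _ _) (yb i))).
congr csum; apply/funext => a; rewrite scalerA; congr (_ *: _).
rewrite /Y /oscint.
have -> : dotv (lsubmx z) (kvec a.2 - rsubmx z) = - dotv (lsubmx z) (rsubmx z) + dotv (lsubmx z) (kvec a.2).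
  by rewrite /dotv -sumrN -big_split /=; apply: eq_bigr => j _; rewrite !mxE; ring.
rewrite cexpD; ring.
Qed.

(** A continuous functional turns the integrand into a scalar series dominated by a summable
    multiple of [pwinv], which is integrated term by term. *)
Lemma osc_scalar_integral e : e != 0 -> is_integral (osc_scalar e) (fsum mm (osccoef e)).
Proof.
move=> e0 Lf cL.
have [q hq] := csym_growth hc.
have [p hp] := ef_sum (mon_mul_family T).
have [C hC] := Y_bound p e0.
have [CL CL0 hCL] := linear_bounded cL.
have oc a : continuous (fun z => oscint phi (c a.1) (kvec a.2) e z).
  have [C1 C10 hC1] := hq 0%N.
  by have [] := oscint_nice rphi (@c_continuous a.1) (hC1 a.1) (kvec a.2) e0.
pose F (a : L * L) z : R[i]^o := Lf (mm a) * Y e z a.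
have FL z : F ^~ z = Lf \o (fun a => Y e z a *: mm a).
  by apply/funext => a; rewrite /F /= linearZ /= mulrC.
have cF a : continuous (F a).
  by move=> z; apply: (cvgM (FF := nbhs_filter z)); [exact: cvg_cst|apply: (cvgM (FF := nbhs_filter z)); [exact: oc|exact: cvg_cst]].
have C0 : 0 <= C.
  have := hC 0 (0, 0); set l := (X in X <= _) => h.
  have : 0 <= l by rewrite /l; exact: om2n_ge0.
  by move=> /le_trans/(_ h); rewrite pmulr_lge0 // invr_gt0 pw_gt0.
have hb : summable_bound (fun a : L * L => CL * C * (om2 a ^+ p)^-1).
  by apply: summable_boundZ => //; rewrite mulr_ge0.
have bF a z : nr (F a z : R[i]) <= CL * C * (om2 a ^+ p)^-1 * pwinv z.
  rewrite nrM -!mulrA; apply: ler_pM; rewrite ?nr_ge0 //.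
    by apply: (le_trans (hCL _)); rewrite ler_piMr // (ef_norm (mon_mul_family T)).
  have o0 : 0 < om2 a ^+ p by rewrite exprn_gt0 // mulr_gt0 // pw_gt0.
  by rewrite mulrCA mulrC ler_pdivlMr // mulrC; exact: hC.
have cS : continuous (fun z => Lf (osc_scalar e z) : R[i]^o).
  move=> z; apply: (@cvg_comp _ _ _ (osc_scalar e) Lf (nbhs z) (nbhs (osc_scalar e z))); last exact: cL.
  rewrite (osc_scalarE z e0) (_ : osc_scalar e = fun z => fsum mm (Y e z)); last by apply/funext => y; exact: osc_scalarE.
  apply: (@cvg_fsum_uniform _ _ _ _ _ _ _ _ (mon_mul_family T) _ (nbhs z) (nbhs_pfilter z) setT); first exact: filterT.
    move=> p'; have [C' hC'] := Y_bound p' e0; exists `|C'| => t a _.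
    apply: (le_trans (hC' t a)); apply: (@le_trans _ _ (`|C'| * pwinv t)).
      by rewrite ler_wpM2r ?pwinv_ge0 ?ler_norm.
    by rewrite ler_piMr // pwinv_le1.
  by move=> a; apply: (cvgM (FF := nbhs_filter z)); [exact: oc|exact: cvg_cst].
have hS z : psum (F ^~ z) @ \oo --> (Lf (osc_scalar e z) : R[i]^o).
  rewrite FL osc_scalarE //.
  have -> : psum (Lf \o (fun a => Y e z a *: mm a)) = Lf \o psum (fun a => Y e z a *: mm a).
    by apply/funext => N; rewrite -(psum_morph Lf).
  apply: (@cvg_comp _ _ _ (psum (fun a => Y e z a *: mm a)) Lf \oo (nbhs (fsum mm (Y e z)))); last exact: cL.
  exact: (fsum_cvg (mon_mul_family T) (Y_rapid z e0)).
have [nS lim] := cint_psum hb cF bF cS hS.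
split.
- exact: (rnice_integrable (cnice_Re nS)).
- exact: (rnice_integrable (cnice_Im nS)).
have lim2 : psum (fun a => cint (F a)) @ \oo --> (Lf (fsum mm (osccoef e)) : R[i]^o).
  have -> : (fun a => cint (F a)) = Lf \o (fun a => osccoef e a *: mm a).
    apply/funext => a; rewrite /= linearZ /= /F /osccoef /Y.
    have [C1 C10 hC1] := hq 0%N.
    have no := oscint_nice rphi (@c_continuous a.1) (hC1 a.1) (kvec a.2) e0.
    have -> : (fun z : Z => Lf (mm a) * ((oscint phi (c a.1) (kvec a.2) e z : R[i]) * x a.2) : R[i]^o) =
        fun z => (Lf (mm a) * x a.2) * (oscint phi (c a.1) (kvec a.2) e z : R[i]).
      by apply/funext => z; ring.
    by rewrite cintZ //; ring.
  have -> : psum (Lf \o (fun a => osccoef e a *: mm a)) = Lf \o psum (fun a => osccoef e a *: mm a).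
    by apply/funext => N; rewrite -(psum_morph Lf).
  apply: (@cvg_comp _ _ _ (psum (fun a => osccoef e a *: mm a)) Lf \oo (nbhs (fsum mm (osccoef e)))); last exact: cL.
  exact: (fsum_cvg (mon_mul_family T) (osccoef_rapid e0)).
exact: (cvg_unique (@norm_hausdorff _ R[i]^o) lim2 lim).
Qed.

(** Each coefficient converges by [cint_oscint_cvg] and [cint_oscint_bound] dominates them all. A
    seminorm of the smooth subalgebra only multiplies coefficients by [ipow], so convergence holds
    in the Frechet topology. *)
Lemma osc_scalar_cvg : phi 0 = 1 -> smooth_cvg (ncta T)
  ((fun e => ((2 * pi) ^- n)%:C%C *: fsum mm (osccoef e)) @ 0^') (opc T c x).
Proof.
move=> phi0; have E := mon_mul_family T.
have ro := opcoef_rapid hc hx; have [so dor] := fsum_smooth E ro.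
split; first exact: so.
move=> w; rewrite dor.
have [q hq] := csym_growth hc; have [B B0 hB] := cint_oscint_bound q rphi.
pose y (e : R) (a : L * L) : R[i] := ipow (a.1 + a.2) w * (((2 * pi) ^- n)%:C%C * osccoef e a).
have pin : 0 < (2 * pi : R) ^+ n by rewrite exprn_gt0 // mulr_gt0 // pi_gt0.
have lim : (fun e => fsum mm (y e)) @ 0^' --> fsum mm (fun a => ipow (a.1 + a.2) w * opcoef c x a).
  apply: (@cvg_fsum_uniform _ _ _ _ _ _ _ _ E _ (0^') _ [set e | e != 0 /\ `|e| <= 1]).
  - apply/nbhs_ballP; exists 1 => //= e; rewrite /ball /= sub0r normrN => e1 e0.
    by split => //; exact: ltW.
  - move=> p; have [K K1 hK] := ipow_bound E w.
    have [||C hC] := @rapid_growth R n R [set e | e != 0 /\ `|e| <= 1] (fun _ => x)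
      (fun e a => cint (oscint phi (c a.1) (kvec a.2) e)) q _ _ (p + size w)%N.
    + by move=> p'; have [C hC] := rapid_uniform hx p'; exists C => z k _; exact: (hC tt k I).
    + move=> p'; have [C C0 hC] := hq p'; exists (B * C); first by rewrite mulr_ge0.
      move=> e a [e0 e1]; have := hB _ _ (kvec a.2) _ (@c_continuous a.1) (hC a.1) e0 e1.
      by rewrite !mulrA.
    exists ((2 * pi) ^- n * K * C) => e a Be; rewrite /y nrM [nr (_ * osccoef _ _)]nrM nr_real gtr0_norm ?invr_gt0 //.
    have := hC e a Be; rewrite exprD => h.
    have o0 : 0 <= om2 a ^+ p by rewrite exprn_ge0 // mulr_ge0 // ltW // pw_gt0.
    apply: (@le_trans _ _ (om2 a ^+ p * (K * om2 a ^+ size w * ((2 * pi) ^- n * nr (osccoef e a))))).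
      rewrite ler_wpM2l // ler_wpM2r ?hK // mulr_ge0 ?nr_ge0 // ltW // invr_gt0 //.
    have -> : om2 a ^+ p * (K * om2 a ^+ size w * ((2 * pi) ^- n * nr (osccoef e a))) =
       (2 * pi) ^- n * K * (om2 a ^+ p * om2 a ^+ size w * nr (osccoef e a)).
      by move: (om2 a ^+ p) (om2 a ^+ size w) (_ ^- n) => u v t; ring.
    apply: ler_wpM2l h; apply: mulr_ge0; last exact: le_trans K1.
    by rewrite invr_ge0 ltW.
  - move=> a; rewrite /y; apply: cvgM; first exact: cvg_cst.
    have [C1 C10 hC1] := hq 0%N.
    have h := @cint_oscint_cvg _ _ phi q rphi _ _ (@c_continuous a.1) (hC1 a.1) (kvec a.2).
    rewrite phi0 mul1r in h.
    have -> : opcoef c x a = ((2 * pi) ^- n)%:C%C * (((2 * pi) ^+ n)%:C%C * (c a.1 (kvec a.2) : R[i]) * x a.2).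
      by rewrite !mulrA -rmorphM mulVf ?gt_eqF // mul1r.
    apply: cvgM; first exact: cvg_cst.
    by apply: cvgM; [exact: h|exact: cvg_cst].
apply: cvg_dnbhs_eq lim => e e0 _.
have rs := osccoef_rapid e0.
have rz : rapid om2 (fun a => ((2 * pi) ^- n)%:C%C * osccoef e a).
  exact: rapidZ.
have [b hb yb] := rapid_bound E rs.
rewrite /fsum -(csumZ _ hb (fun i => le_trans (nr_U_le E _ _) (yb i))).
have -> : csum (fun i : L * L => ((2 * pi) ^- n)%:C%C *: (osccoef e i *: mm i)) = fsum mm (fun a => ((2 * pi) ^- n)%:C%C * osccoef e a).
  by congr csum; apply/funext => a; rewrite scalerA.
by rewrite (fsum_smooth E rz).2.
Qed.

End OscillatoryOperators.

Section OperatorAlgebra.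
Context {R : realType} {n : nat} {theta : 'M[R]_n} (T : ncTorus theta).
#[local] Opaque pderiv.
Local Notation L := 'rV[int]_n.
Local Notation om := (fun k : L => pw (kvec (R := R) k)).
Local Notation om2 := (fun p : L * L => pw (kvec (R := R) p.1) * pw (kvec (R := R) p.2)).
Local Notation mm := (fun p : L * L => mon T p.1 * mon T p.2).
Local Notation smooth := (smooth_vec (ncta T)).

(** A convergent sequence is bounded in every seminorm, so its coefficients decay rapidly uniformly
    along the sequence. *)
Lemma smooth_cvg_rapid (u : nat -> T) a : (forall N, smooth (u N)) ->
  smooth_cvg (ncta T) (u @ \oo) a ->
  forall p, exists C, forall N k, om k ^+ p * nr (coef k (u N)) <= C.
Proof.
move=> su [_ ua] p; have [C C0 hC] := coef_bounded T.
have [|D hD] := @moments_pw R n (nat * L) (fun i => kvec i.2) (fun i => nr (coef i.2 (u i.1)))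
    (fun i => nr_ge0 _) _ p.
move=> l; have ul : (fun N => nr (orbit_deriv (ncta T) (mword l) (u N)) : R) @ \oo -->
    nr (orbit_deriv (ncta T) (mword l) a).
  by apply: cvg_nr; exact: ua.
have /cvg_seq_bounded/pinfty_ex_gt0[B B0 hB] := cvgP _ ul.
exists (C * B) => -[N k] /=.
rewrite -freq_mword -nr_real -nrM -nr_ipow -coef_orbit_deriv //.
apply: (le_trans (hC _ _)); rewrite ler_wpM2l //.
by apply: le_trans (hB N I); exact: ler_norm.
by exists D => N k; exact: (hD (N, k)).
Qed.

Section WithSymbol.
Context (M : R) (c : L -> 'rV[R]_n -> R[i]^o).
Context (hc : csym om M c).

Definition opa (a : T) : T := opc T c (fun k => coef k a).

Definition symval (xi : 'rV[R]_n) : T := fsum (mon T) (c ^~ xi).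

Lemma opa_cvg (u : nat -> T) a : (forall N, smooth (u N)) ->
  smooth_cvg (ncta T) (u @ \oo) a -> opa \o u @ \oo --> opa a.
Proof.
move=> su ua; have [q hq] := csym_growth hc.
have ucvg : u @ \oo --> a.
  have e : orbit_deriv (ncta T) [::] = id by apply/funext => b; exact: orbit_deriv0.
  by move: (ua.2 [::]); rewrite e.
apply: (@cvg_fsum_uniform _ _ _ _ _ _ _ _ (mon_mul_family T) _ \oo _ setT).
- exact: filterT.
- apply: (@rapid_growth R n nat setT (fun N k => coef k (u N)) (fun _ p => c p.1 (kvec p.2)) q).
    by move=> p; have [C hC] := smooth_cvg_rapid su ua p; exists C => N k _; exact: hC.
  by move=> p; have [C C0 hC] := hq p; exists C => // N p' _; exact: hC.
- move=> p; apply: cvgM; first exact: cvg_cst.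
  apply: (@cvg_comp _ _ _ u (coef p.2 : T -> R[i]^o) \oo (nbhs a)); first exact: ucvg.
  exact: coef_continuous.
Qed.

Lemma opaZD (s : R[i]) a b : smooth a -> smooth b -> opa (s *: a + b) = s *: opa a + opa b.
Proof.
move=> /smooth_rapid ra /smooth_rapid rb.
rewrite /opa /opc -(fsumZD (mon_mul_family T) s (opcoef_rapid hc ra) (opcoef_rapid hc rb)).
congr fsum; apply/funext => p; rewrite /opcoef linearD linearZ /=; ring.
Qed.

Lemma opa_mon (s : R[i]) k : opa (s *: mon T k) = s *: (symval (kvec k) * mon T k).
Proof.
have rs := rapid_single k s (ef_ge1 (mon_family T)).
rewrite scalerAr -[in RHS](fsum_single (mon T)) /symval fsumM //; last exact: (csym_rapid [::] (kvec k) hc).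
congr fsum; apply/funext => p; rewrite /opcoef linearZ /= coef_mon.
by case: eqVneq => [->|_]; rewrite ?mulr1 ?mulr0.
Qed.

(** Valid for every eigenfamily: on U^l U^m the operator multiplies by the symbol at l + m, and the
    phase relating this product to the monomial of frequency l + m drops out by linearity. *)
Lemma opa_fsum (I : countType) (V : I -> T) (q : I -> L) (w : I -> R) (x : I -> R[i]) :
  eigenfamily V q w -> rapid w x ->
  opa (fsum V x) = csum (fun i => x i *: (symval (kvec (q i)) * V i)).
Proof.
move=> E rx; symmetry; apply: csum_unique.
have sV i : smooth (x i *: V i).
  by have [s ->] := ef_mon E i; rewrite scalerA; exact: smooth_scale_mon.
have oV i : opa (x i *: V i) = x i *: (symval (kvec (q i)) * V i).
  have [s ->] := ef_mon E i; rewrite scalerA opa_mon -scalerA; congr (_ *: _).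
  by rewrite scalerAr.
have o0 : opa 0 = 0.
  by have := opa_mon 0 0; rewrite !scale0r.
have sp N : smooth (psum (fun i => x i *: V i) N) by exact: (smooth_psum E x N).1.
have -> : psum (fun i => x i *: (symval (kvec (q i)) * V i)) = opa \o psum (fun i => x i *: V i).
  apply/funext => N /=; elim: N => [|N IH]; first by rewrite /psum !big_ord0.
  have -> : psum (fun i => x i *: V i) N.+1 =
    1 *: cseq (fun i => x i *: V i) N + psum (fun i => x i *: V i) N.
    by rewrite scale1r addrC /psum big_ord_recr.
  rewrite opaZD // -?IH.
    rewrite scale1r addrC /psum big_ord_recr /=; congr (_ + _).
    by rewrite /cseq; case: pickle_inv => //= i.
  rewrite /cseq; case: pickle_inv => [i|] /=; first exact: sV.
  by have := smooth_scale_mon T 0 0; rewrite scale0r.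
exact: opa_cvg sp (smooth_cvg_psum E rx).
Qed.

End WithSymbol.
End OperatorAlgebra.

(** * Composition and adjoint on Fourier series *)

Section CompositionAdjoint.
Context {R : realType} {n : nat} {theta : 'M[R]_n} (T : ncTorus theta) (n_gt0 : (0 < n)%N).
#[local] Opaque pderiv.
Local Notation L := 'rV[int]_n.
Local Notation om := (fun k : L => pw (kvec (R := R) k)).
Local Notation om2 := (fun p : L * L => pw (kvec (R := R) p.1) * pw (kvec (R := R) p.2)).
Local Notation mm := (fun p : L * L => mon T p.1 * mon T p.2).
Local Notation smooth := (smooth_vec (ncta T)).

(** A smooth element is the Frechet limit of the partial sums of its Fourier series. *)
Lemma smooth_ind (P : T -> Prop) : (forall k, P (mon T k)) ->
  (forall s a b, smooth a -> smooth b -> P a -> P b -> P (s *: a + b)) ->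
  (forall (u : nat -> T) a, (forall N, smooth (u N)) -> (forall N, P (u N)) ->
     smooth_cvg (ncta T) (u @ \oo) a -> P a) ->
  forall a, smooth a -> P a.
Proof.
move=> Pmon PZD Plim a sa; have ra := smooth_rapid sa.
have E := mon_family T; rewrite (smooth_fsum n_gt0 sa).
have sm k : smooth (mon T k) by have := smooth_scale_mon T 1 k; rewrite scale1r.
have P0 : P 0.
  by have := PZD (-1) _ _ (sm 0) (sm 0) (Pmon 0) (Pmon 0); rewrite scaleN1r addNr.
apply: (Plim (psum (fun k => coef k a *: mon T k))) (smooth_cvg_psum E ra) => N.
  exact: (smooth_psum E _ N).1.
elim: N => [|N IH]; first by rewrite /psum big_ord0.
rewrite /psum big_ord_recr /= -/(psum _ N) addrC {1}/cseq.
case: pickle_inv => [k|] /=; last by rewrite add0r.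
by apply: PZD => //; exact: (smooth_psum E _ N).1.
Qed.

(** The exchange theorem for double series requires a majorant of product form; the weight of a pair
    is a product, so rapid decay supplies one even after multiplication by a power of the weight. *)
Lemma rapid_pair_bound (y : L * L -> R[i]) q : rapid om2 y ->
  exists b c : L -> R, [/\ summable_bound b, summable_bound c &
    forall k l, om2 (k, l) ^+ q * nr (y (k, l)) <= b k * c l].
Proof.
move=> ry; have [p hp] := ef_sum (mon_family T); have [C C0 hC] := ry (q + p)%N.
exists (fun k => C * (om k ^+ p)^-1), (fun k => (om k ^+ p)^-1); split => //.
  exact: summable_boundZ.
move=> k l; have := hC (k, l); rewrite exprD /=.
have ok : 0 < om k by exact: pw_gt0.
have ol : 0 < om l by exact: pw_gt0.
rewrite mulrAC => h; rewrite -mulrA -invfM -exprMn ler_pdivlMr // exprn_gt0 //.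
exact: mulr_gt0.
Qed.

Section Composition.
Context (M M' : R) (c c' d : L -> 'rV[R]_n -> R[i]^o).
Context (hc : csym om M c) (hc' : csym om M' c') (hd : csym om (M + M') d).
Let D2 (p : L * L) (xi : 'rV[R]_n) : R[i]^o := (c p.1 (xi + kvec p.2) : R[i]) * c' p.2 xi.
Context (hD : csym om2 (M + M') D2) (dE : forall xi, symval T d xi = fsum mm (D2 ^~ xi)).

Let nr_monM k l : nr (mon T k * mon T l) <= 1.
Proof. by apply: (le_trans (cstar_nrM _ _)); rewrite !nr_mon mulr1. Qed.

Let symval_growth : exists2 C, 0 <= C & exists q : nat, forall xi, nr (symval T c xi) <= C * jb xi ^+ q.
Proof.
have [q hq] := csym_growth hc; have [p [b0 [K hK]]] := ef_sum (mon_family T); have [C C0 hC] := hq p.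
have K0 : 0 <= K by have := hK [::] isT; rewrite big_nil.
exists (C * K); first exact: mulr_ge0.
exists q => xi; apply: (@csum_norm _ _ _ _ (fun k => C * (om k ^+ p)^-1 * jb xi ^+ q)).
  by move=> k; apply: (le_trans (nr_U_le (mon_family T) _ _)); exact: hC.
move=> s us; rewrite -mulr_suml -mulr_sumr ler_wpM2r ?exprn_ge0 ?(ltW (jb_gt0 _)) //.
by rewrite ler_wpM2l // hK.
Qed.

Let symval_comp xi : symval T d xi = csum (fun l => (c' l xi : R[i]) *: (symval T c (xi + kvec l) * mon T l)).
Proof.
rewrite dE; have rD : rapid om2 (D2 ^~ xi) := csym_rapid [::] xi hD.
have [b [e [hb he hbe]]] := rapid_pair_bound 0 rD.
rewrite /fsum (csum_pair_swap hb he); last first.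
  move=> k l; apply: le_trans (hbe k l); rewrite expr0 mul1r.
  exact: (nr_U_le (mon_mul_family T)).
congr csum; apply/funext => l.
have [b' hb' yb'] := rapid_bound (mon_family T) (csym_rapid [::] (xi + kvec l) hc).
have nb k : nr ((c k (xi + kvec l) : R[i]) *: mon T k) <= b' k.
  by apply: le_trans (nr_U_le (mon_family T) _ _) (yb' k).
rewrite /symval /fsum -(csum_mulr _ hb' nb) -(csumZ _ hb'); last first.
  move=> k; apply: (le_trans (cstar_nrM _ _)); rewrite nr_mon mulr1; exact: nb.
congr csum; apply/funext => k.
by rewrite /D2 -scalerAl scalerA mulrC.
Qed.

(** Both sides are series over triples of frequencies. The sum over the frequencies of [c] is
    already contained in [symval]; what remains is to exchange the frequency l of [c'] with the
    frequency m of [a]. *)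
Lemma opa_comp a : smooth a -> opa c (opa c' a) = opa d a.
Proof.
move=> sa; have ra := smooth_rapid sa; have ro := opcoef_rapid hc' ra.
rewrite {2}/opa /opc (opa_fsum hc (mon_mul_family T) ro).
rewrite [in RHS](smooth_fsum n_gt0 sa) (opa_fsum hd (mon_family T) ra).
have [C C0 [q hC]] := symval_growth.
have [b [e [hb he hbe]]] := rapid_pair_bound q ro.
have hbC : summable_bound (fun k => C * (2 ^+ n * 2 ^+ n) ^+ q * b k).
  by apply: summable_boundZ => //; rewrite mulr_ge0 ?exprn_ge0 ?mulr_ge0 ?exprn_ge0.
have bound k l : nr (opcoef c' (fun m => coef m a) (k, l) *: (symval T c (kvec (k + l)) * (mon T k * mon T l)))
    <= C * (2 ^+ n * 2 ^+ n) ^+ q * b k * e l.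
  rewrite nrZ.
  apply: (@le_trans _ _ (nr (opcoef c' (fun m => coef m a) (k, l)) * (C * jb (kvec (R := R) (k + l)) ^+ q))).
    rewrite ler_wpM2l ?nr_ge0 //; apply: (le_trans (cstar_nrM _ _)).
    by apply: le_trans (hC _); rewrite ler_piMr ?nr_ge0 ?nr_monM.
  have h : jb (kvec (R := R) (k + l)) ^+ q <= (2 ^+ n * 2 ^+ n) ^+ q * om2 (k, l) ^+ q.
    rewrite -exprMn lerXn2r ?nnegrE ?mulr_ge0 ?exprn_ge0 ?(ltW (jb_gt0 _)) ?(ltW (pw_gt0 _)) //.
    rewrite kvecD; apply: (le_trans (jbD _ _)); rewrite /= mulrACA.
    by apply: ler_pM; rewrite ?(ltW (jb_gt0 _)) ?jb_le_pw.
  apply: (@le_trans _ _ (nr (opcoef c' (fun m => coef m a) (k, l)) * (C * ((2 ^+ n * 2 ^+ n) ^+ q * om2 (k, l) ^+ q)))).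
    by rewrite ler_wpM2l ?nr_ge0 // ler_wpM2l.
  have := hbe k l; move: ((2 ^+ n * 2 ^+ n) ^+ q) (@exprn_ge0 R q (2 ^+ n * 2 ^+ n) (ltac:(by rewrite mulr_ge0 ?exprn_ge0))) => K K0 hk.
  have -> : nr (opcoef c' (fun m => coef m a) (k, l)) * (C * (K * om2 (k, l) ^+ q)) =
     C * K * (om2 (k, l) ^+ q * nr (opcoef c' (fun m => coef m a) (k, l))).
    by move: (om2 (k, l) ^+ q) => u; ring.
  by rewrite -[X in _ <= X]mulrA ler_wpM2l // mulr_ge0.
rewrite (csum_pair_swap hbC he bound); congr csum; apply/funext => m.
rewrite symval_comp.
have [b' hb' yb'] := rapid_bound (mon_family T) (csym_rapid [::] (kvec m) hc').
pose G l := (c' l (kvec m) : R[i]) *: (symval T c (kvec m + kvec l) * mon T l).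
have [g hg hG] : exists2 g, summable_bound g & forall l, nr (G l) <= g l.
  have [q' hq'] := csym_growth hc'; have [p hp] := ef_sum (mon_family T).
  have [C' C'0 hC'] := hq' (q + p)%N.
  exists (fun l => C' * jb (kvec (R := R) m) ^+ q' * (C * jb (kvec (R := R) m) ^+ q * (2 ^+ n) ^+ q) * (om l ^+ p)^-1).
    apply: summable_boundZ => //.
    by rewrite !mulr_ge0 ?exprn_ge0 ?exprn_ge0 ?(ltW (jb_gt0 _)).
  move=> l; rewrite nrZ.
  have o0 : 0 < om l by exact: pw_gt0.
  apply: (@le_trans _ _ (C' * (om l ^+ (q + p))^-1 * jb (kvec (R := R) m) ^+ q' * (C * (jb (kvec (R := R) m) ^+ q * ((2 ^+ n) ^+ q * om l ^+ q))))).
    apply: ler_pM; rewrite ?nr_ge0 //.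
    apply: (le_trans (cstar_nrM _ _)); rewrite nr_mon mulr1; apply: (le_trans (hC _)); rewrite ler_wpM2l //.
    rewrite -!exprMn lerXn2r ?nnegrE ?mulr_ge0 ?exprn_ge0 ?(ltW (jb_gt0 _)) ?(ltW o0) //.
    by apply: (le_trans (jbD _ _)); rewrite ler_wpM2l ?(ltW (jb_gt0 _)) // jb_le_pw.
  rewrite exprD invfM.
  have e0 : om l ^+ q != 0 by rewrite gt_eqF // exprn_gt0.
  rewrite le_eqVlt; apply/orP; left; apply/eqP.
  move: e0; move: (om l ^+ q) ((om l ^+ p)^-1) (jb _ ^+ q') (jb _ ^+ q) ((2 ^+ n) ^+ q) => u v w z t u0.
  by field.
have e1 : coef m a *: (csum G * mon T m) = csum (fun l => coef m a *: (G l * mon T m)).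
  rewrite -(csum_mulr (mon T m) hg hG); symmetry; apply: (csumZ _ hg) => l.
  by apply: (le_trans (cstar_nrM _ _)); rewrite nr_mon mulr1.
transitivity (csum (fun l => coef m a *: (G l * mon T m))); last exact: esym e1.
congr csum; apply/funext => l.
rewrite /G /opcoef /= -scalerAl scalerA kvecD [kvec l + _]addrC mulrA.
by rewrite mulrC.
Qed.

End Composition.

Lemma star_fsum (I : countType) (U : I -> T) q w (x : I -> R[i]) : eigenfamily U q w -> rapid w x ->
  star (fsum U x) = fsum (fun i => star (U i)) (fun i => conjc (x i)).
Proof.
move=> E rx; apply/esym/csum_unique.
have -> : psum (fun i => conjc (x i) *: star (U i)) = @star R T \o psum (fun i => x i *: U i).
  apply/funext => N; elim: N => [|N IH]; first by rewrite /psum !big_ord0 /= big_ord0 star0.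
  rewrite /psum big_ord_recr /= -/(psum _ N) IH /= big_ord_recr /= starD; congr (_ + _).
  rewrite /cseq; case: pickle_inv => [k|] /=; last by rewrite star0.
  by rewrite starZ.
apply: (@cvg_comp _ _ _ (psum (fun i => x i *: U i)) (@star R T) \oo (nbhs (fsum U x))).
  exact: (fsum_cvg E rx).
exact: continuous_star.
Qed.

Section Adjoint.
Context (M : R) (c d : L -> 'rV[R]_n -> R[i]^o).
Context (hc : csym om M c) (hd : csym om M d).
Let Ds (k : L) (xi : 'rV[R]_n) : R[i]^o := conjc (c k (xi - kvec k)).
Context (hD : csym om M Ds) (dE : forall xi, symval T d xi = fsum (fun k => star (mon T k)) (Ds ^~ xi)).

Lemma coef_monM_eq0 k l m : k + m != l -> coef l (mon T k * mon T m) = 0.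
Proof.
move=> h; have [s ->] := monM T k m; rewrite linearZ /= coef_mon eq_sym (negbTE h).
by rewrite mulr0.
Qed.

Lemma psum_coef_mul (z : L -> R[i]) l m : rapid om z ->
  psum (fun k => z k * coef l (mon T k * mon T m)) @ \oo -->
  (coef l (fsum (mon T) z * mon T m) : R[i]^o).
Proof.
move=> rz.
have -> : psum (fun k => z k * coef l (mon T k * mon T m)) =
   fun N => coef l (psum (fun k => z k *: mon T k) N * mon T m).
  apply/funext => N; rewrite /psum mulr_suml linear_sum /=; apply: eq_bigr => k _.
  rewrite /cseq; case: pickle_inv => [k'|] /=; last by rewrite mul0r linear0.
  by rewrite -scalerAl linearZ.
apply: (@cvg_comp _ _ _ (psum (fun k => z k *: mon T k)) (fun a => coef l (a * mon T m) : R[i]^o) \oo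
   (nbhs (fsum (mon T) z))); first exact: (fsum_cvg (mon_family T) rz).
apply: (@cvg_comp _ _ _ (fun a => a * mon T m) (coef l : T -> R[i]^o) (nbhs (fsum (mon T) z)) (nbhs (fsum (mon T) z * mon T m))).
  exact: continuous_mulr.
exact: coef_continuous.
Qed.

Let star_symval xi : star (symval T d xi) = fsum (mon T) (fun k => c k (xi - kvec k)).
Proof.
rewrite dE (star_fsum (star_mon_family T) (csym_rapid [::] xi hD)).
by congr csum; apply/funext => k; rewrite starK conjcK.
Qed.

(** Only k = l - m contributes to either side, and for this k the evaluation point l - k of the
    adjoint symbol is m. *)
Let adjoint_mon l m : nct_tau T (star (mon T l) * opa c (mon T m)) = nct_tau T (star (opa d (mon T l)) * mon T m).
Proof.
have o (e : L -> 'rV[R]_n -> R[i]^o) k (he : csym om M e) : opa e (mon T k) = symval T e (kvec k) * mon T k.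
  by have := opa_mon T he 1 k; rewrite !scale1r.
rewrite (o c m hc) (o d l hd) starM -[in RHS]mulrA star_symval.
change (coef l (symval T c (kvec m) * mon T m) =
  coef l (fsum (mon T) (fun k => c k (kvec l - kvec k)) * mon T m)).
have r1 : rapid om (c ^~ (kvec m)) := csym_rapid [::] (kvec m) hc.
have r2 : rapid om (fun k => c k (kvec l - kvec k) : R[i]).
  by apply: (rapid_le (mon_family T) (csym_rapid [::] (kvec l) hD)) => k; rewrite nr_conj.
have l1 := psum_coef_mul (l := l) (m := m) r1; have l2 := psum_coef_mul (l := l) (m := m) r2.
have e12 : psum (fun k => (c k (kvec m) : R[i]) * coef l (mon T k * mon T m) : R[i]^o) =
    psum (fun k => (c k (kvec l - kvec k) : R[i]) * coef l (mon T k * mon T m) : R[i]^o).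
  congr psum; apply/funext => k; have [e|/coef_monM_eq0 ->] := eqVneq (k + m) l; last by rewrite !mulr0.
  by rewrite -e kvecD addrAC subrr add0r.
rewrite e12 in l1.
exact: (@cvg_unique R[i]^o (@norm_hausdorff _ R[i]^o) _ _ _ _ l1 l2).
Qed.

(** Both sides are sesquilinear and sequentially continuous for the Frechet topology, so monomials
    in each variable suffice. *)
Lemma opa_adjoint a b : smooth a -> smooth b ->
  nct_tau T (star b * opa c a) = nct_tau T (star (opa d b) * a).
Proof.
have cl (u : nat -> T) v w : u @ \oo --> v -> (fun N => nct_tau T (w * u N) : R[i]^o) @ \oo --> (nct_tau T (w * v) : R[i]^o).
  move=> uv; apply: (@cvg_comp _ _ _ (fun N => w * u N) (nct_tau T : T -> R[i]^o) \oo (nbhs (w * v))).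
    by apply: (@cvg_comp _ _ _ u (fun x => w * x) \oo (nbhs v)); [exact: uv|exact: continuous_mull].
  exact: nct_tau_cont.
have cr (u : nat -> T) v w : u @ \oo --> v -> (fun N => nct_tau T (star (u N) * w) : R[i]^o) @ \oo --> (nct_tau T (star v * w) : R[i]^o).
  move=> uv; apply: (@cvg_comp _ _ _ (fun N => star (u N) * w) (nct_tau T : T -> R[i]^o) \oo (nbhs (star v * w))).
    apply: (@cvg_comp _ _ _ (fun N => star (u N)) (fun x => x * w) \oo (nbhs (star v))); last exact: continuous_mulr.
    by apply: (@cvg_comp _ _ _ u (@star R T) \oo (nbhs v)); [exact: uv|exact: continuous_star].
  exact: nct_tau_cont.
have scvg (u : nat -> T) v : smooth_cvg (ncta T) (u @ \oo) v -> u @ \oo --> v.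
  have e : orbit_deriv (ncta T) [::] = id by apply/funext => x; exact: orbit_deriv0.
  by move=> h; move: (h.2 [::]); rewrite e.
move=> sa; move: a sa b; apply: smooth_ind.
- move=> m; apply: smooth_ind.
  + by move=> l; exact: adjoint_mon.
  + move=> s b1 b2 s1 s2 e1 e2; rewrite (opaZD hd s s1 s2) !starD !starZ !mulrDl -!scalerAl.
    by rewrite !linearD !linearZ /= e1 e2.
  + move=> u b su eu ub.
    have l1 := cr _ _ (opa c (mon T m)) (scvg _ _ ub).
    have l2 := cr _ _ (mon T m) (opa_cvg hd su ub).
    apply: (cvg_unique (@norm_hausdorff _ R[i]^o) l1).
    by rewrite (_ : (fun N => _) = fun N => nct_tau T (star ((opa d \o u) N) * mon T m)) //; apply/funext => N; exact: eu.
- move=> s a1 a2 s1 s2 e1 e2 b sb; rewrite (opaZD hc s s1 s2) !mulrDr -!scalerAr.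
  by rewrite !linearD !linearZ /= e1 // e2.
- move=> u a su eu ua b sb.
  have l1 := cl _ _ (star b) (opa_cvg hc su ua).
  have l2 := cl _ _ (star (opa d b)) (scvg _ _ ua).
  apply: (cvg_unique (@norm_hausdorff _ R[i]^o) l1).
  by rewrite (_ : (fun N => _) = fun N => nct_tau T (star (opa d b) * u N)) //; apply/funext => N; exact: eu.
Qed.

End Adjoint.
End CompositionAdjoint.

(** * Existence and uniqueness of oscillatory integrals *)

Section Gaussian.
Context {R : realType}.

(** The k-th derivative of exp(-t^2) is [hermite k] times exp(-t^2): the Hermite polynomials up to
    the sign (-1)^k. *)
Fixpoint hermite (k : nat) : {poly R} :=
  if k is k'.+1 then deriv (hermite k') - 2 *: 'X * hermite k' else 1.

Definition hgauss k (t : R) : R := (hermite k).[t] * expR (- t ^+ 2).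

Lemma is_derive_hgauss k t : is_derive t (1 : R) (hgauss k) (hgauss k.+1 t).
Proof.
have h1 := is_derive_poly (hermite k) t.
have h2 : is_derive t (1 : R) (fun u : R => - u ^+ 2) (- (2%:R * t)).
  have := @is_deriveN _ _ _ _ t 1 _ (@is_deriveX _ _ id 2 t 1 1 (is_derive_id _ _)).
  by rewrite /GRing.scale /= mulr1 exprfctE expr1.
have h3 : is_derive t (1 : R) (fun u : R => expR (- u ^+ 2)) (- (2%:R * t) * expR (- t ^+ 2)).
  have := @is_derive1_comp _ expR (fun u : R => - u ^+ 2) t _ _ (is_derive_expR _) h2.
  by rewrite [_ * (- _)]mulrC.
have := is_deriveM h1 h3; rewrite /GRing.scale /=.
set v := (X in is_derive _ _ _ X); have -> // : v = hgauss k.+1 t.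
rewrite /v /hgauss /= !hornerE; move: (expR _) (_.[_]) (_.[_]) => a b c /=; ring.
Qed.

Lemma hgauss_continuous k : continuous (hgauss k).
Proof.
move=> t; apply: differentiable_continuous; apply/derivable1_diffP.
by have [] := is_derive_hgauss k t.
Qed.

(** Reduces to monomials: |t|^q <= 1 + t^(2q), and t^(2q) / q! is bounded by exp(t^2). *)
Lemma hgauss_bound k p : exists2 C, 0 <= C & forall t, `|t ^+ p * hgauss k t| <= C.
Proof.
have mono q (t : R) : `|t| ^+ q * expR (- t ^+ 2) <= 1 + q`!%:R.
  have h1 : `|t| ^+ q <= 1 + (t ^+ 2) ^+ q.
    rewrite -normrX -exprM mulnC exprM -[X in _ <= 1 + X]real_normK ?num_real //.
    by move: (`|t ^+ q|) (normr_ge0 (t ^+ q)) => u u0; nra.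
  rewrite expRN ler_pdivrMr ?expR_gt0 //; apply: (le_trans h1).
  rewrite mulrDl mul1r lerD //.
    by rewrite -expR0 ler_expR sqr_ge0.
  case: q {h1} => [|q]; first by rewrite expr0 fact0 mul1r -{1}expR0 ler_expR sqr_ge0.
  have := expR_ge1Dxn q (sqr_ge0 t); rewrite -lerBrDl => h.
  rewrite mulrC -ler_pdivrMr ?ltr0n ?fact_gt0 //; apply: (le_trans h).
  by rewrite gerBl.
exists (\sum_(i < size (hermite k)) `|(hermite k)`_i| * (1 + (p + i)`!%:R)).
  by apply: sumr_ge0 => i _; rewrite mulr_ge0 // addr_ge0.
move=> t; rewrite /hgauss horner_coef mulrA mulr_sumr mulr_suml.
apply: (le_trans (ler_norm_sum _ _ _)); apply: ler_sum => i _.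
rewrite !normrM (ger0_norm (expR_ge0 _)) !normrX mulrCA -!mulrA ler_wpM2l //.
by rewrite mulrA -exprD mono.
Qed.

Context {m : nat}.

Definition gaussd (w : seq 'I_m) (z : 'rV[R]_m) : R[i]^o :=
  (\prod_j hgauss (count_mem j w) (z 0 j))%:C%C.

Lemma gaussd_continuous w : continuous (gaussd w).
Proof.
apply: complexR_continuous => z; apply: cvg_big => //; [exact: mul_continuous|exact: nbhs_filter|].
move=> j _.
apply: (@cvg_comp _ _ _ (fun z : 'rV[R]_m => z 0 j) (hgauss (count_mem j w)) (nbhs z) (nbhs (z 0 j))).
  exact: coord_continuous.
exact: hgauss_continuous.
Qed.

Lemma is_pd_gaussd w j z : is_pd (gaussd w) j z (gaussd (j :: w) z).
Proof.
pose c := \prod_(i | i != j) hgauss (count_mem i w) (z 0 i).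
have e h : \prod_i hgauss (count_mem i w) ((z + h *: delta_mx 0 j) 0 i) =
    c * hgauss (count_mem j w) (z 0 j + h).
  rewrite (bigD1 j) //= mulrC !mxE !eqxx mulr1; congr (_ * _).
  apply: eq_bigr => i ij; rewrite !mxE eqxx (negbTE ij) mulr0 addr0 //.
have e1 : gaussd (j :: w) z = (c * hgauss (count_mem j w).+1 (z 0 j))%:C%C.
  rewrite /gaussd (bigD1 j) //= eqxx add1n mulrC; congr ((_ * _)%:C%C).
  by apply: eq_bigr => i ij; rewrite eq_sym (negbTE ij).
have q := is_derive_quot (is_derive_hgauss (count_mem j w) (z 0 j)).
rewrite /is_pd e1; apply/cvg_ReIm; split=> /=.
  rewrite (_ : (fun t : R => _) = fun h : R => c * (h^-1 *
     (hgauss (count_mem j w) (z 0 j + h) - hgauss (count_mem j w) (z 0 j)))).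
    by apply: cvgM; [exact: cvg_cst|exact: q].
  apply/funext => h; rewrite /dquot /gaussd e.
  have -> : \prod_i hgauss (count_mem i w) (z 0 i) = c * hgauss (count_mem j w) (z 0 j).
    by have := e 0; rewrite scale0r !addr0.
  by rewrite /=; ring.
rewrite (_ : (fun t : R => _) = fun=> 0); first exact: cvg_cst.
by apply/funext => h; rewrite /dquot /=; ring.
Qed.

(** [is_oscillatory] quantifies over all cutoffs, so uniqueness of the value requires that one
    exists. *)
Lemma schwartz_gauss : schwartz (gaussd [::]) /\ gaussd [::] 0 = 1.
Proof.
split; last first.
  by rewrite /gaussd big1 // => j _; rewrite /hgauss /= !mxE hornerC mul1r expr0n oppr0 expR0.
split; first exact: (Cinfty_family gaussd_continuous is_pd_gaussd).
move=> k l; rewrite /mderiv (wderiv_family is_pd_gaussd).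
have h j := cid2 (hgauss_bound (count_mem j (mword l)) (k j)).
exists (\prod_j projT1 (h j)) => z.
rewrite normrM [X in _ * X]nrE [X in X * _]nrE -rmorphM /= lecR /gaussd !nr_real -normrM -big_split /=.
rewrite normr_prod; apply: ler_prod => j _; rewrite normr_ge0 /=.
by case: (h j) => C /= _; apply.
Qed.

End Gaussian.

Section OscillatoryUniqueness.
Context {R : realType} {n : nat} {theta : 'M[R]_n} (T : ncTorus theta).
Local Notation L := 'rV[int]_n.
Local Notation om := (fun k : L => pw (kvec (R := R) k)).
Local Notation mm := (fun p : L * L => mon T p.1 * mon T p.2).
Local Notation smooth := (smooth_vec (ncta T)).

Lemma is_integral0 (A : cstarAlg R) m : is_integral (fun _ : 'rV[R]_m => 0 : A) 0.
Proof.
move=> F _ /=; rewrite linear0 /=.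
have e : (fun t : m.-tuple (measurableTypeR R) => complex.Re (0 : R[i])) = fun=> 0 by [].
split; try exact: integrable0.
by rewrite /= /Rintegral integral0.
Qed.

Lemma is_integralD (A : cstarAlg R) m (f g : 'rV[R]_m -> A) u v :
  is_integral f u -> is_integral g v -> is_integral (fun z => f z + g z) (u + v).
Proof.
move=> hf hg F cF /=; have [f1 f2 f3] := hf F cF; have [g1 g2 g3] := hg F cF.
have eRe : (fun t : m.-tuple (measurableTypeR R) => complex.Re (F (f (row_of_tuple t) + g (row_of_tuple t)))) =
   fun t => complex.Re (F (f (row_of_tuple t))) + complex.Re (F (g (row_of_tuple t))).
  by apply/funext => t; rewrite linearD raddfD.
have eIm : (fun t : m.-tuple (measurableTypeR R) => complex.Im (F (f (row_of_tuple t) + g (row_of_tuple t)))) =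
   fun t => complex.Im (F (f (row_of_tuple t))) + complex.Im (F (g (row_of_tuple t))).
  by apply/funext => t; rewrite linearD raddfD.
rewrite eRe eIm; split; [exact: (integrableD _ f1 g1)|exact: (integrableD _ f2 g2)|].
by rewrite linearD f3 g3 !RintegralD.
Qed.

Lemma is_integral_sum (A : cstarAlg R) m (I : Type) (s : seq I) (f : I -> 'rV[R]_m -> A) v :
  (forall i, is_integral (f i) (v i)) ->
  is_integral (fun z => \sum_(i <- s) f i z) (\sum_(i <- s) v i).
Proof.
move=> h; elim: s => [|i s IH].
  rewrite big_nil (_ : (fun z => _) = fun=> 0); first exact: is_integral0.
  by apply/funext => z; rewrite big_nil.
rewrite big_cons (_ : (fun z => _) = fun z => f i z + \sum_(j <- s) f j z); first exact: is_integralD.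
by apply/funext => z; rewrite big_cons.
Qed.

Lemma smooth_sum (I : Type) (s : seq I) (f : I -> T) : (forall i, smooth (f i)) ->
  smooth (\sum_(i <- s) f i) /\ forall w, orbit_deriv (ncta T) w (\sum_(i <- s) f i) =
    \sum_(i <- s) orbit_deriv (ncta T) w (f i).
Proof.
move=> h; elim: s => [|i s [IH1 IH2]].
  have s0 : smooth 0 by have := smooth_scale_mon T 0 0; rewrite scale0r.
  rewrite big_nil; split => // w; rewrite big_nil.
  have [_ /(_ w)] := smoothZD (-1) s0 s0.
  by rewrite scaleN1r addNr scaleN1r addNr.
have [h1 h2] := smoothZD 1 (h i) IH1.
rewrite scale1r in h1 h2; rewrite big_cons; split => // w.
by rewrite h2 scale1r IH2 big_cons.
Qed.

Lemma smooth_cvg_sum (S I : Type) (F : set_system S) {FF : Filter F} (s : seq I)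
   (f : I -> S -> T) (v : I -> T) : (forall i t, smooth (f i t)) ->
  (forall i, smooth_cvg (ncta T) (f i @ F) (v i)) ->
  smooth_cvg (ncta T) ((fun t => \sum_(i <- s) f i t) @ F) (\sum_(i <- s) v i).
Proof.
move=> hf hc; have [h1 h2] := smooth_sum s (fun i => (hc i).1).
split => // w; rewrite h2.
have e : orbit_deriv (ncta T) w \o (fun t => \sum_(i <- s) f i t) =
    fun t => \sum_(i <- s) orbit_deriv (ncta T) w (f i t).
  by apply/funext => t /=; rewrite (smooth_sum s (hf ^~ t)).2.
change ((orbit_deriv (ncta T) w \o (fun t => \sum_(i <- s) f i t)) @ F -->
  \sum_(i <- s) orbit_deriv (ncta T) w (v i)).
rewrite e; apply: cvg_sum_seq => i _; exact: (hc i).2.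
Qed.

Definition mxop r (rho : 'rV[R]_n -> 'M[T]_r) (a : 'cV[T]_r) : 'cV[T]_r :=
  \col_i \sum_j opa (fun k xi => coef k (rho xi i j)) (a j 0).

Context (n_gt0 : (0 < n)%N).

Lemma mxop_smooth r M (rho : 'rV[R]_n -> 'M[T]_r) (a : 'cV[T]_r) i : mxsymbol M rho ->
  (forall j, Tinf (a j 0)) -> Tinf (mxop rho a i 0).
Proof.
move=> hr ha; rewrite /mxop mxE; apply: (smooth_sum _ _).1 => j.
have [hc _] := symbol_csym n_gt0 (hr i j).
exact: (fsum_smooth (mon_mul_family T) (opcoef_rapid hc (smooth_rapid (ha j)))).1.
Qed.

Lemma mxop_oscillatory r M (rho : 'rV[R]_n -> 'M[T]_r) (a : 'cV[T]_r) : mxsymbol M rho ->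
  (forall j, Tinf (a j 0)) -> is_oscillatory rho a (mxop rho a).
Proof.
move=> hr ha phi sphi phi0; have rphi := schwartz_rdec sphi.
pose c i j := fun (k : L) xi => coef k (rho xi i j) : R[i]^o.
have hc i j : csym om M (c i j) := (symbol_csym n_gt0 (hr i j)).1.
have hx j := smooth_rapid (ha j).
exists (fun e => \col_i \sum_j fsum mm (osccoef (c i j) (fun k => coef k (a j 0)) phi e)).
have sm e i j : e != 0 -> smooth (fsum mm (osccoef (c i j) (fun k => coef k (a j 0)) phi e)).
  by move=> e0; exact: (fsum_smooth (mon_mul_family T) (osccoef_rapid (hc i j) (hx j) rphi e0)).1.
split=> [e e0 i|i].
  rewrite mxE; split; first by apply: (smooth_sum _ _).1 => j; exact: sm.
  rewrite (_ : (fun z => _) = fun z => \sum_j osc_scalar T (c i j) (fun k => coef k (a j 0)) phi e z).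
    by apply: is_integral_sum => j; exact: (osc_scalar_integral (hc i j) (hx j) rphi e0).
  apply/funext => z; rewrite /osc_integrand /osc_scalar !mxE scaler_sumr; apply: eq_bigr => j _.
  rewrite !mxE -(smooth_fsum n_gt0 (ha j)); congr (_ *: (_ * _)).
  exact: (congr1 (fun f => f (rsubmx z)) (symbol_csym n_gt0 (hr i j)).2).
(* [smooth_cvg_sum] asks for smooth values at every parameter, whereas the regularised integrals are
   controlled for nonzero [e] only; the value 0 at e = 0 does not affect the limit. *)
rewrite mxE; pose f j e := if e == 0 then 0 else
  ((2 * pi) ^- n)%:C%C *: fsum mm (osccoef (c i j) (fun k => coef k (a j 0)) phi e).
have fE e : e != 0 -> ((2 * pi) ^- n)%:C%C *: (\col_i \sum_j fsum mm (osccoef (c i j) (fun k => coef k (a j 0)) phi e)) i 0 = \sum_j f j e.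
  move=> e0; rewrite mxE scaler_sumr; apply: eq_bigr => j _.
  by rewrite /f (negbTE e0).
have s0 : smooth 0 by have := smooth_scale_mon T 0 0; rewrite scale0r.
have fs j e : smooth (f j e).
  rewrite /f; case: eqP => [//|/eqP e0].
  by have := (smoothZD (((2 * pi) ^- n)%:C%C) (sm e i j e0) s0).1; rewrite addr0.
have fc j : smooth_cvg (ncta T) (f j @ 0^') (opa (c i j) (a j 0)).
  have h := osc_scalar_cvg T (hc i j) (hx j) rphi phi0.
  split; first exact: h.1.
  move=> w; move: (h.2 w).
  apply: (@cvg_dnbhs_eq _ _ (orbit_deriv (ncta T) w \o f j)) => e e0 _.
  by rewrite /= /f (negbTE e0).
have h := smooth_cvg_sum (FF := dnbhs_filter 0) (index_enum 'I_r) fs fc.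
split; first exact: h.1.
move=> w; move: (h.2 w).
apply: (@cvg_dnbhs_eq _ _ (orbit_deriv (ncta T) w \o (fun e => _))) => e e0 _.
by rewrite /= fE.
Qed.

(** The Fourier coefficients are continuous functionals, and they separate points. *)
Lemma is_integral_unique m (f : 'rV[R]_m -> T) u v :
  is_integral f u -> is_integral f v -> u = v.
Proof.
move=> hu hv; apply: (coef_inj n_gt0) => k.
have [_ _ ->] := hu (coef k) (@coef_continuous _ _ _ T k).
by have [_ _ ->] := hv (coef k) (@coef_continuous _ _ _ T k).
Qed.

Lemma is_oscillatory_unique r (rho : 'rV[R]_n -> 'M[T]_r) a u v :
  is_oscillatory rho a u -> is_oscillatory rho a v -> u = v.
Proof.
have [sg g0] := @schwartz_gauss R (n + n).
move=> /(_ _ sg g0)[I [I1 I2]] /(_ _ sg g0)[J [J1 J2]].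
apply/colP => k.
have e0 : orbit_deriv (ncta T) [::] = id by apply/funext => x; exact: orbit_deriv0.
have l1 := (I2 k).2 [::]; have l2 := (J2 k).2 [::]; rewrite e0 in l1 l2.
have l3 : (fun e => ((2 * pi) ^- n)%:C%C *: J e k 0 : T) @ 0^' --> u k 0.
  move: l1; apply: cvg_dnbhs_eq => e en _.
  by rewrite (is_integral_unique (I1 e en k).2 (J1 e en k).2).
exact: (cvg_unique (@norm_hausdorff _ T) l3 l2).
Qed.

Lemma is_pdo_mxop r M (e : 'M[T]_r) (rho : 'rV[R]_n -> 'M[T]_r) P : mxsymbol M rho ->
  is_pdo e rho P -> forall a, Defs.inE e a -> P a = mxop rho a.
Proof.
move=> hr hP a ha; have [_ o] := hP a ha.
exact: is_oscillatory_unique o (mxop_oscillatory hr ha.1).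
Qed.

Lemma mxop_is_pdo r M (e : 'M[T]_r) (rho : 'rV[R]_n -> 'M[T]_r) P : mxsymbol M rho ->
  (forall a, Defs.inE e a -> Defs.inE e (P a) /\ P a = mxop rho a) -> is_pdo e rho P.
Proof.
move=> hr h a ha; have [h1 h2] := h a ha; split => //; rewrite h2.
exact: mxop_oscillatory hr ha.1.
Qed.

End OscillatoryUniqueness.

(** * Symbol calculus *)

Section SymbolFamilies.
Context {R : realType} {n : nat}.
#[local] Opaque pderiv.

Lemma CinftyD (W : normedModType R[i]) (f g : 'rV[R]_n -> W) : Cinfty f -> Cinfty g ->
  Cinfty (fun x => f x + g x) /\
  forall w, wderiv w (fun x => f x + g x) = fun x => wderiv w f x + wderiv w g x.
Proof.
move=> hf hg; pose D w x := wderiv w f x + wderiv w g x.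
have hd w j x : is_pd (D w) j x (D (j :: w) x).
  by apply: is_pdD; [exact: (hf w).2|exact: (hg w).2].
have hc w : continuous (D w).
  by move=> x; apply: (cvgD (FF := nbhs_filter x)); [exact: (hf w).1|exact: (hg w).1].
split; [exact: (Cinfty_family hc hd)|exact: (wderiv_family hd)].
Qed.

Lemma csymD (I : Type) (om : I -> R) m c d : (forall i, 0 <= om i) ->
  csym om m c -> csym om m d -> csym om m (fun i (x : 'rV[R]_n) => c i x + d i x : R[i]^o).
Proof.
move=> o0 [c1 c2] [d1 d2]; split=> [i|p w]; first exact: (CinftyD (c1 i) (d1 i)).1.
have [C C0 hC] := c2 p w; have [D D0 hD] := d2 p w.
exists (C + D); first exact: addr_ge0.
move=> i x; rewrite (CinftyD (c1 i) (d1 i)).2 mulrDl.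
apply: le_trans (lerD (hC i x) (hD i x)); rewrite -mulrDr ler_wpM2l ?exprn_ge0 //.
exact: nrD.
Qed.

Lemma csymZ (I : Type) (om : I -> R) m c (s : R[i]) :
  csym om m c -> csym om m (fun i (x : 'rV[R]_n) => s * c i x : R[i]^o).
Proof.
move=> [c1 c2]; split=> [i|p w]; first exact: (Cinfty_Z s (c1 i)).1.
have [C C0 hC] := c2 p w; exists (nr s * C); first by rewrite mulr_ge0 ?nr_ge0.
move=> i x; rewrite (Cinfty_Z s (c1 i)).2.
by rewrite -[nr _]/(nr (s * wderiv w (c i) x)) nrM mulrCA -mulrA ler_wpM2l ?nr_ge0.
Qed.

Lemma csym_cst (I : Type) (om : I -> R) (x : I -> R[i]) : rapid om x ->
  csym om 0 (fun i (_ : 'rV[R]_n) => x i : R[i]^o).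
Proof.
move=> hx; split=> [i|p w]; first exact: (Cinfty_cst (x i : R[i]^o)).1.
have [C C0 hC] := hx p; exists C => // i y; rewrite (Cinfty_cst (x i : R[i]^o)).2.
case: w => [|j w]; first by rewrite subr0 powRr0 mulr1.
by rewrite -[nr _]/(nr (0 : R[i])) nr0 mulr0 mulr_ge0 ?powR_ge0.
Qed.

(* A Taylor remainder of c_k in the direction l decays rapidly in k but grows
   polynomially in l; the growth is absorbed by the coefficients c'_l. *)
Definition gsym (I : Type) (a b : I -> R) m (f : I -> 'rV[R]_n -> R[i]^o) : Prop :=
  (forall i, Cinfty (f i)) /\ forall w, exists A : nat, forall p, exists2 C : R, 0 <= C &
    forall i x, a i ^+ p * nr (wderiv w (f i) x : R[i]) <= C * b i ^+ A * jb x `^ (m - (size w)%:R).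

Lemma csym_gsym (I : Type) (a b : I -> R) m f : csym a m f -> gsym a b m f.
Proof.
move=> [f1 f2]; split => // w; exists 0%N => p; have [C C0 hC] := f2 p w.
by exists C => // i x; rewrite expr0 mulr1; exact: hC.
Qed.

(** The growth exponent A does not depend on the decay exponent p, so decay of order A + p beats the
    growth when both are measured by the same weight. *)
Lemma gsym_csym (I : Type) (a : I -> R) m f : (forall i, 0 < a i) -> gsym a a m f -> csym a m f.
Proof.
move=> a0 [f1 f2]; split => // p w; have [A hA] := f2 w; have [C C0 hC] := hA (A + p)%N.
exists C => // i x; rewrite -(ler_pM2l (exprn_gt0 A (a0 i))) mulrA -exprD.
by apply: (le_trans (hC i x)); rewrite mulrA [C * _]mulrC.
Qed.

(** In each term of the Leibniz rule the growth of [f] in the weight [b] is absorbed by asking [g]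
    for A further powers of decay. *)
Lemma csymM (I : Type) (a b : I -> R) m m' f g : (forall i, 0 <= a i) -> (forall i, 0 <= b i) ->
  gsym a b m f -> csym b m' g ->
  csym (fun i => a i * b i) (m + m') (fun i x => (f i x : R[i]) * g i x : R[i]^o).
Proof.
move=> a0 b0 [f1 f2] [g1 g2]; split=> [i|p w]; first exact: (Cinfty_scale (f1 i) (g1 i)).1.
have h (q : seq 'I_n * seq 'I_n) : exists2 C : R, 0 <= C & forall i x,
    (a i * b i) ^+ p * nr ((wderiv q.1 (f i) x : R[i]) * wderiv q.2 (g i) x) <=
    C * jb x `^ (m + m' - (size q.1 + size q.2)%:R).
  have [A hA] := f2 q.1; have [C C0 hC] := hA p; have [D D0 hD] := g2 (A + p)%N q.2.
  exists (C * D); first exact: mulr_ge0.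
  move=> i x; rewrite nrM exprMn.
  have -> : a i ^+ p * b i ^+ p * (nr (wderiv q.1 (f i) x) * nr (wderiv q.2 (g i) x : R[i])) =
     a i ^+ p * nr (wderiv q.1 (f i) x) * (b i ^+ p * nr (wderiv q.2 (g i) x : R[i])).
    by move: (a i ^+ p) (b i ^+ p) => u v; ring.
  have e : m + m' - (size q.1 + size q.2)%:R = (m - (size q.1)%:R) + (m' - (size q.2)%:R).
    by rewrite natrD; ring.
  rewrite e powRD; last by rewrite (gt_eqF (jb_gt0 x)) implybT.
  apply: (@le_trans _ _ (C * b i ^+ A * jb x `^ (m - (size q.1)%:R) * (b i ^+ p * nr (wderiv q.2 (g i) x : R[i])))).
    by rewrite ler_wpM2r // mulr_ge0 ?exprn_ge0 ?nr_ge0.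
  have := hD i x; rewrite exprD.
  move: (b i ^+ A) (b i ^+ p) (jb x `^ _) (powR_ge0 (jb x) (m - (size q.1)%:R)) (jb x `^ _) => u v s s0 t ht.
  have -> : C * u * s * (v * nr (wderiv q.2 (g i) x : R[i])) = (C * s) * (u * v * nr (wderiv q.2 (g i) x : R[i])) by ring.
  have -> : C * D * (s * t) = (C * s) * (D * t) by ring.
  by rewrite ler_wpM2l // mulr_ge0.
pose C q := s2val (cid2 (h q)).
have C0 q : 0 <= C q := s2valP (cid2 (h q)).
exists (\sum_(q <- splits w) C q); first exact: sumr_ge0.
move=> i x; rewrite (Cinfty_scale (f1 i) (g1 i)).2.
apply: (@le_trans _ _ (\sum_(q <- splits w) (a i * b i) ^+ p * nr ((wderiv q.1 (f i) x : R[i]) * wderiv q.2 (g i) x))).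
  by rewrite -mulr_sumr ler_wpM2l ?exprn_ge0 ?mulr_ge0 //; exact: nr_sum.
rewrite mulr_suml !big_seq; apply: ler_sum => q qw.
by rewrite -(splits_size qw); exact: (s2valP' (cid2 (h q))).
Qed.

(** As a function of the base point the remainder is a finite combination of a translate and
    derivatives of [f]; by symmetry of mixed derivatives it commutes with differentiation. *)
Lemma rem_Cinfty K N (f : 'rV[R]_n -> R[i]^o) l : Cinfty f ->
  Cinfty (fun x => rem K N f x l) /\
  forall w, wderiv w (fun x => rem K N f x l) = fun x => rem K N (wderiv w f) x l.
Proof.
move=> hf; have [t1 t2] := Cinfty_translate l hf.
pose P (b : {ffun 'I_n -> 'I_K.+1}) := (mabs (fun j => b j) < N)%N.
pose s (b : {ffun 'I_n -> 'I_K.+1}) : R[i] := - ((mfact (fun j => b j))%:R^-1 * monom (fun j => b j) l).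
have hs b : P b -> Cinfty (fun x => s b *: mderiv (fun j => b j) f x).
  by move=> _; exact: (Cinfty_Z (s b) (Cinfty_wderiv _ hf)).1.
have [s1 s2] := @Cinfty_sum _ _ _ _ (index_enum _) P _ hs.
have e g : (fun x => rem K N g x l) = fun x => g (x + l) + \sum_(b | P b) s b *: mderiv (fun j => b j) g x.
  apply/funext => x; rewrite /rem -sumrN; congr (_ + _); apply: eq_bigr => b _.
  rewrite /s /tcoef scaleNr; congr (- _).
  by rewrite -[_ *: _]/(_ * _) -!mulrA [monom _ _ * _]mulrC.
rewrite e; have [h1 h2] := CinftyD t1 s1; split => // w; rewrite h2 e t2 s2.
apply/funext => x; congr (_ + _); apply: eq_bigr => b _.
rewrite (Cinfty_Z (s b) (Cinfty_wderiv _ hf)).2; congr (_ *: _).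
by rewrite /mderiv (wderivC _ _ hf).
Qed.

(** [rem_bound] involves only derivatives of order exactly N, whence the drop of N in the order.
    Peetre's inequality moves the weight from xi + z to xi at the cost of a power of [jb (y i)], and
    the constants of the finitely many words of length N are added up. *)
Lemma rem_gsym (I J : Type) (om : J -> R) M c (k : I -> J) (y : I -> 'rV[R]_n) K N :
  (forall j, 0 < om j) -> csym om M c -> (N <= K.+1)%N ->
  gsym (fun i => om (k i)) (fun i => pw (y i)) (M - N%:R)
    (fun i xi => rem K N (c (k i)) xi (y i)).
Proof.
move=> o0 [c1 c2] NK; split=> [i|w]; first exact: (rem_Cinfty _ _ _ (c1 _)).1.
pose s : R := M - N%:R - (size w)%:R.
have [B hB] := @jb_powR_le R n `|s|.
exists (N + B)%N => p.
have h (t : N.-tuple 'I_n) := cid2 (c2 p (t ++ w)).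
pose C t := s2val (h t); have C0 t : 0 <= C t := s2valP (h t).
have T0 : 0 <= \sum_t C t by exact: sumr_ge0.
exists (\sum_t C t * (2 ^+ N * (2 ^+ n) ^+ (N + B))); first by rewrite -mulr_suml !mulr_ge0 ?exprn_ge0 ?exprn_ge0.
move=> i xi; rewrite (rem_Cinfty _ _ _ (c1 _)).2.
have op : 0 < om (k i) ^+ p by rewrite exprn_gt0.
have J0 := ltW (jb_gt0 (y i)).
have bd : nr (rem K N (wderiv w (c (k i))) xi (y i)) <= (2 * \sum_j `|y i 0 j|) ^+ N *
    ((om (k i) ^+ p)^-1 * ((\sum_t C t) * (jb (y i) ^+ B * jb xi `^ s))).
  apply: rem_bound => //; first exact: Cinfty_wderiv.
  move=> v z sv hz; rewrite -wderiv_cat ler_pdivlMl //.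
  have st : size v == N by exact/eqP.
  have hv : om (k i) ^+ p * nr (wderiv (v ++ w) (c (k i)) (xi + z) : R[i]) <=
      C (Tuple st) * jb (xi + z) `^ (M - (size (v ++ w))%:R) := s2valP' (h (Tuple st)) (k i) (xi + z).
  apply: (le_trans hv); rewrite size_cat sv natrD opprD addrA -/s.
  apply: ler_pM; rewrite ?powR_ge0 ?C0 //.
    by rewrite [X in _ <= X](bigD1 (Tuple st)) //= lerDl sumr_ge0.
  apply: (le_trans (peetre xi z s)); rewrite ler_wpM2r ?powR_ge0 //.
  apply: le_trans (hB (y i)); rewrite ge0_ler_powR ?nnegrE ?(ltW (jb_gt0 _)) //.
  by rewrite /jb lerD2l; apply: ler_sum => j _; exact: hz.
apply: (@le_trans _ _ (om (k i) ^+ p * ((2 * jb (y i)) ^+ N *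
    ((om (k i) ^+ p)^-1 * ((\sum_t C t) * (jb (y i) ^+ B * jb xi `^ s)))))).
  rewrite ler_wpM2l ?(ltW op) //; apply: (le_trans bd).
  rewrite ler_wpM2r ?mulr_ge0 ?invr_ge0 ?(ltW op) ?exprn_ge0 ?powR_ge0 //.
  rewrite lerXn2r ?nnegrE ?mulr_ge0 ?sumr_ge0 // ler_wpM2l // /jb lerDr //.
rewrite -mulr_suml -/s.
have -> : om (k i) ^+ p * ((2 * jb (y i)) ^+ N *
    ((om (k i) ^+ p)^-1 * ((\sum_t C t) * (jb (y i) ^+ B * jb xi `^ s)))) =
   (\sum_t C t) * 2 ^+ N * (jb (y i) ^+ (N + B)) * jb xi `^ s.
  rewrite exprMn exprD; move: op; move: (om (k i) ^+ p) (2 ^+ N) (jb (y i) ^+ N) (jb (y i) ^+ B) => u a b d u0.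
  by field; rewrite gt_eqF.
rewrite ler_wpM2r ?powR_ge0 // -!mulrA ler_wpM2l // ler_wpM2l ?exprn_ge0 //.
rewrite -exprMn lerXn2r ?nnegrE ?mulr_ge0 ?exprn_ge0 ?(ltW (pw_gt0 _)) //; exact: jb_le_pw.
Qed.

End SymbolFamilies.

(** * Product and adjoint of scalar symbols *)

Section ScalarProduct.
Context {R : realType} {n : nat} {theta : 'M[R]_n} {T : ncTorus theta} (n_gt0 : (0 < n)%N).
#[local] Opaque pderiv.
Local Notation L := 'rV[int]_n.
Local Notation om := (fun k : L => pw (kvec (R := R) k)).
Local Notation om2 := (fun p : L * L => pw (kvec (R := R) p.1) * pw (kvec (R := R) p.2)).
Local Notation mm := (fun p : L * L => mon T p.1 * mon T p.2).

Let om_gt0 (k : L) : 0 < om k. Proof. exact: pw_gt0. Qed.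
Let om_ge0 (k : L) : 0 <= om k. Proof. exact: ltW. Qed.

Lemma csym_pull (I J : Type) (a : J -> R) m f (h : I -> J) : csym a m f ->
  csym (fun i => a (h i)) m (fun i => f (h i) : 'rV[R]_n -> R[i]^o).
Proof.
move=> [f1 f2]; split => [i|p w]; first exact: f1.
by have [C C0 hC] := f2 p w; exists C => // i x; exact: hC.
Qed.

Lemma csym_mulw (I : Type) (a : I -> R) m f (s : I -> R[i]) q : (forall i, 0 <= a i) ->
  (forall i, nr (s i) <= a i ^+ q) -> csym a m f ->
  csym a m (fun i (x : 'rV[R]_n) => s i * f i x : R[i]^o).
Proof.
move=> a0 hs [f1 f2]; split=> [i|p w]; first exact: (Cinfty_Z (s i) (f1 i)).1.
have [C C0 hC] := f2 (p + q)%N w; exists C => // i x; rewrite (Cinfty_Z (s i) (f1 i)).2.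
apply: le_trans (hC i x); rewrite -[nr (s i *: _)]/(nr (s i * wderiv w (f i) x)) nrM mulrA.
by rewrite ler_wpM2r ?nr_ge0 // exprD ler_wpM2l ?exprn_ge0.
Qed.

Lemma nr_monom (l : 'I_n -> nat) (y : 'rV[R]_n) : nr (monom l y : R[i]) <= pw y ^+ mabs l.
Proof.
rewrite /monom nr_real normr_prod /mabs -prodrXr; apply: ler_prod => j _.
rewrite normr_ge0 normrX lerXn2r ?nnegrE ?(ltW (pw_gt0 _)) //; exact: coord_le_pw.
Qed.

Lemma fsum_sum (I : countType) (U : I -> T) q w (J : Type) (s : seq J) (P : pred J) (y : J -> I -> R[i]) :
  eigenfamily U q w -> (forall j, rapid w (y j)) ->
  rapid w (fun i => \sum_(j <- s | P j) y j i) /\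
  fsum U (fun i => \sum_(j <- s | P j) y j i) = \sum_(j <- s | P j) fsum U (y j).
Proof.
move=> E hy; elim: s => [|j s [r1 e1]].
  have e0 : (fun i => \sum_(j <- [::] | P j) y j i) = fun=> 0 by apply/funext => i; rewrite big_nil.
  rewrite e0 big_nil; split.
    by move=> p; exists 0 => // i; rewrite nr0 mulr0.
  rewrite /fsum (_ : (fun i => _) = fun=> 0); last by apply/funext => i; rewrite scale0r.
  apply: csum_unique; rewrite (_ : psum _ = fun=> 0); first exact: cvg_cst.
  apply/funext => N; rewrite /psum big1 // => k _; rewrite /cseq; by case: pickle_inv.
rewrite big_cons; have [Pj|Pj] := boolP (P j).
  have e : (fun i => \sum_(j <- j :: s | P j) y j i) = fun i => 1 * y j i + \sum_(j <- s | P j) y j i.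
    by apply/funext => i; rewrite big_cons Pj mul1r.
  rewrite e; split; first exact: (rapidZD E 1 (hy j) r1).
  by rewrite (fsumZD E 1 (hy j) r1) scale1r e1.
have e : (fun i => \sum_(j <- j :: s | P j) y j i) = fun i => \sum_(j <- s | P j) y j i.
  by apply/funext => i; rewrite big_cons (negbTE Pj).
by rewrite e.
Qed.

Lemma rapid_eq (I : Type) (w : I -> R) x y : (forall i, x i = y i) -> rapid w x -> rapid w y.
Proof. by move=> e; rewrite (_ : x = y) //; apply/funext. Qed.

(* With rho = sum_k c_k U^k, P_rho' U^m = sum_l c'_l(m) U^l U^m has components
   of frequency l + m, so that P_rho P_rho' U^m =
   sum_{k,l} c_k(m + l) c'_l(m) U^k U^l U^m. *)
Definition sprod (rho rho' : 'rV[R]_n -> T) : 'rV[R]_n -> T :=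
  tsum mm (fun p xi => coef p.1 (rho (xi + kvec p.2)) * coef p.2 (rho' xi) : R[i]^o).

Definition pterm (rho rho' : 'rV[R]_n -> T) (l : 'I_n -> nat) (xi : 'rV[R]_n) : T :=
  (mfact l)%:R^-1 *: (mderiv l rho xi * mdelta l (rho' xi)).

Lemma fsumZ (I : countType) (U : I -> T) q w (s : R[i]) (x : I -> R[i]) :
  eigenfamily U q w -> rapid w x -> fsum U (fun i => s * x i) = s *: fsum U x.
Proof.
move=> E rx; have [b hb xb] := rapid_bound E rx.
rewrite /fsum -(csumZ s hb) => [|i]; last exact: le_trans (nr_U_le E _ _) (xb i).
by congr csum; apply/funext => i; rewrite scalerA.
Qed.

Section Product.
Context (M M' : R) (rho rho' : 'rV[R]_n -> T) (hr : symbol M rho) (hr' : symbol M' rho').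
Let c (k : L) (xi : 'rV[R]_n) : R[i]^o := coef k (rho xi).
Let c' (k : L) (xi : 'rV[R]_n) : R[i]^o := coef k (rho' xi).
Let hc : csym om M c := (symbol_csym n_gt0 hr).1.
Let hc' : csym om M' c' := (symbol_csym n_gt0 hr').1.

(** For N = 0 the Taylor polynomial is empty and this is the family defining [sprod] itself; for N =
    K + 1 it is the remainder of the asymptotic expansion. *)
Let rem_csym K N : (N <= K.+1)%N -> csym om2 (M + M' - N%:R)
  (fun p xi => (rem K N (c p.1) xi (kvec p.2) : R[i]) * c' p.2 xi : R[i]^o).
Proof.
move=> NK; rewrite (_ : M + M' - N%:R = (M - N%:R) + M'); last by ring.
apply: (@csymM _ _ _ (fun p : L * L => om p.1) (fun p : L * L => om p.2)) => //.
  exact: (rem_gsym fst (fun p : L * L => kvec p.2) om_gt0 hc NK).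
exact: (csym_pull snd hc').
Qed.

Let pf l (p : L * L) (xi : 'rV[R]_n) : R[i]^o := (tcoef (c p.1) xi l : R[i]) * monom l (kvec p.2) * c' p.2 xi.

Let pf_csym l : csym om2 (M + M' - (mabs l)%:R) (pf l).
Proof.
rewrite (_ : M + M' - (mabs l)%:R = (M - (mabs l)%:R) + M'); last by ring.
have h1 : csym om (M - (mabs l)%:R) (fun k xi => (mfact l)%:R^-1 * mderiv l (c k) xi : R[i]^o).
  by rewrite -size_mword; apply: csymZ; exact: (csym_wderiv _ hc).
have h2 : csym om M' (fun k xi => monom l (kvec k) * c' k xi : R[i]^o).
  by apply: (csym_mulw om_ge0 _ hc') => k; exact: nr_monom.
have := @csymM _ _ _ (fun p : L * L => om p.1) (fun p : L * L => om p.2) _ _ _ _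
  (fun p => om_ge0 p.1) (fun p => om_ge0 p.2) (csym_gsym _ (csym_pull fst h1)) (csym_pull snd h2).
congr csym; apply/funext => p; apply/funext => xi; rewrite /pf /tcoef /=.
by rewrite -!mulrA.
Qed.

Let ptermE l : pterm rho rho' l = tsum mm (pf l).
Proof.
apply/funext => xi; rewrite /pterm {1}(symbol_csym n_gt0 hr).2 {1}(symbol_csym n_gt0 hr').2 -/c -/c'.
rewrite /mderiv (tsum_wderiv (mon_family T) _ hc).
have r1 := csym_rapid (mword l) xi hc; have r2 := csym_rapid [::] xi hc'.
change (mdelta l (tsum (mon T) c' xi)) with (mdelta l (fsum (mon T) (c' ^~ xi))).
rewrite (mdelta_fsum (mon_family T) _ r2).
have r3 : rapid om (fun k => (freq k (mword l))%:C%C * wderiv [::] (c' k) xi).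
  apply: (rapid_eq _ (csym_rapid [::] xi (csym_mulw (s := fun k => monom l (kvec k)) om_ge0 (fun k => nr_monom l (kvec k)) hc'))) => k.
  by rewrite freq_mword.
rewrite (fsumM T r1 r3) -(fsumZ _ (mon_mul_family T) (rapid_prod r1 r3)).
congr csum; apply/funext => p; congr (_ *: _).
rewrite /pf /tcoef /monom freq_mword /= -/(mderiv l (c p.1)) -[in RHS]mulrA.
by rewrite -mulrA; congr (_ * _); rewrite mulrA.
Qed.

Lemma symbol_sprod : symbol (M + M') (sprod rho rho').
Proof.
have := csym_symbol (mon_mul_family T) (rem_csym (leq0n 1)); rewrite subr0.
congr symbol; rewrite /sprod; congr tsum; apply/funext => p; apply/funext => xi.
by rewrite /rem big_pred0 // subr0.
Qed.

Lemma symbol_pterm l : symbol (M + M' - (mabs l)%:R) (pterm rho rho' l).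
Proof. by rewrite ptermE; exact: (csym_symbol (mon_mul_family T) (pf_csym l)). Qed.

Lemma symbol_sprod_rem N : (0 < N)%N -> symbol (M + M' - N%:R) (fun xi => sprod rho rho' xi -
  \sum_(l : {ffun 'I_n -> 'I_N} | (mabs (fun j => l j) < N)%N) pterm rho rho' (fun j => l j) xi).
Proof.
case: N => // K _; have := csym_symbol (mon_mul_family T) (rem_csym (leqnn K.+1)).
congr symbol; apply/funext => xi.
have r0 : rapid om2 (fun p => (rem K 0 (c p.1) xi (kvec p.2) : R[i]) * c' p.2 xi).
  exact: (csym_rapid [::] xi (rem_csym (leq0n _))).
pose P (l : {ffun 'I_n -> 'I_K.+1}) := (mabs (fun j => l j) < K.+1)%N.
have [r1 e1] := fsum_sum (index_enum _) P (mon_mul_family T)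
  (fun l : {ffun 'I_n -> 'I_K.+1} => csym_rapid [::] xi (pf_csym (fun j => l j))).
have eP : \sum_(l | P l) pterm rho rho' (fun j => l j) xi =
    fsum mm (fun p => \sum_(l | P l) pf (fun j => l j) p xi).
  by apply: (eq_trans _ (esym e1)); apply: eq_bigr => l _; rewrite ptermE.
rewrite -/P eP addrC -scaleN1r.
have e0 : sprod rho rho' xi = fsum mm (fun p => (rem K 0 (c p.1) xi (kvec p.2) : R[i]) * c' p.2 xi).
  by rewrite /sprod; congr csum; apply/funext => p; rewrite /rem big_pred0 // subr0.
rewrite e0 -(fsumZD (mon_mul_family T) (-1) r1 r0).
congr csum; apply/funext => p; congr (_ *: _).
rewrite /rem [X in _ = _ + (_ - X) * _]big_pred0 // subr0 mulrBl mulN1r [RHS]addrC; congr (_ - _).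
by rewrite mulr_suml.
Qed.

Lemma opa_sprod (a : T) : Tinf a ->
  opa (fun k xi => coef k (rho xi)) (opa (fun k xi => coef k (rho' xi)) a) =
  opa (fun k xi => coef k (sprod rho rho' xi)) a :> T.
Proof.
move=> sa; have [hd dE] := symbol_csym n_gt0 symbol_sprod.
have hD := rem_csym (leq0n 1); rewrite subr0 in hD.
apply: (opa_comp n_gt0 hc hc' hd _ _ sa).
  move: hD; congr csym; apply/funext => p; apply/funext => xi.
  by rewrite /rem big_pred0 // subr0.
move=> xi; exact: (esym (congr1 (fun f => f xi) dE)).
Qed.

End Product.
End ScalarProduct.

Section ScalarAdjoint.
Context {R : realType} {n : nat} {theta : 'M[R]_n} {T : ncTorus theta} (n_gt0 : (0 < n)%N).
#[local] Opaque pderiv.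
Local Notation L := 'rV[int]_n.
Local Notation om := (fun k : L => pw (kvec (R := R) k)).
Local Notation sm := (fun k : L => star (mon T k)).

Let om_gt0 (k : L) : 0 < om k. Proof. exact: pw_gt0. Qed.
Let om_ge0 (k : L) : 0 <= om k. Proof. exact: ltW. Qed.

Lemma wderiv_conj (f : 'rV[R]_n -> R[i]^o) : Cinfty f ->
  Cinfty (fun x => conjc (f x) : R[i]^o) /\
  forall w, wderiv w (fun x => conjc (f x) : R[i]^o) = fun x => conjc (wderiv w f x).
Proof.
move=> hf; have hZ (r : R) (a : R[i]^o) : conjc (r%:C%C *: a) = r%:C%C *: (conjc a : R[i]^o).
  by case: a => x y; apply/eqP; rewrite eq_complex /=; apply/andP; split; apply/eqP; ring.
have hc : continuous (@conjc R : R[i]^o -> R[i]^o).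
  move=> z; have h : (id : R[i]^o -> R[i]^o) @ z --> z by exact: cvg_id.
  apply/(cvg_nrP (FF := nbhs_filter z)) => e e0.
  have := (cvg_nrP (FF := nbhs_filter z) (id : R[i]^o -> R[i]^o) z).1 h e e0.
  by apply: filterS => t; rewrite -rmorphB nr_conj.
pose S : {additive R[i]^o -> R[i]^o} := GRing.Additive.clone _ _ (@conjc R : R[i]^o -> R[i]^o) _.
split; first exact: (Cinfty_comp (T := S) hZ hc hf).
by move=> w; rewrite (wderiv_comp (T := S) hZ hc (fun w => (hf w).2)).
Qed.

Lemma csym_conj (I : Type) (a : I -> R) m f : csym a m f ->
  csym a m (fun i (x : 'rV[R]_n) => conjc (f i x) : R[i]^o).
Proof.
move=> [f1 f2]; split=> [i|p w]; first exact: (wderiv_conj (f1 i)).1.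
have [C C0 hC] := f2 p w; exists C => // i x.
by rewrite (wderiv_conj (f1 i)).2 nr_conj.
Qed.

(* The matrix coefficient of P_rho from U^m to U^(m + k) is c_k(m); conjugating
   it, evaluated at m = xi - k, gives the adjoint symbol. *)
Definition sadj (rho : 'rV[R]_n -> T) : 'rV[R]_n -> T :=
  tsum sm (fun k xi => conjc (coef k (rho (xi - kvec k))) : R[i]^o).

Definition aterm (rho : 'rV[R]_n -> T) (l : 'I_n -> nat) (xi : 'rV[R]_n) : T :=
  (mfact l)%:R^-1 *: mderiv l (fun eta => mdelta l (star (rho eta))) xi.

Section Adjoint.
Context (M : R) (rho : 'rV[R]_n -> T) (hr : symbol M rho).
Let c (k : L) (xi : 'rV[R]_n) : R[i]^o := coef k (rho xi).
Let hc : csym om M c := (symbol_csym n_gt0 hr).1.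
Let g (k : L) (xi : 'rV[R]_n) : R[i]^o := conjc (c k xi).
Let hg : csym om M g := csym_conj hc.

(** The increment is -k, so the growth of the remainder is in the same index in which the
    coefficients decay; hence [gsym_csym] in place of a second rapidly decreasing factor. *)
Let rem_csym K N : (N <= K.+1)%N -> csym om (M - N%:R)
  (fun k xi => rem K N (g k) xi (- kvec k) : R[i]^o).
Proof.
move=> NK; apply: gsym_csym => //.
have := rem_gsym id (fun k : L => - kvec k) om_gt0 hg NK.
congr gsym; apply/funext => k; apply: eq_bigr => j _.
by rewrite mxE sqrrN.
Qed.

Let af l (k : L) (xi : 'rV[R]_n) : R[i]^o := (tcoef (g k) xi l : R[i]) * monom l (- kvec k).

Let monomN_bound l (k : L) : nr (monom l (- kvec k : 'rV[R]_n) : R[i]) <= om k ^+ mabs l.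
Proof.
apply: (le_trans (nr_monom l (- kvec k : 'rV[R]_n))); rewrite le_eqVlt; apply/orP; left; apply/eqP.
by congr (_ ^+ _); apply: eq_bigr => j _; rewrite mxE sqrrN.
Qed.

Let af_csym l : csym om (M - (mabs l)%:R) (af l).
Proof.
have h1 : csym om (M - (mabs l)%:R) (fun k xi => (mfact l)%:R^-1 * mderiv l (g k) xi : R[i]^o).
  by rewrite -size_mword; apply: csymZ; exact: (csym_wderiv _ hg).
have := csym_mulw om_ge0 (monomN_bound l) h1.
by congr csym; apply/funext => k; apply/funext => xi; rewrite /af /tcoef mulrC.
Qed.

Let kvecN (k : L) : kvec (- k) = - kvec k :> 'rV[R]_n.
Proof. by apply/rowP => j; rewrite !mxE intrN. Qed.

Let atermE l : aterm rho l = tsum sm (af l).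
Proof.
apply/funext => xi; rewrite /aterm.
have hm : csym om M (fun k xi => monom l (- kvec k) * g k xi : R[i]^o).
  exact: (csym_mulw om_ge0 (monomN_bound l) hg).
have e : (fun eta => mdelta l (star (rho eta))) = tsum sm (fun k xi => monom l (- kvec k) * g k xi : R[i]^o).
  apply/funext => eta; have rc := csym_rapid [::] eta hc; have rg := csym_rapid [::] eta hg.
  rewrite {1}(symbol_csym n_gt0 hr).2 -/c -[tsum _ _ _]/(fsum (mon T) (c ^~ eta)).
  rewrite (star_fsum (mon_family T) rc) (mdelta_fsum (star_mon_family T) _ rg).
  by congr csum; apply/funext => k; rewrite freq_mword kvecN.
rewrite e /mderiv (tsum_wderiv (star_mon_family T) _ hm).
rewrite -(fsumZ _ (star_mon_family T) (csym_rapid _ _ hm)).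
congr csum; apply/funext => k; congr (_ *: _).
rewrite (Cinfty_Z (monom l (- kvec k)) (hg.1 k)).2 /af /tcoef -/(mderiv l (g k)).
by rewrite -[_ *: _]/(_ * _) mulrA mulrAC.
Qed.

Let rem0E k xi : rem 0 0 (g k) xi (- kvec k) = conjc (coef k (rho (xi - kvec k))).
Proof. by rewrite /rem big_pred0 // subr0. Qed.

Let sadj_csym : csym om M (fun k xi => conjc (coef k (rho (xi - kvec k))) : R[i]^o).
Proof.
have := rem_csym (leq0n 1); rewrite subr0.
by congr csym; apply/funext => k; apply/funext => xi; exact: rem0E.
Qed.

Lemma symbol_sadj : symbol M (sadj rho).
Proof. exact: (csym_symbol (star_mon_family T) sadj_csym). Qed.

Lemma symbol_aterm l : symbol (M - (mabs l)%:R) (aterm rho l).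
Proof. by rewrite atermE; exact: (csym_symbol (star_mon_family T) (af_csym l)). Qed.

Lemma symbol_sadj_rem N : (0 < N)%N -> symbol (M - N%:R) (fun xi => sadj rho xi -
  \sum_(l : {ffun 'I_n -> 'I_N} | (mabs (fun j => l j) < N)%N) aterm rho (fun j => l j) xi).
Proof.
case: N => // K _; have := csym_symbol (star_mon_family T) (rem_csym (leqnn K.+1)).
congr symbol; apply/funext => xi.
have r0 := csym_rapid [::] xi sadj_csym.
pose P (l : {ffun 'I_n -> 'I_K.+1}) := (mabs (fun j => l j) < K.+1)%N.
have [r1 e1] := fsum_sum (index_enum _) P (star_mon_family T)
  (fun l : {ffun 'I_n -> 'I_K.+1} => csym_rapid [::] xi (af_csym (fun j => l j))).
have eP : \sum_(l | P l) aterm rho (fun j => l j) xi =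
    fsum sm (fun k => \sum_(l | P l) af (fun j => l j) k xi).
  by apply: (eq_trans _ (esym e1)); apply: eq_bigr => l _; rewrite atermE.
rewrite -/P eP addrC -scaleN1r.
rewrite -[sadj rho xi]/(fsum sm (fun k => conjc (coef k (rho (xi - kvec k))))).
rewrite -(fsumZD (star_mon_family T) (-1) r1 r0).
by congr csum; apply/funext => k; congr (_ *: _); rewrite mulN1r [RHS]addrC.
Qed.

Lemma opa_sadj (a b : T) : Tinf a -> Tinf b ->
  nct_tau T (star b * opa (fun k xi => coef k (rho xi)) a) =
  nct_tau T (star (opa (fun k xi => coef k (sadj rho xi)) b : T) * a).
Proof.
move=> sa sb; have [hd dE] := symbol_csym n_gt0 symbol_sadj.
apply: (opa_adjoint n_gt0 hc hd sadj_csym _ sa sb) => xi.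
exact: (esym (congr1 (fun f => f xi) dE)).
Qed.

End Adjoint.
End ScalarAdjoint.

(** * Matrix symbols and the projector *)

Section MatrixSymbols.
Context {R : realType} {n : nat} {theta : 'M[R]_n} {T : ncTorus theta} (n_gt0 : (0 < n)%N).
Local Notation L := 'rV[int]_n.
Local Notation om := (fun k : L => pw (kvec (R := R) k)).
Local Notation mm := (fun p : L * L => mon T p.1 * mon T p.2).
Local Notation sc rho := (fun (k : L) (xi : 'rV[R]_n) => coef k (rho xi) : R[i]^o).

Lemma symbol_sum m (J : Type) (s : seq J) (rho : J -> 'rV[R]_n -> T) :
  (forall j, symbol m (rho j)) -> symbol m (fun xi => \sum_(j <- s) rho j xi).
Proof.
move=> h; pose c j := sc (rho j); have hc j : csym om m (c j) := (symbol_csym n_gt0 (h j)).1.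
have hs : csym om m (fun k xi => \sum_(j <- s) c j k xi : R[i]^o).
  elim: s => [|j s IH].
    rewrite (_ : (fun k => _) = fun k (xi : 'rV[R]_n) => 0 * (\sum_(j <- [::]) c j k xi) : R[i]^o); last first.
      by apply/funext => k; apply/funext => xi; rewrite big_nil mul0r.
    split=> [k|p w].
      rewrite (_ : (fun x => _) = fun=> 0 : R[i]^o); first exact: (Cinfty_cst (0 : R[i]^o)).1.
      by apply/funext => x; rewrite big_nil mul0r.
    exists 0 => // k x; rewrite (_ : (fun x => _) = fun=> 0 : R[i]^o).
      rewrite (Cinfty_cst (0 : R[i]^o)).2; case: w => [|i w];
      by rewrite -[nr _]/(nr (0 : R[i])) nr0 mulr0 mul0r.
    by apply/funext => y; rewrite big_nil mul0r.
  have := csymD (fun k => ltW (pw_gt0 (kvec k))) (hc j) IH.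
  by congr csym; apply/funext => k; apply/funext => xi; rewrite big_cons.
have := csym_symbol (mon_family T) hs; congr symbol; apply/funext => xi.
have [_ e] := fsum_sum s xpredT (mon_family T) (fun j => csym_rapid [::] xi (hc j)).
apply: (eq_trans e); apply: eq_bigr => j _.
exact: (esym (congr1 (fun f => f xi) (symbol_csym n_gt0 (h j)).2)).
Qed.

Lemma opa_symbol_sum m (J : Type) (s : seq J) (rho : J -> 'rV[R]_n -> T) (a : T) :
  (forall j, symbol m (rho j)) -> Tinf a ->
  opa (sc (fun xi => \sum_(j <- s) rho j xi)) a = \sum_(j <- s) opa (sc (rho j)) a.
Proof.
move=> h sa; have ra := smooth_rapid sa.
have ho j := opcoef_rapid (symbol_csym n_gt0 (h j)).1 ra.
have [_ e] := fsum_sum s xpredT (mon_mul_family T) ho.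
apply: etrans e; rewrite /opa /opc; congr csum; apply/funext => p; congr (_ *: _).
by rewrite /opcoef linear_sum mulr_suml.
Qed.

Lemma opa_sum m (J : Type) (s : seq J) (rho : 'rV[R]_n -> T) (a : J -> T) :
  symbol m rho -> (forall j, Tinf (a j)) ->
  opa (sc rho) (\sum_(j <- s) a j) = \sum_(j <- s) opa (sc rho) (a j).
Proof.
move=> h sa; have hc := (symbol_csym n_gt0 h).1.
have s0 : Tinf (0 : T) by have := smooth_scale_mon T 0 0; rewrite scale0r.
elim: s => [|j s IH].
  by rewrite !big_nil; have := opaZD hc (-1) s0 s0; rewrite !scaleN1r !addNr.
by rewrite !big_cons -IH -[a j in LHS]scale1r (opaZD hc 1 (sa j) (smooth_sum s sa).1) scale1r.
Qed.

Lemma symbol_cst (x : T) : Tinf x -> symbol 0 (fun _ : 'rV[R]_n => x).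
Proof.
move=> sx; have := csym_symbol (mon_family T) (csym_cst (n := n) (smooth_rapid sx)).
congr symbol; apply/funext => xi; exact: (esym (smooth_fsum n_gt0 sx)).
Qed.

Lemma opa_cst (x a : T) : Tinf x -> Tinf a -> opa (sc (fun=> x)) a = x * a.
Proof.
move=> sx sa; rewrite [x in RHS](smooth_fsum n_gt0 sx) [a in RHS](smooth_fsum n_gt0 sa).
exact: (esym (fsumM T (smooth_rapid sx) (smooth_rapid sa))).
Qed.

Lemma sprod_cst M (x : T) rho : Tinf x -> symbol M rho ->
  sprod (fun=> x) rho = fun xi => x * rho xi.
Proof.
move=> sx hr; apply/funext => xi.
have [hc e] := symbol_csym n_gt0 hr; rewrite [in RHS]e [x in RHS](smooth_fsum n_gt0 sx).
exact: (esym (fsumM T (smooth_rapid sx) (csym_rapid [::] xi hc))).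
Qed.

(** Faithfulness of the trace: an element of L^2 norm 0 has vanishing Fourier coefficients by
    Bessel's inequality. *)
Lemma tau_eq0 (a : T) : nct_tau T (star a * a) = 0 -> a = 0.
Proof.
move=> h; apply: (coef_inj n_gt0) => k; rewrite [RHS]linear0; apply: nr_eq0.
apply/eqP; rewrite eq_le nr_ge0 andbT; apply: (le_trans (nr_coef_le_l2norm k a)).
by rewrite /l2norm h /= sqrtr0.
Qed.

Context {r : nat}.
Implicit Types (rho : 'rV[R]_n -> 'M[T]_r) (a b : 'cV[T]_r).

Lemma inner_mulmx (A : 'M[T]_r) a b : inner (A *m a) b = inner a (mxstar A *m b).
Proof.
rewrite /inner; under eq_bigr => i _ do rewrite mxE mulr_sumr linear_sum.
rewrite exchange_big; apply: eq_bigr => j _.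
rewrite mxE (big_morph _ (@starD _ T) (@star0 _ T)) mulr_suml linear_sum.
by apply: eq_bigr => i _; rewrite !mxE starM starK mulrA.
Qed.

Lemma inner_eq0 a : inner a a = 0 -> a = 0.
Proof.
move=> /eqP; rewrite psumr_eq0 => [/allP h|j _]; last exact: nct_tau_ge0.
apply/colP => j; rewrite mxE; apply: tau_eq0; apply/eqP.
by apply: h; rewrite mem_index_enum.
Qed.

Definition mxprod rho rho' (xi : 'rV[R]_n) : 'M[T]_r :=
  \matrix_(i, k) \sum_j sprod (fun eta => rho eta i j) (fun eta => rho' eta j k) xi.

Definition mxadj rho (xi : 'rV[R]_n) : 'M[T]_r :=
  \matrix_(i, j) sadj (fun eta => rho eta j i) xi.

Section Product.
Context (M M' : R) (rho rho' : 'rV[R]_n -> 'M[T]_r) (hr : mxsymbol M rho) (hr' : mxsymbol M' rho').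

Lemma product_asymptotic : asymptotic (M + M') (mxprod rho rho') (product_term rho rho').
Proof.
have pE l xi i k : product_term rho rho' l xi i k =
    \sum_j pterm (fun eta => rho eta i j) (fun eta => rho' eta j k) l xi.
  rewrite /product_term !mxE scaler_sumr; apply: eq_bigr => j _.
  by rewrite !mxE.
split=> [i k|l i k|N N0 i k].
- have := symbol_sum (index_enum 'I_r) (fun j => symbol_sprod n_gt0 (hr i j) (hr' j k)).
  by congr symbol; apply/funext => xi; rewrite mxE.
- have := symbol_sum (index_enum 'I_r) (fun j => symbol_pterm n_gt0 (hr i j) (hr' j k) l).
  by congr symbol; apply/funext => xi; rewrite pE.
have := symbol_sum (index_enum 'I_r) (fun j => symbol_sprod_rem n_gt0 (hr i j) (hr' j k) N0).
congr symbol; apply/funext => xi; rewrite sumrB [RHS]mxE [X in _ = X + _]mxE [X in _ = _ + X]mxE.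
congr (_ + - _); rewrite summxE exchange_big; apply: eq_bigr => l _.
by rewrite pE.
Qed.

Lemma mxop_mxprod a : (forall j, Tinf (a j 0)) ->
  mxop rho (mxop rho' a) = mxop (mxprod rho rho') a.
Proof.
move=> sa; apply/colP => i; rewrite !mxE.
have op_smooth j k : Tinf (opa (sc (fun xi => rho' xi j k)) (a k 0) : T).
  have [hc _] := symbol_csym n_gt0 (hr' j k).
  exact: (fsum_smooth (mon_mul_family T) (opcoef_rapid hc (smooth_rapid (sa k)))).1.
under eq_bigr => j _ do rewrite mxE (opa_sum _ (hr i j) (op_smooth j)).
rewrite exchange_big; apply: eq_bigr => k _.
have -> : (fun (q : L) xi => coef q (mxprod rho rho' xi i k)) =
    sc (fun xi => \sum_j sprod (fun eta => rho eta i j) (fun eta => rho' eta j k) xi).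
  by apply/funext => q; apply/funext => xi; rewrite mxE.
rewrite (opa_symbol_sum _ (fun j => symbol_sprod n_gt0 (hr i j) (hr' j k)) (sa k)).
by apply: eq_bigr => j _; exact: opa_sprod.
Qed.

End Product.

Section Adjoint.
Context (M : R) (rho : 'rV[R]_n -> 'M[T]_r) (hr : mxsymbol M rho).

Lemma adjoint_asymptotic : asymptotic M (mxadj rho) (adjoint_term rho).
Proof.
have aE l xi i j : adjoint_term rho l xi i j = aterm (fun eta => rho eta j i) l xi.
  rewrite /adjoint_term !mxE; congr (_ *: mderiv l _ xi).
  by apply/funext => eta; rewrite !mxE.
split=> [i j|l i j|N N0 i j].
- by have := symbol_sadj n_gt0 (hr j i); congr symbol; apply/funext => xi; rewrite mxE.
- by have := symbol_aterm n_gt0 (hr j i) l; congr symbol; apply/funext => xi; rewrite aE.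
have := symbol_sadj_rem n_gt0 (hr j i) N0.
congr symbol; apply/funext => xi; rewrite [RHS]mxE [X in _ = X + _]mxE [X in _ = _ + X]mxE.
by congr (_ + - _); rewrite summxE; apply: eq_bigr => l _; rewrite aE.
Qed.

Lemma inner_mxop a b : (forall j, Tinf (a j 0)) -> (forall j, Tinf (b j 0)) ->
  inner (mxop rho a) b = inner a (mxop (mxadj rho) b).
Proof.
move=> sa sb; rewrite /inner.
under eq_bigr => i _ do rewrite mxE mulr_sumr linear_sum.
rewrite exchange_big; apply: eq_bigr => j _.
rewrite mxE (big_morph _ (@starD _ T) (@star0 _ T)) mulr_suml linear_sum.
apply: eq_bigr => i _.
have -> : (fun (q : L) xi => coef q (mxadj rho xi j i)) = sc (sadj (fun eta => rho eta i j)).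
  by apply/funext => q; apply/funext => xi; rewrite mxE.
exact: (opa_sadj n_gt0 (hr i j) (sa j) (sb i)).
Qed.

End Adjoint.

Section ConstantFactor.
Context (e : 'M[T]_r) (se : forall j k, Tinf (e j k)).

Lemma mxsymbol_cst : mxsymbol 0 (fun _ : 'rV[R]_n => e).
Proof. by move=> j k; exact: symbol_cst. Qed.

Lemma mxop_cst a : (forall j, Tinf (a j 0)) -> mxop (fun=> e) a = e *m a.
Proof.
move=> sa; apply/colP => i; rewrite !mxE; apply: eq_bigr => j _.
exact: (opa_cst (se i j) (sa j)).
Qed.

Lemma mulmx_smooth a i : (forall j, Tinf (a j 0)) -> Tinf ((e *m a) i 0).
Proof. by move=> sa; rewrite -mxop_cst //; exact: (mxop_smooth n_gt0 i mxsymbol_cst sa). Qed.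

(** Multiplication by [e] is the operator with constant symbol [e]. Since that symbol does not vary
    with the covector, its product with another symbol is the pointwise one, without correction
    terms. *)
Lemma mulmx_mxprod M rho : mxsymbol M rho -> mxprod (fun=> e) rho = fun xi => e *m rho xi.
Proof.
move=> hr; apply/funext => xi; apply/matrixP => i k; rewrite !mxE; apply: eq_bigr => j _.
by rewrite (sprod_cst (se i j) (hr j k)).
Qed.

Lemma mxsymbol_mulmx M rho : mxsymbol M rho -> mxsymbol M (fun xi => e *m rho xi).
Proof.
move=> hr; have [h _ _] := product_asymptotic mxsymbol_cst hr.
by rewrite add0r (mulmx_mxprod hr) in h.
Qed.

Lemma mxop_mulmx M rho a : mxsymbol M rho -> (forall j, Tinf (a j 0)) ->
  mxop (fun xi => e *m rho xi) a = e *m mxop rho a.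
Proof.
move=> hr sa; rewrite -(mulmx_mxprod hr) -(mxop_mxprod mxsymbol_cst hr sa) mxop_cst // => j.
exact: (mxop_smooth n_gt0 j hr sa).
Qed.

End ConstantFactor.
End MatrixSymbols.

Theorem theorem1p5 (R : realType) (n : nat) (theta : 'M[R]_n)
  (n_gt0 : (0 < n)%N)
  (theta_skew : theta^T = - theta)
  (theta_irr : forall j k : 'I_n, (j < k)%N -> irrational (theta j k))
  (theta_free : upper_Qfree theta)
  (T : ncTorus theta) (r : nat) (e : 'M[T]_r) (e_proj : projector e)
  (M : R) (rho : 'rV[R]_n -> 'M[T]_r) (P : 'cV[T]_r -> 'cV[T]_r)
  (rho_symbol : mxsymbol M rho) (P_rho : is_pdo e rho P) :
  (exists (Ps : 'cV[T]_r -> 'cV[T]_r) (sg : 'rV[R]_n -> 'M[T]_r),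
     [/\ is_adjoint e P Ps,
         asymptotic M sg (adjoint_term rho),
         is_pdo e (fun xi => e *m sg xi) Ps
       & respects_complement e rho -> is_pdo e sg Ps])
  /\
  (forall (M' : R) (rho' : 'rV[R]_n -> 'M[T]_r) (Q : 'cV[T]_r -> 'cV[T]_r),
     mxsymbol M' rho' -> is_pdo e rho' Q ->
     exists sg : 'rV[R]_n -> 'M[T]_r,
       asymptotic (M + M') sg (product_term rho rho') /\
       is_pdo e sg (fun a => P (Q a))).
Proof.
have [se e_star ee] := e_proj.
have PE a : Defs.inE e a -> P a = mxop rho a := is_pdo_mxop n_gt0 rho_symbol P_rho (a := a).
split; last first.
  move=> M' rho' Q hr' Q_rho'; exists (mxprod rho rho').
  have [hs hs1 hs2] := product_asymptotic n_gt0 rho_symbol hr'.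
  split=> //; apply: (mxop_is_pdo n_gt0 hs) => a aE.
  have [QE _] := Q_rho' a aE; have [PQE _] := P_rho _ QE; split => //.
  by rewrite (PE _ QE) (is_pdo_mxop n_gt0 hr' Q_rho' aE) (mxop_mxprod n_gt0 rho_symbol hr' aE.1).
have asym := adjoint_asymptotic n_gt0 rho_symbol; have [hs _ _] := asym.
pose sg := mxadj rho.
have eK a : e *m (e *m a) = e *m a by rewrite mulmxA ee.
have sgE b j : Defs.inE e b -> Tinf (mxop sg b j 0).
  by move=> bE; exact: (mxop_smooth n_gt0 j hs bE.1).
have PsE b : Defs.inE e b -> Defs.inE e (e *m mxop sg b).
  by move=> bE; split=> [j|]; [apply: (mulmx_smooth n_gt0 se) => k; exact: sgE|exact: eK].
(* The adjoint on E is the compression to E of the operator with symbol [sg]: the pairing with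
   elements of E sees only the component e P_sigma b. *)
exists (fun b => e *m mxop sg b), sg; split => //.
- split=> // a b aE bE.
  by rewrite (PE _ aE) (inner_mxop n_gt0 rho_symbol aE.1 bE.1) -{1}aE.2 inner_mulmx e_star.
- apply: (mxop_is_pdo n_gt0 (mxsymbol_mulmx n_gt0 se hs)) => b bE; split; first exact: PsE.
  by rewrite (mxop_mulmx n_gt0 se hs bE.1).
move=> [P' P'_rho]; apply: (mxop_is_pdo n_gt0 hs) => b bE; split; first exact: PsE.
(* It remains to see that v = 0. As v lies in the complement, so does P_rho v, which is thus
   orthogonal to b in E. Hence <v, w> = <P_rho v, b> = 0; also <v, e w> = <e v, w> = 0, so <v, v> =
   0. *)
pose w := mxop sg b; pose v := w - e *m w.
have ev : e *m v = 0 by rewrite mulmxBr eK subrr.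
have sv j : Tinf (v j 0).
  have sew : Tinf ((e *m w) j 0) by apply: (mulmx_smooth n_gt0 se) => k; exact: sgE.
  have -> : v j 0 = -1 *: (e *m w) j 0 + w j 0 by rewrite scaleN1r addrC /v mxE [X in _ + X]mxE.
  exact: (smoothZD (-1) sew (sgE b j bE)).1.
have vE : Defs.inE (1%:M - e) v by split=> //; rewrite mulmxBl mul1mx ev subr0.
have eP'v : e *m mxop rho v = 0.
  rewrite -(is_pdo_mxop n_gt0 rho_symbol P'_rho vE).
  by have [[_ <-] _] := P'_rho v vE; rewrite mulmxA mulmxBr mulmx1 ee subrr mul0mx.
have i0 (u : 'cV[T]_r) : inner 0 u = 0.
  by rewrite /inner big1 // => j _; rewrite mxE mulr0 linear0.
have vw : inner v w = 0.
  by rewrite -(inner_mxop n_gt0 rho_symbol sv bE.1) -bE.2 -[X in inner _ (X *m _)]e_star -inner_mulmx eP'v i0.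
have vv : inner v v = 0.
  have h : inner v (e *m w) = 0.
    by rewrite -[X in inner _ (X *m _)]e_star -inner_mulmx ev i0.
  apply: etrans vw; rewrite -[RHS]subr0 -h /inner -sumrB; apply: eq_bigr => j _.
  by rewrite -linearB -mulrBl -starB !mxE.
by have /eqP := inner_eq0 n_gt0 vv; rewrite subr_eq0 => /eqP <-.
Qed.
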